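(* For $\mathsf a,\mathsf b\in\mathbb R$, $M>0$ and $\rho\in\mathrm L^1_+(\mathbb R^2)$ with $\int_{\mathbb R^2}\rho\,dx=M$, let $$\mathcal F_{\mathsf a,\mathsf b}[\rho]:=\int_{\mathbb R^2}\rho\,\log\left(\frac{\rho}{M}\right)dx+\mathsf a\int_{\mathbb R^2}\log\left(1+|x|^2\right)\rho\,dx-\frac{\mathsf b}{M}\iint_{\mathbb R^2\times\mathbb R^2}\rho(x)\,\rho(y)\,\log|x-y|\,dx\,dy\,,$$ and consider the inequality $$(\star)\qquad\mathcal F_{\mathsf a,\mathsf b}[\rho]\ge\mathcal C(\mathsf a,\mathsf b)\,M\quad\text{for all }M>0\text{ and all }\rho\in\mathrm L^1_+(\mathbb R^2)\text{ such that }\|\rho\|_{\mathrm L^1(\mathbb R^2)}=M\,,$$ where $\mathcal C(\mathsf a,\mathsf b)$ denotes the best (largest) constant. 1. Inequality $(\star)$ holds for some $\mathcal C(\mathsf a,\mathsf b)>-\infty$ if either $\mathsf a=0$ and $\mathsf b=-2$, or $$\mathsf a>0\,,\quad-2\le\mathsf b<\mathsf a-1\quad\text{and}\quad\mathsf b\le2\,\mathsf a-2\,.$$ 2. If either $\mathsf a<0$, or $\mathsf b<-2$, or $\mathsf b>\min\{\mathsf a-1,2\,\mathsf a-2\}$, or $(\mathsf a,\mathsf b)=(1,0)$, then $$\inf_{\rho\in\mathcal X_1}\mathcal F_{\mathsf a,\mathsf b}[\rho]=-\infty\,.$$ 3. If $0\le\mathsf a<1$ and $\mathsf b=2\,\mathsf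 a-2$, then $$\mathcal C(\mathsf a,2\,\mathsf a-2)=-\log\left(\frac{e\,\pi}{1-\mathsf a}\right).$$ Moreover, if in addition $\mathsf a>0$, there is no minimizer for $\mathcal C(\mathsf a,2\,\mathsf a-2)$, that is, no $\rho$ of mass $M$ satisfies $\mathcal F_{\mathsf a,2\mathsf a-2}[\rho]=\mathcal C(\mathsf a,2\,\mathsf a-2)\,M$.
   Context: $\mathrm L^1_+(\mathbb R^2)$ is the set of nonnegative integrable functions on $\mathbb R^2$, and $\mathcal X_M:=\{\rho\in\mathrm L^1_+(\mathbb R^2):\|\rho\|_{\mathrm L^1(\mathbb R^2)}=M\}$. $\log$ is the natural logarithm and $0\log 0=0$. By homogeneity, $\mathcal C(\mathsf a,\mathsf b)$ does not depend on $M$, and $\mathcal C(\mathsf a,\mathsf b)=\inf_{\rho\in\mathcal X_1}\mathcal F_{\mathsf a,\mathsf b}[\rho]$. Functionals are evaluated, and infima taken, on those $\rho$ for which all the integrals appearing are absolutely convergent. *)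

(* Defs.v *)
From HB Require Import structures.
From mathcomp Require Import all_boot all_order all_algebra.
From mathcomp Require Import all_classical all_reals all_analysis.
Set Implicit Arguments.
Unset Strict Implicit.
Unset Printing Implicit Defensive.
Import Order.TTheory GRing.Theory Num.Theory.
Import numFieldNormedType.Exports.
Local Open Scope classical_set_scope.
Local Open Scope ring_scope.

Section free_energy.
Context {R : realType}.

(* [measurableTypeR R] is [R] with its Borel sigma-algebra. *)
Definition lebesgue2 :
    set (measurableTypeR R * measurableTypeR R)%type -> \bar R :=
  (@lebesgue_measure R \x @lebesgue_measure R)%E.

HB.instance Definition _ := Measure.on lebesgue2.

(* The library's sigma-finite instance on products of sigma-finite measures is
   shadowed by its subprobability instance, so it is rebuilt here. *)
Lemma lebesgue2_sigma_finite : sigma_finite setT lebesgue2.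
Proof.
have /sigma_finiteP[F [TF ndF Foo]] := sigma_finiteT (@lebesgue_measure R).
exists (fun n => F n `*` F n).
  rewrite -setXTT TF predeqE => -[x y]; split.
    move=> [/= [n _ Fnx] [k _ Fky]]; exists (maxn n k) => //; split.
    - by move: x Fnx; exact/subsetPset/ndF/leq_maxl.
    - by move: y Fky; exact/subsetPset/ndF/leq_maxr.
  by move=> [n _ []/= ? ?]; split; exists n.
move=> k; have [? ?] := Foo k.
split; first exact: measurableX.
by rewrite /lebesgue2 product_measure1E// lte_mul_pinfty// ge0_fin_numE.
Qed.

HB.instance Definition _ :=
  Measure_isSigmaFinite.Build _ _ _ lebesgue2 lebesgue2_sigma_finite.

(* The library's norm on [R * R] is the sup norm; this is the Euclidean one. *)
Definition enorm (x : R * R) : R := Num.sqrt (x.1 ^+ 2 + x.2 ^+ 2).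

(* Elements of L^1_+ are represented by everywhere nonnegative Borel
   functions. *)
Definition L1plus : set (R * R -> R) :=
  [set rho | (forall x, 0 <= rho x) /\
             lebesgue2.-integrable setT (EFin \o rho)].

Definition mass_class (M : R) : set (R * R -> R) :=
  [set rho | L1plus rho /\ 'N[lebesgue2]_1 [EFin \o rho] = M%:E]%E.

(* Since [ln 0 = 0], the entropy density is 0 where [rho] vanishes and the
   interaction density is 0 on the (negligible) diagonal. *)
Definition entropy_density (M : R) (rho : R * R -> R) (x : R * R) : R :=
  rho x * ln (rho x / M).

Definition potential_density (rho : R * R -> R) (x : R * R) : R :=
  ln (1 + enorm x ^+ 2) * rho x.

Definition interaction_density (rho : R * R -> R) (z : (R * R) * (R * R)) : R :=
  rho z.1 * rho z.2 * ln (enorm (z.1 - z.2)).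

Definition convergent (M : R) : set (R * R -> R) :=
  [set rho | [/\ lebesgue2.-integrable setT (EFin \o entropy_density M rho),
                 lebesgue2.-integrable setT (EFin \o potential_density rho)
               & (lebesgue2 \x lebesgue2)%E.-integrable setT
                   (EFin \o interaction_density rho)]].

(* The densities of mass [M] at which the functional is evaluated. *)
Definition admissible (M : R) : set (R * R -> R) :=
  mass_class M `&` convergent M.

Definition free_energy (a b M : R) (rho : R * R -> R) : R :=
  \int[lebesgue2]_x entropy_density M rho x
  + a * \int[lebesgue2]_x potential_density rho x
  - b / M * \int[(lebesgue2 \x lebesgue2)%E]_z interaction_density rho z.

(* [-oo] is always a valid constant. *)
Definition energy_bound (a b : R) (c : \bar R) : Prop :=
  forall (M : R) (rho : R * R -> R), 0 < M -> admissible M rho ->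
    (c * M%:E <= (free_energy a b M rho)%:E)%E.

Definition best_constant (a b : R) : \bar R :=
  ereal_sup [set c | energy_bound a b c].

Definition is_minimizer (a b M : R) (rho : R * R -> R) : Prop :=
  admissible M rho /\
  ((free_energy a b M rho)%:E = best_constant a b * M%:E)%E.

End free_energy.

(* Main.v *)
Require Import Defs.
From HB Require Import structures.
From mathcomp Require Import all_boot all_order all_algebra.
From mathcomp Require Import all_classical all_reals all_analysis.
From mathcomp Require Import measurable_realfun.
From mathcomp Require complex.
From mathcomp Require Import ring lra.
Set Implicit Arguments.
Unset Strict Implicit.
Unset Printing Implicit Defensive.
Import Order.TTheory GRing.Theory Num.Theory.
Import numFieldNormedType.Exports.
Local Open Scope classical_set_scope.
Local Open Scope ring_scope.

(** For [a = 0], [b = -2] and mass 1 the inequality is the critical logarithmic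
    Hardy-Littlewood-Sobolev inequality. Since [log |x - y|] is reflection
    positive, folding [rho] across a line that halves its mass does not increase
    the energy on average, so [rho] may be assumed even in both coordinates.
    In polar coordinates, [log |x - y|^2 = log (max r r')^2
    - 2 \sum_n (min r r' / max r r')^n cos (n (theta - theta')) / n], and the
    contribution of the angular modes to the interaction is compensated by the
    angular entropy, by the Lebedev-Milin inequality and Gibbs' variational
    principle. There remains a one-dimensional inequality for the law [h] of
    [s = log r], namely [\int h log h + \iint h h |s - s'| >= log 2 - 1]: with [H]
    the distribution function of [h], the double integral is [2 \int H (1 - H)]
    and the entropy is compared with that of [2 H (1 - H)].

    For [0 < a < 1] and [b = 2 a - 2], the map [x |-> |x|^(l - 1) x] with
    [l = 1 / (1 - a)] reduces the energy with potential [log |x|^2] to the previous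
    case, because the angular modes of the interaction are ordered: the kernel
    [exp (- n |s - s'|) / n - exp (- l n |s - s'|) / (l n)] is positive definite.
    The potential [log (1 + |x|^2)] being strictly larger, there is no minimizer.
    The other lower bounds follow by comparison with these.

    All unboundedness claims and the sharpness of the constant are tested on
    radial densities, in terms of the law of [log |x|]: a block moving to
    [-oo] ([b < -2]), a wide block ([(a, b) = (1, 0)]), a mass [eps] at distance
    [sg] from the rest ([b > min (a - 1) (2 a - 2)]), and truncated logistic laws
    moving to [+oo] ([b = 2 a - 2]). *)

(** * Measurability, derivatives and integrals *)

(** The balance between angular entropy and interaction is exact only under a symmetry.
    Lebedev-Milin lets the entropy pay [1 / n] for the n-th squared mode, while the kernel
    [log |x - y|^2] charges [2 / n]. Folding in both coordinates makes the density invariant under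
    [x |-> - x], which kills the odd modes; the mode [n = 2 m] then costs [1 / m], exactly what the
    entropy pays for the m-th mode of the doubled angle. Hence polar coordinates made of a signed
    radius and a line through the origin, and the averaging of [log |x - y|] with [log |x + y|],
    whose sum is [log |x^2 - y^2|] in complex notation. The comparison function [2 H (1 - H)] is
    dictated by the extremal [1 / (pi (1 + |x|^2)^2)]: there [log |x|] has the logistic law, which
    satisfies [h = 2 H (1 - H)]. The sharp bounds need [log |x|] bounded, hence densities supported
    in an annulus. When the truncation is removed, the excess of [log (1 + |x|^2)] over [log |x|^2]
    on one fixed annulus is retained: it makes the inequality strict for [a > 0]. *)

Section measurable_aux.
Context {R : realType}.

Lemma measurable_invr : measurable_fun setT (fun x : R => x^-1).
Proof.
(* The inverse, with its default value at 0, is not continuous; the power function is measurable on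
   the whole line, and squaring makes its base nonnegative. *)
rewrite (_ : (fun x : R => x^-1) = fun x => x * powR (x ^+ 2) (-1)); last first.
  apply/funext => x; rewrite powR_inv1 ?sqr_ge0//.
  have [->|x0] := eqVneq x 0; first by rewrite invr0 mul0r.
  by rewrite expr2 invfM mulrA divff// mul1r.
apply: measurable_funM => //; apply: (measurableT_comp (@measurable_powR R (-1))).
exact: measurable_funX.
Qed.

Lemma measurable_sqrtr : measurable_fun setT (@Num.sqrt R).
Proof. by apply: continuous_measurable_fun; exact: sqrt_continuous. Qed.

Lemma measurable_atan : measurable_fun setT (@atan R).
Proof. by apply: continuous_measurable_fun; exact: continuous_atan. Qed.

Lemma measurable_cos : measurable_fun setT (@cos R).
Proof. by apply: continuous_measurable_fun; exact: continuous_cos. Qed.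

Lemma measurable_sin : measurable_fun setT (@sin R).
Proof. by apply: continuous_measurable_fun; exact: continuous_sin. Qed.

Lemma measurable_normr : measurable_fun setT (fun x : R => `|x|).
Proof. exact: normr_measurable. Qed.

End measurable_aux.

Ltac solve_measurable :=
  repeat (match goal with
  | |- measurable_fun _ (fun _ => (_, _)) => apply: measurable_fun_pair
  | |- measurable_fun _ (fun _ => EFin _) => apply/measurable_EFinP
  | |- measurable_fun _ (EFin \o _) => apply/measurable_EFinP
  | |- measurable_fun setT _ => first [ assumption | exact: measurable_cst
     | exact: measurable_id | exact: measurable_fst | exact: measurable_snd
     | exact: measurable_expR | exact: measurable_ln
     | apply: measurable_funD | apply: measurable_funB | apply: measurable_funN
     | apply: measurable_funM | apply: measurable_funX
     | apply: measurable_maxr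
     | apply: (measurableT_comp (@measurable_ln _))
     | apply: (measurableT_comp (@measurable_expR _))
     | apply: (measurableT_comp measurable_normr)
     | apply: (measurableT_comp measurable_sqrtr)
     | apply: (measurableT_comp measurable_invr)
     | apply: (measurableT_comp measurable_atan)
     | apply: (measurableT_comp measurable_cos)
     | apply: (measurableT_comp measurable_sin)
     | match goal with H : measurable_fun _ _ |- _ => apply: (measurableT_comp H) end
     | apply: (measurableT_comp measurable_fst)
     | apply: (measurableT_comp measurable_snd) ]
  end).

Section derivation.
Context {R : realType}.
Implicit Types (f g : R -> R) (x a b : R).

(** The rules below are stated for explicit lambda-terms, so that a derivative is computed by
    applying them along the syntax of the function, its closed form being adjusted by [der_eq]. *)
Definition der f x a := is_derive x 1 f a.

Lemma der_eq f x a b : der f x a -> a = b -> der f x b.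
Proof. by move=> h <-. Qed.

Lemma der_addf f g x a b : der f x a -> der g x b ->
  der (fun y => f y + g y) x (a + b).
Proof. by move=> hf hg; exact: is_deriveD. Qed.

Lemma der_subf f g x a b : der f x a -> der g x b ->
  der (fun y => f y - g y) x (a - b).
Proof. by move=> hf hg; exact: is_deriveB. Qed.

Lemma der_oppf f x a : der f x a -> der (fun y => - f y) x (- a).
Proof. by move=> hf; exact: is_deriveN. Qed.

Lemma der_mulf f g x a b : der f x a -> der g x b ->
  der (fun y => f y * g y) x (a * g x + f x * b).
Proof.
move=> hf hg; apply: (is_derive_eq (is_deriveM hf hg)).
by rewrite addrC [a * _]mulrC.
Qed.

Lemma der_scalef (c : R) f x a : der f x a ->
  der (fun y => c * f y) x (c * a).
Proof. by move=> hf; exact: (is_deriveZ c hf). Qed.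

Lemma der_idf x : der (fun y : R => y) x 1.
Proof. exact: is_derive_id. Qed.

Lemma der_cstf (c : R) x : der (fun=> c) x 0.
Proof. exact: is_derive_cst. Qed.

Lemma der_expnf f n x a : der f x a ->
  der (fun y => f y ^+ n) x (n%:R * f x ^+ n.-1 * a).
Proof.
move=> hf; have := is_deriveX n hf.
by rewrite (_ : f ^+ n = (fun y => f y ^+ n))//; apply/funext => y; rewrite exprfctE.
Qed.

Lemma der_lnf f x a : 0 < f x -> der f x a ->
  der (fun y => ln (f y)) x ((f x)^-1 * a).
Proof. by move=> f0 hf; exact: (is_derive1_comp (is_derive1_ln f0) hf). Qed.

Lemma der_expf f x a : der f x a ->
  der (fun y => expR (f y)) x (expR (f x) * a).
Proof. by move=> hf; exact: is_derive1_comp. Qed.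

Lemma der_sumf n (h : 'I_n -> R -> R) x (dh : 'I_n -> R) :
  (forall i, der (h i) x (dh i)) ->
  der (fun y => \sum_(i < n) h i y) x (\sum_(i < n) dh i).
Proof.
move=> H; have := is_derive_sum H.
by congr (is_derive _ _ _ _); apply/funext => y; rewrite fct_sumE.
Qed.

Lemma bounded_derive_diff f (df : R -> R) (M : R) :
  (forall s : R, 0 <= s <= 1 -> der f s (df s)) ->
  (forall s : R, 0 <= s <= 1 -> `|df s| <= M) -> `|f 1 - f 0| <= M.
Proof.
move=> hd hM.
have c s : 0 <= s <= 1 -> {for s, continuous f}.
  by move=> /hd[h _]; exact/differentiable_continuous/derivable1_diffP.
have [||x x01 ->] := @MVT_segment R f df 0 1 ler01.
- by move=> x; rewrite in_itv/= => /andP[x0 x1]; apply: hd; rewrite !ltW.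
- by apply: derivable_within_continuous => x; rewrite in_itv/= => /hd[].
by rewrite subr0 mulr1; apply: hM; move: x01; rewrite in_itv.
Qed.

Lemma der_nonpos (f df : R -> R) : (forall s : R, 0 <= s <= 1 -> der f s (df s)) ->
  (forall s : R, 0 <= s <= 1 -> df s <= 0) -> f 1 <= f 0.
Proof.
move=> hd hM.
have [||x x01 e] := @MVT_segment R f df 0 1 ler01.
- by move=> x; rewrite in_itv/= => /andP[x0 x1]; apply: hd; rewrite !ltW.
- by apply: derivable_within_continuous => x; rewrite in_itv/= => /hd[].
by rewrite -subr_le0 e subr0 mulr1; apply: hM; move: x01; rewrite in_itv.
Qed.

End derivation.

Section real_integrals.
Context {R : realType} d (T : measurableType d) (mu : {measure set T -> \bar R}).
Implicit Types f g : T -> R.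

Definition ig f := mu.-integrable setT (EFin \o f).

Lemma ig_meas f : ig f -> measurable_fun setT f.
Proof. by move=> /measurable_int/measurable_EFinP. Qed.

Lemma ig_le f g : measurable_fun setT f -> ig g -> (forall x, `|f x| <= g x) -> ig f.
Proof.
move=> mf ig_g fg; apply: le_integrable ig_g => //; first exact/measurable_EFinP.
by move=> x _ /=; rewrite lee_fin (le_trans (fg x))// ler_norm.
Qed.

Lemma igD f g : ig f -> ig g -> ig (fun x => f x + g x).
Proof.
move=> hf hg; have := integrableD measurableT hf hg.
by apply: eq_integrable => // x _ /=; rewrite EFinD.
Qed.

Lemma igB f g : ig f -> ig g -> ig (fun x => f x - g x).
Proof.
move=> hf hg; have := integrableB measurableT hf hg.
by apply: eq_integrable => // x _ /=; rewrite EFinB.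
Qed.

Lemma igZ (c : R) f : ig f -> ig (fun x => c * f x).
Proof.
move=> hf; have := integrableZl measurableT c hf.
by apply: eq_integrable => // x _ /=; rewrite EFinM.
Qed.

Lemma igZr (c : R) f : ig f -> ig (fun x => f x * c).
Proof. by move=> /(igZ c); apply: eq_integrable => // x _ /=; rewrite mulrC. Qed.

Lemma igN f : ig f -> ig (fun x => - f x).
Proof. by move=> /(igZ (-1)); apply: eq_integrable => // x _ /=; rewrite mulN1r. Qed.

Lemma ig0 : ig (fun=> 0).
Proof. exact: integrable0. Qed.

Lemma ig_norm f : ig f -> ig (fun x => `|f x|).
Proof. exact: integrable_norm. Qed.

Lemma eq_ig f g : (forall x, f x = g x) -> ig f -> ig g.
Proof. by move=> e; apply: eq_integrable => // x _ /=; rewrite e. Qed.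

(** [g] is bounded only where [f] does not vanish: this is how logarithms, unbounded on the plane,
    are integrated against densities supported in an annulus. *)
Lemma igMb f g (B : R) : ig f -> measurable_fun setT g ->
  (forall x, f x != 0 -> `|g x| <= B) -> ig (fun x => f x * g x).
Proof.
move=> hf mg gB; apply: (@ig_le _ (fun x => `|f x| * B)).
- by apply: measurable_funM => //; exact: ig_meas.
- by apply: igZr; exact: ig_norm.
move=> x; rewrite normrM; have [->|fx] := eqVneq (f x) 0.
  by rewrite normr0 !mul0r.
by rewrite ler_wpM2l// gB.
Qed.

Lemma ig_sum I (s : seq I) (F : I -> T -> R) : (forall i, ig (F i)) ->
  ig (fun x => \sum_(i <- s) F i x).
Proof.
move=> h; elim: s => [|i s ih].
  by apply: eq_ig ig0 => x; rewrite big_nil.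
by apply: eq_ig (igD (h i) ih) => x; rewrite big_cons.
Qed.

Lemma eq_Int f g : (forall x, f x = g x) -> \int[mu]_x f x = \int[mu]_x g x.
Proof. by move=> e; apply: eq_Rintegral => x _; exact: e. Qed.

Lemma IntD f g : ig f -> ig g ->
  \int[mu]_x (f x + g x) = \int[mu]_x f x + \int[mu]_x g x.
Proof. exact: RintegralD. Qed.

Lemma IntB f g : ig f -> ig g ->
  \int[mu]_x (f x - g x) = \int[mu]_x f x - \int[mu]_x g x.
Proof. exact: RintegralB. Qed.

Lemma IntZ (c : R) f : ig f -> \int[mu]_x (c * f x) = c * \int[mu]_x f x.
Proof. by move=> h; rewrite RintegralZl. Qed.

Lemma IntZr (c : R) f : ig f -> \int[mu]_x (f x * c) = \int[mu]_x f x * c.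
Proof. by move=> h; rewrite RintegralZr. Qed.

Lemma IntN f : ig f -> \int[mu]_x (- f x) = - \int[mu]_x f x.
Proof.
by move=> h; rewrite -mulN1r -IntZ//; apply: eq_Int => x; rewrite mulN1r.
Qed.

Lemma Int0 : \int[mu]_x (0 : R) = 0.
Proof. by rewrite /Rintegral integral0. Qed.

Lemma Int_sum I (s : seq I) (F : I -> T -> R) : (forall i, ig (F i)) ->
  \int[mu]_x (\sum_(i <- s) F i x) = \sum_(i <- s) \int[mu]_x F i x.
Proof.
move=> h; elim: s => [|i s ih].
  by rewrite big_nil -[RHS]Int0; apply: eq_Int => x; rewrite big_nil.
rewrite big_cons -ih -IntD//; last exact: ig_sum.
by apply: eq_Int => x; rewrite big_cons.
Qed.

Lemma Int_ge0 f : (forall x, 0 <= f x) -> 0 <= \int[mu]_x f x.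
Proof. by move=> h; apply: Rintegral_ge0. Qed.

Lemma le_Int f g : ig f -> ig g -> (forall x, f x <= g x) ->
  \int[mu]_x f x <= \int[mu]_x g x.
Proof. by move=> hf hg h; apply: le_Rintegral. Qed.

Lemma le_norm_Int f : ig f -> `|\int[mu]_x f x| <= \int[mu]_x `|f x|.
Proof. by move=> h; apply: le_normr_Rintegral. Qed.

Lemma EFin_Int f : ig f -> (\int[mu]_x (f x)%:E)%E = (\int[mu]_x f x)%:E.
Proof. by move=> h; rewrite /Rintegral fineK//; exact: integrable_fin_num. Qed.

Lemma ge0_Int f (r : R) : (\int[mu]_x (f x)%:E)%E = r%:E -> \int[mu]_x f x = r.
Proof. by rewrite /Rintegral => ->. Qed.

Lemma ge0_ig f : measurable_fun setT f -> (forall x, 0 <= f x) ->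
  (\int[mu]_x (f x)%:E < +oo)%E -> ig f.
Proof.
move=> mf f0 h; apply/integrableP; split; first exact/measurable_EFinP.
by under eq_integral => x _ do rewrite /= ger0_norm//.
Qed.

(** Discards the null sets on which logarithms and quotients take default values. The measurability
    of [g] is a hypothesis because almost everywhere equality does not provide it. *)
Lemma ae_eq_Int f g : ig f -> measurable_fun setT g ->
  {ae mu, forall x, f x = g x} -> ig g /\ \int[mu]_x f x = \int[mu]_x g x.
Proof.
move=> hf mg fg.
have e : ae_eq mu setT (EFin \o f) (EFin \o g).
  by apply: filterS fg => x /= -> _.
have mf := ig_meas hf.
have mf' : measurable_fun setT (EFin \o f) by exact/measurable_EFinP.
have mg' : measurable_fun setT (EFin \o g) by exact/measurable_EFinP.
split; last by rewrite /Rintegral; congr fine; apply: ae_eq_integral => //.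
apply/integrableP; split => //.
case/integrableP : hf => _; congr (_ < _)%E; apply: ae_eq_integral => //.
- exact: measurableT_comp.
- exact: measurableT_comp.
- by apply: filterS fg => x /= -> _.
Qed.

Lemma dominated_Int (F : nat -> T -> R) f g :
  (forall n, measurable_fun setT (F n)) -> measurable_fun setT f -> ig g ->
  {ae mu, forall x, F ^~ x @ \oo --> f x} ->
  {ae mu, forall x n, `|F n x| <= g x} ->
  ig f /\ \int[mu]_x F n x @[n --> \oo] --> \int[mu]_x f x.
Proof.
move=> mF mf hg Ff Fg.
have [] := @dominated_convergence _ _ _ mu setT measurableT
  (fun n => EFin \o F n) (EFin \o f) (EFin \o g).
- by move=> n; exact/measurable_EFinP.
- exact/measurable_EFinP.
- by apply: filterS Ff => x h _; apply: cvg_comp h _; exact: cvg_refl.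
- exact: hg.
- by apply: filterS Fg => x h n _ /=; rewrite lee_fin.
move=> hf _ h; split => //.
have fn : (\int[mu]_x (f x)%:E)%E \is a fin_num by exact: integrable_fin_num.
by apply: fine_cvg; rewrite fineK.
Qed.

End real_integrals.

(** * Changes of variables *)

Section change_of_variables.
Local Open Scope ereal_scope.
Context {R : realType} d1 d2 (A : measurableType d1) (X : measurableType d2).

(** The image under [Phi] of the measure with density [J] is the restriction of [m2] to [Q]. Testing
    on nonnegative functions lets such formulas be composed and tensorized. *)
Definition cov (m1 : set A -> \bar R) (m2 : set X -> \bar R) (Q : set X)
    (Phi : A -> X) (J : A -> R) :=
  forall f : X -> \bar R, measurable_fun setT f -> (forall x, 0 <= f x) ->
    \int[m2]_(x in Q) f x = \int[m1]_a (f (Phi a) * (J a)%:E).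

Import HBNNSimple.

(** Simple functions reduce the claim to level sets, and monotone convergence passes to the limit on
    both sides. *)
Lemma cov_of_sets (m1 : {measure set A -> \bar R})
    (m2 : {measure set X -> \bar R}) (Q : set X) (Phi : A -> X) (J : A -> R) :
  measurable Q -> measurable_fun setT Phi -> measurable_fun setT J ->
  (forall a, (0 <= J a)%R) ->
  (forall B, measurable B -> m2 (B `&` Q) = \int[m1]_(a in Phi @^-1` B) (J a)%:E) ->
  cov m1 m2 Q Phi J.
Proof.
move=> mQ mPhi mJ J0 H f mf f0.
have mfQ : measurable_fun Q f by exact: measurable_funTS.
pose f_ := nnsfun_approx measurableT mf.
have f_cvg x : (EFin \o f_ ^~ x) @ \oo --> f x by exact: cvg_nnsfun_approx.
transitivity (limn (fun n => \int[m2]_(x in Q) (f_ n x)%:E)).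
  rewrite -monotone_convergence//.
  - by apply: eq_integral => y _; apply/esym/cvg_lim => //; exact: f_cvg.
  - by move=> n; exact/measurable_EFinP/measurable_funTS.
  - by move=> n x _; rewrite lee_fin.
  - by move=> x _ m n mn; rewrite lee_fin; exact/lefP/nd_nnsfun_approx.
have mfP n : measurable_fun setT (fun a => (f_ n (Phi a))%:E * (J a)%:E).
  apply: emeasurable_funM; last exact/measurable_EFinP.
  by apply/measurable_EFinP; exact: measurableT_comp.
transitivity (limn (fun n => \int[m1]_a ((f_ n (Phi a))%:E * (J a)%:E))); last first.
  rewrite -monotone_convergence//.
  - apply: eq_integral => y _; apply/cvg_lim => //.
    by apply: cvgeZr => //; exact: f_cvg.
  - by move=> n x _; rewrite mule_ge0// lee_fin.
  - move=> x _ m n mn; rewrite lee_wpmul2r ?lee_fin//.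
    exact/lefP/nd_nnsfun_approx.
congr (limn _); apply/funext => n.
under eq_integral do rewrite fimfunE// -fsumEFin//.
rewrite ge0_integral_fsum//=; last 2 first.
  by move=> r; exact/measurable_EFinP/measurable_funTS/measurable_funM.
  by move=> r x _; rewrite nnfun_muleindic_ge0.
under [RHS]eq_integral.
  move=> a _; rewrite fimfunE// -fsumEFin// ge0_mule_fsuml; last first.
    by move=> r; rewrite EFinM nnfun_muleindic_ge0.
  over.
rewrite ge0_integral_fsum//=; last 2 first.
  move=> r; apply: emeasurable_funM; last exact/measurable_EFinP.
  apply/measurable_EFinP; apply: measurable_funM => //.
  by apply: measurableT_comp => //.
  by move=> r x _; rewrite mule_ge0 ?lee_fin// -lee_fin EFinM nnfun_muleindic_ge0.
apply: eq_fsbigr => r _.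
have mB : measurable (f_ n @^-1` [set r]) by exact: measurable_funPTI.
under eq_integral do rewrite EFinM.
under [RHS]eq_integral do rewrite EFinM -muleA.
(* A nonnegative simple function never takes the value [r < 0]; for [r >= 0] the constant comes out
   of both integrals. *)
have [r0|r0] := ltP r 0%R.
  have e : f_ n @^-1` [set r] = set0 by apply: preimage_nnfun0.
  rewrite e !integral0_eq//.
    by move=> x _; rewrite indic0 mul0e mule0.
  by move=> x _; rewrite indic0 mule0.
have mI : measurable_fun Q (fun x => (\1_(f_ n @^-1` [set r]) x : R)%:E).
  by apply/measurable_EFinP; exact: measurable_funTS.
rewrite ge0_integralZl//=.
have mIP : measurable_fun setT
    (fun x => (\1_(f_ n @^-1` [set r]) (Phi x))%:E * (J x)%:E).
  apply: emeasurable_funM; last exact/measurable_EFinP.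
  by apply/measurable_EFinP; exact: measurableT_comp.
rewrite ge0_integralZl//=; last by move=> x _; rewrite mule_ge0 ?lee_fin.
congr (_ * _).
rewrite integral_indic// H// [RHS](eq_integral (fun a => ((fun a => (J a)%:E) \_ (Phi @^-1` (f_ n @^-1` [set r]))) a)).
  by rewrite [LHS]integral_mkcond.
move=> a _; rewrite patchE indicE.
have [/set_mem h|h] := boolP (a \in _).
  by rewrite mem_set// mul1e.
rewrite memNset ?mul0e//.
by move=> /= e; move/negP: h; apply; rewrite inE/=.
Qed.

End change_of_variables.

Section density_measure.
Local Open Scope ereal_scope.
Context {R : realType} d1 d2 (A : measurableType d1) (X : measurableType d2).
Variables (m1 : {measure set A -> \bar R}) (Phi : A -> X) (J : A -> R).
Hypotheses (mPhi : measurable_fun setT Phi) (mJ : measurable_fun setT J).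
Hypothesis J0 : forall a, (0 <= J a)%R.

Definition dens_push (B : set X) : \bar R := \int[m1]_(a in Phi @^-1` B) (J a)%:E.

Let dens_push0 : dens_push set0 = 0.
Proof. by rewrite /dens_push preimage_set0 integral_set0. Qed.

Let dens_push_ge0 B : 0 <= dens_push B.
Proof. by apply: integral_ge0 => a _; rewrite lee_fin. Qed.

Let dens_push_sigma_additive : semi_sigma_additive dens_push.
Proof.
move=> /= F mF tF mUF.
have mP B : measurable B -> measurable (Phi @^-1` B).
  by move=> mB; rewrite -[X in measurable X]setTI; exact: mPhi.
rewrite /dens_push preimage_bigcup ge0_integral_bigcup//=; last 4 first.
- by move=> k; exact: mP.
- exact/measurable_EFinP/measurable_funTS.
- by move=> x _; rewrite lee_fin.
- apply/trivIsetP => i j _ _ ij; rewrite -preimage_setI.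
  by move/trivIsetP : tF => -> //; rewrite preimage_set0.
apply: is_cvg_ereal_nneg_natsum_cond => n _ _.
by apply: integral_ge0 => a _; rewrite lee_fin.
Qed.

HB.instance Definition _ := isMeasure.Build _ _ _ dens_push
  dens_push0 dens_push_ge0 dens_push_sigma_additive.

Definition dens_push_measure : {measure set X -> \bar R} := dens_push.

End density_measure.

Section cov_line.
Local Open Scope ereal_scope.
Context {R : realType}.
Local Notation mu := (@lebesgue_measure R).
Local Notation T := (measurableTypeR R).

(** Lebesgue measure is determined by its values on half-open intervals. The image measure lives on
    [Q] only, so Lebesgue measure outside [Q] is added to it to obtain a candidate on the whole
    line. *)
Lemma cov_of_itv (Q : set T) (Phi : T -> T) (J : T -> R) :
  measurable Q -> measurable_fun setT Phi -> measurable_fun setT J ->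
  (forall a, (0 <= J a)%R) -> (forall a, Q (Phi a)) ->
  (forall a b : R, (a < b)%R ->
    mu (`]a, b]%classic `&` Q) = \int[mu]_(x in Phi @^-1` `]a, b]%classic) (J x)%:E) ->
  cov mu mu Q Phi J.
Proof.
move=> mQ mPhi mJ J0 QPhi H; apply: cov_of_sets => // B mB.
have E : forall A, measurable A ->
    mu A = dens_push mu Phi J A + mu (A `&` ~` Q).
  move=> A mA; pose nu := measure_add (dens_push_measure mu mPhi mJ J0)
    (mrestr mu (measurableC mQ)).
  rewrite -[RHS](measure_addE (dens_push_measure mu mPhi mJ J0)
    (mrestr mu (measurableC mQ))).
  apply: (lebesgue_measure_unique (mu := nu)) => // _ [[a b]] _ <-.
  rewrite [RHS]measure_addE/= /dens_push_measure /dens_push /mrestr/=.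
  have [ab|ba] := ltP a b; last first.
    rewrite set_itv_ge ?bnd_simp -?leNgt// preimage_set0 set0I integral_set0.
    by rewrite add0e.
  rewrite -H//; apply: etrans; last first.
    apply: measureU; [exact: measurableI|apply: measurableI => //; exact: measurableC|].
    by rewrite setIACA setICr setI0.
  by rewrite -setIUr setUCr setIT.
transitivity (mu (B `&` Q)) => //.
rewrite E; last exact: measurableI.
rewrite -setIA setICr setI0 measure0 adde0.
rewrite /dens_push/=; congr (integral _ _ _).
by apply/seteqP; split => a /= => [[]//|Ba]; split.
Qed.

Lemma cov_shift (c : R) : cov mu mu setT (fun x : T => x + c : T)%R (fun=> 1%R).
Proof.
apply: cov_of_itv => //; first exact: measurable_funD.
move=> a b ab; rewrite setIT.
rewrite (_ : _ @^-1` _ = `]a - c, b - c]%classic)%R; last first.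
  by apply/seteqP; split => x /=; rewrite !in_itv/= => /andP[? ?]; apply/andP; split; lra.
rewrite integral_cst//= mul1e !lebesgue_measure_itv/= !lte_fin ab ltrD2r ab.
by rewrite -!EFinB; congr EFin; ring.
Qed.

Lemma cov_scale (c : R) : (0 < c)%R ->
  cov mu mu setT (fun x : T => c * x : T)%R (fun=> c).
Proof.
move=> c0; apply: cov_of_itv => //; first exact: measurable_funM.
  by move=> _; exact: ltW.
move=> a b ab; rewrite setIT.
rewrite (_ : _ @^-1` _ = `](c^-1 * a), (c^-1 * b)]%classic)%R; last first.
  by apply/seteqP; split => x /=; rewrite !in_itv/= ltr_pdivrMl// ler_pdivlMl.
rewrite integral_cst//= !lebesgue_measure_itv/= !lte_fin ab ltr_pM2l ?invr_gt0// ab.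
by rewrite -!EFinB -EFinM -mulrBr mulrA divff ?mul1r ?gt_eqF.
Qed.

Lemma cov_opp : cov mu mu setT (fun x : T => - x : T)%R (fun=> 1%R).
Proof.
apply: cov_of_itv => //; first exact: measurable_funN.
move=> a b ab; rewrite setIT.
rewrite (_ : _ @^-1` _ = `[(- b), (- a)[%classic)%R; last first.
  by apply/seteqP; split => x /=; rewrite !in_itv/= => /andP[? ?]; apply/andP; split; lra.
rewrite integral_cst//= mul1e !lebesgue_measure_itv/= !lte_fin ab ltrN2 ab.
by rewrite -!EFinB opprK addrC.
Qed.

Lemma integral_expR_Ny (b : R) :
  \int[mu]_(x in `]-oo, b]) (expR x)%:E = (expR b)%:E.
Proof.
rewrite -(opprK b) ge0_integration_by_substitutionNy//=; last first.
  exact/continuous_subspaceT/continuous_expR.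
rewrite (@ge0_continuous_FTC2y _ (fun x => expR (- x)) (fun x => - expR (- x))%R _ 0%R)//.
- by rewrite -EFinN opprK add0e opprK.
- apply/continuous_subspaceT => x.
  by apply: continuous_comp; [exact: opp_continuous|exact: continuous_expR].
- by rewrite -oppr0; apply: cvgN; exact: cvgr_expR.
- apply: cvgN; apply: cvg_at_right_filter; apply: continuous_comp.
    exact: opp_continuous.
  exact: continuous_expR.
- move=> x _; rewrite derive1E derive_val/=; ring.
Qed.

Lemma cov_expR (c : R) : (0 < c)%R ->
  cov mu mu `]0%R, +oo[%classic (fun x : T => c * expR x : T)%R (fun x => c * expR x)%R.
Proof.
move=> c0.
have mE : measurable_fun setT (fun x : T => c * expR x : T)%R.
  by apply: measurable_funM => //; exact: measurable_expR.
apply: cov_of_itv => //.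
- by move=> a; rewrite mulr_ge0 ?expR_ge0// ltW.
- by move=> a /=; rewrite in_itv/= andbT mulr_gt0 ?expR_gt0.
have H (b : R) : (0 < b)%R ->
    \int[mu]_(x in `]-oo, (ln (c^-1 * b))]) (c * expR x)%:E = b%:E.
  move=> b0; under eq_integral do rewrite EFinM.
  rewrite ge0_integralZl//=; last 2 first.
  - by apply/measurable_EFinP; apply: measurable_funTS; exact: measurable_expR.
  - by rewrite lee_fin ltW.
  rewrite integral_expR_Ny lnK ?posrE ?mulr_gt0 ?invr_gt0//.
  by rewrite -EFinM mulrA divff ?mul1r ?gt_eqF.
have P (b x : R) : (0 < b)%R -> (c * expR x <= b)%R = (x <= ln (c^-1 * b))%R.
  move=> b0; rewrite -ler_pdivlMl// -[in RHS]ler_expR lnK// posrE.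
  by rewrite mulr_gt0// invr_gt0.
move=> a b ab.
have [b0|b0] := leP b 0%R.
  rewrite (_ : `]a, b]%classic `&` _ = set0); last first.
    by apply/seteqP; split => x //=; rewrite !in_itv/= => -[/andP[? ?] /andP[? _]]; lra.
  rewrite (_ : _ @^-1` _ = set0) ?measure0 ?integral_set0//.
  apply/seteqP; split => x //=; rewrite !in_itv/= => /andP[_].
  by rewrite leNgt (le_lt_trans b0)// mulr_gt0// expR_gt0.
have [a0|a0] := leP a 0%R.
  rewrite (_ : `]a, b]%classic `&` _ = `]0%R, b]%classic); last first.
    apply/seteqP; split => x //=; rewrite !in_itv/=.
      by move=> [/andP[? ?] /andP[? _]]; apply/andP.
    by move=> /andP[? ?]; rewrite andbT; split => //; apply/andP; split => //; lra.
  rewrite (_ : _ @^-1` _ = `]-oo, (ln (c^-1 * b))]%classic); last first.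
    apply/seteqP; split => x //=; rewrite !in_itv/= P//.
      by move=> /andP[].
    by move=> ->; rewrite andbT (le_lt_trans a0)// mulr_gt0// expR_gt0.
  by rewrite H// lebesgue_measure_itv/= lte_fin b0 -EFinB subr0.
rewrite (_ : `]a, b]%classic `&` _ = `]a, b]%classic); last first.
  apply/seteqP; split => x //=; rewrite !in_itv/=; first by case.
  by move=> /andP[? ?]; split; [exact/andP|rewrite andbT; lra].
have hb := H _ b0.
have -> : (fun x : T => c * expR x : T)%R @^-1` `]a, b]%classic =
    `](ln (c^-1 * a))%R, (ln (c^-1 * b))%R]%classic.
  have P' x : (a < c * expR x)%R = (ln (c^-1 * a) < x)%R by rewrite !ltNge P.
  by apply/seteqP; split => x /=; rewrite !in_itv/= P' P.
have L : (ln (c^-1 * a) <= ln (c^-1 * b))%R.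
  by rewrite ler_ln ?posrE ?mulr_gt0 ?invr_gt0// ler_pM2l ?invr_gt0// ltW.
(* The bounded interval is the difference of the half-lines ending at [ln (c^-1 * b)] and
   [ln (c^-1 * a)]. *)
move: hb; rewrite (@itv_bndbnd_setU _ _ -oo%O (BRight (ln (c^-1 * a))%R) (BRight _)) ?bnd_simp//.
rewrite ge0_integral_setU//=; last 3 first.
- exact/measurable_EFinP/measurable_funTS.
- by move=> x _; rewrite lee_fin mulr_ge0 ?expR_ge0// ltW.
- by apply/disj_setPS => x [] /=; rewrite !in_itv/= => ? /andP[? _]; lra.
rewrite H// lebesgue_measure_itv/= lte_fin ab => h.
by rewrite -h addeAC -EFinD subrr add0e.
Qed.

End cov_line.

Section cov_theory.
Local Open Scope ereal_scope.
Context {R : realType}.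

Lemma cov_integral d1 d2 (A : measurableType d1) (X : measurableType d2)
    (m1 : {measure set A -> \bar R}) (m2 : {measure set X -> \bar R})
    (Q : set X) (Phi : A -> X) (J : A -> R) (f : X -> R) :
  (forall a, (0 <= J a)%R) -> cov m1 m2 Q Phi J -> measurable_fun setT f ->
  \int[m2]_(x in Q) (f x)%:E = \int[m1]_a (f (Phi a) * J a)%:E.
Proof.
move=> J0 H mf; rewrite integralE [RHS]integralE.
have mf' : measurable_fun setT (EFin \o f) by exact/measurable_EFinP.
have e1 := H _ (measurable_funepos mf') (@funepos_ge0 _ _ _).
have e2 := H _ (measurable_funeneg mf') (@funeneg_ge0 _ _ _).
rewrite -/(EFin \o f) e1 e2; congr (_ - _); apply: eq_integral => a _.
  by rewrite !funeposE/= -!EFin_max -EFinM maxr_pMl// mul0r.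
by rewrite !funenegE/= -!EFin_max -EFinM maxr_pMl// mul0r mulNr.
Qed.

Lemma cov_integrable d1 d2 (A : measurableType d1) (X : measurableType d2)
    (m1 : {measure set A -> \bar R}) (m2 : {measure set X -> \bar R})
    (Q : set X) (Phi : A -> X) (J : A -> R) (f : X -> R) :
  measurable_fun setT Phi -> measurable_fun setT J ->
  (forall a, (0 <= J a)%R) -> cov m1 m2 Q Phi J -> measurable_fun setT f ->
  m2.-integrable Q (EFin \o f) <->
  m1.-integrable setT (fun a => (f (Phi a) * J a)%:E).
Proof.
move=> mPhi mJ J0 H mf.
have e : \int[m2]_(x in Q) `|(f x)%:E| = \int[m1]_a `|(f (Phi a) * J a)%:E|.
  rewrite H//; last by apply: measurableT_comp => //; exact/measurable_EFinP.
  by apply: eq_integral => a _; rewrite /= -EFinM normrM (ger0_norm (J0 a)).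
have mfJ : measurable_fun setT (fun a => f (Phi a) * J a)%R.
  by apply: measurable_funM => //; exact: measurableT_comp.
split => /integrableP[_ h]; apply/integrableP; split.
- exact/measurable_EFinP.
- by rewrite -e.
- exact/measurable_EFinP/measurable_funTS.
- by rewrite e.
Qed.

Lemma cov_Rintegral d1 d2 (A : measurableType d1) (X : measurableType d2)
    (m1 : {measure set A -> \bar R}) (m2 : {measure set X -> \bar R})
    (Q : set X) (Phi : A -> X) (J : A -> R) (f : X -> R) :
  (forall a, (0 <= J a)%R) -> cov m1 m2 Q Phi J -> measurable_fun setT f ->
  (\int[m2]_(x in Q) f x = \int[m1]_a (f (Phi a) * J a))%R.
Proof. by move=> J0 H mf; rewrite /Rintegral (cov_integral J0 H mf). Qed.

(** Tonelli on both sides, then one formula per variable. *)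
Lemma cov_prod d1 d2 d3 d4 (A : measurableType d1) (X : measurableType d2)
    (B : measurableType d3) (Y : measurableType d4)
    (m1 : {sigma_finite_measure set A -> \bar R})
    (m2 : {sigma_finite_measure set X -> \bar R})
    (m3 : {sigma_finite_measure set B -> \bar R})
    (m4 : {sigma_finite_measure set Y -> \bar R})
    (Q : set X) (Q' : set Y) (Phi : A -> X) (Psi : B -> Y)
    (J : A -> R) (K : B -> R) :
  measurable Q -> measurable Q' ->
  measurable_fun setT Phi -> measurable_fun setT J -> (forall a, (0 <= J a)%R) ->
  measurable_fun setT Psi -> measurable_fun setT K -> (forall a, (0 <= K a)%R) ->
  cov m1 m2 Q Phi J -> cov m3 m4 Q' Psi K ->
  cov (m1 \x m3) (m2 \x m4) (Q `*` Q') (fun a => (Phi a.1, Psi a.2))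
    (fun a => J a.1 * K a.2)%R.
Proof.
move=> mQ mQ' mPhi mJ J0 mPsi mK K0 H H' f mf f0.
rewrite integral_mkcond.
have mg : measurable_fun setT (f \_ (Q `*` Q')).
  by apply/(measurable_restrictT _ _).1 => //; [exact: measurableX|exact: measurable_funTS].
have g0 x : 0 <= (f \_ (Q `*` Q')) x by rewrite patchE; case: ifP.
pose h (a : A * B) := f (Phi a.1, Psi a.2) * (J a.1 * K a.2)%:E.
have mh : measurable_fun setT h.
  apply: emeasurable_funM; last by solve_measurable.
  apply: (measurableT_comp mf); solve_measurable.
have h0 x : 0 <= h x by rewrite mule_ge0// lee_fin mulr_ge0.
apply: (etrans (fubini_tonelli1 (m1 := m2) (m2 := m4) _ mg g0)).
apply: (etrans _ (esym (fubini_tonelli1 (m1 := m1) (m2 := m3) _ mh h0))).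
rewrite /fubini_F/=.
pose F x := \int[m4]_(y in Q') f (x, y).
have mF : measurable_fun setT F.
  rewrite /F; under eq_fun do rewrite integral_mkcond.
  have m' : measurable_fun setT (f \_ (setT `*` Q')).
    by apply/(measurable_restrictT _ _).1 => //; [exact: measurableX|exact: measurable_funTS].
  have g0' x : 0 <= (f \_ (setT `*` Q')) x by rewrite patchE; case: ifP.
  have := measurable_fun_fubini_tonelli_F (m2 := m4) _ m' g0'.
  congr (measurable_fun _ _); apply/funext => x; apply: eq_integral => y _.
  by rewrite !patchE in_setX in_setT.
transitivity (\int[m2]_(x in Q) F x).
  rewrite [RHS]integral_mkcond; apply: eq_integral => x _.
  rewrite [RHS]patchE /F; case: ifPn => [/set_mem Qx|Qx].
    rewrite [RHS]integral_mkcond; apply: eq_integral => y _.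
    by rewrite !patchE in_setX mem_set.
  apply: integral0_eq => y _; rewrite patchE memNset//= => -[Qx' _].
  by move/negP : Qx; apply; rewrite inE.
rewrite H//; last by move=> x; apply: integral_ge0 => y _; exact: f0.
apply: eq_integral => a _; rewrite /F.
have mfa : measurable_fun setT (fun y => f (Phi a, y)) by apply: (measurableT_comp mf); solve_measurable.
rewrite H'// muleC.
have mZ : measurable_fun setT (fun y => f (Phi a, Psi y) * (K y)%:E).
  by apply: emeasurable_funM; [apply: (measurableT_comp mfa)|solve_measurable].
have Z0 y : setT y -> 0 <= f (Phi a, Psi y) * (K y)%:E by rewrite mule_ge0// lee_fin.
have Ja0 : 0 <= (J a)%:E by rewrite lee_fin.
rewrite -ge0_integralZl//.
by apply: eq_integral => y _; rewrite /h/= EFinM muleCA.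
Qed.

End cov_theory.

(** * The logarithmic kernel on the disc *)

Section complex_pairs.
Context {R : realType}.
Implicit Types z w : R * R.

(** Complex arithmetic on pairs, so that the coordinates of a map into the disc are plain measurable
    functions. *)
Definition cmul z w : R * R := (z.1 * w.1 - z.2 * w.2, z.1 * w.2 + z.2 * w.1).
Definition conjp z : R * R := (z.1, - z.2).
Definition cscal (t : R) z : R * R := (t * z.1, t * z.2).
Definition nrm2 z : R := z.1 ^+ 2 + z.2 ^+ 2.
Fixpoint cpow z n : R * R := if n is n'.+1 then cmul z (cpow z n') else (1, 0).

Lemma cpowM z w n : cpow (cmul z w) n = cmul (cpow z n) (cpow w n).
Proof.
elim: n => [|n ih] /=; first by rewrite /cmul/=; congr pair; ring.
by rewrite ih /cmul/=; congr pair; ring.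
Qed.

Lemma cpow_conj z n : cpow (conjp z) n = conjp (cpow z n).
Proof.
elim: n => [|n ih] /=; first by rewrite /conjp/= oppr0.
by rewrite ih /cmul/conjp/=; congr pair; ring.
Qed.

Lemma cpow_cscal (t : R) z n : cpow (cscal t z) n = cscal (t ^+ n) (cpow z n).
Proof.
elim: n => [|n ih] /=; first by rewrite /cscal/= expr0 mul1r mulr0.
by rewrite ih /cmul/cscal/= exprS; congr pair; ring.
Qed.

Lemma nrm2_cmul z w : nrm2 (cmul z w) = nrm2 z * nrm2 w.
Proof. by rewrite /nrm2 /cmul/=; ring. Qed.

Lemma nrm2_ge0 z : 0 <= nrm2 z.
Proof. by rewrite addr_ge0// sqr_ge0. Qed.

Lemma nrm2_cpow z n : nrm2 (cpow z n) = nrm2 z ^+ n.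
Proof.
elim: n => [|n ih] /=; first by rewrite /nrm2/= expr0; ring.
by rewrite nrm2_cmul ih exprS.
Qed.

(** [z] is a root of [X^2 - 2 (Re z) X + |z|^2]; this recurrence makes the geometric sum below
    telescope. *)
Lemma cpow_rec z n :
  (cpow z n.+2).1 = 2 * z.1 * (cpow z n.+1).1 - nrm2 z * (cpow z n).1.
Proof. by rewrite /= /cmul /nrm2/=; ring. Qed.

Lemma cpow_trig (x : R) n :
  cpow (cos x, sin x) n = (cos (x *+ n), sin (x *+ n)).
Proof.
elim: n => [|n ih] /=; first by rewrite mulr0n cos0 sin0.
by rewrite ih mulrS cosD sinD /cmul/=; congr pair; ring.
Qed.

Lemma cpow_re_le z n : nrm2 z <= 1 -> `|(cpow z n).1| <= 1.
Proof.
move=> z1; rewrite -ler_sqr ?nnegrE// real_normK ?num_real// expr1n.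
have : nrm2 (cpow z n) <= 1 by rewrite nrm2_cpow exprn_ile1// nrm2_ge0.
by rewrite /nrm2; have := sqr_ge0 (cpow z n).2; lra.
Qed.

Lemma measurable_cpow d (T : measurableType d) (z : T -> R * R) n :
  measurable_fun setT (fun x => (z x).1) -> measurable_fun setT (fun x => (z x).2) ->
  measurable_fun setT (fun x => (cpow (z x) n).1) /\
  measurable_fun setT (fun x => (cpow (z x) n).2).
Proof.
move=> m1 m2; elim: n => [|n [ih1 ih2]]; first by split; solve_measurable.
by split; [apply: measurable_funB|apply: measurable_funD]; apply: measurable_funM.
Qed.

(* [lognorm1 z] is [log |1 - z|] with the junk value 0 at [z = 1]. *)
Definition lognorm1 z : R := 2^-1 * ln ((1 - z.1) ^+ 2 + z.2 ^+ 2).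

Lemma measurable_lognorm1 d (T : measurableType d) (z : T -> R * R) :
  measurable_fun setT (fun x => (z x).1) -> measurable_fun setT (fun x => (z x).2) ->
  measurable_fun setT (fun x => lognorm1 (z x)).
Proof.
move=> m1 m2; apply: measurable_funM => //; apply: (measurableT_comp (@measurable_ln R)).
by apply: measurable_funD; apply: measurable_funX => //; apply: measurable_funB.
Qed.

(** Real part of the finite geometric sum of the [s^n z^(n+1)]; the factor in front is
    [|1 - s z|^2]. *)
Lemma geom_cpow z (s : R) N :
  (1 - 2 * s * z.1 + s ^+ 2 * nrm2 z) * \sum_(n < N) s ^+ n * (cpow z n.+1).1 =
  z.1 - s * nrm2 z - s ^+ N * ((cpow z N.+1).1 - s * nrm2 z * (cpow z N).1).
Proof.
elim: N => [|N ih]; first by rewrite big_ord0 /= /cmul/= expr0; ring.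
rewrite big_ord_recr mulrDr ih -/(cpow z N.+2) cpow_rec [_ ^+ N.+1]exprS.
move: (cpow z N.+1).1 (cpow z N).1 => a b; rewrite /=; ring.
Qed.

(** Along the segment from 0 to [z], the sum [D s] of [log |1 - s z|] and of its partial series
    vanishes at 0, and its derivative is the remainder of a geometric sum: the numerator is at most
    [2 r^N], the denominator [|1 - s z|^2] at least [(1 - r)^2]. *)
Lemma lognorm1_series z (r : R) N : 0 <= r -> r < 1 -> nrm2 z <= r ^+ 2 ->
  `|lognorm1 z + \sum_(n < N) (cpow z n.+1).1 / n.+1%:R|
    <= 2 * r ^+ N / (1 - r) ^+ 2.
Proof.
move=> r0 r1 zr.
have z1r : `|z.1| <= r.
  rewrite -ler_sqr ?nnegrE// real_normK ?num_real//.
  by move: zr; rewrite /nrm2; have := sqr_ge0 z.2; lra.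
have q0 := nrm2_ge0 z.
have cr n : `|(cpow z n).1| <= r ^+ n.
  rewrite -ler_sqr ?nnegrE ?exprn_ge0// real_normK ?num_real//.
  have : nrm2 (cpow z n) <= (r ^+ n) ^+ 2.
    by rewrite nrm2_cpow -exprM mulnC exprM lerXn2r// nnegrE ?sqr_ge0.
  by rewrite {1}/nrm2; have := sqr_ge0 (cpow z n).2; lra.
pose q (s : R) : R := 1 - 2 * s * z.1 + s ^+ 2 * nrm2 z.
pose D (s : R) : R := 2^-1 * ln (q s) + \sum_(n < N) s ^+ n.+1 * ((cpow z n.+1).1 / n.+1%:R).
pose D' (s : R) : R := - s ^+ N * ((cpow z N.+1).1 - s * nrm2 z * (cpow z N).1) / q s.
have qlb (s : R) : 0 <= s <= 1 -> (1 - r) ^+ 2 <= q s.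
  move=> /andP[s0 s1].
  have h : (s * z.1) ^+ 2 <= s ^+ 2 * nrm2 z.
    by rewrite exprMn ler_wpM2l ?sqr_ge0// /nrm2 lerDl sqr_ge0.
  apply: (@le_trans _ _ ((1 - s * z.1) ^+ 2)); last by rewrite /q; move: h; lra.
  have : s * z.1 <= r.
    apply: (le_trans (ler_norm _)); rewrite normrM (ger0_norm s0).
    by apply: (le_trans _ z1r); rewrite ler_piMl.
  by move=> h1; rewrite lerXn2r ?nnegrE; lra.
have r1' : 0 < (1 - r) ^+ 2 by rewrite exprn_gt0// subr_gt0.
have q0s (s : R) : 0 <= s <= 1 -> 0 < q s by move=> /qlb; apply: lt_le_trans.
have dD (s : R) : 0 <= s <= 1 -> der D s (D' s).
  move=> s01; have qs := q0s s s01.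
  have dq : der q s (- 2 * z.1 + 2 * s * nrm2 z).
    rewrite /q; apply: der_eq.
      apply: der_addf; last first.
        by apply: der_mulf; [apply: der_expnf; exact: der_idf|exact: der_cstf].
      apply: der_subf; first exact: der_cstf.
      apply: der_mulf; last exact: der_cstf.
      by apply: der_scalef; exact: der_idf.
    by rewrite /=; ring.
  have ds : der (fun s => \sum_(n < N) s ^+ n.+1 * ((cpow z n.+1).1 / n.+1%:R)) s
      (\sum_(n < N) s ^+ n * (cpow z n.+1).1).
    apply: der_sumf => n; apply: der_eq.
      by apply: der_mulf; [apply: der_expnf; exact: der_idf|exact: der_cstf].
    have : n.+1%:R != 0 :> R by rewrite pnatr_eq0.
    move: (cpow z n.+1).1 (n.+1%:R : R) => a k k0.
    by rewrite mulr1 mulr0 addr0 /=; field.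
  rewrite /D; apply: der_eq.
    by apply: der_addf ds; apply: der_scalef; exact: der_lnf qs dq.
  apply: (mulfI (lt0r_neq0 qs)); rewrite mulrDr geom_cpow /D'.
  rewrite [q s * (_ / q s)]mulrCA divff ?gt_eqF// mulr1.
  rewrite mulrCA [q s * _]mulrA divff ?gt_eqF// mul1r.
  by move: (cpow z N.+1).1 (cpow z N).1 => a b; field.
have dM (s : R) : 0 <= s <= 1 -> `|D' s| <= 2 * r ^+ N / (1 - r) ^+ 2.
  move=> s01; have /andP[s0 s1] := s01.
  rewrite /D' normrM normfV (gtr0_norm (q0s s s01)).
  rewrite ler_pM ?invr_ge0// ?(ltW (q0s s s01))//; last first.
    by rewrite lef_pV2 ?posrE// ?qlb// q0s.
  rewrite mulNr normrN normrM normrX (ger0_norm s0).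
  apply: (@le_trans _ _ (`|(cpow z N.+1).1 - s * nrm2 z * (cpow z N).1|)).
    by rewrite ler_piMl// exprn_ile1.
  apply: (le_trans (ler_normB _ _)).
  have h1 : `|(cpow z N.+1).1| <= r ^+ N.
    by apply: (le_trans (cr _)); rewrite exprS ler_piMl ?exprn_ge0// ltW.
  have h2 : `|s * nrm2 z * (cpow z N).1| <= r ^+ N.
    rewrite normrM; apply: le_trans (cr N); rewrite ler_piMl//.
    rewrite ger0_norm ?mulr_ge0//.
    by rewrite mulr_ile1// (le_trans zr)// exprn_ile1// ltW.
  by move: h1 h2; lra.
have := bounded_derive_diff dD dM.
rewrite /D; congr (`| _ | <= _).
rewrite [X in _ - X](_ : _ = 0) ?subr0; last first.
  rewrite big1 ?addr0; last by move=> n _; rewrite expr0n mul0r.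
  by rewrite /q mulr0 mul0r expr0n/= mul0r subr0 addr0 ln1 mulr0.
congr (_ + _); last by apply: eq_bigr => n _; rewrite expr1n mul1r.
by rewrite /lognorm1 /q /nrm2; congr (_ * ln _); ring.
Qed.

End complex_pairs.
Arguments cpow : simpl never.

Section abel.
Context {R : realType} d (T : measurableType d) (mu : {measure set T -> \bar R}).
Implicit Types (w : T -> R) (z : T -> R * R).

Lemma cvg_geometric_error (C tau : R) : 0 <= tau -> tau < 1 ->
  C * tau ^+ n @[n --> \oo] --> 0.
Proof.
move=> t0 t1; rewrite -[X in _ --> X](mulr0 C); apply: cvgMr => //.
by apply: cvg_expr; rewrite ger0_norm.
Qed.

Lemma cvg_of_bound (u e : nat -> R) (l : R) : (forall n, `|u n - l| <= e n) ->
  e n @[n --> \oo] --> 0 -> u n @[n --> \oo] --> l.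
Proof.
move=> h /cvgrPdist_le e0; apply/cvgrPdist_le => eps eps0.
apply: filterS (e0 eps eps0) => n; rewrite sub0r normrN distrC => /(le_trans (ler_norm _)).
exact: le_trans.
Qed.

Lemma ig_cpow w z n : ig mu w ->
  measurable_fun setT (fun x => (z x).1) -> measurable_fun setT (fun x => (z x).2) ->
  (forall x, nrm2 (z x) <= 1) -> ig mu (fun x => w x * (cpow (z x) n).1).
Proof.
move=> hw m1 m2 z1; apply: (@igMb _ _ _ _ _ _ 1) => //.
  by have [] := measurable_cpow n m1 m2.
by move=> x _; exact: cpow_re_le.
Qed.

(** Strictly inside the disc the error of the series is uniform, so summation and integration
    commute. *)
Lemma cvg_lognorm1_radius w z (tau : R) : ig mu w ->
  measurable_fun setT (fun x => (z x).1) -> measurable_fun setT (fun x => (z x).2) ->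
  (forall x, nrm2 (z x) <= 1) -> 0 <= tau -> tau < 1 ->
  \sum_(n < N) (tau ^+ n.+1 / n.+1%:R * \int[mu]_x (w x * (cpow (z x) n.+1).1))
    @[N --> \oo] --> - \int[mu]_x (w x * lognorm1 (cscal tau (z x))).
Proof.
move=> hw m1 m2 z1 t0 t1.
pose K N := 2 * tau ^+ N / (1 - tau) ^+ 2.
have zt x : nrm2 (cscal tau (z x)) <= tau ^+ 2.
  rewrite (_ : nrm2 _ = tau ^+ 2 * nrm2 (z x)); last by rewrite /nrm2/=; ring.
  by rewrite ler_piMr ?sqr_ge0.
have mL : measurable_fun setT (fun x => lognorm1 (cscal tau (z x))).
  by apply: measurable_lognorm1; apply: measurable_funM.
have hN N x : `|lognorm1 (cscal tau (z x)) +
    \sum_(n < N) (cpow (cscal tau (z x)) n.+1).1 / n.+1%:R| <= K N.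
  exact: lognorm1_series.
have igL : ig mu (fun x => w x * lognorm1 (cscal tau (z x))).
  apply: (@igMb _ _ _ _ _ _ (K 0%N)) => // x _.
  by have := hN 0%N x; rewrite big_ord0 addr0.
have E N : \sum_(n < N) (tau ^+ n.+1 / n.+1%:R * \int[mu]_x (w x * (cpow (z x) n.+1).1)) =
   \int[mu]_x (w x * \sum_(n < N) (cpow (cscal tau (z x)) n.+1).1 / n.+1%:R) /\
   ig mu (fun x => w x * \sum_(n < N) (cpow (cscal tau (z x)) n.+1).1 / n.+1%:R).
  have h (i : 'I_N) : ig mu (fun x => tau ^+ i.+1 / i.+1%:R * (w x * (cpow (z x) i.+1).1)).
    by apply: igZ; exact: ig_cpow.
  have e x : \sum_(i < N) (tau ^+ i.+1 / i.+1%:R * (w x * (cpow (z x) i.+1).1)) =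
      w x * \sum_(n < N) (cpow (cscal tau (z x)) n.+1).1 / n.+1%:R.
    rewrite mulr_sumr; apply: eq_bigr => i _; rewrite cpow_cscal.
    by move: (cpow _ _) (i.+1%:R^-1) => c k; rewrite /cscal/=; ring.
  split.
    transitivity (\sum_(i < N) \int[mu]_x (tau ^+ i.+1 / i.+1%:R * (w x * (cpow (z x) i.+1).1))).
      by apply: eq_bigr => i _; rewrite IntZ//; exact: ig_cpow.
    by rewrite -Int_sum//; exact: eq_Int.
  by apply: eq_ig e _; exact: ig_sum.
have bound N : `|\sum_(n < N) (tau ^+ n.+1 / n.+1%:R * \int[mu]_x (w x * (cpow (z x) n.+1).1))
     - - \int[mu]_x (w x * lognorm1 (cscal tau (z x)))| <= K N * \int[mu]_x `|w x|.
  have [-> hS] := E N; rewrite opprK -IntD// -IntZ; last exact: ig_norm.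
  apply: le_trans (le_norm_Int (igD hS igL)) _; apply: le_Int.
  - exact/ig_norm/igD.
  - exact/igZ/ig_norm.
  move=> x; rewrite -mulrDr normrM mulrC ler_wpM2r// addrC; exact: hN.
apply: (cvg_of_bound bound).
rewrite (_ : (fun n => _) =
  fun n => (2 / (1 - tau) ^+ 2 * \int[mu]_x `|w x|) * tau ^+ n); last first.
  by apply/funext => n; rewrite /K; ring.
exact: cvg_geometric_error.
Qed.

(** On the closed disc [|1 - z| <= 2 |1 - tau z|] and [|1 - tau z| <= 2]. Hence, up to a constant,
    the logarithm on the boundary dominates the ones at smaller radii, as dominated convergence
    requires. *)
Lemma lognorm1_scal_le (tau : R) (z : R * R) : 0 <= tau -> tau < 1 -> nrm2 z <= 1 ->
  z != (1, 0) -> `|lognorm1 (cscal tau z)| <= `|lognorm1 z| + ln 4.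
Proof.
case: z => x y; rewrite /nrm2/= => t0 t1 xy1 xy; rewrite /lognorm1/=.
have q0 : 0 < (1 - x) ^+ 2 + y ^+ 2.
  rewrite lt_neqAle addr_ge0 ?sqr_ge0// andbT eq_sym paddr_eq0 ?sqr_ge0//.
  rewrite !sqrf_eq0 subr_eq0; apply: contra xy => /andP[/eqP <- /eqP ->] //.
have x1 : x ^+ 2 <= 1 by have := sqr_ge0 y; lra.
have x11 : -1 <= x <= 1 by apply/andP; split; nra.
have /andP[xl xu] := x11.
have h1 : (1 - tau * x) ^+ 2 + (tau * y) ^+ 2 <= 4.
  have : 0 <= tau * (1 + x) by rewrite mulr_ge0//; lra.
  have : tau ^+ 2 * (x ^+ 2 + y ^+ 2) <= 1.
    by rewrite mulr_ile1 ?sqr_ge0 ?addr_ge0 ?sqr_ge0// exprn_ile1// ltW.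
  by lra.
have h2 : ((1 - x) ^+ 2 + y ^+ 2) <= 4 * ((1 - tau * x) ^+ 2 + (tau * y) ^+ 2).
  rewrite -subr_ge0; have y0 := sqr_ge0 y.
  (* The difference of the two sides is affine in [y^2] with slope [4 tau^2 - 1], hence smallest at
     [y = 0] or on the unit circle, according to the sign of the slope. *)
  have [t2|t2] := lerP 0 (4 * tau ^+ 2 - 1).
    apply: (@le_trans _ _ ((1 - 2 * tau * x + x) * (3 - 2 * tau * x - x))).
      apply: mulr_ge0.
        have [x0|x0] := leP 0 x; first by have := mulr_ge0 x0 (ltW (etrans (subr_gt0 _ _) t1)); lra.
        by have := mulr_ge0 t0 (ltW (etrans (oppr_gt0 _) x0)); lra.
      have [x0|x0] := leP 0 x; first by have := mulr_ge0 x0 (ltW (etrans (subr_gt0 _ _) t1)); lra.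
      by have := mulr_ge0 t0 (ltW (etrans (oppr_gt0 _) x0)); lra.
    by have := mulr_ge0 t2 y0; lra.
  have h : 0 <= (1 - 4 * tau ^+ 2) * (1 - x ^+ 2 - y ^+ 2) by apply: mulr_ge0; lra.
  have t12 : tau <= 2^-1.
    by rewrite -ler_sqr ?nnegrE//; move: t2; rewrite expr2; lra.
  have h3 : 0 <= (1 - 4 * tau) * (1 + x) \/ 0 <= (4 * tau - 1) * (1 - x).
    by have [?|?] := leP 0 (1 - 4 * tau); [left|right]; apply: mulr_ge0; lra.
  have := sqr_ge0 (1 - tau); have := sqr_ge0 tau; lra.
have q1 : 0 < (1 - tau * x) ^+ 2 + (tau * y) ^+ 2 by lra.
have l4 : ln ((1 - tau * x) ^+ 2 + (tau * y) ^+ 2) <= ln 4 by rewrite ler_ln ?posrE.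
have l4' : ln ((1 - x) ^+ 2 + y ^+ 2) <= ln 4 + ln ((1 - tau * x) ^+ 2 + (tau * y) ^+ 2).
  by rewrite -lnM ?posrE// ler_ln ?posrE// mulr_gt0.
have l40 : 0 <= ln (4 : R) by rewrite ln_ge0// ler1n.
have := ler_norm (- (2^-1 * ln ((1 - x) ^+ 2 + y ^+ 2))); rewrite normrN.
have := normr_ge0 (2^-1 * ln ((1 - x) ^+ 2 + y ^+ 2)).
by rewrite ler_norml => ? ?; apply/andP; split; lra.
Qed.

Let tau_ (k : nat) : R := 1 - k.+2%:R^-1.

Let tau_ge0 k : 0 <= tau_ k.
Proof. by rewrite /tau_ subr_ge0 invf_le1 ?ler1n// ltr0n. Qed.

Let tau_lt1 k : tau_ k < 1.
Proof. by rewrite /tau_ ltrBlDr ltrDl invr_gt0 ltr0n. Qed.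

Let cvg_tau : tau_ k @[k --> \oo] --> (1 : R).
Proof.
rewrite -[X in _ --> X]subr0; apply: cvgB; first exact: cvg_cst.
by rewrite (cvg_shiftS (@harmonic R)); exact: cvg_harmonic.
Qed.

Lemma cvg_lognorm1_boundary w z : ig mu w ->
  measurable_fun setT (fun x => (z x).1) -> measurable_fun setT (fun x => (z x).2) ->
  (forall x, nrm2 (z x) <= 1) -> {ae mu, forall x, z x != (1, 0)} ->
  ig mu (fun x => w x * lognorm1 (z x)) ->
  \int[mu]_x (w x * lognorm1 (cscal (tau_ k) (z x))) @[k --> \oo] -->
    \int[mu]_x (w x * lognorm1 (z x)).
Proof.
move=> hw m1 m2 z1 zae hL; have mw := ig_meas hw.
suff [] : ig mu (fun x => w x * lognorm1 (z x)) /\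
    \int[mu]_x (w x * lognorm1 (cscal (tau_ k) (z x))) @[k --> \oo] -->
    \int[mu]_x (w x * lognorm1 (z x)) by [].
apply: (dominated_Int (F := fun k x => w x * lognorm1 (cscal (tau_ k) (z x)))
  (g := fun x => `|w x * lognorm1 (z x)| + ln 4 * `|w x|)).
- move=> n; apply: measurable_funM => //.
  by apply: measurable_lognorm1; apply: measurable_funM.
- exact: ig_meas hL.
- by apply: igD; [exact: ig_norm|exact/igZ/ig_norm].
- apply: filterS zae => x zx; apply: cvgMr; apply: cvgMr.
  have q0 : 0 < (1 - (z x).1) ^+ 2 + (z x).2 ^+ 2.
    rewrite lt_neqAle addr_ge0 ?sqr_ge0// andbT eq_sym paddr_eq0 ?sqr_ge0//.
    rewrite !sqrf_eq0 subr_eq0; apply: contra zx.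
    by case: (z x) => a b /= /andP[/eqP <- /eqP ->].
  have ht (a : R) : tau_ k * a @[k --> \oo] --> a.
    by rewrite -[X in _ --> X]mul1r; apply: cvgMl; exact: cvg_tau.
  have h : (1 - tau_ k * (z x).1) ^+ 2 + (tau_ k * (z x).2) ^+ 2 @[k --> \oo] -->
      (1 - (z x).1) ^+ 2 + (z x).2 ^+ 2.
    rewrite !expr2; apply: cvgD; last by apply: cvgM; exact: ht.
    by apply: cvgM; apply: cvgB; [exact: cvg_cst|exact: ht|exact: cvg_cst|exact: ht].
  exact: cvg_comp h (continuous_ln q0).
apply: filterS zae => x zx n; rewrite (normrM (w x)).
apply: le_trans (_ : `|w x| * (`|lognorm1 (z x)| + ln 4) <= _).
  by rewrite ler_wpM2l// lognorm1_scal_le.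
by rewrite (normrM (w x)); lra.
Qed.

(* Abel summation of [- log |1 - z| = \sum_n Re (z ^ n) / n] on the closed
   disc: only an upper bound on the moments of [Re (z ^ n)] is needed. *)
Lemma lognorm1_moments w1 z1 w2 z2 (b : nat -> R) (H : R) :
  ig mu w1 -> measurable_fun setT (fun x => (z1 x).1) ->
  measurable_fun setT (fun x => (z1 x).2) ->
  (forall x, nrm2 (z1 x) <= 1) -> {ae mu, forall x, z1 x != (1, 0)} ->
  ig mu (fun x => w1 x * lognorm1 (z1 x)) ->
  ig mu w2 -> measurable_fun setT (fun x => (z2 x).1) ->
  measurable_fun setT (fun x => (z2 x).2) ->
  (forall x, nrm2 (z2 x) <= 1) -> {ae mu, forall x, z2 x != (1, 0)} ->
  ig mu (fun x => w2 x * lognorm1 (z2 x)) ->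
  (forall n, \int[mu]_x (w1 x * (cpow (z1 x) n.+1).1) +
             \int[mu]_x (w2 x * (cpow (z2 x) n.+1).1) <= b n) ->
  (forall n, 0 <= b n) -> (forall N, \sum_(n < N) b n / n.+1%:R <= H) ->
  - (\int[mu]_x (w1 x * lognorm1 (z1 x)) + \int[mu]_x (w2 x * lognorm1 (z2 x))) <= H.
Proof.
move=> i1 m11 m12 n1 e1 L1 i2 m21 m22 n2 e2 L2 hb b0 bH.
have c1 := cvg_lognorm1_boundary i1 m11 m12 n1 e1 L1.
have c2 := cvg_lognorm1_boundary i2 m21 m22 n2 e2 L2.
have c : - (\int[mu]_x (w1 x * lognorm1 (cscal (tau_ k) (z1 x))) +
    \int[mu]_x (w2 x * lognorm1 (cscal (tau_ k) (z2 x)))) @[k --> \oo] -->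
    - (\int[mu]_x (w1 x * lognorm1 (z1 x)) + \int[mu]_x (w2 x * lognorm1 (z2 x))).
  by apply: cvgN; exact: cvgD.
apply: cvgr_to_le c _; apply: nearW => k; rewrite opprD.
have d1 := cvg_lognorm1_radius i1 m11 m12 n1 (tau_ge0 k) (tau_lt1 k).
have d2 := cvg_lognorm1_radius i2 m21 m22 n2 (tau_ge0 k) (tau_lt1 k).
apply: cvgr_to_le (cvgD d1 d2) _; apply: nearW => N.
apply: le_trans (bH N); rewrite fctE -big_split/=.
apply: ler_sum => n _; rewrite -mulrDr.
apply: (@le_trans _ _ (tau_ k ^+ n.+1 / n.+1%:R * b n)).
  by apply: ler_wpM2l; [rewrite divr_ge0// exprn_ge0|exact: hb].
rewrite mulrAC; apply: ler_wpM2r; first by rewrite invr_ge0 ler0n.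
by rewrite ler_piMl// exprn_ile1// ltW.
Qed.

End abel.

Section abel_one_family.
Context {R : realType} d (T : measurableType d) (mu : {measure set T -> \bar R}).

Lemma lognorm1_moments1 (w : T -> R) (z : T -> R * R) (b : nat -> R) (H : R) :
  ig mu w -> measurable_fun setT (fun x => (z x).1) ->
  measurable_fun setT (fun x => (z x).2) ->
  (forall x, nrm2 (z x) <= 1) -> {ae mu, forall x, z x != (1, 0)} ->
  ig mu (fun x => w x * lognorm1 (z x)) ->
  (forall n, \int[mu]_x (w x * (cpow (z x) n.+1).1) <= b n) ->
  (forall n, 0 <= b n) -> (forall N, \sum_(n < N) b n / n.+1%:R <= H) ->
  - (\int[mu]_x (w x * lognorm1 (z x))) <= H.
Proof.
move=> iw m1 m2 n1 e1 L1 hb b0 bH.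
have e0 (f : T -> R) : \int[mu]_x (0 * f x) = 0.
  by rewrite -[RHS](Int0 mu); apply: eq_Int => x; rewrite mul0r.
have := @lognorm1_moments _ _ _ mu w z (fun=> 0) (fun=> (0, 0)) b H iw m1 m2 n1 e1 L1.
rewrite !e0 addr0; apply => //.
- exact: ig0.
- by move=> x; rewrite /nrm2/= expr0n/= addr0 ler01.
- by apply: aeW => x; rewrite xpair_eqE eq_sym oner_eq0.
- by apply: eq_ig (ig0 mu) => x; rewrite mul0r.
- by move=> n; rewrite e0 addr0.
Qed.

End abel_one_family.

Section product_integrals.
Context {R : realType} d1 d2 (X : measurableType d1) (Y : measurableType d2).
Variables (m1 : {sigma_finite_measure set X -> \bar R})
  (m2 : {sigma_finite_measure set Y -> \bar R}).

(** The real-valued inner integral has a default value where the section is not integrable; this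
    happens on a null set, so it agrees almost everywhere with the extended-valued one. *)
Lemma Int_fubini1 (F : X * Y -> R) : ig (m1 \x m2)%E F ->
  ig m1 (fun x => \int[m2]_y F (x, y)) /\
  \int[(m1 \x m2)%E]_z F z = \int[m1]_x \int[m2]_y F (x, y).
Proof.
move=> hF; have e := integral12_prod_meas1 hF.
have i1 := integrable_fubini_F hF.
have a1 := ae_integrable1 hF.
pose G x := \int[m2]_y F (x, y).
have eG : {ae m1, forall x, fubini_F m2 (EFin \o F) x = (G x)%:E}.
  apply: filterS a1 => x hx; rewrite /fubini_F /G /Rintegral fineK//.
  exact: integrable_fin_num.
have mG : measurable_fun setT G.
  rewrite /G /Rintegral; apply: (measurableT_comp (fine_measurable measurableT)).
  exact: (measurable_fubini_F hF).
have mG' : measurable_fun setT (EFin \o G) by exact/measurable_EFinP.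
have mF' : measurable_fun setT (fubini_F m2 (EFin \o F)) by exact: (measurable_fubini_F hF).
split.
  apply/integrableP; split => //; case/integrableP : i1 => _.
  congr (_ < _)%E; apply: ae_eq_integral => //.
  - exact: measurableT_comp.
  - exact: measurableT_comp.
  - by apply: filterS eG => x /= -> _.
rewrite {1}/Rintegral -e; congr fine; apply: ae_eq_integral => //.
by apply: filterS eG => x /= -> _.
Qed.

Lemma ig_prod (f : X -> R) (h : Y -> R) : ig m1 f -> ig m2 h ->
  ig (m1 \x m2)%E (fun z => f z.1 * h z.2).
Proof.
move=> hf hh; have mf := ig_meas hf; have mh := ig_meas hh.
have m : measurable_fun setT (fun z : X * Y => f z.1 * h z.2) by solve_measurable.
apply/integrable12ltyP; first exact/measurable_EFinP.
rewrite (_ : (fun x => _) = fun x => (`|f x|%:E * (\int[m2]_y `|h y|)%:E)%E); last first.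
  apply/funext => x; rewrite -EFin_Int; last exact: ig_norm.
  rewrite -ge0_integralZl//=; last by apply/measurable_EFinP/measurableT_comp.
  by apply: eq_integral => y _; rewrite -EFinM -normrM.
rewrite ge0_integralZr//=; last 2 first.
- by apply/measurable_EFinP/measurableT_comp.
- by rewrite lee_fin Int_ge0.
by rewrite EFin_Int; [rewrite -EFinM ltry|exact: ig_norm].
Qed.

Lemma Int_prod (f : X -> R) (h : Y -> R) : ig m1 f -> ig m2 h ->
  \int[(m1 \x m2)%E]_z (f z.1 * h z.2) = (\int[m1]_x f x) * \int[m2]_y h y.
Proof.
move=> hf hh; have [_ ->] := Int_fubini1 (ig_prod hf hh).
by rewrite -IntZr//; apply: eq_Int => x /=; rewrite IntZ.
Qed.

End product_integrals.

(** * Reflection positivity of the logarithm *)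

Section reflection_positivity.
Context {R : realType} d (T : measurableType d).
Variables (mu : {sigma_finite_measure set T -> \bar R}) (p q g : T -> R).

(** [xi] is the Cayley transform [(zeta - 1) / (zeta + 1)] of [zeta = p' + i q], and [D] is
    [|zeta + 1|^2]. Replacing [p] by 1 where it is not positive makes [xi] land in the disc
    everywhere; [g] vanishes at those points. *)
Let p' x := if 0 < p x then p x else 1.
Let D x := (p' x + 1) ^+ 2 + q x ^+ 2.
Let xi x : R * R := ((p' x ^+ 2 - 1 + q x ^+ 2) / D x, 2 * q x / D x).

Let p'0 x : 0 < p' x. Proof. by rewrite /p'; case: ifP. Qed.

Let D0 x : 0 < D x.
Proof. by rewrite /D ltr_wpDr ?sqr_ge0// exprn_gt0// addr_gt0. Qed.

Let nrm2_xi x : nrm2 (xi x) = ((p' x - 1) ^+ 2 + q x ^+ 2) / D x.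
Proof. by have := lt0r_neq0 (D0 x); rewrite /nrm2 /xi/= /D => h; field. Qed.

Let nrm2_xi_lt1 x : nrm2 (xi x) < 1.
Proof. by rewrite nrm2_xi ltr_pdivrMr// mul1r /D; have := p'0 x; lra. Qed.

Let z (a : T * T) := cmul (xi a.1) (conjp (xi a.2)).

Let lognorm1_z a : lognorm1 (z a) =
  2^-1 * ln ((p' a.1 + p' a.2) ^+ 2 + (q a.1 - q a.2) ^+ 2) + 2^-1 * ln 4
  - 2^-1 * ln (D a.1) - 2^-1 * ln (D a.2).
Proof.
have h1 := D0 a.1; have h2 := D0 a.2.
rewrite /lognorm1 (_ : (1 - (z a).1) ^+ 2 + (z a).2 ^+ 2 =
  ((p' a.1 + p' a.2) ^+ 2 + (q a.1 - q a.2) ^+ 2) * 4 / (D a.1 * D a.2)); last first.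
  have e1 := lt0r_neq0 h1; have e2 := lt0r_neq0 h2.
  by rewrite /z /cmul/conjp/= /D; rewrite /D in e1 e2; field; rewrite e1 e2.
have h3 : 0 < (p' a.1 + p' a.2) ^+ 2 + (q a.1 - q a.2) ^+ 2.
  by rewrite ltr_wpDr ?sqr_ge0// exprn_gt0// addr_gt0.
rewrite ln_div ?posrE ?mulr_gt0// lnM ?posrE// lnM ?posrE//; ring.
Qed.

(* The Cayley transform maps the right half-plane to the disc and turns
   [log |x + conj y|] into [log |1 - xi conj eta|] up to terms depending on one
   variable only, which are invisible to a neutral [g]. *)
Lemma reflection_positivity :
  measurable_fun setT p -> measurable_fun setT q -> ig mu g ->
  (forall x, g x != 0 -> 0 < p x) -> \int[mu]_x g x = 0 ->
  ig mu (fun x => g x * ln ((p x + 1) ^+ 2 + q x ^+ 2)) ->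
  ig (mu \x mu)%E (fun a => g a.1 * g a.2 *
    ln ((p a.1 + p a.2) ^+ 2 + (q a.1 - q a.2) ^+ 2)) ->
  \int[(mu \x mu)%E]_a (g a.1 * g a.2 *
    ln ((p a.1 + p a.2) ^+ 2 + (q a.1 - q a.2) ^+ 2)) <= 0.
Proof.
move=> mp mq hg gp g0 hD hL.
have mp' : measurable_fun setT p'.
  by apply: measurable_fun_ifT => //; exact: measurable_fun_ltr.
have mD : measurable_fun setT D by rewrite /D; solve_measurable.
have mx1 : measurable_fun setT (fun x => (xi x).1) by rewrite /xi/=; solve_measurable.
have mx2 : measurable_fun setT (fun x => (xi x).2) by rewrite /xi/=; solve_measurable.
have gD x : g x * ln ((p x + 1) ^+ 2 + q x ^+ 2) = g x * ln (D x).
  have [->|gx] := eqVneq (g x) 0; first by rewrite !mul0r.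
  by rewrite /D /p' gp.
have hgg : ig (mu \x mu)%E (fun a => g a.1 * g a.2) by exact: ig_prod.
have hgD : ig mu (fun x => g x * ln (D x)) by apply: eq_ig hD.
have h1 : ig (mu \x mu)%E (fun a => (g a.1 * ln (D a.1)) * g a.2) by exact: ig_prod hgD hg.
have h2 : ig (mu \x mu)%E (fun a => g a.1 * (g a.2 * ln (D a.2))) by exact: ig_prod hg hgD.
have E a : g a.1 * g a.2 * lognorm1 (z a) = 2^-1 * (g a.1 * g a.2 *
    ln ((p a.1 + p a.2) ^+ 2 + (q a.1 - q a.2) ^+ 2)) + (2^-1 * ln 4) * (g a.1 * g a.2)
    - 2^-1 * ((g a.1 * ln (D a.1)) * g a.2) - 2^-1 * (g a.1 * (g a.2 * ln (D a.2))).
  have [e|e1] := eqVneq (g a.1) 0; first by rewrite e !(mul0r,mulr0,subr0,addr0).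
  have [e|e2] := eqVneq (g a.2) 0; first by rewrite e !(mul0r,mulr0,subr0,addr0).
  by rewrite lognorm1_z /p' !gp//; ring.
have hz : ig (mu \x mu)%E (fun a => g a.1 * g a.2 * lognorm1 (z a)).
  apply: eq_ig (fun a => esym (E a)) _.
  by apply: igB; [apply: igB; [apply: igD; exact: igZ|exact: igZ]|exact: igZ].
have -> : \int[(mu \x mu)%E]_a (g a.1 * g a.2 *
    ln ((p a.1 + p a.2) ^+ 2 + (q a.1 - q a.2) ^+ 2)) =
    2 * \int[(mu \x mu)%E]_a (g a.1 * g a.2 * lognorm1 (z a)).
  rewrite (eq_Int _ E) IntB; [|by apply: igB; [apply: igD; exact: igZ|exact: igZ]|exact: igZ].
  rewrite IntB; [|by apply: igD; exact: igZ|exact: igZ].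
  rewrite IntD; [|exact: igZ|exact: igZ].
  rewrite !IntZ//.
  rewrite (Int_prod hgD hg) (Int_prod hg hgD) (Int_prod hg hg) g0.
  by rewrite !(mul0r, mulr0, subr0, addr0) mulrA divff ?mul1r.
rewrite pmulr_rle0//.
have m11 : measurable_fun setT (fun a : T * T => (xi a.1).1) by exact: (measurableT_comp mx1).
have m12 : measurable_fun setT (fun a : T * T => (xi a.2).1) by exact: (measurableT_comp mx1).
have m21 : measurable_fun setT (fun a : T * T => (xi a.1).2) by exact: (measurableT_comp mx2).
have m22 : measurable_fun setT (fun a : T * T => - (xi a.2).2).
  by apply: measurable_funN; exact: (measurableT_comp mx2).
have mz1 : measurable_fun setT (fun a => (z a).1).
  by apply: (measurable_funB (measurable_funM m11 m12)); exact: measurable_funM.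
have mz2 : measurable_fun setT (fun a => (z a).2).
  by apply: (measurable_funD (measurable_funM m11 m22)); exact: measurable_funM.
have nz a : nrm2 (z a) < 1.
  rewrite /z nrm2_cmul (_ : nrm2 (conjp _) = nrm2 (xi a.2)); last by rewrite /nrm2/= sqrrN.
  apply: le_lt_trans (nrm2_xi_lt1 a.1); rewrite ler_piMr ?nrm2_ge0//.
  exact/ltW/nrm2_xi_lt1.
have := @lognorm1_moments1 _ _ _ (mu \x mu)%E (fun a => - (g a.1 * g a.2)) z (fun=> 0) 0.
rewrite (_ : - (\int[_]_x _) = \int[(mu \x mu)%E]_a (g a.1 * g a.2 * lognorm1 (z a))); last first.
  rewrite -IntN; first by apply: eq_Int => a; rewrite mulNr opprK.
  by apply: eq_ig (igN hz) => a; rewrite mulNr.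
apply => //.
- exact: igN.
- by move=> a; exact/ltW.
- by apply: aeW => a; apply: contraTneq (nz a) => ->; rewrite /nrm2/= expr1n expr0n/= addr0 ltxx.
- by apply: eq_ig (igN hz) => a; rewrite mulNr.
- move=> n.
  have [mc ms] := measurable_cpow n.+1 mx1 mx2.
  have b1 x : `|(cpow (xi x) n.+1).1| <= 1 by apply: cpow_re_le; exact/ltW.
  have b2 x : `|(cpow (xi x) n.+1).2| <= 1.
    rewrite -ler_sqr ?nnegrE// real_normK ?num_real// expr1n.
    have : nrm2 (cpow (xi x) n.+1) <= 1.
      by rewrite nrm2_cpow exprn_ile1// ?nrm2_ge0// ltW.
    by rewrite /nrm2; have := sqr_ge0 (cpow (xi x) n.+1).1; lra.
  have ic : ig mu (fun x => g x * (cpow (xi x) n.+1).1) by apply: (igMb (B := 1)).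
  have isn : ig mu (fun x => g x * (cpow (xi x) n.+1).2) by apply: (igMb (B := 1)).
  (* The moment factorizes: [Re (xi^n conj eta^n)] integrates against [g g] to the squared modulus
     of the integral of [g xi^n]. *)
  rewrite (_ : \int[_]_x _ = - ((\int[mu]_x (g x * (cpow (xi x) n.+1).1)) ^+ 2
     + (\int[mu]_x (g x * (cpow (xi x) n.+1).2)) ^+ 2)); last first.
    rewrite !expr2 -(Int_prod ic ic) -(Int_prod isn isn) -IntD; [|exact: (ig_prod ic ic)|exact: (ig_prod isn isn)].
    rewrite -IntN; last exact: igD (ig_prod ic ic) (ig_prod isn isn).
    apply: eq_Int => a; rewrite /z cpowM cpow_conj.
    by move: (cpow _ _) (cpow _ _) => u v; rewrite /cmul/conjp/=; ring.
  by rewrite oppr_le0 addr_ge0// sqr_ge0.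
- by move=> N; rewrite big1// => n _; rewrite mul0r.
Qed.

End reflection_positivity.

(** * The Lebedev-Milin inequality *)

Section complex_parts.
Import complex.
Context {R : realType}.
Implicit Types z w : complex R.

Lemma ReM z w : Re (z * w) = Re z * Re w - Im z * Im w.
Proof. by case: z w => ? ? []. Qed.
Lemma ImM z w : Im (z * w) = Re z * Im w + Im z * Re w.
Proof. by case: z w => ? ? []. Qed.
Lemma ReD z w : Re (z + w) = Re z + Re w.
Proof. by case: z w => ? ? []. Qed.
Lemma ImD z w : Im (z + w) = Im z + Im w.
Proof. by case: z w => ? ? []. Qed.
Lemma ReB z w : Re (z - w) = Re z - Re w.
Proof. by case: z w => ? ? []. Qed.
Lemma ImB z w : Im (z - w) = Im z - Im w.
Proof. by case: z w => ? ? []. Qed.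
Lemma Re_RC (x : R) : Re (real_complex R x) = x. Proof. by []. Qed.
Lemma Im_RC (x : R) : Im (real_complex R x) = 0. Proof. by []. Qed.

Definition complexpE := (ReM, ImM, ReD, ImD, ReB, ImB, Re_RC, Im_RC).

End complex_parts.

Section exp_coefficients.
Import complex.
Context {R : realType}.

(* Taylor coefficients of [exp (\sum_j a_j X^(j+1))]. *)
Fixpoint exp_coefs (a : nat -> R) (k : nat) : seq R :=
  if k is k'.+1 then
    let s := exp_coefs a k' in
    rcons s (k'.+1%:R^-1 * \sum_(j < k'.+1) j.+1%:R * a j * s`_(k' - j))
  else [:: 1].

Definition exp_coef a k := (exp_coefs a k)`_k.

Lemma size_exp_coefs a k : size (exp_coefs a k) = k.+1.
Proof. by elim: k => //= k ih; rewrite size_rcons ih. Qed.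

Lemma nth_exp_coefs a k i : (i <= k)%N -> (exp_coefs a k)`_i = exp_coef a i.
Proof.
elim: k => [|k ih]; first by rewrite leqn0 => /eqP ->.
rewrite leq_eqVlt => /predU1P[->//|]; rewrite ltnS => ik.
by rewrite /= nth_rcons size_exp_coefs ltnS ik ih.
Qed.

(** Comparison of coefficients in [F' = A' F] for [F = exp A]. *)
Lemma exp_coefS a k :
  k.+1%:R * exp_coef a k.+1 = \sum_(j < k.+1) j.+1%:R * a j * exp_coef a (k - j).
Proof.
rewrite {1}/exp_coef /= nth_rcons size_exp_coefs ltnn eqxx.
rewrite mulrA divff ?mul1r ?pnatr_eq0//.
by apply: eq_bigr => j _; rewrite nth_exp_coefs ?leq_subr.
Qed.

Lemma exp_coef0 a : exp_coef a 0 = 1.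
Proof. by []. Qed.

Lemma exp_coef_ge0 a k : (forall j, 0 <= a j) -> 0 <= exp_coef a k.
Proof.
move=> a0; have [m] := ubnP k; elim: m k => // m ih [|k]; first by rewrite exp_coef0.
rewrite ltnS => km; rewrite -(@pmulr_rge0 _ k.+1%:R) ?ltr0n// exp_coefS.
apply: sumr_ge0 => j _; rewrite mulr_ge0 ?mulr_ge0 ?ler0n//.
by apply: ih; apply: leq_ltn_trans km; exact: leq_subr.
Qed.

Lemma sqr_sum_le n (x : 'I_n -> R) : (\sum_i x i) ^+ 2 <= n%:R * \sum_i x i ^+ 2.
Proof.
elim: n x => [|n ih] x; first by rewrite !big_ord0 expr0n mul0r.
rewrite !big_ord_recl; set S := \sum_(i < n) x (lift ord0 i).
set Q := \sum_(i < n) x (lift ord0 i) ^+ 2.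
have hS : S ^+ 2 <= n%:R * Q := ih _.
have Q0 : 0 <= Q by apply: sumr_ge0 => i _; exact: sqr_ge0.
rewrite -natr1 mulrDl mul1r sqrrD.
case: n ih x @S @Q hS Q0 => [|n] _ x S Q hS Q0.
  by rewrite /S big_ord0 mulr0 mul0rn expr0n/= !addr0 mul0r add0r lerDl.
have n0 : 0 < n.+1%:R :> R by rewrite ltr0n.
move: (n.+1%:R : R) n0 hS => k k0 hS.
suff h : x ord0 * S *+ 2 <= k * x ord0 ^+ 2 + Q by rewrite mulrDr; lra.
rewrite -(ler_pM2l k0).
have h2 : 0 <= (k * x ord0 - S) ^+ 2 := sqr_ge0 _.
by move: h2 hS; rewrite -mulr_natr; nra.
Qed.

(** The recurrence writes [k F_k] as a sum of [k] terms [j a_j F_(k-j)]. Squaring it by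
    Cauchy-Schwarz costs a factor [k] and leaves the recurrence for the exponential of the series
    with coefficients [j a_j^2]. *)
Lemma exp_coef_sqr a k :
  exp_coef a k ^+ 2 <= exp_coef (fun j => j.+1%:R * a j ^+ 2) k.
Proof.
have [m] := ubnP k; elim: m k => // m ih [|k]; first by rewrite !exp_coef0 expr1n.
rewrite ltnS => km; have k0 : 0 < k.+1%:R :> R by rewrite ltr0n.
rewrite -(ler_pM2l k0) -(ler_pM2l k0) exp_coefS mulrA -expr2 -exprMn exp_coefS.
apply: le_trans (sqr_sum_le _) _; rewrite ler_pM2l//; apply: ler_sum => j _.
rewrite exprMn exprMn mulrA -expr2; apply: ler_wpM2l.
  by rewrite mulr_ge0 ?sqr_ge0.
by apply: ih; apply: leq_ltn_trans km; exact: leq_subr.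
Qed.

Variables (a : nat -> R) (N : nat).
Hypothesis aN : forall j, (N <= j)%N -> a j = 0.

(** [p K] truncates the exponential of [A], the polynomial with coefficients [a], and [g = A'];
    [D K] measures how far [p K] is from solving [F' = g F]. Its coefficients vanish below degree
    [K]. *)
Let g : {poly R} := \poly_(j < N) (j.+1%:R * a j).
Let p K : {poly R} := \poly_(k < K.+1) exp_coef a k.
Let D K : {poly R} := g * p K - (p K)^`().

Let coef_g j : g`_j = j.+1%:R * a j.
Proof. by rewrite coef_poly; case: ltnP => // h; rewrite aN// mulr0. Qed.

Let coef_p K j : (j <= K)%N -> (p K)`_j = exp_coef a j.
Proof. by move=> jK; rewrite coef_poly ltnS jK. Qed.

Let coef_D_lt K k : (k < K)%N -> (D K)`_k = 0.
Proof.
move=> kK; rewrite coefB coefM coef_deriv coef_p// -mulr_natl exp_coefS.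
apply/eqP; rewrite subr_eq0; apply/eqP; apply: eq_bigr => j _.
by rewrite coef_g coef_p// (leq_trans (leq_subr _ _))// ltnW.
Qed.

Let coef_D_ge K k : (K <= k)%N -> (D K)`_k = \sum_(i < k.+1) g`_i * (p K)`_(k - i).
Proof.
move=> Kk; rewrite coefB coefM coef_deriv coef_poly ltnS ltnNge Kk/= mul0rn subr0 //.
Qed.

(** With nonnegative coefficients the defect [D K] is nonnegative on the positive half-line, so that
    [p K] times [exp (- A)] decreases from its value 1 at 0. *)
Lemma sum_exp_coef_le K : (forall j, 0 <= a j) ->
  \sum_(k < K.+1) exp_coef a k <= expR (\sum_(j < N) a j).
Proof.
move=> a0.
have D0 k : 0 <= (D K)`_k.
  have [kK|Kk] := ltnP k K; first by rewrite coef_D_lt.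
  rewrite coef_D_ge//; apply: sumr_ge0 => i _; rewrite mulr_ge0//.
    by rewrite coef_g mulr_ge0.
  by rewrite coef_poly; case: ifP => // _; exact: exp_coef_ge0.
have Ds s : 0 <= s -> (p K)^`().[s] <= g.[s] * (p K).[s].
  move=> s0; rewrite -subr_ge0 -hornerM -hornerN -hornerD horner_coef.
  by apply: sumr_ge0 => i _; rewrite mulr_ge0 ?exprn_ge0//; exact: D0.
pose A s := \sum_(j < N) a j * s ^+ j.+1.
have dA (s : R) : der A s g.[s].
  apply: der_eq.
    apply: der_sumf => j; apply: der_scalef; apply: der_expnf; exact: der_idf.
  rewrite horner_poly; apply: eq_bigr => j _ /=.
  by rewrite mulr1 mulrA [a j * _]mulrC.
have dp (q : {poly R}) s : der (fun s => q.[s]) s q^`().[s].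
  by have := is_derive_poly q s.
have := @der_nonpos R (fun s => (p K).[s] * expR (- A s))
  (fun s => ((p K)^`().[s] - g.[s] * (p K).[s]) * expR (- A s)).
move=> /(_ _ _)/wrap[||h].
- move=> s _; apply: der_eq.
    exact: (der_mulf (dp (p K) s) (der_expf (der_oppf (dA s)))).
  by rewrite /=; ring.
- move=> s /andP[s0 _]; rewrite mulr_le0_ge0 ?expR_ge0// subr_le0; exact: Ds.
have A1 : A 1 = \sum_(j < N) a j.
  by apply: eq_bigr => j _; rewrite expr1n mulr1.
have A0 : A 0 = 0.
  by rewrite /A big1// => j _; rewrite expr0n mulr0.
move: h; rewrite A0 oppr0 expR0 mulr1 expRN ler_pdivrMr ?expR_gt0// A1.
rewrite horner_coef0 coef_p// exp_coef0 mul1r horner_poly.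
by under eq_bigr do rewrite expr1n mulr1.
Qed.

Local Notation C := (complex R).
Local Notation RC := (@real_complex_def R (Phant R)).
Let ev (P : {poly R}) (e : C) (s : R) : C := (map_poly RC P).[RC s * e].

Let ev_mulXc P e (c : R) s : ev (P * 'X + c%:P) e s = ev P e s * (RC s * e) + RC c.
Proof. by rewrite /ev rmorphD rmorphM/= map_polyX map_polyC/= hornerMXaddC. Qed.

Let der_ev P e s : der (fun s => Re (ev P e s)) s (Re (e * ev P^`() e s)) /\
                 der (fun s => Im (ev P e s)) s (Im (e * ev P^`() e s)).
Proof.
elim/poly_ind: P s => [|P c ih] s.
  rewrite deriv0 (_ : ev 0 e = fun=> 0); last first.
    by apply/funext => t; rewrite /ev rmorph0 horner0.
  by rewrite mulr0; split; exact: der_cstf.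
have [ih1 ih2] := ih s.
have E : ev (P * 'X + c%:P)^`() e s = ev P^`() e s * (RC s * e) + ev P e s.
  by rewrite /ev derivMXaddC addrC rmorphD rmorphM/= map_polyX hornerD hornerMX.
rewrite E; move: ih1 ih2.
have F t : Re (ev (P * 'X + c%:P) e t) =
    (Re (ev P e t) * Re e - Im (ev P e t) * Im e) * t + c.
  by rewrite ev_mulXc !complexpE; ring.
have G t : Im (ev (P * 'X + c%:P) e t) =
    (Re (ev P e t) * Im e + Im (ev P e t) * Re e) * t.
  by rewrite ev_mulXc !complexpE; ring.
rewrite (funext F) (funext G).
move=> ih1 ih2; split; apply: der_eq.
- apply: der_addf; last exact: der_cstf.
  apply: der_mulf; last exact: der_idf.
  by apply: der_subf; apply: der_mulf; first [exact: ih1|exact: ih2|exact: der_cstf].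
- by rewrite !complexpE; ring.
- apply: der_mulf; last exact: der_idf.
  by apply: der_addf; apply: der_mulf; first [exact: ih1|exact: ih2|exact: der_cstf].
- by rewrite !complexpE; ring.
Qed.

Let cisn (t : R) n : (Complex (cos t) (sin t)) ^+ n = Complex (cos (t *+ n)) (sin (t *+ n)).
Proof.
elim: n => [|n ih]; first by rewrite expr0 mulr0n cos0 sin0.
by rewrite exprS ih mulrS cosD sinD; congr Complex; rewrite /= addrC.
Qed.

Let ReIm_ev P t s : ev P (Complex (cos t) (sin t)) s =
  Complex (\sum_(k < size P) P`_k * s ^+ k * cos (t *+ k))
          (\sum_(k < size P) P`_k * s ^+ k * sin (t *+ k)).
Proof.
rewrite /ev horner_coef size_map_poly.
elim/big_rec3: _ => [//|i x y z _ ->].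
rewrite coef_map/= exprMn cisn -rmorphXn/=; apply/eqP; rewrite eq_complex /=.
by apply/andP; split; apply/eqP; ring.
Qed.

Let F : R := \sum_(j < N) `|j.+1%:R * a j|.

(** Only the degrees from [K] to [K + N - 1] survive in [D K], and their coefficients involve
    exponential coefficients of index at least [K - N], which are at most [dl]: the defect is small
    on the whole closed disc. *)
Let ReIm_ev_D (dl : R) K (t s : R) : (N <= K)%N -> 0 <= dl ->
  (forall l, (K - N <= l)%N -> `|exp_coef a l| <= dl) -> 0 <= s <= 1 ->
  `|Re (ev (D K) (Complex (cos t) (sin t)) s)| <= N%:R * (F * dl) /\
  `|Im (ev (D K) (Complex (cos t) (sin t)) s)| <= N%:R * (F * dl).
Proof.
move=> NK dl0 h /andP[s0 s1].
have F0 : 0 <= F by apply: sumr_ge0.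
have hD k : `|(D K)`_k| <= if (k < K)%N then 0 else F * dl.
  case: ltnP => kK; first by rewrite coef_D_lt// normr0.
  rewrite coef_D_ge//; apply: le_trans (ler_norm_sum _ _ _) _.
  apply: (@le_trans _ _ (\sum_(i < k.+1) `|g`_i| * dl)).
    apply: ler_sum => i _; rewrite normrM.
    have [iN|Ni] := ltnP i N; last by rewrite coef_g aN// mulr0 normr0 !mul0r.
    apply: ler_wpM2l => //; rewrite coef_poly; case: ifP => [_|_]; last by rewrite normr0.
    apply: h; apply: leq_sub => //; exact: ltnW.
  rewrite -mulr_suml; apply: ler_wpM2r => //.
  rewrite (bigID (fun i : 'I_k.+1 => (i < N)%N))/= [X in _ + X]big1 ?addr0; last first.
    by move=> i; rewrite -leqNgt => Ni; rewrite coef_g aN// mulr0 normr0.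
  have Nk : (N <= k.+1)%N by apply: leq_trans NK _; apply: leq_trans kK _.
  rewrite -(big_ord_widen _ (fun i => `|g`_i|) Nk)/=.
  by rewrite /F le_eqVlt; apply/orP; left; apply/eqP/eq_bigr => i _; rewrite coef_g.
have sz : (size (D K) <= K + N)%N.
  apply/leq_sizeP => k hk; rewrite coef_D_ge; last exact: leq_trans (leq_addr _ _) hk.
  rewrite big1// => i _.
  have [iN|Ni] := ltnP i N; last by rewrite coef_g aN// mulr0 mul0r.
  rewrite [(p K)`_ _]coef_poly ltnS leqNgt ltn_subRL.
  by rewrite (leq_trans _ hk) ?mulr0// addnC ltn_add2l.
have B (w : nat -> R) : (forall k, `|w k| <= 1) ->
   `|\sum_(k < size (D K)) (D K)`_k * s ^+ k * w k| <= N%:R * (F * dl).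
  move=> hw; apply: le_trans (ler_norm_sum _ _ _) _.
  apply: (@le_trans _ _ (\sum_(k < size (D K)) if (k < K)%N then 0 else F * dl)).
    apply: ler_sum => k _; rewrite -mulrA normrM; apply: le_trans (hD k).
    by rewrite ler_piMr// normrM mulr_ile1// ger0_norm ?exprn_ge0// exprn_ile1.
  apply: (@le_trans _ _ (\sum_(k < K + N) if (k < K)%N then 0 else F * dl)).
    rewrite (big_ord_widen _ (fun k => if (k < K)%N then 0 else F * dl) sz).
    rewrite [X in X <= _]big_mkcond/=.
    by apply: ler_sum => k _; case: ifP => // _; case: ifP => // _; rewrite mulr_ge0.
  rewrite big_split_ord/= big1 ?add0r; last by move=> i _; rewrite ltn_ord.
  under eq_bigr do rewrite ltnNge leq_addr/=.
  by rewrite sumr_const card_ord mulr_natl.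
rewrite ReIm_ev/=; split.
  apply: (B (fun k => cos (t *+ k))) => k.
  by rewrite ler_norml cos_geN1 cos_le1.
apply: (B (fun k => sin (t *+ k))) => k.
by rewrite ler_norml sin_geN1 sin_le1.
Qed.

Let A (t s : R) : R := \sum_(j < N) a j * s ^+ j.+1 * cos (t *+ j.+1).
Let S : R := \sum_(j < N) `|a j|.

Let A_le (t s : R) : 0 <= s <= 1 -> `|A t s| <= S.
Proof.
move=> /andP[s0 s1]; apply: le_trans (ler_norm_sum _ _ _) _; apply: ler_sum => j _.
rewrite -mulrA normrM ler_piMr// normrM mulr_ile1//.
  by rewrite ger0_norm ?exprn_ge0// exprn_ile1.
by rewrite ler_norml cos_geN1 cos_le1.
Qed.

Let sqnorm K (t s : R) : R := Re (ev (p K) (Complex (cos t) (sin t)) s) ^+ 2 +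
                    Im (ev (p K) (Complex (cos t) (sin t)) s) ^+ 2.

(** Approximate Gronwall argument on the ray from 0 to [exp (i t)], where [|p K|^2 exp (- 2 A)]
    would be constant without defect. The defect perturbs the derivative of [|p K|^2] by at most
    [2 eps (2 + |p K|^2)]; as [exp (- 2 A) <= E], the shift [2 E] and the factor [exp (2 eps s)]
    absorb it, so [y] is nondecreasing. *)
Let sqnorm_lower (dl : R) K (t : R) : (N <= K)%N -> 0 <= dl ->
  (forall l, (K - N <= l)%N -> `|exp_coef a l| <= dl) ->
  expR (2 * A t 1) * ((1 + 2 * expR (2 * S)) * expR (- (2 * (N%:R * (F * dl))))
    - 2 * expR (2 * S)) <= sqnorm K t 1.
Proof.
move=> NK dl0 h; set eps := N%:R * (F * dl); set E := expR (2 * S).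
pose e := Complex (cos t) (sin t).
have eps0 : 0 <= eps by rewrite /eps !mulr_ge0//; apply: sumr_ge0.
have E0 : 0 < E := expR_gt0 _.
pose hh s := e * ev g e s.
have dA (s : R) : der (A t) s (Re (hh s)).
  apply: der_eq.
    apply: der_sumf => j; apply: der_mulf; last exact: der_cstf.
    by apply: der_scalef; apply: der_expnf; exact: der_idf.
  rewrite /hh /ev horner_coef size_map_poly mulr_sumr.
  rewrite (_ : Re (\sum_(i < size g) _) = \sum_(i < size g) (g`_i * s ^+ i * cos (t *+ i.+1))); last first.
    rewrite (big_morph (@Re R) (id1 := 0) (op1 := +%R))//; last by case=> ? ? [].
    apply: eq_bigr => i _; rewrite coef_map/= exprMn -rmorphXn/= cisn !complexpE mulrS cosD /=; ring.
  rewrite (big_ord_widen _ (fun i => g`_i * s ^+ i * cos (t *+ i.+1)) (size_poly _ _)).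
  rewrite -/g [RHS]big_mkcond/=; apply: eq_bigr => j _; case: ifPn.
    by rewrite coef_g/= => _; ring.
  rewrite -leqNgt => /leq_sizeP/(_ j (leqnn _)); rewrite coef_g => /eqP.
  by rewrite mulf_eq0 pnatr_eq0/= => /eqP ->; ring.
pose u s := ev (p K) e s; pose r s := e * ev (D K) e s.
have hv s : e * ev (p K)^`() e s = hh s * u s - r s.
  rewrite /hh /r /u /ev /D rmorphB rmorphM/= hornerD hornerN hornerM; ring.
pose y (s : R) : R := (sqnorm K t s * expR (- (2 * A t s)) + 2 * E) * expR (2 * eps * s).
pose dy (s : R) : R := (- (2 * (Re (u s) * Re (r s) + Im (u s) * Im (r s))) * expR (- (2 * A t s))
   + (sqnorm K t s * expR (- (2 * A t s)) + 2 * E) * (2 * eps)) * expR (2 * eps * s).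
have Ey (s : R) : 0 <= s <= 1 -> der (fun s => - y s) s (- dy s).
  move=> _; apply: der_oppf; apply: der_eq.
    have [d1 d2] := der_ev (p K) e s.
    apply: der_mulf; last by apply: der_expf; apply: der_scalef; exact: der_idf.
    apply: der_addf; last exact: der_cstf.
    apply: der_mulf; last by apply: der_expf; apply: der_oppf; apply: der_scalef; exact: dA.
    by apply: der_addf; apply: der_expnf; [exact: d1|exact: d2].
  rewrite hv /dy /sqnorm -/e -/(u s) /=.
  by move: (u s) (r s) (hh s) => U V W; rewrite !complexpE; ring.
have dy0 (s : R) : 0 <= s <= 1 -> - dy s <= 0.
  move=> s01; rewrite oppr_le0 mulr_ge0 ?expR_ge0//.
  have [r1 r2] : `|Re (r s)| <= 2 * eps /\ `|Im (r s)| <= 2 * eps.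
    have [] := ReIm_ev_D t NK dl0 h s01; rewrite -/e -/eps /r.
    rewrite !complexpE /=; move: (Re (ev _ _ _)) (Im (ev _ _ _)) => x1 x2 hx1 hx2.
    have c1 : `|cos t| <= 1 by rewrite ler_norml cos_geN1 cos_le1.
    have s1 : `|sin t| <= 1 by rewrite ler_norml sin_geN1 sin_le1.
    split; [apply: le_trans (ler_normB _ _) _|apply: le_trans (ler_normD _ _) _]; rewrite !normrM.
      have := ler_pM (normr_ge0 _) (normr_ge0 _) c1 hx1.
      have := ler_pM (normr_ge0 _) (normr_ge0 _) s1 hx2; lra.
    have := ler_pM (normr_ge0 _) (normr_ge0 _) c1 hx2.
    have := ler_pM (normr_ge0 _) (normr_ge0 _) s1 hx1; lra.
  rewrite /sqnorm -/e -/(u s); move: (u s) (r s) r1 r2 => [u1 u2] [r1 r2] /= h1 h2.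
  have /(_ _)/wrap[//|hA] := @A_le t s.
  have : expR (- (2 * A t s)) <= E.
    by rewrite ler_expR; move: hA; rewrite ler_norml => /andP[]; lra.
  have := expR_gt0 (- (2 * A t s)); move: (expR _) => E' E'0 E'E.
  have k1 : u1 * r1 <= `|u1| * (2 * eps).
    by apply: le_trans (ler_norm _) _; rewrite normrM ler_wpM2l.
  have k2 : u2 * r2 <= `|u2| * (2 * eps).
    by apply: le_trans (ler_norm _) _; rewrite normrM ler_wpM2l.
  have k3 (v : R) : `|v| * (2 * eps) <= eps * (1 + v ^+ 2).
    have hv2 : 2 * `|v| <= 1 + v ^+ 2.
      by rewrite -(real_normK (num_real v)); have := sqr_ge0 (`|v| - 1); lra.
    by have := ler_wpM2l eps0 hv2; lra.
  have k4 : 2 * (u1 * r1 + u2 * r2) <= 2 * eps * (2 + (u1 ^+ 2 + u2 ^+ 2)).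
    by have := k3 u1; have := k3 u2; lra.
  have k5 := ler_wpM2r (ltW E'0) k4.
  have k6 : 2 * eps * (2 * E') <= 2 * eps * (2 * E).
    by apply: ler_wpM2l; [exact: mulr_ge0|lra].
  lra.
have ev0 (P : {poly R}) : ev P e 0 = RC P`_0.
  by rewrite /ev (rmorph0 (real_complex R)) mul0r horner_coef0 coef_map.
have := der_nonpos Ey dy0; rewrite lerN2 /y /sqnorm -/e ev0 coef_p// exp_coef0/=.
have -> : A t 0 = 0 by rewrite /A big1// => j _; rewrite expr0n mulr0 mul0r.
rewrite !(mulr0, oppr0, expR0, mulr1) expr1n expr0n addr0.
move=> hy.
have := expR_gt0 (2 * A t 1); rewrite expRN.
have := expR_gt0 (2 * eps); move: hy; rewrite expRN.
move: (expR (2 * eps)) (expR (2 * A t 1)) (_ + _) => X Y n hy X0 Y0.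
move: hy; move: (Re _ ^+ 2 + _) => M hy.
have -> : M = Y * (M / Y) by rewrite mulrCA divff ?mulr1// gt_eqF.
by rewrite ler_pM2l// lerBlDr ler_pdivrMr.
Qed.

Lemma trig_exp_lower (dl : R) K (t : R) : (N <= K)%N -> 0 <= dl ->
  (forall l, (K - N <= l)%N -> `|exp_coef a l| <= dl) ->
  expR (2 * \sum_(j < N) a j * cos (t *+ j.+1)) *
    ((1 + 2 * expR (2 * \sum_(j < N) `|a j|)) *
       expR (- (2 * (N%:R * ((\sum_(j < N) `|j.+1%:R * a j|) * dl))))
     - 2 * expR (2 * \sum_(j < N) `|a j|)) <=
  (\sum_(k < K.+1) exp_coef a k * cos (t *+ k)) ^+ 2 +
  (\sum_(k < K.+1) exp_coef a k * sin (t *+ k)) ^+ 2.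
Proof.
move=> NK dl0 h; have := sqnorm_lower t NK dl0 h.
rewrite (_ : A t 1 = \sum_(j < N) a j * cos (t *+ j.+1)); last first.
  by apply: eq_bigr => j _; rewrite expr1n mulr1.
have W (w : nat -> R) : \sum_(k < size (p K)) (p K)`_k * 1 ^+ k * w k =
    \sum_(k < K.+1) exp_coef a k * w k.
  rewrite (big_ord_widen _ (fun k => (p K)`_k * 1 ^+ k * w k) (size_poly _ _)).
  rewrite big_mkcond/=; apply: eq_bigr => j _.
  have <- : (p K)`_j = exp_coef a j by rewrite coef_p// -ltnS.
  rewrite -/(p K); case: ifPn => [_|]; first by rewrite expr1n mulr1.
  by rewrite -leqNgt => /leq_sizeP/(_ j (leqnn _)) ->; rewrite mul0r.
by rewrite /sqnorm ReIm_ev/= (W (fun k => cos (t *+ k))) (W (fun k => sin (t *+ k))).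
Qed.

End exp_coefficients.

Section lebedev_milin.
Context {R : realType}.

(** The squares are dominated by the terms of a nonnegative series with bounded partial sums. *)
Lemma exp_coef_cvg0 (a : nat -> R) N (dl : R) : (forall j, (N <= j)%N -> a j = 0) ->
  0 < dl -> exists K0, forall l, (K0 <= l)%N -> `|exp_coef a l| <= dl.
Proof.
move=> aN dl0; pose c j : R := j.+1%:R * a j ^+ 2.
have c0 j : 0 <= c j by rewrite mulr_ge0 ?sqr_ge0.
have cN j : (N <= j)%N -> c j = 0 by move=> /aN e; rewrite /c e expr0n mulr0.
have nd : nondecreasing_seq (series (exp_coef c)).
  apply/nondecreasing_seqP => n; rewrite /series/= big_nat_recr//= lerDl.
  exact: exp_coef_ge0.
have cv : cvgn (series (exp_coef c)).
  apply: nondecreasing_is_cvgn => //.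
  exists (expR (\sum_(j < N) c j)) => _ [n _ <-].
  rewrite /series/= big_mkord.
  case: n => [|n]; first by rewrite big_ord0 expR_ge0.
  exact: sum_exp_coef_le.
have /cvgr0Pnorm_le/(_ (dl ^+ 2) (exprn_gt0 2 dl0)) := cvg_series_cvg_0 cv.
case=> K0 _ h; exists K0 => l lK.
rewrite -ler_sqr ?nnegrE ?(ltW dl0)// real_normK ?num_real//.
apply: le_trans (exp_coef_sqr a l) _; exact: le_trans (ler_norm _) (h l lK).
Qed.

Context d (T : measurableType d) (mu : {measure set T -> \bar R}).
Variables (kap phi : T -> R).
Hypotheses (ikap : ig mu kap) (mphi : measurable_fun setT phi).
Hypothesis kap0 : forall x, 0 < kap x.
Hypothesis kap1 : \int[mu]_x kap x = 1.
Hypothesis kapn : forall n, \int[mu]_x (kap x * cos (phi x *+ n.+1)) = 0.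

Let mcosn n : measurable_fun setT (fun x => cos (phi x *+ n)).
Proof.
rewrite (_ : (fun x => _) = fun x => cos (n%:R * phi x)); last first.
  by apply/funext => x; rewrite mulr_natl.
by apply: (measurableT_comp measurable_cos); apply: measurable_funM.
Qed.

Let ikcos n : ig mu (fun x => kap x * cos (phi x *+ n)).
Proof. by apply: (igMb (B := 1)) => // x _; rewrite ler_norml cos_geN1 cos_le1. Qed.

(** Parseval's identity: [kap] integrates [cos ((k - l) phi)] to 1 if [k = l] and to 0 otherwise. *)
Let int_sqnorm (b : nat -> R) K :
  ig mu (fun x => kap x * ((\sum_(k < K) b k * cos (phi x *+ k)) ^+ 2 +
    (\sum_(k < K) b k * sin (phi x *+ k)) ^+ 2)) /\
  \int[mu]_x (kap x * ((\sum_(k < K) b k * cos (phi x *+ k)) ^+ 2 +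
    (\sum_(k < K) b k * sin (phi x *+ k)) ^+ 2)) = \sum_(k < K) b k ^+ 2.
Proof.
pose dist (k l : nat) := ((k - l) + (l - k))%N.
have cosd (t : R) (k l : nat) :
    cos (t *+ k) * cos (t *+ l) + sin (t *+ k) * sin (t *+ l) = cos (t *+ dist k l).
  rewrite -cosB; have [kl|lk] := leqP k l.
    rewrite /dist (eqP (_ : (k - l)%N == 0%N)) ?subn_eq0// add0n mulrnBr//.
    by rewrite -cosN opprB.
  by rewrite /dist (eqP (_ : (l - k)%N == 0%N)) ?subn_eq0 ?(ltnW lk)// addn0 mulrnBr// ltnW.
have E x : \sum_(k < K) \sum_(l < K) (b k * b l * (kap x * cos (phi x *+ dist k l))) =
  kap x * ((\sum_(k < K) b k * cos (phi x *+ k)) ^+ 2 +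
    (\sum_(k < K) b k * sin (phi x *+ k)) ^+ 2).
  rewrite !expr2 !big_distrlr/= -big_split/= mulr_sumr; apply: eq_bigr => k _.
  rewrite -big_split/= mulr_sumr; apply: eq_bigr => l _; rewrite -cosd; ring.
have ik k l : ig mu (fun x => b k * b l * (kap x * cos (phi x *+ dist k l))) by exact/igZ.
split.
  by apply: eq_ig E _; apply: ig_sum => k; apply: ig_sum => l; exact: ik.
transitivity (\int[mu]_x \sum_(k < K) \sum_(l < K) (b k * b l * (kap x * cos (phi x *+ dist k l)))).
  by apply: eq_Int => x; rewrite E.
rewrite Int_sum; last by move=> k; apply: ig_sum => l; exact: ik.
apply: eq_bigr => k _; rewrite Int_sum; last by move=> l; exact: ik.
rewrite (bigD1 k)//= big1 ?addr0.
  rewrite IntZ// /dist subnn addn0.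
  rewrite [X in _ * X](_ : _ = 1) ?mulr1 ?expr2//.
  by rewrite -[RHS]kap1; apply: eq_Int => x; rewrite mulr0n cos0 mulr1.
move=> l lk; rewrite IntZ//.
have : (0 < dist k l)%N.
  by rewrite /dist addn_gt0 !subn_gt0; move: lk; rewrite -val_eqE/= neq_ltn orbC.
by case: (dist k l) => // n _; rewrite kapn mulr0.
Qed.

(** Up to a factor tending to 1, [exp (2 A)] is below the trigonometric polynomial [|p K|^2]. By
    Parseval the integral of the latter is the sum of the squared coefficients, which [exp_coef_sqr]
    and [sum_exp_coef_le] control. *)
Lemma lebedev_milin (a : nat -> R) N :
  ig mu (fun x => kap x * expR (2 * \sum_(j < N) a j * cos (phi x *+ j.+1))) /\
  \int[mu]_x (kap x * expR (2 * \sum_(j < N) a j * cos (phi x *+ j.+1))) <=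
    expR (\sum_(j < N) j.+1%:R * a j ^+ 2).
Proof.
wlog aN : a / forall j, (N <= j)%N -> a j = 0.
  move=> /(_ (fun j => if (j < N)%N then a j else 0)) h.
  have e1 x : \sum_(j < N) a j * cos (phi x *+ j.+1) =
     \sum_(j < N) (if (j < N)%N then a j else 0) * cos (phi x *+ j.+1).
    by apply: eq_bigr => j _; rewrite ltn_ord.
  have e2 : \sum_(j < N) j.+1%:R * a j ^+ 2 =
     \sum_(j < N) j.+1%:R * (if (j < N)%N then a j else 0) ^+ 2.
    by apply: eq_bigr => j _; rewrite ltn_ord.
  have [|h1 h2] := h; first by move=> j; rewrite leqNgt => /negbTE ->.
  split; first by apply: eq_ig h1 => x; rewrite e1.
  by rewrite e2; apply: le_trans h2; rewrite le_eqVlt; apply/orP; left; apply/eqP/eq_Int => x; rewrite e1.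
set S := \sum_(j < N) `|a j|; set F := \sum_(j < N) `|j.+1%:R * a j|.
pose V x := 2 * \sum_(j < N) a j * cos (phi x *+ j.+1).
have F0 : 0 <= F by apply: sumr_ge0.
have iV : ig mu (fun x => kap x * expR (V x)).
  apply: (igMb (B := expR (2 * S))) => //.
    apply: (measurableT_comp (@measurable_expR R)); apply: measurable_funM => //.
    apply: measurable_sum => j; exact: measurable_funM.
  move=> x _; rewrite ger0_norm ?expR_ge0// ler_expR /V ler_wpM2l//.
  apply: ler_sum => j _; apply: le_trans (ler_norm _) _.
  by rewrite normrM ler_piMr// ler_norml cos_geN1 cos_le1.
split => //; set I := \int[mu]_x _.
have I0 : 0 <= I by apply: Int_ge0 => x; rewrite mulr_ge0 ?expR_ge0// ltW.
have key (e : R) : 0 < e ->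
   I * ((1 + 2 * expR (2 * S)) * expR (- (2 * e)) - 2 * expR (2 * S)) <=
   expR (\sum_(j < N) j.+1%:R * a j ^+ 2).
  (* Chosen so that [N F dl <= e]; the added 1 guards against a zero denominator. *)
  move=> e0; pose dl := e / (N%:R * F + 1).
  have NF : 0 < N%:R * F + 1 by rewrite ltr_wpDl// mulr_ge0.
  have dl0 : 0 < dl by rewrite divr_gt0.
  have [K0 hK] := exp_coef_cvg0 aN dl0.
  pose K := (K0 + N)%N.
  have low x : (kap x * expR (V x)) *
      ((1 + 2 * expR (2 * S)) * expR (- (2 * e)) - 2 * expR (2 * S)) <=
      kap x * ((\sum_(k < K.+1) exp_coef a k * cos (phi x *+ k)) ^+ 2 +
        (\sum_(k < K.+1) exp_coef a k * sin (phi x *+ k)) ^+ 2).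
    rewrite -mulrA; apply: ler_wpM2l; first exact: ltW.
    apply: le_trans (trig_exp_lower aN (phi x) (leq_addl K0 N) (ltW dl0) _); last first.
      by move=> l; rewrite addnK; exact: hK.
    apply: ler_wpM2l; first exact: expR_ge0.
    rewrite lerD2r; apply: ler_wpM2l; first by rewrite addr_ge0// mulr_ge0// expR_ge0.
    rewrite ler_expR lerN2 ler_pM2l// mulrA -/F /dl mulrA ler_pdivrMr// mulrC.
    by rewrite ler_pM2l// lerDl.
  have [i2 e2] := int_sqnorm (exp_coef a) K.+1.
  rewrite /I -IntZr//; apply: le_trans (le_Int (igZr _ iV) i2 low) _.
  rewrite e2; apply: le_trans (_ : \sum_(k < K.+1) exp_coef (fun j => j.+1%:R * a j ^+ 2) k <= _).
    by apply: ler_sum => k _; exact: exp_coef_sqr.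
  apply: sum_exp_coef_le => j; first by move=> /aN ->; rewrite expr0n mulr0.
  by rewrite mulr_ge0// sqr_ge0.
have cv : I * ((1 + 2 * expR (2 * S)) * expR (- (2 * n.+1%:R^-1)) - 2 * expR (2 * S))
    @[n --> \oo] --> I.
  rewrite -[X in _ --> X]mulr1; apply: cvgMr.
  have e : (1 + 2 * expR (2 * S)) * expR (- (2 * 0)) - 2 * expR (2 * S) = 1.
    by rewrite mulr0 oppr0 expR0 mulr1 addrK.
  rewrite -[X in _ --> X]e; apply: cvgB; last exact: cvg_cst.
  have c2 : - (2 * n.+1%:R^-1) @[n --> \oo] --> - (2 * 0 : R).
    by apply: cvgN; apply: cvgMr; exact: cvg_harmonic.
  by apply: cvgMr; exact: cvg_comp c2 (@continuous_expR R _).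
apply: cvgr_to_le cv _; apply: nearW => n; apply: key.
by rewrite invr_gt0 ltr0n.
Qed.

(* Gibbs' variational principle with the trial density
   [kap * exp (2 \sum_j a_j cos (j phi))], [a_j = d_j / (j p)]. *)
Lemma entropy_fourier_bound (q : T -> R) N : ig mu q -> (forall x, 0 <= q x) ->
  ig mu (fun x => q x * ln (q x / kap x)) ->
  (\int[mu]_x q x) * ln (\int[mu]_x q x) + \sum_(n < N)
    (\int[mu]_x (q x * cos (phi x *+ n.+1))) ^+ 2 / (n.+1%:R * \int[mu]_x q x)
  <= \int[mu]_x (q x * ln (q x / kap x)).
Proof.
move=> iq q0 iH; set p := \int[mu]_x q x.
pose D n := \int[mu]_x (q x * cos (phi x *+ n.+1)); rewrite -/(D _).
have iqc n : ig mu (fun x => q x * cos (phi x *+ n.+1)).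
  by apply: (igMb (B := 1)) => // x _; rewrite ler_norml cos_geN1 cos_le1.
have p0 : 0 <= p by exact: Int_ge0.
pose a n := D n / (n.+1%:R * p).
have [iV hV] := lebedev_milin a N.
set V := fun x => 2 * \sum_(j < N) a j * cos (phi x *+ j.+1).
set A := \sum_(j < N) j.+1%:R * a j ^+ 2 in hV *.
have iqV : ig mu (fun x => \sum_(j < N) (2 * a j * (q x * cos (phi x *+ j.+1)))).
  by apply: ig_sum => j; exact: igZ.
have qV x : \sum_(j < N) (2 * a j * (q x * cos (phi x *+ j.+1))) = q x * V x.
  by rewrite /V mulrCA mulr_sumr mulr_sumr; apply: eq_bigr => j _; ring.
have gibbs (lam : R) : 0 < lam -> \sum_(j < N) 2 * a j * D j + (ln lam + 1) * p - lam * expR A <=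
    \int[mu]_x (q x * ln (q x / kap x)).
  move=> lam0.
  have pt x : q x * V x + (ln lam + 1) * q x - lam * (kap x * expR (V x)) <= q x * ln (q x / kap x).
    have [->|qx] := eqVneq (q x) 0.
      rewrite !(mul0r,mulr0,add0r) oppr_le0 mulr_ge0 ?(ltW lam0)// mulr_ge0 ?expR_ge0//.
      exact: ltW.
    have qx0 : 0 < q x by rewrite lt_neqAle eq_sym qx q0.
    pose W := lam * (kap x * expR (V x)).
    have W0 : 0 < W by rewrite !mulr_gt0 ?expR_gt0.
    have h : ln (W / q x) <= W / q x - 1.
      have := @le_ln1Dx R (W / q x - 1); rewrite addrCA subrr addr0; apply.
      by rewrite ltrBrDr addrC subrr divr_gt0.
    have lW : ln W = ln lam + (ln (kap x) + V x).
      by rewrite /W lnM ?posrE ?mulr_gt0 ?expR_gt0// lnM ?posrE ?expR_gt0// expRK.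
    have h' := ler_wpM2l (ltW qx0) h.
    rewrite ln_div ?posrE// in h'; rewrite ln_div ?posrE// -/W.
    have qW : q x * (W / q x) = W by rewrite mulrCA divff ?mulr1.
    by move: h'; rewrite lW [in X in _ <= X]mulrBr qW; lra.
  have e : \sum_(j < N) 2 * a j * D j = \int[mu]_x (q x * V x).
    rewrite -(eq_Int _ qV) Int_sum; last by move=> j; exact: igZ.
    by apply: eq_bigr => j _; rewrite IntZ.
  have iqV' : ig mu (fun x => q x * V x) by apply: eq_ig qV iqV.
  apply: le_trans (le_Int _ iH pt); last first.
    by apply: igB; [apply: igD => //; exact: igZ|exact: igZ].
  rewrite IntB; [|by apply: igD => //; exact: igZ|exact: igZ].
  rewrite IntD//; last exact: igZ.
  rewrite !IntZ// -e lerD2l lerN2 ler_wpM2l//; exact: ltW.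
have [p00|pn0] := eqVneq p 0.
  rewrite p00 mul0r add0r big1; last by move=> j _; rewrite mulr0 invr0 mulr0.
  have aj j : a j = 0 by rewrite /a p00 mulr0 invr0 mulr0.
  have A0 : A = 0 by rewrite /A big1// => j _; rewrite aj expr0n mulr0.
  apply/ler_addgt0Pr => e e0; have := gibbs _ e0.
  rewrite big1; last by move=> j _; rewrite aj mulr0 mul0r.
  by rewrite p00 mulr0 A0 expR0 mulr1; lra.
have pp : 0 < p by rewrite lt_neqAle eq_sym pn0.
(* The optimal multiple of the trial density: it maximizes [p ln lam - lam exp A]. *)
apply: le_trans (gibbs (p * expR (- A)) _); last by rewrite mulr_gt0 ?expR_gt0.
rewrite lnM ?posrE ?expR_gt0// expRK -mulrA -expRD addNr expR0 mulr1.
have aD j : a j * D j = j.+1%:R * a j ^+ 2 * p.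
  have := pn0; have : j.+1%:R != 0 :> R by rewrite pnatr_eq0.
  by rewrite /a; move: (j.+1%:R) => k k0 p0'; field; rewrite p0' k0.
have -> : \sum_(j < N) 2 * a j * D j = 2 * (A * p).
  by rewrite /A mulr_suml mulr_sumr; apply: eq_bigr => j _; rewrite -mulrA aD.
have -> : \sum_(n < N) D n ^+ 2 / (n.+1%:R * p) = A * p.
  rewrite /A mulr_suml; apply: eq_bigr => j _; rewrite -aD /a.
  by rewrite [RHS]mulrAC expr2.
by lra.
Qed.

End lebedev_milin.

(** * The one-dimensional inequality *)

Section indicators.
Context {R : realType} d (T : measurableType d).

Lemma measurable_boolr (b : T -> bool) : measurable_fun setT b ->
  measurable_fun setT (fun x => (b x)%:R : R).
Proof.
move=> mb; rewrite (_ : (fun x => _) = fun x => if b x then 1 else 0 : R).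
  exact: measurable_fun_ifT.
by apply/funext => x; case: (b x).
Qed.

Lemma measurable_ltr (f g : T -> R) : measurable_fun setT f -> measurable_fun setT g ->
  measurable_fun setT (fun x => ((f x < g x)%R)%:R : R).
Proof. by move=> mf mg; apply: measurable_boolr; exact: measurable_fun_ltr. Qed.

Lemma measurable_ler (f g : T -> R) : measurable_fun setT f -> measurable_fun setT g ->
  measurable_fun setT (fun x => ((f x <= g x)%R)%:R : R).
Proof. by move=> mf mg; apply: measurable_boolr; exact: measurable_fun_ler. Qed.

End indicators.

Section interval_indicator.
Context {R : realType}.
Local Notation mu := (@lebesgue_measure R).
Local Notation T := (measurableTypeR R).

Lemma measurable_inside (a b : R) : measurable_fun setT (fun s : T => (a <= s <= b)%R).
Proof. by apply: measurable_and; exact: measurable_fun_ler. Qed.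

Lemma integral_inside (a b : R) : a <= b ->
  (\int[mu]_s (((a <= s <= b)%R)%:R : R)%:E)%E = (b - a)%:E.
Proof.
move=> ab; transitivity (\int[mu]_s ((\1_(`[a, b]%classic) s : R)%:E))%E.
  by apply: eq_integral => s _; rewrite indicE mem_setE in_itv/=.
rewrite integral_indic//= setIT.
rewrite lebesgue_measure_itv/= lte_fin.
by case: ltgtP ab => // -> _; rewrite subrr.
Qed.

Lemma ig_inside (a b : R) : ig mu (fun s => ((a <= s <= b)%R)%:R).
Proof.
have [ab|ba] := leP a b.
  apply: ge0_ig => //; first by apply: measurable_boolr; exact: measurable_inside.
  by rewrite integral_inside// ltry.
apply: eq_ig (ig0 mu) => s; case: (boolP (a <= s <= b)%R) => // /andP[h1 h2].
by have := lt_le_trans ba (le_trans h1 h2); rewrite ltxx.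
Qed.

Lemma Int_inside (a b : R) : a <= b -> \int[mu]_s ((a <= s <= b)%R)%:R = b - a.
Proof. by move=> ab; apply: ge0_Int; exact: integral_inside. Qed.

Lemma ig_bounded_supp (f : T -> R) (C L : R) : measurable_fun setT f ->
  (forall s, `|f s| <= C) -> (forall s, f s != 0 -> - L <= s <= L) -> ig mu f.
Proof.
move=> mf fC fL.
have C0 : 0 <= C by apply: le_trans (fC 0).
apply: (@ig_le _ _ _ _ _ (fun s : T => C * ((- L <= s <= L)%R)%:R)) => //.
  by apply: igZ; exact: ig_inside.
move=> s; have [->|fs] := eqVneq (f s) 0; first by rewrite normr0 mulr_ge0.
by rewrite fL// mulr1.
Qed.

End interval_indicator.

(** The tangent line of the convex function [x ln x] at [w], that is, Gibbs' inequality before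
    integration. *)
Lemma xlnx_ge {R : realType} (x w : R) : 0 <= x -> 0 < w -> x * ln w + x - w <= x * ln x.
Proof.
rewrite le_eqVlt => /predU1P[<-|x0] w0; first by rewrite !mul0r !add0r oppr_le0 ltW.
have : ln (w / x) <= w / x - 1.
  have := @le_ln1Dx R (w / x - 1); rewrite addrCA subrr addr0; apply.
  by rewrite ltrBrDr addrC subrr divr_gt0.
move=> /(ler_wpM2l (ltW x0)); rewrite ln_div ?posrE//.
have -> : x * (w / x - 1) = w - x by rewrite mulrBr mulrCA divff ?mulr1// gt_eqF.
by lra.
Qed.

Section log_cdf.
Context {R : realType} d (T : measurableType d) (mu : {measure set T -> \bar R}).

(* Under [h], [M] is stochastically larger than a uniform variable on [0, 1],
   whose expected logarithm is [-1]. *)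
Lemma Int_ln_cdf (h M : T -> R) (del : R) : ig mu h -> (forall x, 0 <= h x) ->
  \int[mu]_x h x = 1 -> measurable_fun setT M -> (forall x, 0 <= M x <= 1) ->
  (forall t : R, 0 < t -> \int[mu]_x (h x * ((M x < t)%R)%:R) <= t) -> 0 < del ->
  ig mu (fun x => h x * ln (M x + del)) /\
  -1 <= \int[mu]_x (h x * ln (M x + del)).
Proof.
move=> ih h0 h1 mM M01 hM d0.
have M0 x : 0 <= M x by have /andP[] := M01 x.
have M1 x : M x <= 1 by have /andP[] := M01 x.
have mI (t : R) : measurable_fun setT (fun x => ((M x < t)%R)%:R : R).
  exact: measurable_ltr.
have iI (t : R) : ig mu (fun x => h x * ((M x < t)%R)%:R).
  apply: (igMb (B := 1)) => // x _.
  by case: (M x < t)%R; rewrite ?normr1 ?normr0.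
have ilog : ig mu (fun x => h x * ln (M x + del)).
  apply: (igMb (B := `|ln del| + `|ln (1 + del)|)) => //.
    by apply: (measurableT_comp (@measurable_ln R)); exact: measurable_funD.
  move=> x _.
  have l1 : ln del <= ln (M x + del) by rewrite ler_ln ?posrE ?lerDr// ltr_wpDl.
  have l2 : ln (M x + del) <= ln (1 + del).
    by rewrite ler_ln ?posrE ?lerD2r ?ltr_wpDl.
  rewrite ler_norml; apply/andP; split.
    by have := ler_norm (- ln del); rewrite normrN; have := normr_ge0 (ln (1 + del)); lra.
  by have := ler_norm (ln (1 + del)); have := normr_ge0 (ln del); lra.
split => //.
(* Discrete layer cake on a grid of step [1 / n <= del]: [ln (M + del)] is at least [ln (1 + del)]
   minus the increments of [L] ending at grid points above [M]. An increment occurs with probability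
   at most [t i.+1], so its mean is at most [1 / n]. *)
pose n := (Num.truncn del^-1).+1.
have n0 : 0 < n%:R :> R by rewrite ltr0n.
have nd : n%:R^-1 <= del.
  rewrite -[del]invrK lef_pV2 ?posrE ?invr_gt0//.
  by rewrite ltW//; exact: truncnS_gt.
pose t (i : nat) : R := i%:R / n%:R.
pose L (i : nat) : R := ln (t i + del).
have t0 i : 0 <= t i by rewrite divr_ge0.
have L_le i : 0 <= L i.+1 - L i /\ t i.+1 * (L i.+1 - L i) <= n%:R^-1.
  have ti : 0 < t i + del by rewrite ltr_wpDl.
  have tS : t i.+1 = t i + n%:R^-1 by rewrite /t -natr1 mulrDl mul1r.
  have q0 : 0 < n%:R^-1 :> R by rewrite invr_gt0.
  have ti' : 0 < t i.+1 + del by rewrite ltr_wpDl.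
  have l0 : 0 <= L i.+1 - L i.
    by rewrite subr_ge0 ler_ln ?posrE// lerD2r tS lerDl ltW.
  split => //.
  have : L i.+1 - L i <= n%:R^-1 / (t i + del).
    rewrite -ln_div ?posrE//.
    have -> : (t i.+1 + del) / (t i + del) = 1 + n%:R^-1 / (t i + del).
      by rewrite tS addrAC mulrDl divff// gt_eqF.
    by apply: le_ln1Dx; apply: lt_trans (ltrN10 R) _; rewrite divr_gt0.
  move=> hL; apply: le_trans (ler_wpM2l (t0 _) hL) _.
  by rewrite mulrA ler_pdivrMr// mulrC ler_wpM2l ?(ltW q0)// tS lerD2l.
have low x : ln (1 + del) - \sum_(i < n) (L i.+1 - L i) * ((M x < t i.+1)%R)%:R <= ln (M x + del).
  have Ln : L n = ln (1 + del) by rewrite /L /t divff ?gt_eqF.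
  suff Q k : L k - \sum_(i < k) (L i.+1 - L i) * ((M x < t i.+1)%R)%:R <= L k /\
      L k - \sum_(i < k) (L i.+1 - L i) * ((M x < t i.+1)%R)%:R <= ln (M x + del).
    by have [_] := Q n; rewrite Ln.
  elim: k => [|k [ih1 ih2]].
    rewrite big_ord0 subr0; split => //.
    by rewrite /L /t mul0r add0r ler_ln ?posrE ?lerDr// ltr_wpDl.
  rewrite big_ord_recr/=; have [l0 _] := L_le k.
  have [h2|h2] := ltP (M x) (t k.+1); rewrite /= ?mulr1 ?mulr0; first by split; lra.
  have : L k.+1 <= ln (M x + del).
    by rewrite ler_ln ?posrE ?lerD2r// ltr_wpDl.
  by split; lra.
have iS : ig mu (fun x => \sum_(i < n) (L i.+1 - L i) * (h x * ((M x < t i.+1)%R)%:R)).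
  by apply: ig_sum => i; exact: igZ.
apply: (@le_trans _ _ (\int[mu]_x (ln (1 + del) * h x -
    \sum_(i < n) (L i.+1 - L i) * (h x * ((M x < t i.+1)%R)%:R)))).
  rewrite IntB//; last exact: igZ.
  rewrite IntZ// h1 mulr1 Int_sum; last by move=> i; exact: igZ.
  have : 0 <= ln (1 + del) by rewrite ln_ge0// lerDl ltW.
  have : \sum_(i < n) \int[mu]_x ((L i.+1 - L i) * (h x * ((M x < t i.+1)%R)%:R)) <= 1.
    apply: (@le_trans _ _ (\sum_(i < n) n%:R^-1)).
      apply: ler_sum => i _; rewrite IntZ//.
      have [l0 l1] := L_le i; apply: le_trans l1; rewrite mulrC ler_wpM2r//.
      by apply: hM; rewrite divr_gt0// ltr0n.
    by rewrite sumr_const card_ord -(mulr_natr n%:R^-1) mulVf// gt_eqF.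
  by lra.
apply: le_Int => //; first by apply: igB => //; exact: igZ.
move=> x; have := ler_wpM2l (h0 x) (low x).
rewrite mulrBr mulr_sumr [h x * ln (1 + del)]mulrC.
by under [X in _ - X <= _ -> _]eq_bigr do rewrite mulrCA.
Qed.

End log_cdf.

Section radial.
Context {R : realType}.
Local Notation mu := (@lebesgue_measure R).
Local Notation T := (measurableTypeR R).
Variables (h : T -> R) (B K : R).
Hypotheses (ih : ig mu h) (h0 : forall s, 0 <= h s) (h1 : \int[mu]_s h s = 1).
Hypotheses (hB : forall s, h s <= B) (hK : forall s, h s != 0 -> - K <= s <= K).

Definition cdf (t : R) : R := \int[mu]_s (h s * ((s <= t)%R)%:R).

Let mh : measurable_fun setT h := ig_meas ih.

Let igh (b : T -> bool) : measurable_fun setT b -> ig mu (fun s => h s * (b s)%:R).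
Proof.
move=> mb; apply: (igMb (B := 1)) => //; first exact: measurable_boolr.
by move=> x _; case: (b x); rewrite ?normr1 ?normr0.
Qed.

Let mle (t : R) : measurable_fun setT (fun s : T => (s <= t)%R).
Proof. exact: measurable_fun_ler. Qed.

Let mge (t : R) : measurable_fun setT (fun s : T => (t <= s)%R).
Proof. exact: measurable_fun_ler. Qed.

Let mlt (t : R) : measurable_fun setT (fun s : T => (s < t)%R).
Proof. exact: measurable_fun_ltr. Qed.

Let mgt (t : R) : measurable_fun setT (fun s : T => (t < s)%R).
Proof. exact: measurable_fun_ltr. Qed.

Lemma cdf_ge0 t : 0 <= cdf t.
Proof. by apply: Int_ge0 => s; rewrite mulr_ge0. Qed.

Lemma cdf_le1 t : cdf t <= 1.
Proof.
rewrite -h1; apply: le_Int => //; first exact: igh.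
by move=> s; rewrite ler_piMr ?lern1 ?leq_b1.
Qed.

Lemma cdf_mono s t : s <= t -> cdf s <= cdf t.
Proof.
move=> st; apply: le_Int; [exact: igh|exact: igh|move=> x].
rewrite ler_wpM2l//; case: (leP x s) => // xs; by rewrite (le_trans xs st).
Qed.

Lemma measurable_cdf : measurable_fun setT cdf.
Proof. by apply: nondecreasing_measurable => // s t; exact: cdf_mono. Qed.

Lemma cdf_compl (t : R) : \int[mu]_s (h s * ((t < s)%R)%:R) = 1 - cdf t.
Proof.
rewrite -[X in _ = X - _]h1 /cdf -IntB//; last exact: igh.
apply: eq_Int => s; rewrite ltNge.
by have [] := leP s t => _ /=; ring.
Qed.

Let B0 : 0 <= B. Proof. exact: le_trans (h0 0) (hB 0). Qed.

Lemma Int_slab_le (a b : R) : a <= b -> \int[mu]_s (h s * ((a <= s <= b)%R)%:R) <= B * (b - a).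
Proof.
move=> ab.
have mI := measurable_inside a b.
rewrite -(Int_inside ab) -IntZ; last exact: ig_inside.
apply: le_Int; [exact: igh|by apply: igZ; exact: ig_inside|].
by move=> s; rewrite ler_wpM2r.
Qed.

Lemma cdf_lipschitz (s t : R) : s <= t -> cdf t - cdf s <= B * (t - s).
Proof.
move=> st; rewrite lerBlDr addrC.
apply: le_trans (lerD (lexx _) (Int_slab_le st)).
rewrite -IntD; [|exact: igh|by apply: igh; exact: measurable_inside].
apply: le_Int; [exact: igh|by apply: igD; [exact: igh|by apply: igh; exact: measurable_inside]|].
move=> x; rewrite -mulrDr ler_wpM2l//.
by have [xs|xs] := leP x s; have [xt|xt] := leP x t;
  rewrite /= ?(ltW xs) ?xt ?add0r ?addr0 ?lerDl ?addr_ge0.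
Qed.

Lemma continuous_cdf : continuous cdf.
Proof.
move=> s; apply/cvgrPdist_le => e e0.
have B1 : 0 < B + 1 by rewrite ltr_wpDl.
near=> t.
have d : (B + 1) * `|s - t| <= e.
  rewrite -ler_pdivlMl// mulrC; near: t.
  by exists (e / (B + 1)) => [|t] /=; [rewrite divr_gt0|exact: ltW].
apply: le_trans d; have [st|ts] := leP s t.
  rewrite distrC [`|s - t|]distrC !ger0_norm ?subr_ge0//; last exact: cdf_mono.
  by apply: le_trans (cdf_lipschitz st) _; rewrite ler_wpM2r ?subr_ge0// lerDl.
rewrite !ger0_norm ?subr_ge0//; [|exact: ltW|exact: cdf_mono (ltW ts)].
apply: le_trans (cdf_lipschitz (ltW ts)) _.
by rewrite ler_wpM2r ?subr_ge0 ?lerDl// ltW.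
Unshelve. all: by end_near.
Qed.

(** The set where [cdf < t] lies below its supremum and has points arbitrarily close to it; the slab
    that remains has small mass because [h <= B]. *)
Let P_cdf_lt (t : R) : 0 < t -> \int[mu]_s (h s * ((cdf s < t)%R)%:R) <= t.
Proof.
move=> t0; have mc := measurable_cdf.
have mS : measurable_fun setT (fun s : T => (cdf s < t)%R) by exact: measurable_fun_ltr.
have [t1|t1] := leP 1 t.
  apply: le_trans t1; rewrite -[leRHS]h1; apply: le_Int => //; first exact: (igh mS).
  by move=> s; rewrite ler_piMr ?lern1 ?leq_b1.
have K1 : 1 <= cdf K.
  rewrite -h1; apply: le_Int => //; first exact: igh.
  by move=> s; have [->|/hK/andP[_ ->]] := eqVneq (h s) 0; rewrite ?mul0r// mulr1.
pose S := [set s : R | cdf s < t].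
have ubS : ubound S K.
  move=> s; rewrite /S/= => st; rewrite leNgt; apply/negP => Ks.
  by have := cdf_mono (ltW Ks); move: st; lra.
have [S0|/set0P nS] := eqVneq S set0.
  rewrite (eq_Int _ (g := fun=> 0)) ?Int0 ?ltW// => s.
  rewrite (_ : (cdf s < t)%R = false) ?mulr0//; apply/negbTE/negP => st.
  by have : S s by []; rewrite S0.
have hS : has_sup S by split=> //; exists K.
apply/ler_addgt0Pr => e e0.
have e1 : 0 < e / (B + 1) by rewrite divr_gt0// ltr_wpDl.
have [s Ss hs] := sup_adherent e1 hS.
have sS : s <= sup S by exact: sup_ubound (ex_intro _ K ubS) _ Ss.
apply: (@le_trans _ _ (cdf s + \int[mu]_x (h x * ((s <= x <= sup S)%R)%:R))).
  rewrite -IntD; [|exact: igh|by apply: igh; exact: measurable_inside].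
  apply: le_Int; [exact: (igh mS)|by apply: igD; [exact: igh|by apply: igh; exact: measurable_inside]|].
  move=> x; rewrite -mulrDr ler_wpM2l//.
  have [xt|_] := boolP (cdf x < t)%R; last by rewrite addr_ge0.
  have xS : x <= sup S by apply: (sup_ubound (ex_intro _ K ubS)).
  by case: (leP x s) => xs; rewrite ?lerDl// (ltW xs) xS add0r.
apply: lerD; first exact: ltW.
apply: le_trans (Int_slab_le sS) _.
apply: (@le_trans _ _ ((B + 1) * (e / (B + 1)))).
  by apply: ler_pM => //; lra.
by rewrite mulrCA divff ?mulr1// gt_eqF// ltr_wpDl.
Qed.

Let cdf_lt_K (s : R) : s < - K -> cdf s = 0.
Proof.
move=> sK; rewrite -[RHS](Int0 mu); apply: eq_Int => x.
have [->|/hK/andP[xK _]] := eqVneq (h x) 0; first by rewrite mul0r.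
by rewrite leNgt (lt_le_trans sK xK) mulr0.
Qed.

Let cdf_ge_K (s : R) : K <= s -> cdf s = 1.
Proof.
move=> sK; rewrite -h1; apply: eq_Int => x.
have [->|/hK/andP[_ xK]] := eqVneq (h x) 0; first by rewrite mul0r.
by rewrite (le_trans xK sK) mulr1.
Qed.

Let P_cdf_gt (t : R) : 0 < t -> \int[mu]_s (h s * ((1 - cdf s < t)%R)%:R) <= t.
Proof.
move=> t0; have mc := measurable_cdf.
have mS : measurable_fun setT (fun s : T => (1 - cdf s < t)%R).
  by apply: measurable_fun_ltr => //; exact: measurable_funB.
have [t1|t1] := leP 1 t.
  apply: le_trans t1; rewrite -[leRHS]h1; apply: le_Int => //; first exact: (igh mS).
  by move=> s; rewrite ler_piMr ?lern1 ?leq_b1.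
pose S := [set s : R | 1 - cdf s < t].
have lbS : lbound S (- K).
  move=> s; rewrite /S/= => st; rewrite leNgt; apply/negP => Ks.
  by move: st; rewrite cdf_lt_K//; lra.
have [S0|/set0P nS] := eqVneq S set0.
  rewrite (eq_Int _ (g := fun=> 0)) ?Int0 ?ltW// => s.
  rewrite (_ : (1 - cdf s < t)%R = false) ?mulr0//; apply/negbTE/negP => st.
  by have : S s by []; rewrite S0.
have hS : has_inf S by split=> //; exists (- K).
apply/ler_addgt0Pr => e e0.
have e1 : 0 < e / (B + 1) by rewrite divr_gt0// ltr_wpDl.
have [s Ss hs] := inf_adherent e1 hS.
have sS : inf S <= s by exact: inf_lbound (ex_intro _ (- K) lbS) _ Ss.
apply: (@le_trans _ _ (\int[mu]_x (h x * ((s < x)%R)%:R) + \int[mu]_x (h x * ((inf S <= x <= s)%R)%:R))).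
  rewrite -IntD; [|exact: igh|by apply: igh; exact: measurable_inside].
  apply: le_Int; [exact: (igh mS)|by apply: igD; [exact: igh|by apply: igh; exact: measurable_inside]|].
  move=> x; rewrite -mulrDr ler_wpM2l//.
  have [xt|_] := boolP (1 - cdf x < t)%R; last by rewrite addr_ge0.
  have xS : inf S <= x by apply: (inf_lbound (ex_intro _ (- K) lbS)).
  by case: (ltP s x) => xs; rewrite ?lerDl// xS add0r.
apply: lerD; first by rewrite cdf_compl; exact: ltW.
apply: le_trans (Int_slab_le sS) _.
apply: (@le_trans _ _ ((B + 1) * (e / (B + 1)))).
  by apply: ler_pM => //; lra.
by rewrite mulrCA divff ?mulr1// gt_eqF// ltr_wpDl.
Qed.

Let K0 : 0 <= K.
Proof.
rewrite leNgt; apply/negP => K0; have : \int[mu]_s h s = 0.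
  rewrite -[RHS](Int0 mu); apply: eq_Int => s; apply/eqP/negPn/negP => /hK/andP[? ?]; lra.
by rewrite h1 => /eqP; rewrite oner_eq0.
Qed.

Let ig_cdfM : ig mu (fun s => cdf s * (1 - cdf s)).
Proof.
have mc := measurable_cdf.
apply: (@ig_bounded_supp _ _ 1 K) => //.
- by apply: measurable_funM => //; exact: measurable_funB.
- move=> s; have := cdf_ge0 s; have := cdf_le1 s => ? ?.
  by rewrite ger0_norm ?mulr_ge0 ?subr_ge0// mulr_ile1 ?subr_ge0//; lra.
move=> s; apply: contraR; rewrite negb_and -!ltNge => /orP[sK|sK].
  by rewrite cdf_lt_K// mul0r.
by rewrite cdf_ge_K ?ltW// subrr mulr0.
Qed.

Lemma cdf_median : exists c, cdf c = 2^-1.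
Proof.
have KK : - K - 1 <= K by apply: le_trans (_ : - K <= K); [rewrite gerDl|apply: le_trans K0]; rewrite oppr_le0.
have c1 : cdf (- K - 1) = 0 by rewrite cdf_lt_K// gtrDl.
have c2 : cdf K = 1 by rewrite cdf_ge_K.
have [||c _ hc] := @IVT R cdf (- K - 1) K 2^-1 KK.
- by apply: continuous_subspaceT; exact: continuous_cdf.
- rewrite c1 c2 /Num.min /Num.max ltr01 invr_ge0/= ler0n/=; lra.
by exists c.
Qed.

Lemma ig_xlnx : ig mu (fun s => h s * ln (h s)).
Proof.
apply: (@ig_bounded_supp _ _ (1 + B ^+ 2) K).
- by apply: measurable_funM => //; exact: (measurableT_comp (@measurable_ln R)).
- move=> s; have h1' := @xlnx_ge R _ _ (h0 s) (@ltr01 R); rewrite ln1 mulr0 add0r in h1'.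
  have [->|hs] := eqVneq (h s) 0; first by rewrite mul0r normr0 addr_ge0// sqr_ge0.
  have hs0 : 0 < h s by rewrite lt_neqAle eq_sym hs h0.
  have h2 := ler_wpM2l (h0 s) (ltW (ln_sublinear hs0)).
  have h3 : h s * h s <= B ^+ 2 by rewrite expr2 ler_pM.
  rewrite ler_norml; apply/andP; split; last by lra.
  by have := sqr_ge0 B; have := h0 s; lra.
by move=> s; have [->|/hK] := eqVneq (h s) 0; rewrite ?mul0r ?eqxx.
Qed.

(** Gibbs' inequality against [w = 2 H (1 - H)]. The means of [ln H] and [ln (1 - H)] are at least
    -1 by [Int_ln_cdf], and the mass of [h] gives back 1. Regularizing both logarithms by [del] adds
    [2 (del + del^2)] to [w] on the support, which costs a multiple of [2 K]. *)
Lemma entropy_cdf_bound :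
  ln 2 - 1 - 2 * \int[mu]_s (cdf s * (1 - cdf s)) <= \int[mu]_s (h s * ln (h s)).
Proof.
have mc := measurable_cdf.
have mc' : measurable_fun setT (fun s => 1 - cdf s) by exact: measurable_funB.
set I := \int[mu]_s (cdf s * (1 - cdf s)).
have key (del : R) : 0 < del -> ln 2 - 1 - 2 * I - 2 * ((del + del ^+ 2) * (2 * K)) <=
    \int[mu]_s (h s * ln (h s)).
  move=> d0.
  have [i1 l1] := Int_ln_cdf ih h0 h1 mc (fun s => introT andP (conj (cdf_ge0 s) (cdf_le1 s))) P_cdf_lt d0.
  have c01 s : 0 <= 1 - cdf s <= 1 by have := cdf_ge0 s; have := cdf_le1 s => ? ?; apply/andP; lra.
  have [i2 l2] := Int_ln_cdf ih h0 h1 mc' c01 P_cdf_gt d0.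
  pose b (s : T) : R := ((- K <= s <= K)%R)%:R.
  have KK : - K <= K by apply: le_trans K0; rewrite oppr_le0.
  have eb : \int[mu]_s b s = 2 * K by rewrite Int_inside//; ring.
  have ib : ig mu b by exact: ig_inside.
  have pt s : (h s * ln (cdf s + del) + h s * ln (1 - cdf s + del)) + (ln 2 + 1) * h s
      - (2 * (cdf s * (1 - cdf s)) + (2 * (del + del ^+ 2)) * b s) <= h s * ln (h s).
    have c0 := cdf_ge0 s; have c1 := cdf_le1 s.
    have w1 : 0 < cdf s + del by rewrite ltr_wpDl.
    have w2 : 0 < 1 - cdf s + del by rewrite ltr_wpDl// subr_ge0.
    have cc : 0 <= cdf s * (1 - cdf s) by rewrite mulr_ge0// subr_ge0.
    have dd : 0 <= 2 * (del + del ^+ 2) * b s.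
      by rewrite !mulr_ge0// addr_ge0 ?ltW// exprn_gt0.
    have [->|hs] := eqVneq (h s) 0; first by rewrite !mul0r !mulr0; lra.
    have := @xlnx_ge R (h s) (2 * (cdf s + del) * (1 - cdf s + del)) (h0 s) _.
    rewrite !mulr_gt0// => /(_ isT); rewrite !lnM ?posrE ?mulr_gt0//.
    by rewrite /b hK// mulr1; lra.
  apply: le_trans (le_Int _ ig_xlnx pt); last first.
    apply: igB; last by apply: igD; exact: igZ.
    by apply: igD; [exact: igD|exact: igZ].
  rewrite IntB; [|by apply: igD; [exact: igD|exact: igZ]|by apply: igD; exact: igZ].
  rewrite IntD; [|exact: igD|exact: igZ].
  rewrite IntD// IntZ// h1 IntD; [|exact: igZ|exact: igZ].
  by rewrite !IntZ// eb -/I; lra.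
apply/ler_addgt0Pr => e e0.
pose del := Num.min 1 (e / (8 * (K + 1))).
have K1 : 0 < 8 * (K + 1) by rewrite mulr_gt0// ltr_wpDl.
have d0 : 0 < del by rewrite lt_min ltr01 divr_gt0.
have := key _ d0.
have d1 : del <= 1 by rewrite ge_min lexx.
have d2 : del * (8 * (K + 1)) <= e by rewrite -ler_pdivlMr// ge_min lexx orbT.
have d3 : del ^+ 2 <= del by rewrite expr2 ler_piMl// ltW.
have d4 : (del + del ^+ 2) * K <= 2 * del * K by rewrite ler_wpM2r//; lra.
by lra.
Qed.

End radial.

Section sigma_finite_product.
Context {R : realType} d1 d2 (X : measurableType d1) (Y : measurableType d2).
Variables (m1 : {sigma_finite_measure set X -> \bar R})
  (m2 : {sigma_finite_measure set Y -> \bar R}).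

(** A synonym of the product that carries a sigma-finite structure, so that it can in turn be a
    factor of a product. *)
Definition sprod : set (X * Y) -> \bar R := (m1 \x m2)%E.

HB.instance Definition _ := Measure.on sprod.

Let sprod_sigma_finite : sigma_finite setT sprod.
Proof.
have /sigma_finiteP[F [TF ndF Foo]] := sigma_finiteT m1.
have /sigma_finiteP[G [TG ndG Goo]] := sigma_finiteT m2.
exists (fun n => F n `*` G n).
  rewrite -setXTT TF TG predeqE => -[x y]; split.
    move=> [/= [n _ Fnx] [k _ Gky]]; exists (maxn n k) => //; split.
    - by move: x Fnx; exact/subsetPset/ndF/leq_maxl.
    - by move: y Gky; exact/subsetPset/ndG/leq_maxr.
  by move=> [n _ []/= ? ?]; split; exists n.
move=> k; have [? ?] := Foo k; have [? ?] := Goo k.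
split; first exact: measurableX.
by rewrite /sprod product_measure1E// lte_mul_pinfty// ge0_fin_numE.
Qed.

HB.instance Definition _ :=
  Measure_isSigmaFinite.Build _ _ _ sprod sprod_sigma_finite.

Definition swap (z : X * Y) : Y * X := (z.2, z.1).

Lemma cov_swap : cov sprod (m2 \x m1)%E setT swap (fun=> 1).
Proof.
move=> f mf f0.
have ms : measurable_fun setT swap by rewrite /swap; solve_measurable.
have mg : measurable_fun setT (fun z => f (swap z)) by exact: measurableT_comp.
have g0 z : (0 <= f (swap z))%E by exact: f0.
transitivity (\int[sprod]_z f (swap z))%E; last first.
  by apply: eq_integral => z _; rewrite mule1.
rewrite /sprod (fubini_tonelli2 (m1 := m1) (m2 := m2) _ mg g0).
by rewrite (fubini_tonelli1 (m1 := m2) (m2 := m1) _ mf f0).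
Qed.

End sigma_finite_product.

Section fubini_swapped.
Context {R : realType} d1 d2 (X : measurableType d1) (Y : measurableType d2).
Variables (m1 : {sigma_finite_measure set X -> \bar R})
  (m2 : {sigma_finite_measure set Y -> \bar R}).

Lemma cov_ig d3 d4 (A : measurableType d3) (Z : measurableType d4)
    (m : {measure set A -> \bar R}) (n : {measure set Z -> \bar R})
    (Phi : A -> Z) (J : A -> R) (f : Z -> R) :
  measurable_fun setT Phi -> measurable_fun setT J -> (forall a, 0 <= J a) ->
  cov m n setT Phi J -> measurable_fun setT f ->
  ig n f <-> ig m (fun a => f (Phi a) * J a).
Proof. exact: cov_integrable. Qed.

Lemma Int_fubini2 (F : X * Y -> R) : ig (m1 \x m2)%E F ->
  ig m2 (fun y => \int[m1]_x F (x, y)) /\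
  \int[(m1 \x m2)%E]_z F z = \int[m2]_y \int[m1]_x F (x, y).
Proof.
move=> hF; have mF := ig_meas hF.
have ms : measurable_fun setT (@swap _ _ Y X) by rewrite /swap; solve_measurable.
have C := cov_swap m2 m1.
have i2 : ig (m2 \x m1)%E (fun z => F (swap z)).
  have := (cov_ig ms (measurable_cst _) (fun=> ler01) C mF).1 hF.
  by apply: eq_ig => z; rewrite mulr1.
have [k1 k2] := Int_fubini1 i2; split => //.
rewrite -[RHS]k2 (cov_Rintegral (fun=> ler01) C mF).
by apply: eq_Int => z; rewrite mulr1.
Qed.

End fubini_swapped.

Section mixture.
Context {R : realType} d1 d2 (X : measurableType d1) (Y : measurableType d2).
Variables (mu : {sigma_finite_measure set X -> \bar R})
  (nu : {sigma_finite_measure set Y -> \bar R}).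

(** A kernel that is a superposition over [y] of products [a x y * b x' y] turns a double integral
    into a single one. This is applied to [|s - s'|] and to differences of exponentials. *)
Lemma Int_mixture (a b : X -> Y -> R) :
  ig (sprod mu mu \x nu)%E (fun w => a w.1.1 w.2 * b w.1.2 w.2) ->
  (forall y, ig mu (a ^~ y)) -> (forall y, ig mu (b ^~ y)) ->
  ig (mu \x mu)%E (fun z => \int[nu]_y (a z.1 y * b z.2 y)) /\
  \int[(mu \x mu)%E]_z (\int[nu]_y (a z.1 y * b z.2 y)) =
    \int[nu]_y ((\int[mu]_x a x y) * \int[mu]_x b x y).
Proof.
move=> hF ha hb.
have [i1 e1] := Int_fubini1 hF; have [i2 e2] := Int_fubini2 hF.
split; first exact: i1.
apply: (etrans (esym e1)); apply: (etrans e2); apply: eq_Int => y.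
exact: (Int_prod (ha y) (hb y)).
Qed.

End mixture.

Section radial_interaction.
Context {R : realType}.
Local Notation mu := (@lebesgue_measure R).
Local Notation T := (measurableTypeR R).
Variables (h : T -> R) (B K : R).
Hypotheses (ih : ig mu h) (h0 : forall s, 0 <= h s) (h1 : \int[mu]_s h s = 1).
Hypotheses (hB : forall s, h s <= B) (hK : forall s, h s != 0 -> - K <= s <= K).

Let igh (b : T -> bool) : measurable_fun setT b -> ig mu (fun s => h s * (b s)%:R).
Proof.
move=> mb; apply: (igMb (B := 1)) => //; first exact: measurable_boolr.
by move=> x _; case: (b x); rewrite ?normr1 ?normr0.
Qed.

Let Int_between (s s' : R) : \int[mu]_(t in setT) (((s <= t)%R)%:R * ((t < s')%R)%:R) =
  Num.max 0 (s' - s).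
Proof.
apply: ge0_Int; transitivity (\int[mu]_t ((\1_(`[s, s'[%classic) t : R)%:E))%E.
  apply: eq_integral => t _; rewrite indicE mem_setE in_itv/=.
  by case: (s <= t)%R; case: (t < s')%R; rewrite ?mulr0 ?mulr1.
rewrite integral_indic//= setIT lebesgue_measure_itv/= lte_fin maxC /Num.max subr_lt0.
by case: ltgtP => //= ->; rewrite subrr.
Qed.

(** The positive part of [s' - s] is the length of the set of [t] with [s <= t < s']; at fixed [t]
    the double integral is [H t] times [1 - H t]. *)
Let posdist : ig (mu \x mu)%E (fun z => h z.1 * h z.2 * Num.max 0 (z.2 - z.1)) /\
  \int[(mu \x mu)%E]_z (h z.1 * h z.2 * Num.max 0 (z.2 - z.1)) =
  \int[mu]_t (cdf h t * (1 - cdf h t)).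
Proof.
have mh := ig_meas ih.
have ml : measurable_fun setT (fun w : (T * T) * T => (w.1.1 <= w.2)%R).
  by apply: measurable_fun_ler; solve_measurable.
have mr : measurable_fun setT (fun w : (T * T) * T => (w.2 < w.1.2)%R).
  by apply: measurable_fun_ltr; solve_measurable.
have mlr := @measurable_boolr R _ _ _ ml; have mrr := @measurable_boolr R _ _ _ mr.
have hF : ig (sprod mu mu \x mu)%E (fun w : (T * T) * T =>
    (h w.1.1 * ((w.1.1 <= w.2)%R)%:R) * (h w.1.2 * ((w.2 < w.1.2)%R)%:R)).
  have h2 := ig_prod ih ih.
  have h3 := @ig_prod _ _ _ _ _ (sprod mu mu) mu _ _ h2 (ig_inside (- K) K).
  have f1 : measurable_fun setT (fun w : (T * T) * T => h w.1.1).
    by apply: (measurableT_comp mh); exact: (measurableT_comp measurable_fst).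
  have f2 : measurable_fun setT (fun w : (T * T) * T => h w.1.2).
    by apply: (measurableT_comp mh); exact: (measurableT_comp measurable_snd).
  apply: (ig_le _ h3); first by apply: measurable_funM; exact: measurable_funM.
  move=> w; rewrite ger0_norm ?mulr_ge0//.
  have [->|n1] := eqVneq (h w.1.1) 0; first by rewrite !mul0r.
  have [->|n2] := eqVneq (h w.1.2) 0; first by rewrite !(mul0r, mulr0).
  have /andP[k1 k2] := hK n1; have /andP[k3 k4] := hK n2.
  have hh : 0 <= h w.1.1 * h w.1.2 by rewrite mulr_ge0.
  have [l1|l1] := leP w.1.1 w.2; have [l2|l2] := ltP w.2 w.1.2;
    rewrite ?(mulr0, mul0r, mulr1); rewrite ?mulr_ge0//.
  by rewrite (le_trans k1 l1) (ltW (lt_le_trans l2 k4)) mulr1.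
have [||j1 j2] := Int_mixture (a := fun s t : T => h s * ((s <= t)%R)%:R)
  (b := fun s t : T => h s * ((t < s)%R)%:R) hF.
- by move=> y; apply: igh; exact: measurable_fun_ler.
- by move=> y; apply: igh; exact: measurable_fun_ltr.
have E (z : T * T) : \int[mu]_t ((h z.1 * ((z.1 <= t)%R)%:R) * (h z.2 * ((t < z.2)%R)%:R)) =
    h z.1 * h z.2 * Num.max 0 (z.2 - z.1).
  rewrite -Int_between -IntZ; first by apply: eq_Int => t; rewrite mulrACA.
  apply: (@ig_le _ _ _ _ _ (fun t : T => ((z.1 <= t <= z.2)%R)%:R)).
  - by apply: measurable_funM; [exact: measurable_ler|exact: measurable_ltr].
  - exact: ig_inside.
  move=> t; rewrite ger0_norm ?mulr_ge0//.
  have [l1|l1] := leP z.1 t; have [l2|l2] := ltP t z.2; rewrite ?(mulr0, mul0r, mulr1)//.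
  by rewrite (ltW l2).
split; first by apply: eq_ig j1 => z; exact: E.
rewrite -(eq_Int _ E) j2; apply: eq_Int => t.
by rewrite (cdf_compl ih h1).
Qed.

Lemma Int_dist : ig (mu \x mu)%E (fun z => h z.1 * h z.2 * `|z.1 - z.2|) /\
  \int[(mu \x mu)%E]_z (h z.1 * h z.2 * `|z.1 - z.2|) =
  2 * \int[mu]_t (cdf h t * (1 - cdf h t)).
Proof.
have [p1 p2] := posdist.
have C := cov_swap mu mu.
have ms : measurable_fun setT (@swap _ _ T T) by rewrite /swap; solve_measurable.
have q1 : ig (mu \x mu)%E (fun z => h z.1 * h z.2 * Num.max 0 (z.1 - z.2)).
  have := (cov_ig ms (measurable_cst _) (fun=> ler01) C (ig_meas p1)).1 p1.
  by apply: eq_ig => z; rewrite mulr1/= [h z.2 * _]mulrC.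
have q2 : \int[(mu \x mu)%E]_z (h z.1 * h z.2 * Num.max 0 (z.1 - z.2)) =
    \int[mu]_t (cdf h t * (1 - cdf h t)).
  rewrite -p2 (cov_Rintegral (fun=> ler01) C (ig_meas p1)).
  by apply: eq_Int => z; rewrite mulr1/= [h z.2 * _]mulrC.
have E (z : T * T) : h z.1 * h z.2 * Num.max 0 (z.2 - z.1) + h z.1 * h z.2 * Num.max 0 (z.1 - z.2) =
    h z.1 * h z.2 * `|z.1 - z.2|.
  rewrite -mulrDr; congr (_ * _); rewrite /Num.max !subr_gt0.
  by case: ltgtP => h'; [rewrite addr0 ltr0_norm ?subr_lt0// opprB|
    rewrite add0r gtr0_norm ?subr_gt0|rewrite h' subrr normr0 addr0].
split; first by apply: (eq_ig E); exact: igD.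
by rewrite -(eq_Int _ E) IntD// p2 q2; ring.
Qed.

Lemma radial_bound : ln 2 - 1 <= \int[mu]_s (h s * ln (h s)) +
  \int[(mu \x mu)%E]_z (h z.1 * h z.2 * `|z.1 - z.2|).
Proof. by have [_ ->] := Int_dist; have := entropy_cdf_bound ih h0 h1 hB hK; lra. Qed.

End radial_interaction.

(** * The logarithmic kernel in the plane *)

Section exponential_tail.
Context {R : realType}.
Local Notation mu := (@lebesgue_measure R).
Local Notation T := (measurableTypeR R).

Lemma exp_tail (c b : R) : 0 < c ->
  ig mu (fun s : T => expR (c * s) * ((s <= b)%R)%:R) /\
  \int[mu]_(s in setT) (expR (c * s) * ((s <= b)%R)%:R) = expR (c * b) / c.
Proof.
move=> c0.
have m1 : measurable_fun setT (fun s : T => ((s <= c * b)%R)%:R : R) by exact: measurable_ler.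
have m : measurable_fun setT (fun s : T => expR s * ((s <= c * b)%R)%:R) by solve_measurable.
have m2 : measurable_fun setT (fun s : T => ((s <= b)%R)%:R : R) by exact: measurable_ler.
have m' : measurable_fun setT (fun s : T => expR (c * s) * ((s <= b)%R)%:R) by solve_measurable.
have E : (\int[mu]_s (expR s * ((s <= c * b)%R)%:R)%:E)%E = (expR (c * b))%:E.
  rewrite -integral_expR_Ny [RHS]integral_mkcond; apply: eq_integral => s _.
  rewrite patchE mem_setE in_itv/=; case: ifP => _; by rewrite ?mulr1 ?mulr0.
have ie : ig mu (fun s : T => expR s * ((s <= c * b)%R)%:R).
  by apply: ge0_ig => //; rewrite E ltry.
have mc : measurable_fun setT (fun s : T => c * s : T) by exact: measurable_funM.
have e (s : T) : expR (c * s) * ((c * s <= c * b)%R)%:R * c * c^-1 = expR (c * s) * ((s <= b)%R)%:R.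
  by rewrite -mulrA divff ?mulr1 ?gt_eqF// ler_pM2l.
have i1 := (cov_ig mc (measurable_cst c) (fun=> ltW c0) (cov_scale c0) m).1 ie.
have i2 := igZr c^-1 i1.
split; first exact: (eq_ig e i2).
rewrite -(eq_Int _ e) IntZr//; congr (_ / _).
by rewrite -(cov_Rintegral (fun=> ltW c0) (cov_scale c0) m); exact: ge0_Int.
Qed.

(** An integrable function of one coordinate that dominates the logarithmic singularity; on the
    positive side the substitution [r = exp s] turns it into an exponential tail. *)
Lemma ig_invsqrt (L : R) :
  ig mu (fun r : T => (Num.sqrt `|r|)^-1 * ((- L <= r <= L)%R)%:R).
Proof.
pose f (r : T) : R := (Num.sqrt r)^-1 * ((r <= L)%R)%:R * ((0 < r)%R)%:R.
have m1 : measurable_fun setT (fun s : T => ((s <= L)%R)%:R : R) by exact: measurable_ler.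
have m2 : measurable_fun setT (fun s : T => ((0 < s)%R)%:R : R) by exact: measurable_ltr.
have m3 : measurable_fun setT (fun s : T => ((- L <= s <= L)%R)%:R : R).
  by apply: measurable_boolr; exact: measurable_inside.
have mf : measurable_fun setT f by rewrite /f; solve_measurable.
have f0 r : 0 <= f r by rewrite /f !mulr_ge0// invr_ge0 sqrtr_ge0.
have hf : ig mu f.
  have [L0|L0] := leP L 0.
    apply: eq_ig (ig0 mu) => r; rewrite /f.
    by have [rL|] := leP r L; have [r0|] := ltP 0 r; rewrite ?(mulr0, mul0r)//; lra.
  apply: ge0_ig => //.
  have mfE : measurable_fun setT (fun r => (f r)%:E) by exact/measurable_EFinP.
  have -> : (\int[mu]_r (f r)%:E = \int[mu]_(r in `]0%R, +oo[%classic) (f r)%:E)%E.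
    rewrite [RHS]integral_mkcond; apply: eq_integral => r _.
    by rewrite patchE mem_setE in_itv/= andbT /f; have [] := ltP 0 r => _; rewrite ?mulr0.
  rewrite (cov_expR (@ltr01 R) mfE)//.
  have [i1 _] := exp_tail (ln L) (@divr_gt0 _ 1 2 ltr01 (ltr0n _ 2)).
  rewrite (eq_integral (EFin \o (fun s : T => expR (1 / 2 * s) * ((s <= ln L)%R)%:R))).
    by rewrite EFin_Int ?ltry.
  move=> s _; rewrite -EFinM /f/= !mul1r expR_gt0 mulr1; congr (_%:E).
  have e : expR s = expR (2^-1 * s) ^+ 2 by rewrite -expRM_natl -mulr_natr -mulrA; congr expR; lra.
  have -> : (expR s <= L)%R = (s <= ln L)%R by rewrite -[RHS]ler_expR lnK.
  have h0 : expR (2^-1 * s) != 0 by rewrite gt_eqF// expR_gt0.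
  have -> : Num.sqrt (expR s) = expR (2^-1 * s) by rewrite e sqrtr_sqr ger0_norm ?expR_ge0.
  by rewrite e; field.
have mo : measurable_fun setT (fun x : T => - x : T) by exact: measurable_funN.
have hg := (cov_ig mo (measurable_cst _) (fun=> ler01) (@cov_opp R) mf).1 hf.
apply: (@ig_le _ _ _ _ _ (fun r : T => f r + f (- r) * 1)); [|exact: igD|].
  by solve_measurable.
move=> r; rewrite mulr1 ger0_norm; last by rewrite mulr_ge0// invr_ge0 sqrtr_ge0.
have [/andP[r1 r2]|_] := boolP (- L <= r <= L)%R; last by rewrite mulr0 addr_ge0.
rewrite mulr1; have [r0|r0|->] := ltgtP r 0.
- rewrite ltr0_norm//; apply: (@le_trans _ _ (f (- r))); last by rewrite lerDr.
  by rewrite /f oppr_gt0 r0 lerNl r1 !mulr1.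
- by rewrite gtr0_norm//; apply: (@le_trans _ _ (f r)); [rewrite /f r0 r2 !mulr1|rewrite lerDl].
- by rewrite normr0 sqrtr0 invr0 addr_ge0.
Qed.

End exponential_tail.

Section measure_preserving.
Context {R : realType} d1 d2 (A : measurableType d1) (X : measurableType d2).
Variables (m : {measure set A -> \bar R}) (n : {measure set X -> \bar R}).

Definition mpres (Phi : A -> X) :=
  measurable_fun setT Phi /\ cov m n setT Phi (fun=> 1).

Lemma mpres_ig Phi (f : X -> R) : mpres Phi -> measurable_fun setT f ->
  ig n f <-> ig m (fun a => f (Phi a)).
Proof.
move=> [mP C] mf; rewrite (cov_ig mP (measurable_cst _) (fun=> ler01) C mf).
by split; apply: eq_ig => a; rewrite mulr1.
Qed.

Lemma mpres_Int Phi (f : X -> R) : mpres Phi -> measurable_fun setT f ->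
  \int[n]_x f x = \int[m]_a f (Phi a).
Proof.
move=> [mP C] mf; rewrite (cov_Rintegral (fun=> ler01) C mf).
by apply: eq_Int => a; rewrite mulr1.
Qed.

Lemma mpres_igP Phi (f : X -> R) : mpres Phi -> ig n f -> ig m (fun a => f (Phi a)).
Proof. by move=> h hf; apply/(mpres_ig h) => //; exact: ig_meas hf. Qed.

Lemma eq_mpres Phi Psi : (forall a, Phi a = Psi a) -> mpres Phi -> mpres Psi.
Proof. by move=> /funext ->. Qed.

End measure_preserving.

Section measure_preserving_products.
Context {R : realType} d1 d2 d3 d4 (A : measurableType d1) (X : measurableType d2)
  (B : measurableType d3) (Y : measurableType d4).
Variables (m1 : {sigma_finite_measure set A -> \bar R})
  (m2 : {sigma_finite_measure set X -> \bar R})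
  (m3 : {sigma_finite_measure set B -> \bar R})
  (m4 : {sigma_finite_measure set Y -> \bar R}).

Lemma mpres_prod (Phi : A -> X) (Psi : B -> Y) : mpres m1 m2 Phi -> mpres m3 m4 Psi ->
  mpres (m1 \x m3)%E (m2 \x m4)%E (fun a => (Phi a.1, Psi a.2)).
Proof.
move=> [h1 c1] [h2 c2]; split.
  by solve_measurable.
have := cov_prod measurableT measurableT h1 (measurable_cst _) (fun=> ler01)
  h2 (measurable_cst _) (fun=> ler01) c1 c2.
rewrite setXTT => C f mf f0; rewrite C//.
by apply: eq_integral => a _; rewrite mulr1.
Qed.

Lemma mpres_id : mpres m1 m1 id.
Proof.
split; first exact: measurable_id.
by move=> f mf f0; apply: eq_integral => x _; rewrite mule1.
Qed.

Lemma mpres_comp (Phi : A -> X) (Psi : X -> B) : mpres m1 m2 Phi -> mpres m2 m3 Psi ->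
  mpres m1 m3 (Psi \o Phi).
Proof.
move=> [h1 c1] [h2 c2]; split; first exact: measurableT_comp.
move=> f mf f0; rewrite c2//.
under eq_integral do rewrite mule1.
by rewrite c1//; exact: measurableT_comp.
Qed.

End measure_preserving_products.

Section plane.
Context {R : realType}.
Local Notation mu := (@lebesgue_measure R).
Local Notation T := (measurableTypeR R).
Local Notation pl := (T * T)%type.
Local Notation L2 := (@lebesgue2 R).

Definition sqdist (x y : pl) : R := (x.1 - y.1) ^+ 2 + (x.2 - y.2) ^+ 2.

Definition square_ind (K : R) (x : pl) : R := ((- K <= x.1 <= K)%R)%:R * ((- K <= x.2 <= K)%R)%:R.

Lemma square_ind_ge0 K x : 0 <= square_ind K x. Proof. by rewrite mulr_ge0. Qed.

Lemma ig_square_ind K : ig L2 (square_ind K).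
Proof. exact: (ig_prod (ig_inside _ _) (ig_inside _ _)). Qed.

Lemma square_indP K x : square_ind K x != 0 -> (- K <= x.1 <= K) && (- K <= x.2 <= K).
Proof. by rewrite /square_ind; case: (_ <= _ <= _)%R; rewrite ?mul0r ?eqxx// mul1r; case: (_ <= _ <= _)%R; rewrite ?eqxx. Qed.

Definition bdd (u : pl -> R) := measurable_fun setT u /\
  exists B K : R, [/\ 0 <= B, 0 <= K & forall x, `|u x| <= B * square_ind K x].

Lemma ig_bdd u : bdd u -> ig L2 u.
Proof. by move=> [mu' [B [K [B0 K0 h]]]]; apply: ig_le mu' _ h; apply: igZ; exact: ig_square_ind. Qed.

Lemma measurable_swap : measurable_fun setT (fun x : pl => (x.2, x.1) : pl).
Proof. by solve_measurable. Qed.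

Lemma mpres_swap : mpres L2 L2 (fun x : pl => (x.2, x.1) : pl).
Proof. by split; [exact: measurable_swap|exact: cov_swap]. Qed.

Lemma mpres_shift (c : R) : mpres mu mu (fun x : T => x + c : T).
Proof. by split; [exact: measurable_funD|exact: cov_shift]. Qed.

Lemma mpres_opp : mpres mu mu (fun x : T => - x : T).
Proof. by split; [exact: measurable_funN|exact: cov_opp]. Qed.

Lemma mpres_flip : mpres L2 L2 (fun x : pl => (- x.1, x.2) : pl).
Proof. exact: (mpres_prod mpres_opp (mpres_id mu)). Qed.

Lemma mpres_shift1 (c : R) : mpres L2 L2 (fun x : pl => (x.1 + c, x.2) : pl).
Proof. exact: (mpres_prod (mpres_shift c) (mpres_id mu)). Qed.

Lemma mpres_subl (a : pl) : mpres L2 L2 (fun x : pl => (a.1 - x.1, a.2 - x.2) : pl).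
Proof.
have h (c : R) : mpres mu mu (fun x : T => c - x : T).
  by apply: eq_mpres (mpres_comp mpres_opp (mpres_shift c)) => x /=; rewrite addrC.
exact: (mpres_prod (h a.1) (h a.2)).
Qed.

Lemma measurable_coords : [/\ measurable_fun setT (fun z : pl * pl => z.1.1),
  measurable_fun setT (fun z : pl * pl => z.1.2),
  measurable_fun setT (fun z : pl * pl => z.2.1) &
  measurable_fun setT (fun z : pl * pl => z.2.2)].
Proof. by split; apply: measurableT_comp => //; solve_measurable. Qed.

Lemma ig_convolution (f G : pl -> R) : ig L2 f -> ig L2 G ->
  ig (L2 \x L2)%E (fun z => f z.1 * G (z.1.1 - z.2.1, z.1.2 - z.2.2)).
Proof.
move=> hf hG; have mf := ig_meas hf; have mG := ig_meas hG.
have m : measurable_fun setT (fun z : pl * pl => f z.1 * G (z.1.1 - z.2.1, z.1.2 - z.2.2)).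
  have [m11 m12 m21 m22] := measurable_coords.
  apply: measurable_funM; first by apply: (measurableT_comp mf); solve_measurable.
  by apply: (measurableT_comp mG); apply: measurable_fun_pair; apply: measurable_funB.
apply/integrable12ltyP; first exact/measurable_EFinP.
have hh x : ig L2 (fun y : pl => `|G (x.1 - y.1, x.2 - y.2)|).
  exact: (mpres_igP (mpres_subl x) (ig_norm hG)).
rewrite (_ : (fun x => _) = fun x => (`|f x|%:E * (\int[L2]_y `|G y|)%:E)%E); last first.
  apply/funext => x.
  rewrite (mpres_Int (mpres_subl x)); last by apply: measurableT_comp => //; exact: normr_measurable.
  rewrite -EFin_Int; last exact: hh.
  rewrite -ge0_integralZl//=; last by apply/measurable_EFinP; exact: ig_meas (hh x).
  by apply: eq_integral => y _; rewrite -EFinM -normrM.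
rewrite ge0_integralZr//=; last 2 first.
- by apply/measurable_EFinP/measurableT_comp.
- by rewrite lee_fin Int_ge0.
by rewrite EFin_Int; [rewrite -EFinM ltry|exact: ig_norm].
Qed.

Lemma line_null : {ae (L2 \x L2)%E, forall z : pl * pl, z.1.1 != z.2.1}.
Proof.
have mD : measurable [set z : pl * pl | z.1.1 = z.2.1].
  rewrite [X in measurable X](_ : _ = (fun z : pl * pl => z.1.1 - z.2.1) @^-1` [set 0]).
    have [m11 _ m21 _] := measurable_coords.
    by rewrite -[X in measurable X]setTI; apply: measurable_funB.
  by apply/seteqP; split => z /=; [move=> ->; rewrite subrr|move=> /eqP; rewrite subr_eq0 => /eqP].
exists [set z | z.1.1 = z.2.1]; split => //; last first.
  by move=> z /= /negP; rewrite negbK => /eqP.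
rewrite /product_measure1/= integral0_eq// => x _ /=.
rewrite (_ : xsection _ _ = [set x.1] `*` setT); last first.
  apply/seteqP; split => y; rewrite /xsection/= inE/=; first by move=> ->.
  by move=> [-> _].
have m1 : measurable ([set x.1] : set T) by exact: measurable_set1.
apply: (etrans (product_measure1E mu mu m1 measurableT)).
by rewrite /= lebesgue_measure_set1 mul0e.
Qed.

Lemma ln_expr4_ge (r : R) : 0 < r -> - (4 * r^-1) <= ln (r ^+ 4).
Proof.
move=> r0; rewrite lnXn// -mulr_natl.
have r1 : 0 < r^-1 by rewrite invr_gt0.
have := ln_sublinear r1; rewrite lnV ?posrE//; lra.
Qed.

Lemma itv_sub (a b K K' : R) : - K <= a <= K -> - K' <= b <= K' ->
  - (K + K') <= a - b <= K + K'.
Proof. by move=> /andP[? ?] /andP[? ?]; apply/andP; split; lra. Qed.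

Lemma ig_log_kernel (u v : pl -> R) (k : pl * pl -> R) (C : R) :
  bdd u -> bdd v -> measurable_fun setT k ->
  (forall z, (z.1.1 - z.2.1) ^+ 2 <= k z) ->
  (forall z, u z.1 != 0 -> v z.2 != 0 -> k z <= C) ->
  ig (L2 \x L2)%E (fun z => u z.1 * v z.2 * ln (k z)).
Proof.
move=> hu hv mk k1 k2.
have [mu' [B [K [B0 K0 hB]]]] := hu; have [mv [B' [K' [B0' K0' hB']]]] := hv.
pose L := K + K'.
pose w (x : pl) : R := ((Num.sqrt `|x.1|)^-1 * ((- L <= x.1 <= L)%R)%:R) * ((- L <= x.2 <= L)%R)%:R.
have iw : ig L2 w by exact: (ig_prod (ig_invsqrt L) (ig_inside _ _)).
have w0 x : 0 <= w x by rewrite /w !mulr_ge0// invr_ge0 sqrtr_ge0.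
have i1 := ig_convolution (ig_square_ind K) iw.
have i2 := ig_prod (ig_square_ind K) (ig_square_ind K').
pose dom (z : pl * pl) := (4 * B * B') * (square_ind K z.1 * w (z.1.1 - z.2.1, z.1.2 - z.2.2)) +
  (B * B' * `|C|) * (square_ind K z.1 * square_ind K' z.2).
have idom : ig (L2 \x L2)%E dom by apply: igD; exact: igZ.
pose n (z : pl * pl) : R := (z.1.1 != z.2.1)%:R.
have [mz1 _ mz2 _] := measurable_coords.
have mn : measurable_fun setT n.
  rewrite /n; apply: measurable_boolr.
  apply: (measurableT_comp (f := negb)) => //; exact: measurable_fun_eqr.
have muv : measurable_fun setT (fun z : pl * pl => u z.1 * v z.2).
  by apply: measurable_funM; [apply: (measurableT_comp mu')|apply: (measurableT_comp mv)]; solve_measurable.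
have mF : measurable_fun setT (fun z : pl * pl => u z.1 * v z.2 * ln (k z)).
  by apply: measurable_funM => //; exact: (measurableT_comp (@measurable_ln R)).
have : ig (L2 \x L2)%E (fun z => u z.1 * v z.2 * ln (k z) * n z).
  apply: (ig_le _ idom); first exact: measurable_funM.
  move=> z; rewrite /n; have [e|ne] := eqVneq z.1.1 z.2.1.
    rewrite mulr0 normr0 addr_ge0// !mulr_ge0// ?square_ind_ge0//.
  rewrite mulr1.
  have [->|nu] := eqVneq (u z.1) 0.
    by rewrite !mul0r normr0 addr_ge0// !mulr_ge0// ?square_ind_ge0//.
  have [->|nv] := eqVneq (v z.2) 0.
    by rewrite mulr0 mul0r normr0 addr_ge0// !mulr_ge0// ?square_ind_ge0//.
  have pu : square_ind K z.1 != 0.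
    by apply: contraNneq nu => e; have := hB z.1; rewrite e mulr0 normr_le0.
  have pv : square_ind K' z.2 != 0.
    by apply: contraNneq nv => e; have := hB' z.2; rewrite e mulr0 normr_le0.
  have [a1 a2] := andP (square_indP pu).
  have [b1 b2] := andP (square_indP pv).
  have w1 : (- L <= z.1.1 - z.2.1 <= L)%R by exact: itv_sub.
  have w2 : (- L <= z.1.2 - z.2.2 <= L)%R by exact: itv_sub.
  have wE : w (z.1.1 - z.2.1, z.1.2 - z.2.2) = (Num.sqrt `|z.1.1 - z.2.1|)^-1.
    rewrite /w; set r : T := _ - z.2.1 in w1 *; set r' : T := _ - z.2.2 in w2 *.
    by rewrite w1 w2 !mulr1.
  have d0 : 0 < `|z.1.1 - z.2.1| by rewrite normr_gt0 subr_eq0.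
  have s0 : 0 < Num.sqrt `|z.1.1 - z.2.1| by rewrite sqrtr_gt0.
  have kk : 0 < k z by apply: lt_le_trans (k1 z); rewrite -real_normK ?num_real// exprn_gt0.
  have lk : `|ln (k z)| <= 4 * w (z.1.1 - z.2.1, z.1.2 - z.2.2) + `|C|.
    rewrite wE; set r := Num.sqrt _ in s0 *.
    have rK : (z.1.1 - z.2.1) ^+ 2 = r ^+ 4.
      by rewrite (exprM r 2 2) sqr_sqrtr// real_normK// num_real.
    have l1 : - (4 * r^-1) <= ln (k z).
      apply: (@le_trans _ _ (ln (r ^+ 4))); last by rewrite ler_ln ?posrE ?exprn_gt0// -rK.
      exact: ln_expr4_ge.
    have l2 : ln (k z) <= `|C|.
      apply: le_trans (ler_norm C); apply: le_trans (k2 z nu nv).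
      by apply: ltW; exact: ln_sublinear.
    have rr : 0 <= 4 * r^-1 by rewrite mulr_ge0// invr_ge0 ltW.
    rewrite ler_norml; apply/andP; split; last by rewrite (le_trans l2)// lerDr.
    by rewrite opprD (le_trans _ l1)// gerDl oppr_le0.
  have uv : `|u z.1 * v z.2| <= B * B' * (square_ind K z.1 * square_ind K' z.2).
    rewrite normrM (_ : B * B' * _ = (B * square_ind K z.1) * (B' * square_ind K' z.2)); last by ring.
    exact: ler_pM.
  have s1 : square_ind K' z.2 = 1.
    by rewrite /square_ind b1 b2 mulr1.
  rewrite normrM /dom; apply: le_trans (ler_pM _ _ uv lk) _ => //.
  by rewrite s1 mulr1 le_eqVlt; apply/orP; left; apply/eqP; ring.
move=> i3; have [//|] := ae_eq_Int i3 mF; last by [].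
apply: filterS line_null => z hz.
by rewrite /n hz mulr1.
Qed.

End plane.

(** * Reduction to even densities *)

Section bounded_densities.
Context {R : realType}.
Local Notation mu := (@lebesgue_measure R).
Local Notation T := (measurableTypeR R).
Local Notation pl := (T * T)%type.
Local Notation L2 := (@lebesgue2 R).

Definition in_square (K : R) (x : pl) := (- K <= x.1 <= K) && (- K <= x.2 <= K).

Lemma square_indE K x : square_ind K x = (in_square K x)%:R.
Proof.
by rewrite /square_ind /in_square; case: (- K <= x.1 <= K); rewrite ?mul0r// mul1r.
Qed.

Lemma bddI (u : pl -> R) (B K : R) : measurable_fun setT u ->
  (forall x, u x != 0 -> `|u x| <= B /\ in_square K x) -> bdd u.
Proof.
move=> mu' h; split => //; exists `|B|, `|K|; split => // x.
rewrite square_indE; have [->|/h[h1 h2]] := eqVneq (u x) 0; first by rewrite normr0 mulr_ge0.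
have -> : in_square `|K| x.
  move: h2 => /andP[/andP[a b] /andP[c d]]; have k := ler_norm K.
  have k' : - `|K| <= - K by rewrite lerN2.
  by rewrite /in_square (le_trans k' a) (le_trans b k) (le_trans k' c) (le_trans d k).
by rewrite mulr1 (le_trans h1)// ler_norm.
Qed.

Lemma bddE (u : pl -> R) : bdd u -> measurable_fun setT u /\
  exists B K : R, [/\ 0 <= B, 0 <= K, forall x, `|u x| <= B &
    forall x, u x != 0 -> in_square K x].
Proof.
move=> [mu' [B [K [B0 K0 h]]]]; split => //; exists B, K; split => // x.
  by apply: le_trans (h x) _; rewrite square_indE ler_piMr// lern1 leq_b1.
by apply: contraNT => /negbTE e; have := h x; rewrite square_indE e mulr0 normr_le0.
Qed.

Lemma bddM (u f : pl -> R) (C : R) : bdd u -> measurable_fun setT f ->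
  (forall x, u x != 0 -> `|f x| <= C) -> bdd (fun x => u x * f x).
Proof.
move=> /bddE[mu' [B [K [B0 K0 h1 h2]]]] mf h.
apply: (@bddI _ (B * C) K); first exact: measurable_funM.
move=> x; rewrite mulf_eq0 negb_or => /andP[ux _].
by split; [rewrite normrM ler_pM// h|exact: h2].
Qed.

Lemma bdd_comp (u : pl -> R) (Phi : pl -> pl) : bdd u -> measurable_fun setT Phi ->
  (forall K, 0 <= K -> exists K', forall x, in_square K (Phi x) -> in_square K' x) ->
  bdd (u \o Phi).
Proof.
move=> /bddE[mu' [B [K [B0 K0 h1 h2]]]] mP h; have [K' hK'] := h _ K0.
apply: (@bddI _ B K'); first exact: measurableT_comp.
by move=> x /= ux; split => //; apply: hK'; exact: h2.
Qed.

Lemma bddB (u v : pl -> R) : bdd u -> bdd v -> bdd (fun x => u x - v x).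
Proof.
move=> [mu' [B [K [B0 K0 h]]]] [mv [B' [K' [B0' K0' h']]]].
have mono (L L' : R) x : 0 <= L' -> in_square L x -> in_square (L + L') x.
  move=> l /andP[/andP[a b] /andP[c d]].
  have n1 : L <= L + L' by rewrite lerDl.
  have n2 : - (L + L') <= - L by rewrite lerN2.
  by rewrite /in_square (le_trans n2 a) (le_trans b n1) (le_trans n2 c) (le_trans d n1).
apply: (@bddI _ (B + B') (K + K')); first exact: measurable_funB.
move=> x ux; have := h x; have := h' x; rewrite !square_indE => b' b; split.
  apply: le_trans (ler_normB _ _) _; apply: lerD.
    by apply: le_trans b _; rewrite ler_piMr// lern1 leq_b1.
  by apply: le_trans b' _; rewrite ler_piMr// lern1 leq_b1.
have [i|ni] := boolP (in_square K x); first exact: mono.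
have [i'|ni'] := boolP (in_square K' x); first by rewrite addrC; exact: mono.
move: ux b b'; rewrite (negbTE ni) (negbTE ni') !mulr0 !normr_le0 => ux /eqP e /eqP e'.
by move: ux; rewrite e e' subrr eqxx.
Qed.

Lemma bdd_xlnx (u : pl -> R) : bdd u -> (forall x, 0 <= u x) -> bdd (fun x => u x * ln (u x)).
Proof.
move=> /bddE[mu' [B [K [B0 K0 h1 h2]]]] u0.
apply: (@bddI _ (1 + B ^+ 2) K).
  by apply: measurable_funM => //; exact: (measurableT_comp (@measurable_ln R)).
move=> x; rewrite mulf_eq0 negb_or => /andP[ux _]; split; last exact: h2.
have p : 0 < u x by rewrite lt_neqAle eq_sym ux u0.
have := @xlnx_ge R _ _ (u0 x) (@ltr01 R); rewrite ln1 mulr0 add0r => l1.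
have l2 := ler_wpM2l (u0 x) (ltW (ln_sublinear p)).
have := h1 x; rewrite ger0_norm// => uB.
have l3 : u x * u x <= B ^+ 2 by rewrite expr2 ler_pM.
have := sqr_ge0 B; rewrite ler_norml => ?; apply/andP; split; last by lra.
by have := u0 x; lra.
Qed.

Definition ent (u : pl -> R) : R := \int[L2]_x (u x * ln (u x)).

(* Normalized with [log |x - y|^2]: twice the integral of the interaction density. *)
Definition inter (u : pl -> R) : R :=
  \int[(L2 \x L2)%E]_z (u z.1 * u z.2 * ln (sqdist z.1 z.2)).

Definition critical_energy (u : pl -> R) : R := ent u + inter u.

Definition dens (u : pl -> R) : Prop :=
  [/\ bdd u, forall x, 0 <= u x & \int[L2]_x u x = 1].

Lemma measurable_sqdist : measurable_fun setT (fun z : pl * pl => sqdist z.1 z.2).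
Proof.
have [m11 m12 m21 m22] := @measurable_coords R.
by apply: measurable_funD; apply: measurable_funX; exact: measurable_funB.
Qed.

Lemma norm_le_1Dsqr (a K : R) : 0 <= K -> - K <= a <= K -> a ^+ 2 <= K ^+ 2.
Proof.
move=> K0; rewrite -ler_norml => h.
by rewrite -[a ^+ 2]real_normK ?num_real// lerXn2r ?nnegrE.
Qed.

Lemma ig_inter (u v : pl -> R) : bdd u -> bdd v ->
  ig (L2 \x L2)%E (fun z => u z.1 * v z.2 * ln (sqdist z.1 z.2)).
Proof.
move=> hu hv; have [_ [_ [K [_ K0 _ h2]]]] := bddE hu; have [_ [_ [K' [_ K0' _ h2']]]] := bddE hv.
apply: (ig_log_kernel (C := (K + K') ^+ 2 + (K + K') ^+ 2)) => //.
- exact: measurable_sqdist.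
- by move=> z; rewrite /sqdist lerDl sqr_ge0.
move=> z /h2/andP[a b] /h2'/andP[c d].
by rewrite /sqdist lerD// norm_le_1Dsqr ?addr_ge0// itv_sub.
Qed.

Lemma measurable_ent (u : pl -> R) : measurable_fun setT u ->
  measurable_fun setT (fun x => u x * ln (u x)).
Proof. by move=> m; apply: measurable_funM => //; exact: (measurableT_comp (@measurable_ln R)). Qed.

Lemma measurable_inter (u : pl -> R) : measurable_fun setT u ->
  measurable_fun setT (fun z : pl * pl => u z.1 * u z.2 * ln (sqdist z.1 z.2)).
Proof.
move=> m; apply: measurable_funM.
  by apply: measurable_funM; apply: measurableT_comp.
by apply: (measurableT_comp (@measurable_ln R)); exact: measurable_sqdist.
Qed.

Lemma critical_energy_isometry (u : pl -> R) (Phi : pl -> pl) : measurable_fun setT u ->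
  mpres L2 L2 Phi -> (forall x y, sqdist (Phi x) (Phi y) = sqdist x y) ->
  critical_energy (u \o Phi) = critical_energy u /\ \int[L2]_x (u \o Phi) x = \int[L2]_x u x.
Proof.
move=> mu' hP iso; split; last by rewrite (mpres_Int hP mu').
rewrite /critical_energy; congr (_ + _).
  by rewrite /ent [RHS](mpres_Int hP (measurable_ent mu')).
rewrite /inter [RHS](mpres_Int (mpres_prod hP hP) (measurable_inter mu')).
by apply: eq_Int => z /=; rewrite iso.
Qed.

Definition flip_x (x : pl) : pl := (- x.1, x.2).
Definition fold_x (x : pl) : pl := (`|x.1|, x.2).
Definition nfold_x (x : pl) : pl := (- `|x.1|, x.2).
Definition shift_x (c : R) (x : pl) : pl := (x.1 + c, x.2).

Lemma measurable_fold_x : measurable_fun setT fold_x. Proof. by rewrite /fold_x; solve_measurable. Qed.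
Lemma measurable_nfold_x : measurable_fun setT nfold_x. Proof. by rewrite /nfold_x; solve_measurable. Qed.
Lemma measurable_shift_x c : measurable_fun setT (shift_x c).
Proof. by have [] := mpres_shift1 c. Qed.

Lemma bdd_fold_x u : bdd u -> bdd (u \o fold_x).
Proof.
move=> hu; apply: bdd_comp hu measurable_fold_x _ => K K0; exists K => -[x y].
by rewrite /in_square/= => /andP[/andP[a b] ->]; rewrite -ler_norml b.
Qed.

Lemma bdd_nfold_x u : bdd u -> bdd (u \o nfold_x).
Proof.
move=> hu; apply: bdd_comp hu measurable_nfold_x _ => K K0; exists K => -[x y].
by rewrite /in_square/= => /andP[/andP[a b] ->]; rewrite -ler_norml -lerN2 a.
Qed.

Lemma bdd_shift_x c u : bdd u -> bdd (u \o shift_x c).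
Proof.
move=> hu; apply: bdd_comp hu (measurable_shift_x c) _ => K K0; exists (K + `|c|) => -[x y].
rewrite /in_square/= => /andP[/andP[a b] /andP[a' b']].
have c0 := normr_ge0 c; have c1 := ler_norm c.
have c2 : - c <= `|c| by rewrite -normrN ler_norm.
by apply/andP; split; apply/andP; split; lra.
Qed.

Lemma bdd_swap u : bdd u -> bdd (u \o (fun x : pl => (x.2, x.1) : pl)).
Proof.
move=> hu; apply: bdd_comp hu measurable_swap _ => K K0; exists K => -[x y].
by rewrite /in_square/= andbC.
Qed.

Let kk (p q : pl) : R := ln (sqdist p q).

(** Let [a], [b] be the values of [u] at [fold_x x], [nfold_x x], and [a'], [b'] those for [y]. Over
    the four reflections of the pair, the logarithms of points on the same side cancel, and those of
    points on opposite sides collect the factor [(a - b) (a' - b')]. *)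
Lemma reflection_pointwise (u : pl -> R) (x y : pl) :
  let D x y := u (fold_x x) * u (fold_x y) * kk x y + u (nfold_x x) * u (nfold_x y) * kk x y
    - 2 * (u x * u y * kk x y) in
  D x y + D (flip_x x) y + D x (flip_x y) + D (flip_x x) (flip_x y) =
  2 * ((u (fold_x x) - u (nfold_x x)) * (u (fold_x y) - u (nfold_x y)) *
    ln ((`|x.1| + `|y.1|) ^+ 2 + (x.2 - y.2) ^+ 2)).
Proof.
case: x => x1 x2; case: y => y1 y2 D; rewrite /D /fold_x /nfold_x /flip_x /kk /sqdist/= !normrN.
have e1 : (- x1 - y1) ^+ 2 = (x1 + y1) ^+ 2 by ring.
have e2 : (x1 - - y1) ^+ 2 = (x1 + y1) ^+ 2 by ring.
have e3 : (- x1 - - y1) ^+ 2 = (x1 - y1) ^+ 2 by ring.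
have e4 : (- x1 + y1) ^+ 2 = (x1 - y1) ^+ 2 by ring.
have e5 : (x1 + - y1) ^+ 2 = (x1 - y1) ^+ 2 by ring.
have e6 : (- x1 + - y1) ^+ 2 = (x1 + y1) ^+ 2 by ring.
rewrite e1 e2 e3.
by have [hx|hx] := ler0P x1; have [hy|hy] := ler0P y1; rewrite ?opprK ?e4 ?e5 ?e6; ring.
Qed.

(* The entropies balance, and the interactions differ by [\iint g g log |x - y'|],
   [y'] being the mirror image of [y] and [g = u \o fold_x - u \o nfold_x], which is
   neutral because both halves have the same mass. *)
Lemma critical_energy_reflect (u : pl -> R) : dens u -> \int[L2]_x u (fold_x x) = 1 ->
  \int[L2]_x u (nfold_x x) = 1 /\ critical_energy (u \o fold_x) + critical_energy (u \o nfold_x) <= 2 * critical_energy u.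
Proof.
move=> [hu u0 u1] hab.
have ba := bdd_fold_x hu; have bn := bdd_nfold_x hu.
have ia := ig_bdd ba; have in' := ig_bdd bn; have iu := ig_bdd hu; have mu' := ig_meas iu.
have E (f : R -> R) x : f (u (fold_x x)) + f (u (nfold_x x)) = f (u x) + f (u (flip_x x)).
  case: x => x1 x2; rewrite /fold_x/nfold_x/flip_x/=; have [hx|hx] := ler0P x1 => //.
  by rewrite opprK addrC.
have ifl := mpres_igP (@mpres_flip R) iu.
have n1 : \int[L2]_x u (nfold_x x) = 1.
  have : \int[L2]_x (u (fold_x x) + u (nfold_x x)) = \int[L2]_x (u x + u (flip_x x)).
    by apply: eq_Int => x; exact: (E id).
  rewrite !IntD// hab u1 -(mpres_Int (@mpres_flip R) mu') u1; lra.
split => //.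
have he : ent (u \o fold_x) + ent (u \o nfold_x) = 2 * ent u.
  have ie := ig_bdd (bdd_xlnx hu u0).
  rewrite /ent -IntD; [|exact: ig_bdd (bdd_xlnx ba (fun x => u0 _))|exact: ig_bdd (bdd_xlnx bn (fun x => u0 _))].
  rewrite (eq_Int _ (fun x => E (fun t => t * ln t) x)) IntD//; last exact: (mpres_igP (@mpres_flip R) ie).
  by rewrite -(mpres_Int (@mpres_flip R) (ig_meas ie)); ring.
suff hi : inter (u \o fold_x) + inter (u \o nfold_x) - 2 * inter u <= 0 by rewrite /critical_energy; lra.
pose D (z : pl * pl) := u (fold_x z.1) * u (fold_x z.2) * ln (sqdist z.1 z.2) +
  u (nfold_x z.1) * u (nfold_x z.2) * ln (sqdist z.1 z.2) - 2 * (u z.1 * u z.2 * ln (sqdist z.1 z.2)).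
have j1 := ig_inter ba ba; have j2 := ig_inter bn bn; have j3 := ig_inter hu hu.
have iD : ig (L2 \x L2)%E D by apply: igB; [exact: igD|exact: igZ].
have -> : inter (u \o fold_x) + inter (u \o nfold_x) - 2 * inter u = \int[(L2 \x L2)%E]_z D z.
  rewrite /D IntB; [|exact: igD|exact: igZ].
  by rewrite IntD// IntZ.
have mfl := @mpres_flip R; have mid := mpres_id (@lebesgue2 R).
have M1 := mpres_prod mfl mid; have M2 := mpres_prod mid mfl; have M3 := mpres_prod mfl mfl.
have i1 : ig (L2 \x L2)%E (fun z => D (flip_x z.1, z.2)) := mpres_igP M1 iD.
have i2 : ig (L2 \x L2)%E (fun z => D (z.1, flip_x z.2)) := mpres_igP M2 iD.
have i3 : ig (L2 \x L2)%E (fun z => D (flip_x z.1, flip_x z.2)) := mpres_igP M3 iD.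
have bg := bddB ba bn; rewrite /= in bg.
have [_ [_ [K [_ K0 _ hK]]]] := bddE bg.
have [m11 m12 m21 m22] := @measurable_coords R.
pose k (z : pl * pl) := (`|z.1.1| + `|z.2.1|) ^+ 2 + (z.1.2 - z.2.2) ^+ 2.
have mk : measurable_fun setT k.
  apply: measurable_funD; apply: measurable_funX; last exact: measurable_funB.
  by apply: measurable_funD; apply: measurableT_comp => //; exact: normr_measurable.
have ik : ig (L2 \x L2)%E (fun z => (u (fold_x z.1) - u (nfold_x z.1)) * (u (fold_x z.2) - u (nfold_x z.2)) * ln (k z)).
  apply: (ig_log_kernel (C := (K + K) ^+ 2 + (K + K) ^+ 2) bg bg mk).
    move=> z; rewrite /k ler_wpDr ?sqr_ge0// -real_normK ?num_real//.
    by rewrite lerXn2r ?nnegrE ?addr_ge0// ler_normB.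
  move=> z /hK/andP[a b] /hK/andP[c d]; rewrite /k lerD//.
    by rewrite lerXn2r ?nnegrE ?addr_ge0// lerD// ler_norml.
  by rewrite norm_le_1Dsqr ?addr_ge0// itv_sub.
(* Flips preserve the measure, so the four reflected copies of [D] have the same integral. *)
have E4 : 4 * (\int[(L2 \x L2)%E]_z D z) = 2 * \int[(L2 \x L2)%E]_z
    ((u (fold_x z.1) - u (nfold_x z.1)) * (u (fold_x z.2) - u (nfold_x z.2)) *
      ln ((`|z.1.1| + `|z.2.1|) ^+ 2 + (z.1.2 - z.2.2) ^+ 2)).
  transitivity (\int[(L2 \x L2)%E]_z (D z + D (flip_x z.1, z.2) + D (z.1, flip_x z.2) + D (flip_x z.1, flip_x z.2))).
    rewrite (IntD (igD (igD iD i1) i2) i3) (IntD (igD iD i1) i2) (IntD iD i1).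
    rewrite -(mpres_Int M1 (ig_meas iD)) -(mpres_Int M2 (ig_meas iD)) -(mpres_Int M3 (ig_meas iD)).
    by ring.
  rewrite -IntZ; last exact: ik.
  by apply: eq_Int => z; exact: (reflection_pointwise u z.1 z.2).
have : \int[(L2 \x L2)%E]_z ((u (fold_x z.1) - u (nfold_x z.1)) * (u (fold_x z.2) - u (nfold_x z.2)) *
      ln ((`|z.1.1| + `|z.2.1|) ^+ 2 + (z.1.2 - z.2.2) ^+ 2)) <= 0.
  apply: (@reflection_positivity _ _ _ L2 (fun x : pl => `|x.1|) (fun x : pl => x.2)
    (fun x => u (fold_x x) - u (nfold_x x))) => //.
  - by solve_measurable.
  - exact: measurable_snd.
  - exact: ig_bdd bg.
  - move=> [x y] /=; rewrite normr_gt0; apply: contraNneq => ->.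
    by rewrite /fold_x/nfold_x/= normr0 oppr0 subrr.
  - by rewrite IntB// hab n1 subrr.
  apply: ig_bdd; apply: (bddM (C := (K + 1) ^+ 2 + K ^+ 2) bg).
    by solve_measurable.
  move=> x /hK/andP[a b].
  have t1 : 1 <= (`|x.1| + 1) ^+ 2 + x.2 ^+ 2.
    by rewrite ler_wpDr ?sqr_ge0// exprn_ege1// lerDr.
  rewrite ger0_norm ?ln_ge0//; apply: le_trans (ltW (ln_sublinear (lt_le_trans ltr01 t1))) _.
  apply: lerD; last exact: norm_le_1Dsqr.
  by rewrite lerXn2r ?nnegrE ?addr_ge0// lerD2r ler_norml.
by move=> h; rewrite -(@pmulr_rle0 _ 4)// E4 pmulr_rle0.
Qed.

Lemma marginal (u : pl -> R) (h := fun s : T => \int[mu]_y u (s, y)) : dens u ->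
  [/\ ig mu h, forall s, 0 <= h s, \int[mu]_s h s = 1,
    exists B K : R, (forall s, h s <= B) /\ (forall s, h s != 0 -> - K <= s <= K) &
    forall b : T -> bool, measurable_fun setT b ->
      ig L2 (fun x : pl => u x * (b x.1)%:R) /\
      \int[L2]_x (u x * (b x.1)%:R) = \int[mu]_s (h s * (b s)%:R)].
Proof.
move=> [hu u0 u1]; have iu := ig_bdd hu; have mu' := ig_meas iu.
have [_ [B [K [B0 K0 h1 h2]]]] := bddE hu.
have [j1 j2] := Int_fubini1 iu.
have is_ (s : T) : ig mu (fun y : T => u (s, y)).
  apply: (@ig_bounded_supp _ _ B K) => // [|y /h2/andP[_]//].
  by apply: (measurableT_comp mu'); solve_measurable.
split => //.
- by move=> s; apply: Int_ge0.
- by rewrite -j2.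
- exists (B * (2 * K)), K; split => s.
    have KK : - K <= K by rewrite (le_trans _ K0)// oppr_le0.
    have -> : B * (2 * K) = \int[mu]_(y in setT) (B * ((- K <= y <= K)%R)%:R).
      by rewrite IntZ ?Int_inside//; [ring|exact: ig_inside].
    apply: le_Int => //; first by apply: igZ; exact: ig_inside.
    move=> y; have [->|/h2/andP[_ ->]] := eqVneq (u (s, y)) 0; first by rewrite mulr_ge0.
    by rewrite mulr1; apply: le_trans (h1 _); exact: ler_norm.
  apply: contraNT => ns; apply/eqP; rewrite -[RHS](Int0 mu); apply: eq_Int => y.
  by apply: contraNeq ns => /h2/andP[].
move=> b mb; have mb' := @measurable_boolr R _ _ _ mb.
have ib : ig L2 (fun x : pl => u x * (b x.1)%:R).
  apply: (igMb (B := 1)) => //; first by apply: (measurableT_comp mb'); solve_measurable.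
  by move=> x _; case: (b x.1); rewrite ?normr1 ?normr0.
split => //; have [_ ->] := Int_fubini1 ib.
by apply: eq_Int => s /=; rewrite IntZr.
Qed.

(** At a median [c] of the first marginal each side of the line [x_1 = c] has mass 1/2, and the fold
    counts the right side twice. *)
Lemma median (u : pl -> R) : dens u -> exists c, \int[L2]_x u (shift_x c (fold_x x)) = 1.
Proof.
move=> du; have [ih h0 h1 [B [K [hB hK]]] hI] := marginal du.
have [c hc] := cdf_median ih h0 h1 hB hK.
exists c; have [hu u0 u1] := du; have iu := ig_bdd hu; have mu' := ig_meas iu.
have mle : measurable_fun setT (fun s : T => (c <= s)%R) by exact: measurable_fun_ler.
have mlt : measurable_fun setT (fun s : T => (c < s)%R) by exact: measurable_fun_ltr.
have [i1 e1] := hI _ mle; have [i2 e2] := hI _ mlt.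
have m1 := mpres_shift1 c; have m2 : mpres L2 L2 (fun x : pl => (c - x.1, x.2) : pl).
  by apply: eq_mpres (mpres_comp (@mpres_flip R) m1) => x /=; rewrite addrC.
have E (x : pl) : u (shift_x c (fold_x x)) = u (x.1 + c, x.2) * ((c <= x.1 + c)%R)%:R +
    u (c - x.1, x.2) * ((c < c - x.1)%R)%:R.
  case: x => x1 x2; rewrite /shift_x/fold_x/=.
  rewrite lerDr ltrDl oppr_gt0; have [hx|hx] := leP 0 x1.
    by rewrite mulr1 mulr0 addr0 ger0_norm.
  by rewrite mulr1 mulr0 add0r ltr0_norm// addrC.
rewrite (eq_Int _ E) IntD; [|exact: (mpres_igP m1 i1)|exact: (mpres_igP m2 i2)].
rewrite -(mpres_Int m1 (ig_meas i1)) -(mpres_Int m2 (ig_meas i2)) e1 e2.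
rewrite (cdf_compl ih h1) hc.
suff -> : \int[mu]_s ((\int[mu]_y u (s, y)) * ((c <= s)%R)%:R) = 1 - 2^-1 by lra.
rewrite -hc -(cdf_compl ih h1); apply/eqP; rewrite eq_le; apply/andP; split.
  (* The point [c] has no mass under the bounded marginal, so the open and closed half-lines have
     equal mass. *)
  have s0 := Int_slab_le ih hB (lexx c); rewrite subrr mulr0 in s0.
  have mI := measurable_inside c c.
  have [_ hI'] := hI _ mI.
  have k (b : T -> bool) (mb : measurable_fun setT b) : ig mu (fun s => (\int[mu]_y u (s, y)) * (b s)%:R).
    apply: (igMb (B := 1)) => //; first exact: measurable_boolr.
    by move=> x _; case: (b x); rewrite ?normr1 ?normr0.
  rewrite -[leRHS]addr0; apply: le_trans (lerD (lexx _) s0).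
  rewrite -IntD; [|exact: (k _ mlt)|exact: (k _ mI)].
  apply: le_Int; [exact: (k _ mle)|by apply: igD; [exact: (k _ mlt)|exact: (k _ mI)]|].
  move=> s; rewrite -mulrDr ler_wpM2l//.
  have [l|l] := ltP c s; first by rewrite (ltW l) lerDl.
  by rewrite andbT add0r.
have k (b : T -> bool) (mb : measurable_fun setT b) : ig mu (fun s => (\int[mu]_y u (s, y)) * (b s)%:R).
  apply: (igMb (B := 1)) => //; first exact: measurable_boolr.
  by move=> x _; case: (b x); rewrite ?normr1 ?normr0.
apply: le_Int; [exact: (k _ mlt)|exact: (k _ mle)|].
by move=> s; rewrite ler_wpM2l//; have [l|l] := ltP c s; rewrite ?(ltW l).
Qed.

Definition even_x (u : pl -> R) := forall x, u (flip_x x) = u x.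
Definition even_y (u : pl -> R) := forall x : pl, u (x.1, - x.2) = u x.

(** The energies of the two folds have an average at most the original one, so a bound for even
    densities carries over. [P] is what has to survive translation and folding: nothing in the first
    use, evenness in the other coordinate in the second. *)
Lemma even_x_reduction (C : R) (P : (pl -> R) -> Prop) :
  (forall u c, P u -> P (u \o shift_x c)) -> (forall u, P u -> P (u \o fold_x)) ->
  (forall u, P u -> P (u \o nfold_x)) ->
  (forall u, dens u -> P u -> even_x u -> C <= critical_energy u) ->
  forall u, dens u -> P u -> C <= critical_energy u.
Proof.
move=> Psh Pab Pnab H u du Pu; have [c hc] := median du.
have [hu u0 u1] := du; have mu' := ig_meas (ig_bdd hu).
have iso (x y : pl) : sqdist (shift_x c x) (shift_x c y) = sqdist x y by rewrite /sqdist/=; congr (_ ^+ 2 + _); ring.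
have [<- e2] := critical_energy_isometry mu' (mpres_shift1 c) iso.
pose v := u \o shift_x c.
have dv : dens v by split; [exact: bdd_shift_x|by move=> x; exact: u0|rewrite e2].
have [v1 hF] := critical_energy_reflect dv hc; have [hv v0 _] := dv.
have e1 : even_x (v \o fold_x) by move=> [x y]; rewrite /v/fold_x/flip_x/= normrN.
have e3 : even_x (v \o nfold_x) by move=> [x y]; rewrite /v/nfold_x/flip_x/= normrN.
have l1 : C <= critical_energy (v \o fold_x).
  apply: H => //; last by apply: Pab; exact: Psh.
  by split; [exact: bdd_fold_x|by move=> x; exact: v0|].
have l2 : C <= critical_energy (v \o nfold_x).
  apply: H => //; last by apply: Pnab; exact: Psh.
  by split; [exact: bdd_nfold_x|by move=> x; exact: v0|].
by rewrite -/v; lra.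
Qed.

Lemma even_reduction (C : R) :
  (forall u, dens u -> even_x u -> even_y u -> C <= critical_energy u) ->
  forall u, dens u -> C <= critical_energy u.
Proof.
move=> H u du; apply: (@even_x_reduction C (fun=> True)) => // {du}u du _ ev.
have [hu u0 u1] := du; have mu' := ig_meas (ig_bdd hu).
have iso (x y : pl) : sqdist (x.2, x.1) (y.2, y.1) = sqdist x y by rewrite /sqdist/= addrC.
have [<- e2] := critical_energy_isometry mu' (@mpres_swap R) iso.
apply: (@even_x_reduction C even_y).
- by move=> v c ev2 x; exact: (ev2 (shift_x c x)).
- by move=> v ev2 x; exact: (ev2 (fold_x x)).
- by move=> v ev2 x; exact: (ev2 (nfold_x x)).
- by move=> v dv ev2 ev1; exact: H.
- by split; [exact: bdd_swap|by move=> x; exact: u0|rewrite e2].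
by move=> x; exact: (ev (x.2, x.1)).
Qed.

End bounded_densities.

(** * Polar coordinates *)

Section cauchy_kernel.
Context {R : realType}.
Local Notation mu := (@lebesgue_measure R).
Local Notation T := (measurableTypeR R).

(* Under [cauchy_density], [angle] is uniform on [(-pi, pi)]. *)
Definition cauchy_density (u : T) : R := (pi * (1 + u ^+ 2))^-1.
Definition angle (u : T) : R := atan u *+ 2.

Lemma oneD_gt0 (u : R) : 0 < 1 + u ^+ 2.
Proof. by rewrite ltr_wpDr// sqr_ge0. Qed.

Lemma cauchy_gt0 u : 0 < cauchy_density u.
Proof. by rewrite /cauchy_density invr_gt0 mulr_gt0 ?pi_gt0 ?oneD_gt0. Qed.

Lemma measurable_cauchy : measurable_fun setT cauchy_density. Proof. by rewrite /cauchy_density; solve_measurable. Qed.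
Lemma measurable_angle : measurable_fun setT angle.
Proof.
rewrite (_ : angle = fun u => 2 * atan u); first by solve_measurable.
by apply/funext => u; rewrite /angle mulr_natl.
Qed.

Lemma sqr_cos_atan (u : R) : cos (atan u) ^+ 2 = (1 + u ^+ 2)^-1.
Proof. by rewrite cos_atan exprVn sqr_sqrtr// ltW// oneD_gt0. Qed.

Lemma cos_atan_neq0 (u : R) : cos (atan u) != 0.
Proof. by rewrite -sqrf_eq0 sqr_cos_atan invr_eq0 gt_eqF// oneD_gt0. Qed.

Lemma sin_atan (u : R) : sin (atan u) = u * cos (atan u).
Proof. by rewrite -[X in _ = X * _](atanK u) /tan divfK// cos_atan_neq0. Qed.

Lemma cos_angle u : cos (angle u) = (1 - u ^+ 2) / (1 + u ^+ 2).
Proof.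
have h := lt0r_neq0 (oneD_gt0 u).
by rewrite /angle cos_mulr2n sqr_cos_atan; field.
Qed.

Lemma sin_angle u : sin (angle u) = 2 * u / (1 + u ^+ 2).
Proof.
have h := lt0r_neq0 (oneD_gt0 u).
rewrite /angle sin_mulr2n sin_atan mulrCA -expr2 sqr_cos_atan; field.
exact: h.
Qed.

Lemma sin_mulrn_pi n : sin (pi *+ n) = 0 :> R.
Proof.
elim: n => [|n ih]; first by rewrite mulr0n sin0.
by rewrite mulrSr sinD ih mul0r add0r sinpi mulr0.
Qed.

Lemma continuous_cauchy : continuous cauchy_density.
Proof.
move=> u; apply: cvgV; first by rewrite gt_eqF// mulr_gt0 ?pi_gt0 ?oneD_gt0.
apply: cvgM; first exact: cvg_cst.
by apply: cvgD; [exact: cvg_cst|exact: exprn_continuous].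
Qed.

(** With [|a| <= 1] the integrand stays nonnegative, so the fundamental theorem of calculus on a
    half-line yields integrability along with the value. [a = 0] gives the mass, and [a = 1] then
    shows that the cosine modes vanish. *)
Lemma integral_cauchy_cos (a : R) (n : nat) : `|a| <= 1 ->
  \int[mu]_u (cauchy_density u * (1 + a * cos (angle u *+ n.+1))) = 1 /\
  ig mu (fun u => cauchy_density u * (1 + a * cos (angle u *+ n.+1))).
Proof.
move=> a1; pose f u := cauchy_density u * (1 + a * cos (angle u *+ n.+1)).
have f0 u : 0 <= f u.
  rewrite /f mulr_ge0 ?(ltW (cauchy_gt0 u))//.
  have : `|a * cos (angle u *+ n.+1)| <= 1.
    by rewrite normrM mulr_ile1// ler_norml cos_geN1 cos_le1.
  by rewrite ler_norml => /andP[+ _]; lra.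
have cc : continuous (fun u : R => cos (angle u *+ n.+1)).
  move=> u; apply: (@continuous_comp _ _ _ (fun u => angle u *+ n.+1)); last exact: continuous_cos.
  apply: cvgMn; apply: cvgMn; exact: continuous_atan.
have cf : continuous f.
  move=> u; apply: cvgM; first exact: continuous_cauchy.
  apply: cvgD; first exact: cvg_cst.
  by apply: cvgM; [exact: cvg_cst|exact: cc].
have ef : f =1 f \o -%R.
  by move=> u; rewrite /f/= /cauchy_density /angle sqrrN atanN !mulNrn cosN.
have nn : n.+1%:R != 0 :> R by rewrite pnatr_eq0.
have pp := @pi_gt0 R; have pn := lt0r_neq0 pp.
pose F (u : R) := pi^-1 * (atan u + a / (2 * n.+1%:R) * sin (angle u *+ n.+1)).
have dF (u : R) : is_derive u 1 F (f u).
  have d1 := is_derive1_atan u.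
  have d2 : der (fun u : R => angle u *+ n.+1) u (2 * n.+1%:R * (1 + u ^+ 2)^-1).
    have := der_scalef (2 * n.+1%:R) d1; congr (is_derive _ _ _ _).
    by apply/funext => v; rewrite /angle -[RHS]mulr_natl -[X in _ = _ * X]mulr_natl; ring.
  have d3 : der (fun u : R => sin (angle u *+ n.+1)) u
      (cos (angle u *+ n.+1) * (2 * n.+1%:R * (1 + u ^+ 2)^-1)).
    exact: (is_derive1_comp (is_derive_sin _) d2).
  have := der_scalef pi^-1 (der_addf d1 (der_scalef (a / (2 * n.+1%:R)) d3)).
  move=> h; apply: (der_eq h); rewrite /f /cauchy_density.
  have h1 := lt0r_neq0 (oneD_gt0 u).
  have aux (p d N C : R) : p != 0 -> d != 0 -> N != 0 ->
      p^-1 * (d^-1 + a / (2 * N) * (C * (2 * N / d))) = (p * d)^-1 * (1 + a * C).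
    by move=> p0 d0' N0; field; rewrite p0 d0' N0.
  exact: aux.
have critical_energy : F 0 = 0 by rewrite /F /angle atan0 !mul0rn sin0 mulr0 addr0 mulr0.
have Foo : F u @[u --> +oo] --> (2^-1 : R).
  rewrite (_ : 2^-1 = pi^-1 * (pi / 2 + a / (2 * n.+1%:R) * sin ((pi / 2 *+ 2) *+ n.+1))); last first.
    have -> : pi / 2 *+ 2 = pi :> R by rewrite mulr2n; lra.
    by rewrite sin_mulrn_pi mulr0 addr0 mulrA mulVf// mul1r.
  apply: cvgM; first exact: cvg_cst.
  apply: cvgD; first exact: cvgy_atan.
  apply: cvgM; first exact: cvg_cst.
  apply: (@cvg_comp _ _ _ (fun u => angle u *+ n.+1) (@sin R)); last exact: continuous_sin.
  by apply: cvgMn; apply: cvgMn; exact: cvgy_atan.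
have e : (\int[mu]_u (f u)%:E)%E = 1%:E.
  rewrite ge0_symfun_integralT// -set_itvcy (@ge0_continuous_FTC2y _ f F 0 2^-1)//.
  - by rewrite critical_energy sube0 -EFinM divff// pnatr_eq0.
  - exact: continuous_subspaceT.
  - apply: cvg_at_right_filter.
    by have [h _] := dF 0; apply: differentiable_continuous; apply/derivable1_diffP.
  - by move=> u _; rewrite derive1E; have [_ ->] := dF u.
split; first exact: ge0_Int e.
apply: ge0_ig => //; first exact: continuous_measurable_fun.
by rewrite e ltry.
Qed.

Lemma Int_cauchy : \int[mu]_u cauchy_density u = 1.
Proof.
have [h _] := @integral_cauchy_cos 0 0 ltac:(by rewrite normr0).
by rewrite -[RHS]h; apply: eq_Int => u; rewrite mul0r addr0 mulr1.
Qed.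

Lemma ig_cauchy : ig mu cauchy_density.
Proof.
have [_] := @integral_cauchy_cos 0 0 ltac:(by rewrite normr0).
by apply: eq_ig => u; rewrite mul0r addr0 mulr1.
Qed.

Lemma ig_cauchy_cos n : ig mu (fun u => cauchy_density u * cos (angle u *+ n)).
Proof.
apply: (igMb (B := 1) ig_cauchy); last by move=> u _; rewrite ler_norml cos_geN1 cos_le1.
apply: (measurableT_comp (@measurable_cos R)).
rewrite (_ : (fun u => angle u *+ n) = fun u => angle u * n%:R).
  by apply: measurable_funM => //; exact: measurable_angle.
by apply/funext => u; rewrite mulr_natr.
Qed.

Lemma Int_cauchy_cos n : \int[mu]_u (cauchy_density u * cos (angle u *+ n.+1)) = 0.
Proof.
have [h _] := @integral_cauchy_cos 1 n ltac:(by rewrite normr1).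
have := IntD ig_cauchy (ig_cauchy_cos n.+1); rewrite Int_cauchy.
suff -> : \int[mu]_u (cauchy_density u + cauchy_density u * cos (angle u *+ n.+1)) = 1 by lra.
by rewrite -[RHS]h; apply: eq_Int => u; rewrite mul1r mulrDr mulr1.
Qed.

End cauchy_kernel.

Section polar_coordinates.
Context {R : realType}.
Local Notation mu := (@lebesgue_measure R).
Local Notation T := (measurableTypeR R).
Local Notation pl := (T * T)%type.
Local Notation L2 := (@lebesgue2 R).

Lemma mpres_null0 : {ae mu, forall x : T, x != 0}.
Proof.
exists [set 0]; split; first exact: measurable_set1.
  exact: lebesgue_measure_set1.
by move=> x /= /negP; rewrite negbK => /eqP.
Qed.

Lemma line_null2 : {ae (L2 \x L2)%E, forall z : pl * pl, z.1.2 != z.2.2}.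
Proof.
have mD : measurable [set z : pl * pl | z.1.2 = z.2.2].
  rewrite [X in measurable X](_ : _ = (fun z : pl * pl => z.1.2 - z.2.2) @^-1` [set 0]).
    have [_ m12 _ m22] := @measurable_coords R.
    by rewrite -[X in measurable X]setTI; apply: measurable_funB.
  by apply/seteqP; split => z /=; [move=> ->; rewrite subrr|move=> /eqP; rewrite subr_eq0 => /eqP].
exists [set z | z.1.2 = z.2.2]; split => //; last first.
  by move=> z /= /negP; rewrite negbK => /eqP.
rewrite /product_measure1/= integral0_eq// => x _ /=.
rewrite (_ : xsection _ _ = setT `*` [set x.2]); last first.
  apply/seteqP; split => y; rewrite /xsection/= inE/=; first by move=> ->.
  by move=> [_ ->].
have m1 : measurable ([set x.2] : set T) by exact: measurable_set1.
apply: (etrans (product_measure1E mu mu measurableT m1)).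
by rewrite /= lebesgue_measure_set1 mule0.
Qed.

Lemma cov_scale_abs (c : R) : c != 0 ->
  cov mu mu setT (fun x : T => c * x : T) (fun=> `|c|).
Proof.
move=> c0 f mf f0; have [cn|cp|] := ltgtP c 0; last by move/eqP; rewrite (negbTE c0).
  have cp : 0 < - c by rewrite oppr_gt0.
  have m' : measurable_fun setT (fun x : T => f (- x)).
    by apply: (measurableT_comp mf); exact: measurable_funN.
  rewrite (cov_opp mf f0).
  have -> : (\int[mu]_x (f (- x)%R * 1%:E) = \int[mu]_x f (- x)%R)%E.
    by apply: eq_integral => x _; rewrite mule1.
  rewrite (cov_scale cp m')//; apply: eq_integral => x _.
  by rewrite ltr0_norm// mulNr opprK.
by rewrite (cov_scale cp mf f0); apply: eq_integral => x _; rewrite gtr0_norm.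
Qed.

(* [a.1] is a signed radius and [a.2] the slope of the line through the origin. *)
Definition polar (a : pl) : pl := (cos (atan a.2) * a.1, cos (atan a.2) * a.1 * a.2).
Definition polar_jac (a : pl) : R := `|a.1| / (1 + a.2 ^+ 2).

Lemma polar_jac_ge0 a : 0 <= polar_jac a.
Proof. by rewrite /polar_jac mulr_ge0// invr_ge0 ltW// oneD_gt0. Qed.

Lemma cos_atan_gt0 (u : R) : 0 < cos (atan u).
Proof. by rewrite cos_atan invr_gt0 sqrtr_gt0 oneD_gt0. Qed.

Lemma measurable_polar : measurable_fun setT polar.
Proof. by rewrite /polar; solve_measurable. Qed.

Lemma measurable_polar_jac : measurable_fun setT polar_jac.
Proof. by rewrite /polar_jac; solve_measurable. Qed.

(** Two scalings: [y = x v] at fixed abscissa [x], then [x = r cos (atan v)] at fixed slope [v]. *)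
Lemma cov_polar : cov L2 L2 setT polar polar_jac.
Proof.
move=> f mf f0; have mpol := measurable_polar; have mJ := measurable_polar_jac.
have mfp (Phi : pl -> pl) : measurable_fun setT Phi -> measurable_fun setT (fun a => f (Phi a)).
  by move=> h; exact: measurableT_comp.
pose g (a : pl) : \bar R := (f (a.1, (a.1 * a.2)%R) * (`|a.1|)%:E)%E.
have mg : measurable_fun setT g.
  apply: emeasurable_funM; first by apply: (mfp (fun a => (a.1, a.1 * a.2))); solve_measurable.
  by solve_measurable.
have g0 a : (0 <= g a)%E by rewrite /g mule_ge0// lee_fin.
pose h (a : pl) : \bar R := (f (polar a) * (polar_jac a)%:E)%E.
have mh : measurable_fun setT h.
  by apply: emeasurable_funM; [exact: (mfp _ mpol)|exact/measurable_EFinP].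
have h0 a : (0 <= h a)%E by rewrite /h mule_ge0// lee_fin polar_jac_ge0.
have e1 : (\int[L2]_x f x = \int[L2]_x g x)%E.
  rewrite /lebesgue2 (fubini_tonelli1 (m1 := mu) (m2 := mu) _ mf f0).
  rewrite (fubini_tonelli1 (m1 := mu) (m2 := mu) _ mg g0).
  apply: ae_eq_integral => //.
  - exact: measurable_fun_fubini_tonelli_F.
  - exact: measurable_fun_fubini_tonelli_F.
  apply: filterS mpres_null0 => x x0 _; rewrite /fubini_F.
  have mx : measurable_fun setT (fun y : T => f (x, y)) by apply: (measurableT_comp mf); solve_measurable.
  by rewrite (cov_scale_abs x0 mx).
rewrite e1.
rewrite {1}/lebesgue2 (fubini_tonelli2 (m1 := mu) (m2 := mu) _ mg g0).
rewrite /lebesgue2 (fubini_tonelli2 (m1 := mu) (m2 := mu) _ mh h0).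
apply: eq_integral => u _; rewrite /fubini_G.
have mu' : measurable_fun setT (fun x : T => g (x, u)) by apply: (measurableT_comp mg); solve_measurable.
rewrite (cov_scale (cos_atan_gt0 u) mu')//; apply: eq_integral => r _.
rewrite /g /h /polar /polar_jac/= -muleA -EFinM; congr (_ * _%:E)%E.
by rewrite normrM gtr0_norm ?cos_atan_gt0// mulrAC -expr2 sqr_cos_atan mulrC.
Qed.

End polar_coordinates.

Section separable_integrals.
Context {R : realType} d1 d2 (X : measurableType d1) (Y : measurableType d2).
Variables (m1 : {sigma_finite_measure set X -> \bar R})
  (m2 : {sigma_finite_measure set Y -> \bar R}).

Lemma Int_neq0 d (Z : measurableType d) (m : {measure set Z -> \bar R}) (f : Z -> R) :
  \int[m]_x f x != 0 -> exists x, f x != 0.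
Proof.
move=> h; apply: contrapT => /forallNP h'; move/eqP: h; apply.
rewrite -[RHS](Int0 m); apply: eq_Int => x.
by have := h' x; move=> /negP; rewrite negbK => /eqP.
Qed.

Variables (A B : X * Y -> R) (K : X * X -> R) (C : R).
Hypotheses (iA : ig (sprod m1 m2) A) (iB : ig (sprod m1 m2) B).
Hypotheses (iA1 : forall x, ig m2 (fun y => A (x, y)))
  (iB1 : forall x, ig m2 (fun y => B (x, y))).
Hypothesis mK : measurable_fun setT K.
Hypothesis KC : forall a b, A a != 0 -> B b != 0 -> `|K (a.1, b.1)| <= C.

Let MA x := \int[m2]_y A (x, y).
Let MB x := \int[m2]_y B (x, y).

(** The kernel sees only the first coordinates, so the others are integrated out of [A] and [B].
    This turns double integrals over the plane into double integrals over radii. *)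
Lemma Int_sep :
  [/\ ig (sprod m1 m2 \x sprod m1 m2)%E (fun z => A z.1 * B z.2 * K (z.1.1, z.2.1)),
      ig (m1 \x m1)%E (fun z => MA z.1 * MB z.2 * K z) &
      \int[(sprod m1 m2 \x sprod m1 m2)%E]_z (A z.1 * B z.2 * K (z.1.1, z.2.1)) =
      \int[(m1 \x m1)%E]_z (MA z.1 * MB z.2 * K z)].
Proof.
have [iMA _] := Int_fubini1 iA; have [iMB _] := Int_fubini1 iB.
have i1 : ig (sprod m1 m2 \x sprod m1 m2)%E (fun z => A z.1 * B z.2 * K (z.1.1, z.2.1)).
  apply: (igMb (B := C)); first exact: (ig_prod iA iB).
    apply: (measurableT_comp mK); apply: measurable_fun_pair;
      exact: (measurableT_comp measurable_fst).
  by move=> z; rewrite mulf_eq0 negb_or => /andP[]; exact: KC.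
have i2 : ig (m1 \x m1)%E (fun z => MA z.1 * MB z.2 * K z).
  apply: (igMb (B := C)) => //; first exact: (ig_prod iMA iMB).
  move=> [x x']; rewrite mulf_eq0 negb_or => /andP[/Int_neq0[y hy] /Int_neq0[y' hy']].
  exact: (KC hy hy').
split => //.
pose G x := \int[m1]_x' (MB x' * K (x, x')).
have inner a : A a != 0 -> \int[sprod m1 m2]_b (A a * B b * K (a.1, b.1)) = A a * G a.1.
  move=> nA.
  have mKa : measurable_fun setT (fun b : X * Y => K (a.1, b.1)).
    by apply: (measurableT_comp mK); apply: measurable_fun_pair.
  have j1 : ig (sprod m1 m2) (fun b => B b * K (a.1, b.1)).
    by apply: (igMb (B := C)) => // b nB; exact: KC.
  rewrite (eq_Int _ (fun b => esym (mulrA (A a) (B b) _))) IntZ//; congr (_ * _).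
  have [_ e] := Int_fubini1 j1; rewrite [LHS]e.
  by apply: eq_Int => x /=; rewrite IntZr.
have [j2 e2] := Int_fubini1 i1; rewrite e2.
have e3 a : \int[sprod m1 m2]_b (A (a, b).1 * B (a, b).2 * K ((a, b).1.1, (a, b).2.1)) = A a * G a.1.
  have [A0|nA] := eqVneq (A a) 0; last exact: inner.
  rewrite A0 mul0r -[RHS](Int0 (sprod m1 m2)); apply: eq_Int => b /=.
  by rewrite !mul0r.
have j3 : ig (sprod m1 m2) (fun a => A a * G a.1) by apply: (eq_ig e3 j2).
rewrite (eq_Int _ e3).
have [_ e4] := Int_fubini1 j3; rewrite [LHS]e4.
have [_ e5] := Int_fubini1 i2; rewrite e5.
apply: eq_Int => x /=; rewrite IntZr//.
have [M0|nM] := eqVneq (MA x) 0.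
  rewrite -/(MA x) M0 mul0r -[LHS](Int0 m1); apply: eq_Int => x'.
  by rewrite !mul0r.
rewrite /G -IntZ.
  by apply: eq_Int => x'; rewrite mulrA.
have [y hy] := Int_neq0 nM.
apply: (igMb (B := C)) => //.
  by apply: (measurableT_comp mK); apply: measurable_fun_pair.
by move=> x' /Int_neq0[y' hy']; exact: (KC hy hy').
Qed.

End separable_integrals.

Section doubling.
Context {R : realType}.
Local Notation mu := (@lebesgue_measure R).
Local Notation T := (measurableTypeR R).

Lemma exp_doubling (g : T -> R) : ig mu g -> (forall r, g (- r) = g r) ->
  ig mu (fun s : T => g (expR s) * expR s) /\
  \int[mu]_r g r = 2 * \int[mu]_(s in setT) (g (expR s) * expR s).
Proof.
move=> ig_g ev; have mg := ig_meas ig_g.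
have m1 : measurable_fun setT (fun x : T => ((0 < x)%R)%:R : R) by exact: measurable_ltr.
have m2 : measurable_fun setT (fun x : T => ((x < 0)%R)%:R : R) by exact: measurable_ltr.
have mb (b : T -> bool) : measurable_fun setT (fun x => (b x)%:R : R) -> ig mu (fun x => g x * (b x)%:R).
  move=> h; apply: (igMb (B := 1)) => // x _; by case: (b x); rewrite ?normr1 ?normr0.
have i1 := mb _ m1; have i2 := mb _ m2.
have c1 := @cov_expR R 1 ltr01.
have mE : measurable_fun setT (fun x : T => 1 * expR x : T) by solve_measurable.
have mE' : measurable_fun setT (fun x : T => 1 * expR x : R) by solve_measurable.
have e0 (a : T) : 0 <= 1 * expR a by rewrite mul1r expR_ge0.
have E (s : T) : g (1 * expR s) * (1 * expR s) = g (expR s) * expR s by rewrite !mul1r.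
have j1 : mu.-integrable (`]0%R, +oo[%classic : set T) (EFin \o g).
  by apply: integrableS ig_g.
split; first by apply: (eq_ig E); apply/(cov_integrable mE mE' e0 c1 mg).
have p1 : \int[mu]_x (g x * ((0 < x)%R)%:R) = \int[mu]_(s in setT) (g (expR s) * expR s).
  rewrite -(eq_Int _ E) -(cov_Rintegral e0 c1 mg) /Rintegral; congr fine.
  rewrite [RHS]integral_mkcond; apply: eq_integral => x _.
  by rewrite patchE mem_setE in_itv/= andbT; case: (0 < x); rewrite ?mulr1 ?mulr0.
have p2 : \int[mu]_x (g x * ((x < 0)%R)%:R) = \int[mu]_x (g x * ((0 < x)%R)%:R).
  rewrite (mpres_Int (@mpres_opp R) (ig_meas i2)); apply: eq_Int => x.
  by rewrite ev oppr_lt0.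
have m0 : {ae mu, forall x : T, g x = g x * ((0 < x)%R)%:R + g x * ((x < 0)%R)%:R}.
  exists [set 0]; split; first exact: measurable_set1.
    exact: lebesgue_measure_set1.
  move=> x /=; apply: contra_notP => /eqP x0.
  by have [h|h|h] := ltgtP x 0; [rewrite mulr0 add0r mulr1|rewrite mulr1 mulr0 addr0|rewrite h eqxx in x0].
have mS : measurable_fun setT (fun x => g x * ((0 < x)%R)%:R + g x * ((x < 0)%R)%:R) by solve_measurable.
have [_ ->] := ae_eq_Int ig_g mS m0.
by rewrite IntD// p2 p1; ring.
Qed.

Lemma exp_doubling2 (g : T * T -> R) : ig (mu \x mu)%E g ->
  (forall r r', g (- r, r') = g (r, r')) -> (forall r r', g (r, - r') = g (r, r')) ->
  (forall r, ig mu (fun r' => g (r, r'))) ->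
  ig (mu \x mu)%E (fun z : T * T => g (expR z.1, expR z.2) * (expR z.1 * expR z.2)) /\
  \int[(mu \x mu)%E]_z g z =
    4 * \int[(mu \x mu)%E]_(z in setT) (g (expR z.1, expR z.2) * (expR z.1 * expR z.2)).
Proof.
move=> ig_g ev1 ev2 ig2; have mg := ig_meas ig_g.
have c1 := @cov_expR R 1 ltr01.
have mE : measurable_fun setT (fun x : T => 1 * expR x : T) by solve_measurable.
have e0 (a : T) : 0 <= 1 * expR a by rewrite mul1r expR_ge0.
have mE' : measurable_fun setT (fun x : T => 1 * expR x : R) by solve_measurable.
have mQ : measurable (`]0%R, +oo[%classic : set T) by exact: measurable_itv.
have c2 := cov_prod (m1 := mu) (m2 := mu) (m3 := mu) (m4 := mu) mQ mQ mE mE' e0 mE mE' e0 c1 c1.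
have i4 : ig (mu \x mu)%E (fun z : T * T => g (expR z.1, expR z.2) * (expR z.1 * expR z.2)).
  have mE1 : measurable_fun setT (fun z : T * T => (1 * expR z.1, 1 * expR z.2) : T * T).
    by apply: measurable_fun_pair; exact: (measurableT_comp mE).
  have mE2 : measurable_fun setT (fun z : T * T => 1 * expR z.1 * (1 * expR z.2) : R).
    by apply: measurable_funM; exact: (measurableT_comp mE').
  have E0 (z : T * T) : 0 <= 1 * expR z.1 * (1 * expR z.2) by rewrite mulr_ge0.
  have h := (cov_integrable mE1 mE2 E0 c2 mg).1.
  apply: (@eq_ig _ _ _ _ (fun z : T * T => g (1 * expR z.1, 1 * expR z.2) * (1 * expR z.1 * (1 * expR z.2)))).
    by move=> z; rewrite !mul1r.
  apply: h; apply: integrableS ig_g => //.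
  exact: measurableX.
split => //.
have [k1 e1] := Int_fubini1 ig_g; have [k2 e2] := Int_fubini1 i4.
rewrite e1 e2.
have ev (r : T) : \int[mu]_y g (- r, y) = \int[mu]_y g (r, y) by apply: eq_Int => y; exact: ev1.
have [k3 ->] := exp_doubling k1 ev.
rewrite (_ : 4 = 2 * 2 :> R); last by ring.
rewrite -mulrA; congr (_ * _); rewrite -IntZ//; apply: eq_Int => s.
have [k4 ->] := exp_doubling (ig2 (expR s)) (ev2 _).
rewrite mulrAC -mulrA; congr (_ * _); rewrite mulrC -IntZr//.
by apply: eq_Int => s' /=; ring.
Qed.

End doubling.

Section polar_identities.
Context {R : realType}.
Local Notation T := (measurableTypeR R).
Local Notation pl := (T * T)%type.

Definition sqnorm (x : pl) : R := x.1 ^+ 2 + x.2 ^+ 2.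

Lemma sqnorm_polar (a : pl) : sqnorm (polar a) = a.1 ^+ 2.
Proof.
have h := lt0r_neq0 (oneD_gt0 a.2).
rewrite /sqnorm /polar/= (_ : _ + _ = cos (atan a.2) ^+ 2 * (a.1 ^+ 2 * (1 + a.2 ^+ 2))); last by ring.
by rewrite sqr_cos_atan mulrC mulfK.
Qed.

Lemma polar_jacE (a : pl) : polar_jac a = pi * `|a.1| * cauchy_density a.2.
Proof.
have h := lt0r_neq0 (oneD_gt0 a.2); have hp := lt0r_neq0 (@pi_gt0 R).
have hh : pi * (1 + a.2 ^+ 2) != 0 by rewrite mulf_neq0.
by apply: (mulIf hh); rewrite /polar_jac /cauchy_density -[RHS]mulrA mulVf// mulr1 mulrCA mulfVK// mulrC mulrAC mulrA divfK// mulrC.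
Qed.

(** Radii enter squared because antipodal points are identified: this is the modulus of the quotient
    of the complex squares of two points, the larger one below. *)
Definition ratio (z : T * T) : R :=
  Num.min (z.1 ^+ 2) (z.2 ^+ 2) / Num.max (z.1 ^+ 2) (z.2 ^+ 2).

Lemma ratio01 z : 0 <= ratio z <= 1.
Proof.
rewrite /ratio; set x := z.1 ^+ 2; set y := z.2 ^+ 2.
have x0 : 0 <= x by rewrite sqr_ge0.
have y0 : 0 <= y by rewrite sqr_ge0.
have M0 : 0 <= Num.max x y by rewrite le_max x0.
rewrite mulr_ge0 ?invr_ge0 ?le_min ?x0//=.
have [->|M1] := eqVneq (Num.max x y) 0; first by rewrite invr0 mulr0.
have M2 : 0 < Num.max x y by rewrite lt_neqAle eq_sym M1.
by rewrite ler_pdivrMr// mul1r ge_min !le_max !lexx.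
Qed.

Lemma measurable_ratio : measurable_fun setT ratio.
Proof.
rewrite /ratio; apply: measurable_funM; first by apply: measurable_minr; solve_measurable.
by apply: (measurableT_comp measurable_invr); apply: measurable_maxr; solve_measurable.
Qed.

Definition unit_angle (v : T) : R * R := (cos (angle v), sin (angle v)).

Definition polar_ratio (z : pl * pl) : R * R :=
  cscal (ratio (z.1.1, z.2.1)) (cmul (unit_angle z.1.2) (conjp (unit_angle z.2.2))).

Lemma nrm2_unit_angle v : nrm2 (unit_angle v) = 1.
Proof. by rewrite /nrm2/= cos2Dsin2. Qed.

Lemma cpow_polar_ratio (z : pl * pl) n : (cpow (polar_ratio z) n).1 = ratio (z.1.1, z.2.1) ^+ n *
  (cos (angle z.1.2 *+ n) * cos (angle z.2.2 *+ n) + sin (angle z.1.2 *+ n) * sin (angle z.2.2 *+ n)).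
Proof.
rewrite /polar_ratio cpow_cscal cpowM cpow_conj /unit_angle !cpow_trig /cscal/cmul/conjp/=.
by rewrite mulrN opprK.
Qed.

Lemma nrm2_polar_ratio z : nrm2 (polar_ratio z) <= 1.
Proof.
have [r0 r1] := andP (ratio01 (z.1.1, z.2.1)).
rewrite /polar_ratio (_ : nrm2 (cscal _ _) = ratio (z.1.1, z.2.1) ^+ 2 * nrm2 (cmul (unit_angle z.1.2) (conjp (unit_angle z.2.2)))).
  rewrite nrm2_cmul nrm2_unit_angle mul1r (_ : nrm2 (conjp _) = 1) ?mulr1 ?exprn_ile1//.
  by rewrite /nrm2/conjp/= sqrrN cos2Dsin2.
by rewrite /nrm2/cscal/=; ring.
Qed.

Lemma polar_ratio_neq1 z : z.1.2 != z.2.2 -> polar_ratio z != (1, 0).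
Proof.
apply: contraNneq; case: z => -[r v] [r' v']/= h.
have [m0 m1] := andP (ratio01 (r, r')); set m := ratio (r, r') in h m0 m1.
case: h; rewrite /conjp/= !cos_angle !sin_angle.
have h1 := oneD_gt0 v; have h2 := oneD_gt0 v'.
have n1 := lt0r_neq0 h1; have n2 := lt0r_neq0 h2.
set D := (1 + v ^+ 2) * (1 + v' ^+ 2).
have D0 : 0 < D by rewrite mulr_gt0.
rewrite mulrN opprK.
have -> : (1 - v ^+ 2) / (1 + v ^+ 2) * ((1 - v' ^+ 2) / (1 + v' ^+ 2)) +
    2 * v / (1 + v ^+ 2) * (2 * v' / (1 + v' ^+ 2)) =
    1 - 2 * (v - v') ^+ 2 / D by rewrite /D; field; rewrite n1 n2.
move=> e _.
have q0 : 0 <= 2 * (v - v') ^+ 2 / D.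
  by apply: divr_ge0; [rewrite mulr_ge0// sqr_ge0|exact: ltW].
set q := 2 * _ / D in e q0; rewrite -/m in e.
have : m * q <= 0.
  by move: e; rewrite mulrBr mulr1; lra.
have mp : 0 < m by rewrite lt_neqAle m0 andbT eq_sym; apply: contra_eq_neq e => ->; rewrite mul0r eq_sym oner_eq0.
rewrite pmulr_rle0// => q1.
have : q == 0 by rewrite eq_le q1 q0.
rewrite /q !mulf_eq0 pnatr_eq0 invr_eq0 (gt_eqF D0) orbF/= orbb subr_eq0 => /eqP ->//.
Qed.

(** In complex notation the left side is [log |x^2 - y^2|], where [x^2] has modulus [r^2] and
    argument the doubled angle; the larger modulus is factored out. *)
Lemma log_polar (a b : pl) : a.1 != 0 -> b.1 != 0 -> a.2 != b.2 ->
  2^-1 * ln (sqdist (polar a) (polar b)) + 2^-1 * ln (sqdist (polar a) (- (polar b).1, - (polar b).2)) =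
  ln (Num.max (a.1 ^+ 2) (b.1 ^+ 2)) + lognorm1 (polar_ratio (a, b)).
Proof.
move=> a0 b0 ab.
have A0 : 0 < a.1 ^+ 2 by rewrite exprn_even_gt0.
have B0 : 0 < b.1 ^+ 2 by rewrite exprn_even_gt0.
set t := a.1 ^+ 2 in A0 *; set t' := b.1 ^+ 2 in B0 *.
set M := Num.max t t'; have M0 : 0 < M by rewrite lt_max A0.
pose c := (cmul (unit_angle a.2) (conjp (unit_angle b.2))).1.
have Zn := polar_ratio_neq1 (z := (a, b)) ab.
set X := (1 - (polar_ratio (a, b)).1) ^+ 2 + (polar_ratio (a, b)).2 ^+ 2.
have X0 : 0 < X.
  rewrite /X lt_neqAle addr_ge0 ?sqr_ge0// andbT eq_sym paddr_eq0 ?sqr_ge0//.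
  rewrite !sqrf_eq0 subr_eq0; apply: contra Zn => /andP[/eqP h1 /eqP h2].
  by rewrite [polar_ratio _]surjective_pairing -h1 h2.
have [mM sM] : Num.min t t' * M = t * t' /\ Num.min t t' ^+ 2 + M ^+ 2 = t ^+ 2 + t' ^+ 2.
  by rewrite /M; case: (leP t t') => _; split; ring.
have XE : M ^+ 2 * X = t ^+ 2 + t' ^+ 2 - 2 * (t * t') * c.
  have := nrm2_cmul (unit_angle a.2) (conjp (unit_angle b.2)).
  rewrite nrm2_unit_angle mul1r {2}/nrm2 {2 3}/conjp/= sqrrN cos2Dsin2 {1}/nrm2 -/c.
  set s := (cmul (unit_angle a.2) (conjp (unit_angle b.2))).2 => cs.
  have Z1 : (polar_ratio (a, b)).1 = Num.min t t' / M * c by [].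
  have Z2 : (polar_ratio (a, b)).2 = Num.min t t' / M * s by [].
  have cs' : s ^+ 2 = 1 - c ^+ 2 by rewrite -cs; ring.
  have Mn := lt0r_neq0 M0.
  have aux (m M' d : R) : M' != 0 -> M' ^+ 2 * ((1 - m / M' * d) ^+ 2 +
      (m / M') ^+ 2 * (1 - d ^+ 2)) = m ^+ 2 + M' ^+ 2 - 2 * (m * M') * d.
    by move=> M0'; field.
  by rewrite /X Z1 Z2 [X in _ + X]exprMn cs' -mM -sM; exact: aux.
have SE : sqdist (polar a) (polar b) * sqdist (polar a) (- (polar b).1, - (polar b).2) = M ^+ 2 * X.
  pose S := (polar a).1 * (polar b).1 + (polar a).2 * (polar b).2.
  have s1 : sqdist (polar a) (polar b) = t + t' - 2 * S.
    by rewrite /t /t' -!sqnorm_polar /sqnorm /sqdist /S; ring.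
  have s2 : sqdist (polar a) (- (polar b).1, - (polar b).2) = t + t' + 2 * S.
    by rewrite /t /t' -!sqnorm_polar /sqnorm /sqdist /S/=; ring.
  have h1 := lt0r_neq0 (oneD_gt0 a.2); have h2 := lt0r_neq0 (oneD_gt0 b.2).
  have S2 : S ^+ 2 = t * t' * (1 + a.2 * b.2) ^+ 2 / ((1 + a.2 ^+ 2) * (1 + b.2 ^+ 2)).
    rewrite invfM -!sqr_cos_atan /S /polar/= /t /t'; ring.
  have cE : c = 2 * ((1 + a.2 * b.2) ^+ 2 / ((1 + a.2 ^+ 2) * (1 + b.2 ^+ 2))) - 1.
    by rewrite /c /cmul/conjp/= !cos_angle !sin_angle; field; rewrite h1 h2.
  rewrite XE s1 s2 cE (_ : _ * _ = (t + t') ^+ 2 - 4 * S ^+ 2); last by ring.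
  by rewrite S2; ring.
have P0 : 0 < sqdist (polar a) (polar b) * sqdist (polar a) (- (polar b).1, - (polar b).2).
  by rewrite SE mulr_gt0// exprn_gt0.
have q1 : 0 < sqdist (polar a) (polar b).
  rewrite lt_neqAle addr_ge0 ?sqr_ge0// andbT eq_sym.
  by apply: contraTneq P0 => ->; rewrite mul0r ltxx.
have q2' : 0 < sqdist (polar a) (- (polar b).1, - (polar b).2) by move: P0; rewrite pmulr_rgt0.
rewrite -mulrDr -lnM ?posrE// SE lnM ?posrE ?exprn_gt0// lnXn// /lognorm1 -/X.
by rewrite mulrDr -[ln M *+ 2]mulr_natl mulrA mulVf ?mul1r ?pnatr_eq0.
Qed.

End polar_identities.

Lemma norm_xlnx_le {R : realType} (x C : R) : 0 <= x -> x <= C -> `|x * ln x| <= 1 + C ^+ 2.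
Proof.
move=> x0 xC; have c2 := sqr_ge0 C.
have [->|xn] := eqVneq x 0; first by rewrite mul0r normr0 addr_ge0.
have xp : 0 < x by rewrite lt_neqAle eq_sym xn.
have := @xlnx_ge R _ _ x0 (@ltr01 R); rewrite ln1 mulr0 add0r => l1.
have l2 := ler_wpM2l x0 (ltW (ln_sublinear xp)).
have l3 : x * x <= C ^+ 2 by rewrite expr2 ler_pM.
by rewrite ler_norml; apply/andP; split; lra.
Qed.

Lemma doubling_weights {R : realType} (a b e f x y d : R) :
  4 * (a * b * (x + y + d) * (e * f)) =
  2 * (a * e) * x * (2 * (b * f)) + 2 * (a * e) * (2 * (b * f) * y) + 2 * (a * e) * (2 * (b * f)) * d.
Proof. by ring. Qed.

Lemma radial_sum {R : realType} (l2 A D S lp F : R) : l2 - 1 <= A + D ->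
  A - l2 - S - lp - S + (2 * S + D) <= F -> - 1 - lp <= F.
Proof. by lra. Qed.

(** * The critical inequality for even densities *)

Section even_density.
Context {R : realType}.
Local Notation mu := (@lebesgue_measure R).
Local Notation T := (measurableTypeR R).
Local Notation pl := (T * T)%type.
Local Notation L2 := (@lebesgue2 R).
Variables (u : pl -> R) (B L l : R).
Hypotheses (du : dens u) (ev1 : even_x u) (ev2 : even_y u).
Hypotheses (uB : forall x, u x <= B) (l0 : 0 < l)
  (uL : forall x, u x != 0 -> l <= sqnorm x <= L).

Let bu : bdd u. Proof. by case: du. Qed.
Let u0 x : 0 <= u x. Proof. by case: du. Qed.
Let u1 : \int[L2]_x u x = 1. Proof. by case: du. Qed.
Let iu : ig L2 u. Proof. exact: ig_bdd. Qed.
Let mu' : measurable_fun setT u. Proof. exact: ig_meas iu. Qed.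

Let evN (x : pl) : u (- x.1, - x.2) = u x.
Proof. by have := ev1 (x.1, - x.2); rewrite /flip_x/= => ->; exact: ev2. Qed.

Let L0 : 0 <= L.
Proof.
have [x hx] : exists x, u x != 0 by apply: (@Int_neq0 R _ _ L2); rewrite u1 oner_eq0.
by have /andP[a b] := uL hx; apply: le_trans (ltW l0) (le_trans a b).
Qed.

Let B0 : 0 <= B. Proof. exact: le_trans (u0 (0, 0)) (uB _). Qed.

(** Below, [P] is the density in signed radius and slope, [p] its radial marginal, [d n] its n-th
    cosine mode in the doubled angle, and [b n] the weighted square of that mode. *)
Let P (a : pl) : R := u (polar a) * polar_jac a.

Let mP : measurable_fun setT P.
Proof.
apply: measurable_funM; last exact: measurable_polar_jac.
by apply: (measurableT_comp mu'); exact: measurable_polar.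
Qed.

Let P0 a : 0 <= P a. Proof. by rewrite mulr_ge0// polar_jac_ge0. Qed.

Let P_supp a : P a != 0 -> [/\ u (polar a) != 0, a.1 != 0 & l <= a.1 ^+ 2 <= L].
Proof.
rewrite mulf_eq0 negb_or => /andP[h _]; have := uL h; rewrite sqnorm_polar => h2; split => //.
by have /andP[h3 _] := h2; apply: contraTneq h3 => ->; rewrite expr0n/= -ltNge.
Qed.

Let C := B * pi * (1 + L).

Let C0 : 0 <= C. Proof. by rewrite !mulr_ge0 ?pi_ge0// addr_ge0. Qed.

Let abs_le (r : R) : r ^+ 2 <= L -> `|r| <= 1 + L.
Proof.
move=> h; have := sqr_ge0 (`|r| - 1); rewrite sqrrB1 real_normK ?num_real//.
by rewrite -mulr_natl; have := L0; have := normr_ge0 r; lra.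
Qed.

Let P_le a : P a <= C * cauchy_density a.2.
Proof.
have [->|/P_supp[h1 h2 /andP[h3 h4]]] := eqVneq (P a) 0.
  by rewrite mulr_ge0// ltW// cauchy_gt0.
rewrite /P polar_jacE /C -!mulrA ler_pM// ?mulr_ge0 ?pi_ge0 ?(ltW (cauchy_gt0 _))//.
by rewrite ler_wpM2l ?pi_ge0// ler_wpM2r ?(ltW (cauchy_gt0 _))// abs_le.
Qed.

Let P1 (r : T) : ig mu (fun v => P (r, v)).
Proof.
apply: (ig_le _ (igZ C (@ig_cauchy R))); first by apply: (measurableT_comp mP); solve_measurable.
by move=> v; rewrite ger0_norm//; exact: P_le.
Qed.

Let iP : ig L2 P.
Proof. exact/(cov_ig (@measurable_polar R) (@measurable_polar_jac R) (@polar_jac_ge0 R) (@cov_polar R) mu'). Qed.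

Let IntP : \int[L2]_a P a = 1.
Proof. by rewrite -u1 (cov_Rintegral (@polar_jac_ge0 R) (@cov_polar R) mu'). Qed.

Let p (r : T) : R := \int[mu]_v P (r, v).

Let ip : ig mu p. Proof. by have [] := Int_fubini1 iP. Qed.

Let p0 r : 0 <= p r. Proof. exact: Int_ge0. Qed.

Let Intp : \int[mu]_r p r = 1. Proof. by have [_ <-] := Int_fubini1 iP. Qed.

Let p_le r : p r <= C.
Proof.
rewrite -[C]mulr1 -(@Int_cauchy R) -IntZ; last exact: ig_cauchy.
by apply: le_Int; [exact: P1|apply: igZ; exact: ig_cauchy|move=> v; exact: P_le].
Qed.

Let p_supp r : p r != 0 -> l <= r ^+ 2 <= L.
Proof. by move=> /Int_neq0[v /P_supp[]]. Qed.

Let p_even (r : T) : p (- r) = p r.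
Proof.
apply: eq_Int => v; rewrite /P /polar_jac/= normrN; congr (_ * _).
by rewrite -(evN (polar (r, v))) /polar/= !mulrN mulNr.
Qed.

Let d n (r : T) : R := \int[mu]_v (P (r, v) * cos (angle v *+ n)).

Let mcos n : measurable_fun setT (fun v : T => cos (angle v *+ n) : R).
Proof.
apply: (measurableT_comp (@measurable_cos R)).
rewrite (_ : (fun v => angle v *+ n) = fun v => angle v * n%:R).
  by apply: measurable_funM => //; exact: measurable_angle.
by apply/funext => v; rewrite mulr_natr.
Qed.

Let msin n : measurable_fun setT (fun v : T => sin (angle v *+ n) : R).
Proof.
apply: (measurableT_comp (@measurable_sin R)).
rewrite (_ : (fun v => angle v *+ n) = fun v => angle v * n%:R).
  by apply: measurable_funM => //; exact: measurable_angle.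
by apply/funext => v; rewrite mulr_natr.
Qed.

Let cos1 (x : R) : `|cos x| <= 1. Proof. by rewrite ler_norml cos_geN1 cos_le1. Qed.
Let sin1 (x : R) : `|sin x| <= 1. Proof. by rewrite ler_norml sin_geN1 sin_le1. Qed.

Let iPc1 n (r : T) : ig mu (fun v => P (r, v) * cos (angle v *+ n)).
Proof. by apply: (igMb (B := 1)). Qed.

Let iPs1 n (r : T) : ig mu (fun v => P (r, v) * sin (angle v *+ n)).
Proof. by apply: (igMb (B := 1)). Qed.

Let iPc n : ig L2 (fun a => P a * cos (angle a.2 *+ n)).
Proof. by apply: (igMb (B := 1)) => //; apply: (measurableT_comp (mcos n)); solve_measurable. Qed.

Let iPs n : ig L2 (fun a => P a * sin (angle a.2 *+ n)).
Proof. by apply: (igMb (B := 1)) => //; apply: (measurableT_comp (msin n)); solve_measurable. Qed.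

(** Evenness in the second coordinate is the reflection [v |-> - v] of the slope, under which the
    sine is odd. *)
Let sin_mode n (r : T) : \int[mu]_v (P (r, v) * sin (angle v *+ n)) = 0.
Proof.
set I := Rintegral _ _ _; suff : I = - I by lra.
rewrite {1}/I (mpres_Int (@mpres_opp R) (ig_meas (iPs1 n r))) -IntN; last exact: iPs1.
apply: eq_Int => v; rewrite /P /polar_jac/= sqrrN /angle atanN !mulNrn sinN mulrN.
congr (- (_ * _ * _)); rewrite -(ev2 (polar (r, v))) /polar/=.
by rewrite atanN cosN mulrN.
Qed.

Let d_le n r : `|d n r| <= p r.
Proof.
apply: le_trans (le_norm_Int (iPc1 n r)) _; apply: le_Int => //; first exact: ig_norm.
by move=> v; rewrite normrM ger0_norm// ler_piMr.
Qed.

Let id n : ig mu (d n). Proof. by have [] := Int_fubini1 (iPc n). Qed.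

Let ib n : ig mu (fun r => d n r ^+ 2 / p r).
Proof.
have m1 := ig_meas (id n); have m2 := ig_meas ip.
apply: (ig_le _ ip); first by solve_measurable.
move=> r; rewrite ger0_norm; last by rewrite divr_ge0// sqr_ge0.
have [->|pn] := eqVneq (p r) 0; first by rewrite invr0 mulr0.
have pp : 0 < p r by rewrite lt_neqAle eq_sym pn p0.
by rewrite ler_pdivrMr// -expr2 -real_normK ?num_real// lerXn2r ?nnegrE.
Qed.

Let b n := \int[mu]_r (d n r ^+ 2 / p r).

Let b0 n : 0 <= b n.
Proof. by apply: Int_ge0 => r; rewrite divr_ge0// sqr_ge0. Qed.

Let w (z : pl * pl) : R := P z.1 * P z.2.
Let iw : ig (L2 \x L2)%E w. Proof. exact: (ig_prod iP iP). Qed.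

Let mZ1 : measurable_fun setT (fun z : pl * pl => (polar_ratio z).1).
Proof.
have [m11 m12 m21 m22] := @measurable_coords R.
have c1 := measurableT_comp (mcos 1) m12; have c2 := measurableT_comp (mcos 1) m22.
have s1 := measurableT_comp (msin 1) m12; have s2 := measurableT_comp (msin 1) m22.
have r1 : measurable_fun setT (fun z : pl * pl => ratio (z.1.1, z.2.1)).
  by apply: (measurableT_comp (@measurable_ratio R)); apply: measurable_fun_pair.
rewrite /polar_ratio/=; apply: measurable_funM => //; apply: measurable_funB; apply: measurable_funM => //.
by apply: measurable_funN.
Qed.

Let mZ2 : measurable_fun setT (fun z : pl * pl => (polar_ratio z).2).
Proof.
have [m11 m12 m21 m22] := @measurable_coords R.
have c1 := measurableT_comp (mcos 1) m12; have c2 := measurableT_comp (mcos 1) m22.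
have s1 := measurableT_comp (msin 1) m12; have s2 := measurableT_comp (msin 1) m22.
have r1 : measurable_fun setT (fun z : pl * pl => ratio (z.1.1, z.2.1)).
  by apply: (measurableT_comp (@measurable_ratio R)); apply: measurable_fun_pair.
rewrite /polar_ratio/=; apply: measurable_funM => //; apply: measurable_funD; apply: measurable_funM => //.
by apply: measurable_funN.
Qed.

Let Z_ae : {ae (L2 \x L2)%E, forall z, polar_ratio z != (1, 0)}.
Proof. by apply: filterS (@line_null2 R) => z; exact: polar_ratio_neq1. Qed.

Let mlr (f : T -> R) : measurable_fun setT f -> measurable_fun setT (fun z : T * T => f z.1 * f z.2).
Proof. by move=> h; apply: measurable_funM; apply: (measurableT_comp h); solve_measurable. Qed.

Let moment_eq n : ig (mu \x mu)%E (fun z : T * T => d n.+1 z.1 * d n.+1 z.2 * ratio z ^+ n.+1) /\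
  \int[(L2 \x L2)%E]_z (w z * (cpow (polar_ratio z) n.+1).1) =
  \int[(mu \x mu)%E]_(z in setT) (d n.+1 z.1 * d n.+1 z.2 * ratio z ^+ n.+1).
Proof.
have mK : measurable_fun setT (fun z : T * T => ratio z ^+ n.+1).
  by apply: measurable_funX; exact: measurable_ratio.
have K1 (z : T * T) : `|ratio z ^+ n.+1| <= 1.
  have /andP[r0 r1] := ratio01 z.
  by rewrite ger0_norm ?exprn_ge0// exprn_ile1.
have [j1 j2 j3] := Int_sep (m1 := mu) (m2 := mu) (K := fun z => ratio z ^+ n.+1) (C := 1)
  (iPc n.+1) (iPc n.+1) (iPc1 n.+1) (iPc1 n.+1) mK (fun a b _ _ => K1 _).
have [k1 k2 k3] := Int_sep (m1 := mu) (m2 := mu) (K := fun z => ratio z ^+ n.+1) (C := 1)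
  (iPs n.+1) (iPs n.+1) (iPs1 n.+1) (iPs1 n.+1) mK (fun a b _ _ => K1 _).
have e (z : pl * pl) : w z * (cpow (polar_ratio z) n.+1).1 =
    P z.1 * cos (angle z.1.2 *+ n.+1) * (P z.2 * cos (angle z.2.2 *+ n.+1)) * ratio (z.1.1, z.2.1) ^+ n.+1 +
    P z.1 * sin (angle z.1.2 *+ n.+1) * (P z.2 * sin (angle z.2.2 *+ n.+1)) * ratio (z.1.1, z.2.1) ^+ n.+1.
  by rewrite cpow_polar_ratio /w; ring.
split; first exact: j2.
rewrite (eq_Int _ e); apply: (etrans (@IntD _ _ _ (L2 \x L2)%E _ _ j1 k1)).
rewrite -[RHS]addr0; congr (_ + _); first exact: j3.
apply: (etrans k3); rewrite -[RHS](Int0 (mu \x mu)%E); apply: eq_Int => z.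
by rewrite !sin_mode !mul0r.
Qed.

(** The radial factor is at most 1 and is dropped. By the arithmetic-geometric mean, [|d(r) d(s)|]
    is at most half the sum of [d(r)^2 p(s) / p(r)] and of its mirror image, each of which has
    integral [b]. *)
Let moment n : \int[(L2 \x L2)%E]_z (w z * (cpow (polar_ratio z) n.+1).1) <= b n.+1.
Proof.
have [j2 ->] := moment_eq n.
pose q (r : T) := d n.+1 r ^+ 2 / p r.
have iq1 := ig_prod (ib n.+1) ip; have iq2 := ig_prod ip (ib n.+1).
have -> : b n.+1 = \int[(mu \x mu)%E]_(z in setT) (2^-1 * (q z.1 * p z.2) + 2^-1 * (p z.1 * q z.2)).
  rewrite (IntD (igZ _ iq1) (igZ _ iq2)) (IntZ _ iq1) (IntZ _ iq2).
  rewrite (Int_prod (ib n.+1) ip) (Int_prod ip (ib n.+1)) Intp mulr1 mul1r -/(b n.+1).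
  by rewrite [LHS]splitr [_ / 2]mulrC.
apply: le_Int => //; first by apply: igD; apply: igZ.
move=> -[r s]/=; have /andP[t0 t1] := ratio01 (r, s).
have t2 : ratio (r, s) ^+ n.+1 <= 1 by rewrite exprn_ile1.
have t3 : 0 <= ratio (r, s) ^+ n.+1 by rewrite exprn_ge0.
apply: (@le_trans _ _ `|d n.+1 r * d n.+1 s|).
  apply: le_trans (ler_norm _) _; rewrite normrM (ger0_norm t3).
  by rewrite ler_piMr.
rewrite normrM /q; have := d_le n.+1 r; have := d_le n.+1 s.
rewrite -[d n.+1 r ^+ 2]real_normK ?num_real// -[d n.+1 s ^+ 2]real_normK ?num_real//.
have := p0 r; have := p0 s; move: (p r) (p s) (normr_ge0 (d n.+1 r)) (normr_ge0 (d n.+1 s)).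
move: `|d _ r| `|d _ s| => x y pr ps x0 y0 ps0 pr0 hy hx.
have [e1|n1] := eqVneq pr 0.
  have -> : x = 0 by apply/eqP; rewrite eq_le x0 -e1 hx.
  by rewrite e1 !mul0r expr0n/= !(mul0r, mulr0) addr0.
have [e2|n2] := eqVneq ps 0.
  have -> : y = 0 by apply/eqP; rewrite eq_le y0 -e2 hy.
  by rewrite e2 expr0n/= !(mul0r, mulr0) addr0.
have r0 : 0 < pr by rewrite lt_neqAle eq_sym n1.
have s0 : 0 < ps by rewrite lt_neqAle eq_sym n2.
rewrite -subr_ge0.
have -> : 2^-1 * (x ^+ 2 / pr * ps) + 2^-1 * (pr * (y ^+ 2 / ps)) - x * y =
    2^-1 * (x * ps - y * pr) ^+ 2 / (pr * ps) by field; rewrite n1 n2.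
by apply: divr_ge0; [rewrite mulr_ge0// sqr_ge0|rewrite mulr_ge0].
Qed.

Let G (a : pl) : R := P a * ln (P a / cauchy_density a.2).

Let G_bound a : `|G a| <= (1 + C ^+ 2) * cauchy_density a.2.
Proof.
have k0 := cauchy_gt0 a.2; set x := P a / cauchy_density a.2.
have x0 : 0 <= x by rewrite divr_ge0// ltW.
have xC : x <= C by rewrite ler_pdivrMr// P_le.
have -> : G a = x * ln x * cauchy_density a.2 by rewrite /G -/x -{1}(divfK (lt0r_neq0 k0) (P a)) -/x mulrAC.
rewrite normrM (gtr0_norm k0) ler_wpM2r ?(ltW k0)//.
exact: norm_xlnx_le.
Qed.

Let mG : measurable_fun setT G.
Proof.
apply: measurable_funM => //; apply: (measurableT_comp (@measurable_ln R)).
apply: measurable_funM => //; apply: (measurableT_comp measurable_invr).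
by apply: (measurableT_comp (@measurable_cauchy R)); solve_measurable.
Qed.

Let iG1 (r : T) : ig mu (fun v => G (r, v)).
Proof.
apply: (ig_le _ (igZ (1 + C ^+ 2) (@ig_cauchy R))) => [|v]; last exact: G_bound.
by apply: (measurableT_comp mG); solve_measurable.
Qed.

Let iG : ig L2 G.
Proof.
have h := ig_prod (igZ (1 + C ^+ 2) (ig_inside (- (1 + L)) (1 + L))) (@ig_cauchy R).
apply: (ig_le mG h) => a /=.
have [e|/P_supp[_ _ /andP[_ h4]]] := eqVneq (P a) 0.
  by rewrite /G e mul0r normr0 !mulr_ge0 ?addr_ge0 ?sqr_ge0// (ltW (cauchy_gt0 _)).
have -> : (- (1 + L) <= a.1 <= 1 + L)%R by rewrite -ler_norml abs_le.
by rewrite mulr1; exact: G_bound.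
Qed.

Let Ent := \int[L2]_a G a.

Let ig_plnp : ig mu (fun r => p r * ln (p r)).
Proof.
apply: (@ig_bounded_supp _ _ (1 + C ^+ 2) (1 + L)).
- by have m := ig_meas ip; apply: measurable_funM => //; exact: (measurableT_comp (@measurable_ln R)).
- by move=> r; apply: norm_xlnx_le; rewrite ?p0 ?p_le.
move=> r; rewrite mulf_eq0 negb_or => /andP[/p_supp/andP[_ h] _].
by rewrite -ler_norml abs_le.
Qed.

(** [entropy_fourier_bound] at each radius. The left side is the very sum that bounds the
    interaction modes through [moment], so entropy and interaction compensate without loss. *)
Let entropy_gap N : \sum_(n < N) b n.+1 / n.+1%:R <= Ent - \int[mu]_r (p r * ln (p r)).
Proof.
have key (r : T) : p r * ln (p r) + \sum_(n < N) n.+1%:R^-1 * (d n.+1 r ^+ 2 / p r) <= \int[mu]_v G (r, v).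
  have := entropy_fourier_bound (@ig_cauchy R) (@measurable_angle R) (@cauchy_gt0 R) (@Int_cauchy R)
    (@Int_cauchy_cos R) N (P1 r) (fun v => P0 _) (iG1 r).
  apply: le_trans; rewrite lerD2l le_eqVlt; apply/orP; left; apply/eqP.
  by apply: eq_bigr => n _; rewrite -/(p r) -/(d _ _) invfM mulrCA mulrA.
have [iGr eG] := Int_fubini1 iG.
have is_ : ig mu (fun r => \sum_(n < N) n.+1%:R^-1 * (d n.+1 r ^+ 2 / p r)).
  by apply: ig_sum => n; exact: igZ.
have := le_Int (igD ig_plnp is_) iGr key.
rewrite -eG IntD// Int_sum; last by move=> n; exact: igZ.
rewrite (eq_bigr (fun n : 'I_N => b n.+1 / n.+1%:R)); last first.
  by move=> n _; rewrite IntZ// mulrC.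
by rewrite -/Ent; lra.
Qed.

Let interaction_gap : ig (L2 \x L2)%E (fun z => w z * lognorm1 (polar_ratio z)) ->
  - (\int[(L2 \x L2)%E]_z (w z * lognorm1 (polar_ratio z))) <= Ent - \int[mu]_r (p r * ln (p r)).
Proof.
move=> h; apply: (lognorm1_moments1 iw mZ1 mZ2 (@nrm2_polar_ratio R) Z_ae h moment) => //.
Qed.

Let M (z : T * T) : R := Num.max (z.1 ^+ 2) (z.2 ^+ 2).

Let ln_range (r : R) : l <= r -> r <= L -> `|ln r| <= `|ln l| + `|ln L|.
Proof.
move=> h1 h2; have rp : 0 < r by exact: lt_le_trans l0 h1.
have Lp : 0 < L by exact: lt_le_trans rp h2.
have k1 : ln l <= ln r by rewrite ler_ln ?posrE.
have k2 : ln r <= ln L by rewrite ler_ln ?posrE.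
have k3 := ler_norm (ln L); have k4 := ler_norm (- ln l); rewrite normrN in k4.
have k5 := normr_ge0 (ln l); have k6 := normr_ge0 (ln L).
rewrite ler_norml; apply/andP; split.
  by rewrite opprD lerBlDr (le_trans _ (lerD k1 k6))// addr0 lerNl.
by rewrite (le_trans k2)// (le_trans k3)// lerDr.
Qed.

Let M_bound r s : l <= r ^+ 2 <= L -> l <= s ^+ 2 <= L -> `|ln (M (r, s))| <= `|ln l| + `|ln L|.
Proof.
move=> /andP[a1 a2] /andP[b1 b2]; rewrite /M; apply: ln_range => /=.
  by rewrite le_max a1.
by rewrite ge_max a2.
Qed.

Let mlnM : measurable_fun setT (fun z : T * T => ln (M z)).
Proof.
apply: (measurableT_comp (@measurable_ln R)).
by apply: measurable_maxr; apply: measurable_funX; solve_measurable.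
Qed.

Let max_sep : [/\ ig (L2 \x L2)%E (fun z => w z * ln (M (z.1.1, z.2.1))),
  ig (mu \x mu)%E (fun z => p z.1 * p z.2 * ln (M z)) &
  \int[(L2 \x L2)%E]_z (w z * ln (M (z.1.1, z.2.1))) =
  \int[(mu \x mu)%E]_z (p z.1 * p z.2 * ln (M z))].
Proof.
apply: (Int_sep (m1 := mu) (m2 := mu) (K := fun z => ln (M z)) (C := `|ln l| + `|ln L|)
  iP iP P1 P1 mlnM).
by move=> a b' /P_supp[_ _ h1] /P_supp[_ _ h2]; exact: M_bound.
Qed.

Let inter_polar : ig (L2 \x L2)%E (fun z => w z * lognorm1 (polar_ratio z)) /\
  inter u = \int[(mu \x mu)%E]_z (p z.1 * p z.2 * ln (M z)) +
    \int[(L2 \x L2)%E]_z (w z * lognorm1 (polar_ratio z)).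
Proof.
pose neg (x : pl) : pl := (- x.1, - x.2).
have mneg : mpres L2 L2 neg by apply: eq_mpres (mpres_subl (0, 0)) => x; rewrite /neg/= !sub0r.
pose F1 (z : pl * pl) := u z.1 * u z.2 * ln (sqdist z.1 z.2).
pose F2 (z : pl * pl) := u z.1 * u z.2 * ln (sqdist z.1 (neg z.2)).
have i1 : ig (L2 \x L2)%E F1 by exact: ig_inter.
have mp := mpres_prod (mpres_id (@lebesgue2 R)) mneg.
have E2 (z : pl * pl) : F1 (z.1, neg z.2) = F2 z.
  by rewrite /F1 /F2 /= (evN z.2).
have i2 : ig (L2 \x L2)%E F2 by exact: (eq_ig E2 (mpres_igP mp i1)).
have e2 : \int[(L2 \x L2)%E]_z F2 z = inter u.
  by rewrite -(eq_Int _ E2) /inter [RHS](mpres_Int mp (ig_meas i1)).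
pose F z := 2^-1 * F1 z + 2^-1 * F2 z.
have iF : ig (L2 \x L2)%E F by apply: igD; exact: igZ.
have eF : inter u = \int[(L2 \x L2)%E]_z F z.
  by rewrite /F IntD; [|exact: igZ|exact: igZ]; rewrite !IntZ// e2 -/(inter u); lra.
have c2 := cov_prod measurableT measurableT (@measurable_polar R) (@measurable_polar_jac R)
  (@polar_jac_ge0 R) (@measurable_polar R) (@measurable_polar_jac R) (@polar_jac_ge0 R) (@cov_polar R) (@cov_polar R).
rewrite setXTT in c2.
have J0 (z : pl * pl) : 0 <= polar_jac z.1 * polar_jac z.2 by rewrite mulr_ge0 ?polar_jac_ge0.
have mPhi : measurable_fun setT (fun z : pl * pl => (polar z.1, polar z.2)).
  by apply: measurable_fun_pair; apply: (measurableT_comp (@measurable_polar R)).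
have mJ : measurable_fun setT (fun z : pl * pl => polar_jac z.1 * polar_jac z.2).
  by apply: measurable_funM; apply: (measurableT_comp (@measurable_polar_jac R)).
have k1 := (cov_ig mPhi mJ J0 c2 (ig_meas iF)).1 iF.
have k2 := cov_Rintegral J0 c2 (ig_meas iF).
have [s1 s2 s3] := max_sep.
have ae : {ae (L2 \x L2)%E, forall z : pl * pl,
    F (polar z.1, polar z.2) * (polar_jac z.1 * polar_jac z.2) - w z * ln (M (z.1.1, z.2.1)) = w z * lognorm1 (polar_ratio z)}.
  apply: filterS (@line_null2 R) => z hz.
  have -> : F (polar z.1, polar z.2) * (polar_jac z.1 * polar_jac z.2) =
      w z * (2^-1 * ln (sqdist (polar z.1) (polar z.2)) + 2^-1 * ln (sqdist (polar z.1) (neg (polar z.2)))).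
    by rewrite /F /F1 /F2 /w /P/=; ring.
  have [w0|wn] := eqVneq (w z) 0; first by rewrite w0 !mul0r subrr.
  move: (wn); rewrite /w mulf_eq0 negb_or => /andP[/P_supp[_ n1 _] /P_supp[_ n2 _]].
  rewrite (log_polar n1 n2 hz) -mulrBr; congr (_ * _).
  by rewrite /M/= [X in X - _]addrC addrK -surjective_pairing.
have mw : measurable_fun setT (fun z => w z * lognorm1 (polar_ratio z)).
  by apply: measurable_funM; [exact: ig_meas iw|exact: measurable_lognorm1].
have [t1 t2] := ae_eq_Int (igB k1 s1) mw ae.
by split => //; rewrite eF [LHS]k2 -t2 (IntB k1 s1) s3; ring.
Qed.

(** The polar Jacobian is [pi |r|] times [cauchy_density], so [ln u] is the logarithm of [P]
    relative to [cauchy_density], minus [ln pi] and [ln |r|]. *)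
Let ent_polar : ig mu (fun r => p r * ln (r ^+ 2)) /\
  ent u = Ent - ln pi - 2^-1 * \int[mu]_(r in setT) (p r * ln (r ^+ 2)).
Proof.
have mq : measurable_fun setT (fun r : T => ln (r ^+ 2)).
  by apply: (measurableT_comp (@measurable_ln R)); solve_measurable.
have i1 : ig L2 (fun a => P a * ln (a.1 ^+ 2)).
  apply: (igMb (B := `|ln l| + `|ln L|)) => //; first by apply: (measurableT_comp mq); solve_measurable.
  by move=> a /P_supp[_ _ /andP[h1 h2]]; exact: ln_range.
have [i2 e2] := Int_fubini1 i1.
have e3 (r : T) : \int[mu]_v (P (r, v) * ln ((r, v).1 ^+ 2)) = p r * ln (r ^+ 2).
  by rewrite /p -(IntZr (ln (r ^+ 2)) (P1 r)).
have i3 := eq_ig e3 i2; split => //.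
have m1 := measurable_ent mu'.
rewrite /ent (cov_Rintegral (@polar_jac_ge0 R) (@cov_polar R) m1).
have e4 : \int[mu]_(r in setT) (p r * ln (r ^+ 2)) = \int[L2]_a (P a * ln (a.1 ^+ 2)).
  by rewrite [RHS]e2; apply: eq_Int => r; rewrite e3.
rewrite e4 -[ln pi]mulr1 -[X in _ - ln pi * X - _]IntP -IntZ// -IntZ// -IntB//; last exact: igZ.
rewrite -IntB; [|by apply: igB => //; exact: igZ|exact: igZ].
apply: eq_Int => a; have [e|] := eqVneq (P a) 0.
  by rewrite /G e !(mul0r, mulr0) mulrAC -/(P a) e mul0r !subr0.
move=> Pn; have [un an /andP[h1 h2]] := P_supp Pn.
have up : 0 < u (polar a) by rewrite lt_neqAle eq_sym un u0.
have kp := cauchy_gt0 a.2; have pp := @pi_gt0 R.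
have ap : 0 < `|a.1| by rewrite normr_gt0.
rewrite /G (_ : P a / cauchy_density a.2 = u (polar a) * pi * `|a.1|); last first.
  by rewrite /P polar_jacE !mulrA mulfK// gt_eqF.
rewrite lnM ?posrE ?mulr_gt0// lnM ?posrE//.
rewrite (_ : a.1 ^+ 2 = `|a.1| ^+ 2); last by rewrite real_normK ?num_real.
rewrite lnXn// [ln _ *+ 2]mulr2n mulrAC -/(P a).
by lra.
Qed.

Lemma even_polar_bound :
  \int[mu]_r (p r * ln (p r)) - ln pi - 2^-1 * \int[mu]_(r in setT) (p r * ln (r ^+ 2)) +
  \int[(mu \x mu)%E]_z (p z.1 * p z.2 * ln (M z)) <= critical_energy u.
Proof.
have [h1 h2] := inter_polar; have [h3 h4] := ent_polar.
by have := interaction_gap h1; rewrite /critical_energy h2 h4; lra.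
Qed.

(** The law of [log |r|]; the factor 2 collects the two signs of the radius. *)
Let h (s : T) : R := 2 * (p (expR s) * expR s).
Let K := `|ln l| + `|ln L|.

Let ih : ig mu h.
Proof. by have [j1 _] := exp_doubling ip p_even; exact: igZ. Qed.

Let h0 s : 0 <= h s.
Proof. by rewrite /h !mulr_ge0// expR_ge0. Qed.

Let h1 : \int[mu]_s h s = 1.
Proof. by have [j1 e1] := exp_doubling ip p_even; rewrite /h IntZ// -e1 Intp. Qed.

Let psupp (s : T) : h s != 0 -> [/\ 0 < p (expR s), expR s <= 1 + L, - K <= s <= K & l <= expR s ^+ 2 <= L].
Proof.
rewrite !mulf_eq0 !negb_or => /and3P[_ hp _]; have hh := p_supp hp; have /andP[a1 a2] := hh.
have E : expR s ^+ 2 = expR (s + s) by rewrite expRD expr2.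
split => //; first by rewrite lt_neqAle eq_sym hp p0.
  by apply: le_trans (abs_le a2); exact: ler_norm.
have := ln_range a1 a2; rewrite E expRK -/K => k.
have := ler_norm (s + s); have := ler_norm (- (s + s)); rewrite normrN => k1 k2.
have K0 : 0 <= K by rewrite addr_ge0.
by apply/andP; split; lra.
Qed.

Let hB s : h s <= 2 * (C * (1 + L)).
Proof.
have [->|/psupp[_ a _ _]] := eqVneq (h s) 0; first by rewrite mulr_ge0// mulr_ge0// addr_ge0.
by rewrite /h ler_pM2l// ler_pM ?expR_ge0.
Qed.

Let hK s : h s != 0 -> - K <= s <= K. Proof. by move=> /psupp[]. Qed.

Let ish : ig mu (fun s => h s * s).
Proof. by apply: (igMb (B := K)) => // s /hK; rewrite ler_norml. Qed.

Let E1 : \int[mu]_r (p r * ln (p r)) = \int[mu]_s (h s * ln (h s)) - ln 2 - \int[mu]_s (h s * s).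
Proof.
have ixh := ig_xlnx ih h0 hB hK.
have lnh s : h s != 0 -> ln (h s) = ln 2 + ln (p (expR s)) + s.
  move=> /psupp[a _ _ _]; have e0 := expR_gt0 s.
  by rewrite /h lnM ?posrE ?mulr_gt0// lnM ?posrE// expRK addrA.
have [k1 ->] := exp_doubling ig_plnp (fun r => congr2 *%R (p_even r) (congr1 (@ln R) (p_even r))).
rewrite -IntZ// -[X in _ - X - _](mulr1 (ln 2)) -[X in _ - ln 2 * X - _]h1 -IntZ// -IntB; [|exact: ixh|exact: igZ].
rewrite -IntB; [|by apply: igB; [exact: ixh|exact: igZ]|by []].
apply: eq_Int => s; have [e|hn] := eqVneq (h s) 0.
  rewrite e !(mul0r, mulr0) !subr0; move: e => /eqP.
  rewrite /h !mulf_eq0 pnatr_eq0 (gt_eqF (expR_gt0 s)) orbF/= => /eqP ->.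
  by rewrite !(mul0r, mulr0).
by rewrite lnh// /h; ring.
Qed.

Let E2 : 2^-1 * \int[mu]_(r in setT) (p r * ln (r ^+ 2)) = \int[mu]_s (h s * s).
Proof.
have [i2 _] := ent_polar.
have ev (r : T) : p (- r) * ln ((- r) ^+ 2) = p r * ln (r ^+ 2) by rewrite p_even sqrrN.
have [k1 ->] := exp_doubling i2 ev.
rewrite mulrA mulVf ?mul1r ?pnatr_eq0//; apply: eq_Int => s.
by rewrite lnXn ?expR_gt0// expRK mulr2n /h; ring.
Qed.

Let E3 : \int[(mu \x mu)%E]_z (p z.1 * p z.2 * ln (M z)) =
  2 * \int[mu]_s (h s * s) + \int[(mu \x mu)%E]_z (h z.1 * h z.2 * `|z.1 - z.2|).
Proof.
have [s1 s2 _] := max_sep; have [idist _] := Int_dist ih h0 h1 hK.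
have is2 (r : T) : ig mu (fun r' : T => p (r, r').1 * p (r, r').2 * ln (M (r, r'))).
  have [e|/p_supp pr] := eqVneq (p r) 0.
    by apply: eq_ig (ig0 mu) => r'; rewrite e !mul0r.
  apply: (igMb (B := K)).
  - exact: (igZ (p r) ip).
  - by apply: (measurableT_comp mlnM); solve_measurable.
  - by move=> r'; rewrite mulf_eq0 negb_or => /andP[_ /p_supp]; exact: M_bound.
have [||//|k1 ->] := exp_doubling2 s2.
- by move=> r r'; rewrite /M/= p_even sqrrN.
- by move=> r r'; rewrite /M/= p_even sqrrN.
have t1 := ig_prod ish ih; have t2 := ig_prod ih ish.
have -> : 2 * \int[mu]_s (h s * s) = \int[(mu \x mu)%E]_(z in setT) (h z.1 * z.1 * h z.2) +
    \int[(mu \x mu)%E]_(z in setT) (h z.1 * (h z.2 * z.2)).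
  by rewrite (Int_prod ish ih) (Int_prod ih ish) h1; ring.
rewrite -(IntD t1 t2) -(IntD (igD t1 t2) idist) -(IntZ _ k1); apply: eq_Int => -[s s']/=.
(* Both sides are twice the larger of [s] and [s']. *)
have -> : ln (M (expR s, expR s')) = s + s' + `|s - s'|.
  rewrite /M/= -!expRM_natl; have [ss|ss] := leP s s'.
    rewrite max_r ?ler_expR ?ler_pM2l// expRK ler0_norm ?subr_le0//; ring.
  by rewrite max_l ?ler_expR ?ler_pM2l ?(ltW ss)// expRK gtr0_norm ?subr_gt0//; ring.
exact: doubling_weights.
Qed.

Lemma even_bound : - 1 - ln pi <= critical_energy u.
Proof.
have R1 := radial_bound ih h0 h1 hB hK.
have := even_polar_bound; rewrite E1 E2 E3; exact: (radial_sum R1).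
Qed.

Let moment_phi (phi : R -> R) (B' : R) : measurable_fun setT phi ->
  (forall t, l <= t <= L -> `|phi t| <= B') ->
  \int[L2]_x (u x * phi (sqnorm x)) = \int[mu]_s (h s * phi (expR (2 * s))).
Proof.
move=> mphi hphi.
have mq : measurable_fun setT (fun r : T => phi (r ^+ 2)).
  by apply: (measurableT_comp mphi); solve_measurable.
have mq' : measurable_fun setT (fun x : pl => phi (sqnorm x)).
  by apply: (measurableT_comp mphi); rewrite /sqnorm; solve_measurable.
have i1 : ig L2 (fun a => P a * phi (a.1 ^+ 2)).
  apply: (igMb (B := B')) => //; first by apply: (measurableT_comp mq); solve_measurable.
  by move=> a /P_supp[_ _]; exact: hphi.
have [i2 e2] := Int_fubini1 i1.
have e3 (r : T) : \int[mu]_v (P (r, v) * phi ((r, v).1 ^+ 2)) = p r * phi (r ^+ 2).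
  by rewrite /p -(IntZr (phi (r ^+ 2)) (P1 r)).
have i3 := eq_ig e3 i2.
have m1 : measurable_fun setT (fun x => u x * phi (sqnorm x)) by exact: measurable_funM.
rewrite (cov_Rintegral (@polar_jac_ge0 R) (@cov_polar R) m1).
have -> : \int[L2]_a (u (polar a) * phi (sqnorm (polar a)) * polar_jac a) = \int[mu]_(r in setT) (p r * phi (r ^+ 2)).
  rewrite -(eq_Int _ e3) -[RHS]e2; apply: eq_Int => a.
  by rewrite sqnorm_polar mulrAC.
have ev (r : T) : p (- r) * phi ((- r) ^+ 2) = p r * phi (r ^+ 2) by rewrite p_even sqrrN.
have [k1 ->] := exp_doubling i3 ev.
rewrite -IntZ//; apply: eq_Int => s.
by rewrite expRM_natl /h; ring.
Qed.

(** For a radial density all angular modes vanish and the inequalities above become identities. Abel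
    summation bounds the angular part of the interaction on one side only; it is applied to [w] and
    to [- w] to see that this part is zero. *)
Lemma radial_energy (g : R -> R) (hu := fun s : T => 2 * pi * (g (expR (2 * s)) * expR (2 * s))) :
  (forall x, u x = g (sqnorm x)) ->
  [/\ ent u = \int[mu]_s (hu s * ln (hu s)) - ln 2 - ln pi - 2 * \int[mu]_s (hu s * s),
      inter u = 2 * \int[mu]_s (hu s * s) + \int[(mu \x mu)%E]_z (hu z.1 * hu z.2 * `|z.1 - z.2|) &
      forall (phi : R -> R) (B' : R), measurable_fun setT phi ->
        (forall t, l <= t <= L -> `|phi t| <= B') ->
        \int[L2]_x (u x * phi (sqnorm x)) = \int[mu]_s (hu s * phi (expR (2 * s)))].
Proof.
move=> ug.
have PE (a : pl) : P a = pi * (g (a.1 ^+ 2) * `|a.1|) * cauchy_density a.2.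
  by rewrite /P ug sqnorm_polar polar_jacE; ring.
have pE (r : T) : p r = pi * (g (r ^+ 2) * `|r|).
  have -> : p r = \int[mu]_v (pi * (g (r ^+ 2) * `|r|) * cauchy_density v).
    by apply: eq_Int => v; exact: PE (r, v).
  by rewrite (IntZ _ (@ig_cauchy R)) Int_cauchy mulr1.
have hE : h = hu.
  by apply/funext => s; rewrite /h /hu pE gtr0_norm ?expR_gt0// expRM_natl; ring.
have PE' a : P a = p a.1 * cauchy_density a.2 by rewrite PE pE.
rewrite -hE; split; last exact: moment_phi.
  have [_ ->] := ent_polar; rewrite E2.
  have -> : Ent = \int[mu]_r (p r * ln (p r)).
    rewrite -[RHS]mulr1 -(@Int_cauchy R) -(Int_prod ig_plnp (@ig_cauchy R)); apply: eq_Int => a.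
    have k0 := cauchy_gt0 a.2.
    by rewrite /G PE' mulfK ?gt_eqF//; ring.
  by rewrite E1; ring.
have [iL ->] := inter_polar; rewrite E3.
have d0 n r : d n.+1 r = 0.
  have -> : d n.+1 r = \int[mu]_v (p r * (cauchy_density v * cos (angle v *+ n.+1))).
    by apply: eq_Int => v; rewrite PE' mulrA.
  by rewrite (IntZ _ (ig_cauchy_cos n.+1)) Int_cauchy_cos mulr0.
have m0 n : \int[(L2 \x L2)%E]_z (w z * (cpow (polar_ratio z) n.+1).1) = 0.
  have [_ ->] := moment_eq n; rewrite -[RHS](Int0 (mu \x mu)%E); apply: eq_Int => z.
  by rewrite d0 !mul0r.
have S0 N : \sum_(n < N) (0 : R) / n.+1%:R <= 0 by rewrite big1// => n _; rewrite mul0r.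
have l1 := lognorm1_moments1 iw mZ1 mZ2 (@nrm2_polar_ratio R) Z_ae iL
  (fun n => eq_ind_r (fun t => t <= 0) (lexx 0) (m0 n)) (fun=> lexx 0) S0.
have iL' : ig (L2 \x L2)%E (fun z => - w z * lognorm1 (polar_ratio z)).
  by apply: eq_ig (igN iL) => z; rewrite mulNr.
have m0' n : \int[(L2 \x L2)%E]_z (- w z * (cpow (polar_ratio z) n.+1).1) <= 0.
  rewrite (eq_Int _ (fun z => mulNr (w z) _)) IntN; first by rewrite m0 oppr0.
  by apply: ig_cpow => //; exact: nrm2_polar_ratio.
have l2 := lognorm1_moments1 (igN iw) mZ1 mZ2 (@nrm2_polar_ratio R) Z_ae iL' m0' (fun=> lexx 0) S0.
rewrite (eq_Int _ (fun z => mulNr (w z) _)) IntN// opprK in l2.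
suff -> : \int[(L2 \x L2)%E]_z (w z * lognorm1 (polar_ratio z)) = 0 by rewrite addr0.
by apply/eqP; rewrite eq_le l2/= -oppr_le0.
Qed.

End even_density.

(** * Truncation of general densities *)

Section truncation.
Context {R : realType}.
Local Notation mu := (@lebesgue_measure R).
Local Notation T := (measurableTypeR R).
Local Notation pl := (T * T)%type.
Local Notation L2 := (@lebesgue2 R).

Lemma measurable_sqnorm : measurable_fun setT (@sqnorm R). Proof. by rewrite /sqnorm; solve_measurable. Qed.

Lemma sqnorm_ge0 (x : pl) : 0 <= sqnorm x. Proof. by rewrite addr_ge0 ?sqr_ge0. Qed.

Lemma ae_sqnorm : {ae L2, forall x, 0 < sqnorm x}.
Proof.
have mD : measurable [set x : pl | x.1 = 0].
  rewrite [X in measurable X](_ : _ = fst @^-1` [set 0]); last by apply/seteqP; split.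
  by rewrite -[X in measurable X]setTI; apply: measurable_fst.
exists [set x | x.1 = 0]; split => //.
  rewrite (_ : [set x : pl | x.1 = 0] = [set 0] `*` setT); last first.
    by apply/seteqP; split => [[x y]|[x y] []].
  have m1 : measurable ([set 0] : set T) by exact: measurable_set1.
  apply: (etrans (product_measure1E mu mu m1 measurableT)).
  by rewrite /= lebesgue_measure_set1 mul0e.
move=> [x y] /= /negP; rewrite -leNgt /sqnorm/= => h; have := sqr_ge0 x; have := sqr_ge0 y => y0 x0.
by apply/eqP; rewrite -sqrf_eq0 eq_le x0 andbT; lra.
Qed.

Lemma ae_prod1 (A : set pl) : {ae L2, forall x, A x} -> {ae (L2 \x L2)%E, forall z, A z.1}.
Proof.
move=> [N [mN N0 AN]]; exists (N `*` setT); split.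
- exact: measurableX.
- have e : (L2 N * L2 setT = 0)%E by rewrite N0 mul0e.
  exact: (etrans (product_measure1E L2 L2 mN measurableT) e).
by move=> z /= h; split => //; apply: AN.
Qed.

Lemma ae_prod2 (A : set pl) : {ae L2, forall x, A x} -> {ae (L2 \x L2)%E, forall z, A z.2}.
Proof.
move=> [N [mN N0 AN]]; exists (setT `*` N); split.
- exact: measurableX.
- have e : (L2 setT * L2 N = 0)%E by rewrite N0 mule0.
  exact: (etrans (product_measure1E L2 L2 measurableT mN) e).
by move=> z /= h; split => //; apply: AN.
Qed.

Variable u : pl -> R.
Hypotheses (u0 : forall x, 0 <= u x) (iu : ig L2 u) (u1 : \int[L2]_x u x = 1).
Hypotheses (ie : ig L2 (fun x => u x * ln (u x)))
  (iv : ig L2 (fun x => u x * ln (1 + sqnorm x)))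
  (ii : ig (L2 \x L2)%E (fun z => u z.1 * u z.2 * ln (sqdist z.1 z.2))).

Let mu' : measurable_fun setT u. Proof. exact: ig_meas iu. Qed.

(** The lower cut keeps [log |x|] bounded on the support; the origin is never kept, but it is a null
    set. *)
Definition keep (n : nat) (x : pl) : bool :=
  (u x <= n%:R) && (n.+1%:R^-1 <= sqnorm x <= n%:R).

Definition cutoff (n : nat) (x : pl) : R := u x * (keep n x)%:R.

Let measurable_keep n : measurable_fun setT (keep n).
Proof.
apply: measurable_and; first exact: measurable_fun_ler.
by have := measurable_sqnorm => m; apply: measurable_and; exact: measurable_fun_ler.
Qed.

Let mkeep n : measurable_fun setT (fun x => (keep n x)%:R : R).
Proof. exact: measurable_boolr. Qed.

Lemma cutoff_ge0 n x : 0 <= cutoff n x. Proof. by rewrite mulr_ge0. Qed.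

Lemma cutoff_supp n x : cutoff n x != 0 -> [/\ cutoff n x = u x, u x <= n%:R & n.+1%:R^-1 <= sqnorm x <= n%:R].
Proof.
rewrite /cutoff; case k : (keep n x); rewrite ?mulr0 ?eqxx// mulr1.
by move: k => /andP[].
Qed.

Lemma bdd_cutoff n : bdd (cutoff n).
Proof.
apply: (@bddI _ _ n%:R (1 + n%:R)); first exact: measurable_funM.
move=> x /cutoff_supp[e h /andP[_ h2]]; split; first by rewrite e ger0_norm.
have k (a : R) : a ^+ 2 <= n%:R -> (- (1 + n%:R) <= a <= 1 + n%:R).
  move=> an; rewrite -ler_norml; have := sqr_ge0 (`|a| - 1).
  rewrite sqrrB1 real_normK ?num_real// -mulr_natl; have := normr_ge0 a.
  by have := ler0n R n; lra.
rewrite /in_square !k//; apply: le_trans h2; rewrite /sqnorm; [rewrite lerDr|rewrite lerDl]; exact: sqr_ge0.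
Qed.

Let keep_mono n m x : (n <= m)%N -> keep n x -> keep m x.
Proof.
move=> nm /and3P[a b c]; have h : n%:R <= m%:R :> R by rewrite ler_nat.
rewrite /keep (le_trans a h) (le_trans c h) andbT/=.
by apply: le_trans b; rewrite lef_pV2 ?posrE ?ltr0n// ler_nat ltnS.
Qed.

Let keep_cvg x : 0 < sqnorm x -> exists n, keep n x.
Proof.
move=> q0; pose n := (Num.truncn (u x) + Num.truncn (sqnorm x) + Num.truncn (sqnorm x)^-1).+1.
have k (y : R) m : 0 <= y -> (Num.truncn y <= m)%N -> y <= m.+1%:R.
  move=> y0 ym; apply: le_trans (ltW (truncnS_gt y)) _.
  by rewrite ler_nat ltnS.
exists n; rewrite /keep !k ?sqnorm_ge0//=; last 2 first.
- by rewrite -addnA addnCA leq_addr.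
- by rewrite -addnA leq_addr.
rewrite andbT -[sqnorm x]invrK lef_pV2 ?posrE ?invr_gt0 ?ltr0n//.
apply: (le_trans (k _ (Num.truncn (sqnorm x)^-1) _ _)) => //; first by rewrite invr_ge0 sqnorm_ge0.
by rewrite ler_nat ltnS leqW// leq_addl.
Qed.

Let ae_keep : {ae L2, forall x, exists n, forall m, (n <= m)%N -> keep m x}.
Proof.
apply: filterS ae_sqnorm => x /keep_cvg[n hn]; exists n => m nm.
exact: keep_mono hn.
Qed.

Let cvg_ev (f : nat -> R) (l : R) : (exists n, forall m, (n <= m)%N -> f m = l) -> f @ \oo --> l.
Proof. by move=> [n hn]; apply: cvg_near_cst; exists n => // m; exact: hn. Qed.

Lemma cvg_cutoff (f : pl -> R) : ig L2 (fun x => u x * f x) -> measurable_fun setT f ->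
  \int[L2]_x (cutoff n x * f x) @[n --> \oo] --> \int[L2]_x (u x * f x).
Proof.
move=> hf mf.
have [] // := @dominated_Int _ _ _ L2 (fun n x => cutoff n x * f x) _ _ _ (ig_meas hf) (ig_norm hf).
- by move=> n; apply: measurable_funM => //; exact: measurable_funM.
- apply: filterS ae_keep => x [n hn]; apply: cvg_ev; exists n => m nm.
  by rewrite /cutoff hn// mulr1.
apply: aeW => x n; rewrite /cutoff mulrAC normrM ler_piMr// ger0_norm//.
by rewrite lern1 leq_b1.
Qed.

Lemma cvg_cutoff_ent : \int[L2]_x (cutoff n x * ln (cutoff n x)) @[n --> \oo] --> ent u.
Proof.
have ml : measurable_fun setT (fun x => ln (u x)) by exact: (measurableT_comp (@measurable_ln R)).
have e n : \int[L2]_x (cutoff n x * ln (cutoff n x)) = \int[L2]_x (cutoff n x * ln (u x)).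
  apply: eq_Int => x; have [->|/cutoff_supp[-> _ _]//] := eqVneq (cutoff n x) 0.
  by rewrite !mul0r.
by under eq_fun do rewrite e; exact: cvg_cutoff ie ml.
Qed.

Lemma cvg_cutoff_mass : \int[L2]_x cutoff n x @[n --> \oo] --> (1 : R).
Proof.
have i1 : ig L2 (fun x => u x * 1) by apply: eq_ig iu => x; rewrite mulr1.
have := cvg_cutoff i1 (measurable_cst _); under [X in _ --> X -> _]eq_Int do rewrite mulr1.
by rewrite u1; under eq_fun do under eq_Int do rewrite mulr1.
Qed.

Lemma cvg_cutoff_inter : inter (cutoff n) @[n --> \oo] --> inter u.
Proof.
have mI := measurable_inter mu'.
have [] // := @dominated_Int _ _ _ (L2 \x L2)%E
  (fun n z => cutoff n z.1 * cutoff n z.2 * ln (sqdist z.1 z.2)) _ _ _ (ig_meas ii) (ig_norm ii).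
- by move=> n; apply: measurable_inter; exact: measurable_funM.
- apply: filterS2 (ae_prod1 ae_keep) (ae_prod2 ae_keep) => z [n hn] [k hk].
  apply: cvg_ev; exists (maxn n k) => m; rewrite geq_max => /andP[nm km].
  by rewrite /cutoff hn// hk// !mulr1.
apply: aeW => z n; rewrite /cutoff.
case: (keep n z.1); case: (keep n z.2); rewrite !(mulr1, mulr0, mul0r, normr0)//.
Qed.

(** The excess of [log (1 + |x|^2)] over [log |x|^2] on the cutoff. The bounds for truncated
    densities involve the second potential and those for [u] the first, the integrability of
    [u log |x|^2] not being assumed. *)
Let defect (n : nat) : R := \int[L2]_x (cutoff n x * ln (1 + (sqnorm x)^-1)).

Let ln_split n x : cutoff n x * ln (sqnorm x) = cutoff n x * ln (1 + sqnorm x) - cutoff n x * ln (1 + (sqnorm x)^-1).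
Proof.
have [->|/cutoff_supp[_ _ /andP[h _]]] := eqVneq (cutoff n x) 0; first by rewrite !mul0r subrr.
have q0 : 0 < sqnorm x by apply: lt_le_trans h; rewrite invr_gt0 ltr0n.
have qi : 0 < 1 + (sqnorm x)^-1 by rewrite addr_gt0// invr_gt0.
rewrite -mulrBr; congr (_ * _); apply/eqP; rewrite eq_sym subr_eq -lnM ?posrE//.
by rewrite mulrDr mulr1 (divff (lt0r_neq0 q0)) addrC.
Qed.

Let mlq : measurable_fun setT (fun x : pl => ln (sqnorm x)).
Proof. by apply: (measurableT_comp (@measurable_ln R)); exact: measurable_sqnorm. Qed.

Let mlq1 : measurable_fun setT (fun x : pl => ln (1 + (sqnorm x)^-1)).
Proof.
apply: (measurableT_comp (@measurable_ln R)); apply: measurable_funD => //.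
by apply: (measurableT_comp measurable_invr); exact: measurable_sqnorm.
Qed.

Let mlq2 : measurable_fun setT (fun x : pl => ln (1 + sqnorm x)).
Proof.
by apply: (measurableT_comp (@measurable_ln R)); apply: measurable_funD => //; exact: measurable_sqnorm.
Qed.

Let idef n : ig L2 (fun x => cutoff n x * ln (1 + (sqnorm x)^-1)).
Proof.
apply: ig_bdd; apply: (bddM (C := n.+1%:R) (bdd_cutoff n)) => // x /cutoff_supp[_ _ /andP[h _]].
have q0 : 0 < sqnorm x by apply: lt_le_trans h; rewrite invr_gt0 ltr0n.
have qi : 0 < (sqnorm x)^-1 by rewrite invr_gt0.
have h1 : 0 <= ln (1 + (sqnorm x)^-1) by rewrite ln_ge0// lerDl ltW.
rewrite ger0_norm//; apply: (le_trans (le_ln1Dx _)).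
  by apply: lt_trans qi; exact: ltrN10.
by rewrite -[leRHS]invrK lef_pV2 ?posrE ?invr_gt0 ?ltr0n.
Qed.

Let defect_mono n m : (n <= m)%N -> defect n <= defect m.
Proof.
move=> nm; apply: le_Int => // x.
have [e|/cutoff_supp[_ _ /andP[h _]]] := eqVneq (cutoff m x) 0.
  rewrite e mul0r; have [->|] := eqVneq (cutoff n x) 0; first by rewrite mul0r.
  rewrite /cutoff; case k : (keep n x); rewrite ?mulr0 ?eqxx// mulr1 => un.
  by move: e; rewrite /cutoff (keep_mono nm k) mulr1 => e; rewrite e eqxx in un.
have q0 : 0 < sqnorm x by apply: lt_le_trans h; rewrite invr_gt0 ltr0n.
rewrite ler_wpM2r//; first by rewrite ln_ge0// lerDl invr_ge0 ltW.
rewrite /cutoff ler_wpM2l//; case k : (keep n x) => //; by rewrite (keep_mono nm k).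
Qed.

Let itr n : ig L2 (cutoff n). Proof. exact: ig_bdd (bdd_cutoff n). Qed.

Definition ncutoff n (x : pl) : R := (\int[L2]_x cutoff n x)^-1 * cutoff n x.

Lemma dens_ncutoff n : 0 < \int[L2]_x cutoff n x -> dens (ncutoff n).
Proof.
move=> m0; split; last by rewrite /ncutoff IntZ// mulVf// gt_eqF.
  rewrite (_ : ncutoff n = fun x => cutoff n x * (\int[L2]_x cutoff n x)^-1); last first.
    by apply/funext => x; rewrite /ncutoff mulrC.
  by apply: (bddM (C := `|(\int[L2]_x cutoff n x)^-1|) (bdd_cutoff n)).
by move=> x; rewrite /ncutoff mulr_ge0 ?cutoff_ge0// invr_ge0 ltW.
Qed.

Definition energy (a k : R) (v : pl -> R) : R :=
  ent v + a * \int[L2]_x (v x * ln (sqnorm x)) + k * inter v.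

Lemma energy_ncutoff a k n (m := \int[L2]_x cutoff n x) : 0 < m -> energy a k (ncutoff n) =
  m^-1 * (\int[L2]_x (cutoff n x * ln (cutoff n x))) - ln m +
  a * (m^-1 * (\int[L2]_x (cutoff n x * ln (1 + sqnorm x)) - defect n)) + k * (m ^- 2 * inter (cutoff n)).
Proof.
move=> m0; have mi : 0 < m^-1 by rewrite invr_gt0.
have bt := bdd_cutoff n; have i1 := ig_bdd (bdd_xlnx bt (cutoff_ge0 n)).
have i2 : ig L2 (fun x => cutoff n x * ln (1 + sqnorm x)).
  apply: (ig_le _ (ig_norm iv)); first by apply: measurable_funM => //; exact: measurable_funM.
  move=> x; rewrite /cutoff mulrAC normrM ler_piMr// ger0_norm//.
  by rewrite lern1 leq_b1.
rewrite /energy; congr (_ + _ * _ + _ * _).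
- have -> : ent (ncutoff n) = \int[L2]_x (m^-1 * (cutoff n x * ln (cutoff n x)) - ln m * (m^-1 * cutoff n x)).
    apply: eq_Int => x; rewrite /ncutoff -/m.
    have [->|tn] := eqVneq (cutoff n x) 0; first by rewrite !(mulr0, mul0r) subrr.
    have tp : 0 < cutoff n x by rewrite lt_neqAle eq_sym tn cutoff_ge0.
    by rewrite lnM ?posrE// lnV ?posrE//; ring.
  rewrite IntB; [|exact: igZ|by apply: igZ; exact: igZ].
  by rewrite !IntZ//; [rewrite mulVf ?mulr1// gt_eqF|exact: igZ].
- rewrite (eq_Int _ (g := fun x => m^-1 * (cutoff n x * ln (1 + sqnorm x) - cutoff n x * ln (1 + (sqnorm x)^-1)))); last first.
    by move=> x; rewrite -ln_split /ncutoff -mulrA.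
  by rewrite IntZ; [rewrite IntB|exact: igB].
rewrite /inter -IntZ; last exact: ig_inter.
by apply: eq_Int => z; rewrite /ncutoff -/m -exprVn; ring.
Qed.

(** [defect] is nondecreasing, so for [n >= n0] replacing [defect n] by [defect n0] can only raise
    the energy; all other terms converge. The fixed [defect n0] that survives is the source of
    strictness. *)
Lemma truncation_bound (a k C : R) n0 : 0 <= a ->
  (forall n, 0 < \int[L2]_x cutoff n x -> C <= energy a k (ncutoff n)) ->
  C + a * defect n0 <= ent u + a * \int[L2]_x (u x * ln (1 + sqnorm x)) + k * inter u.
Proof.
move=> a0 H; pose m n := \int[L2]_x cutoff n x.
pose E n := (m n)^-1 * (\int[L2]_x (cutoff n x * ln (cutoff n x))) - ln (m n) +
  a * ((m n)^-1 * (\int[L2]_x (cutoff n x * ln (1 + sqnorm x)) - defect n0)) + k * ((m n) ^- 2 * inter (cutoff n)).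
have cm : m n @[n --> \oo] --> (1 : R) := cvg_cutoff_mass.
have ci : (m n)^-1 @[n --> \oo] --> (1 : R).
  by rewrite -[X in _ --> X]invr1; apply: cvgV => //; exact: oner_neq0.
have cln : ln (m n) @[n --> \oo] --> (0 : R).
  by rewrite -[X in _ --> X](@ln1 R); apply: (cvg_comp _ _ cm); exact: continuous_ln.
have cE : E n @[n --> \oo] --> 1 * ent u - 0 + a * (1 * (\int[L2]_x (u x * ln (1 + sqnorm x)) - defect n0)) + k * (1 ^+ 2 * inter u).
  apply: cvgD; first apply: cvgD; first apply: cvgB => //.
  - by apply: cvgM => //; exact: cvg_cutoff_ent.
  - apply: cvgM; first exact: cvg_cst.
    apply: cvgM => //; apply: cvgB; [exact: cvg_cutoff|exact: cvg_cst].
  apply: cvgM; first exact: cvg_cst.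
  apply: cvgM; last exact: cvg_cutoff_inter.
  rewrite (_ : (fun n => _) = (fun n => (m n)^-1 ^+ 2)); last by apply/funext => n; rewrite exprVn.
  by apply: (@cvg_comp _ _ _ (fun n => (m n)^-1) (fun x : R => x ^+ 2) _ _ _ ci); exact: exprn_continuous.
have : C <= 1 * ent u - 0 + a * (1 * (\int[L2]_x (u x * ln (1 + sqnorm x)) - defect n0)) + k * (1 ^+ 2 * inter u).
  apply: (cvgr_to_ge cE); near=> n.
  have mn : 0 < m n by near: n; exact: (cvgr_gt (1 : R) cm).
  have := H n mn; rewrite energy_ncutoff// -/(m n); move/le_trans; apply.
  rewrite /E lerD2r lerD2l ler_wpM2l// ler_wpM2l ?invr_ge0 ?(ltW mn)// lerD2l lerN2.
  by apply: defect_mono; near: n; exact: nbhs_infty_ge.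
by rewrite !mul1r expr1n mul1r; lra.
Unshelve. all: by end_near.
Qed.

Lemma defect_ge0 n : 0 <= defect n.
Proof.
apply: Int_ge0 => x; have [->|/cutoff_supp[_ _ /andP[h _]]] := eqVneq (cutoff n x) 0; first by rewrite mul0r.
have q0 : 0 < sqnorm x by apply: lt_le_trans h; rewrite invr_gt0 ltr0n.
by rewrite mulr_ge0 ?cutoff_ge0// ln_ge0// lerDl invr_ge0 ltW.
Qed.

Lemma defect_gt0 : exists n, 0 < defect n.
Proof.
have : \forall n \near \oo, 0 < \int[L2]_x cutoff n x by exact: (cvgr_gt (1 : R) cvg_cutoff_mass).
move=> [n _ /(_ n (leqnn n))/= mn]; exists n.
pose c := ln (1 + n.+1%:R^-1) : R.
have c0 : 0 < c by rewrite ln_gt0// ltrDl invr_gt0 ltr0n.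
apply: (@lt_le_trans _ _ (c * \int[L2]_x cutoff n x)); first by rewrite mulr_gt0.
rewrite -IntZ//; apply: le_Int => //; first exact: igZ.
move=> x; have [->|/cutoff_supp[_ _ /andP[h h']]] := eqVneq (cutoff n x) 0; first by rewrite mulr0 mul0r.
have q0 : 0 < sqnorm x by apply: lt_le_trans h; rewrite invr_gt0 ltr0n.
rewrite mulrC ler_wpM2l ?cutoff_ge0// /c ler_ln ?posrE ?addr_gt0 ?invr_gt0 ?ltr0n// lerD2l.
by rewrite lef_pV2 ?posrE ?ltr0n//; apply: le_trans h' _; rewrite ler_nat.
Qed.

End truncation.

Section free_bound.
Context {R : realType}.
Local Notation mu := (@lebesgue_measure R).
Local Notation T := (measurableTypeR R).
Local Notation pl := (T * T)%type.
Local Notation L2 := (@lebesgue2 R).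

(** The cutoff depends on [u x] and [|x|] only, so it preserves both symmetries while providing the
    annular support that [even_bound] asks for. *)
Lemma critical_energy_bound (u : pl -> R) : dens u -> - 1 - ln pi <= critical_energy u.
Proof.
move: u; apply: even_reduction => u du ev1 ev2.
have [bu u0 u1] := du; have iu := ig_bdd bu; have mu' := ig_meas iu.
have [_ [B [K [B0 K0 uB uK]]]] := bddE bu.
have ml : measurable_fun setT (fun x : pl => ln (1 + sqnorm x)).
  by apply: (measurableT_comp (@measurable_ln R)); apply: measurable_funD => //; exact: measurable_sqnorm.
have iv : ig L2 (fun x => u x * ln (1 + sqnorm x)).
  apply: ig_bdd; apply: (bddM (C := K ^+ 2 + K ^+ 2) bu ml) => x /uK/andP[a b].
  rewrite ger0_norm; last by rewrite ln_ge0// lerDl sqnorm_ge0.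
  apply: le_trans (le_ln1Dx _) _; first by apply: lt_le_trans (sqnorm_ge0 x); rewrite ltrN10.
  by rewrite /sqnorm lerD// norm_le_1Dsqr.
have H n : 0 < \int[L2]_x cutoff u n x -> - 1 - ln pi <= energy 0 1 (ncutoff u n).
  move=> mn; rewrite /energy mul0r addr0 mul1r.
  have dn := dens_ncutoff u0 iu mn; have [bn _ _] := dn.
  have [_ [B' [_ [_ _ hB _]]]] := bddE bn.
  have k1 x : keep u n (flip_x x) = keep u n x by rewrite /keep ev1 /sqnorm/= sqrrN.
  have k2 (x : pl) : keep u n (x.1, - x.2) = keep u n x by rewrite /keep ev2 /sqnorm/= sqrrN.
  apply: (@even_bound R _ B' n%:R n.+1%:R^-1) => //.
  - by move=> x; rewrite /ncutoff /cutoff ev1 k1.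
  - by move=> x; rewrite /ncutoff /cutoff ev2 k2.
  - by move=> x; apply: le_trans (hB x); exact: ler_norm.
  by move=> x; rewrite mulf_eq0 negb_or => /andP[_ /cutoff_supp[]].
have := truncation_bound u0 iu u1 (ig_bdd (bdd_xlnx bu u0)) iv (ig_inter bu bu) 0 (lexx 0) H.
by rewrite !mul0r !addr0 mul1r.
Qed.

(** * Radial dilations *)

Section dilations.
Variable l : R.
Hypothesis l0 : 0 < l.

(** The map [r |-> |r|^(l - 1) r] on signed radii, written with [r^2] so that the power has a
    nonnegative base. *)
Definition stretch (r : T) : T := r * (r ^+ 2) `^ ((l - 1) / 2).
Definition stretch_jac (r : T) : R := l * (r ^+ 2) `^ ((l - 1) / 2).
(* The map [x |-> |x|^(l - 1) x]; [sqnorm x] is [|x|^2]. *)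
Definition dilation (x : pl) : pl :=
  (x.1 * (sqnorm x) `^ ((l - 1) / 2), x.2 * (sqnorm x) `^ ((l - 1) / 2)).
Definition dilation_jac (x : pl) : R := l * (sqnorm x) `^ (l - 1).

Lemma measurable_powq (p : R) : measurable_fun setT (fun x : pl => (sqnorm x) `^ p).
Proof. by apply: (measurableT_comp (@measurable_powR R p)); exact: measurable_sqnorm. Qed.

Lemma measurable_pows (p : R) : measurable_fun setT (fun x : T => (x ^+ 2) `^ p).
Proof. by apply: (measurableT_comp (@measurable_powR R p)); solve_measurable. Qed.

Lemma measurable_stretch : measurable_fun setT stretch.
Proof. by apply: measurable_funM => //; exact: measurable_pows. Qed.

Lemma measurable_stretch_jac : measurable_fun setT stretch_jac.
Proof. by apply: measurable_funM => //; exact: measurable_pows. Qed.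

Lemma measurable_dilation : measurable_fun setT dilation.
Proof.
have m := measurable_powq ((l - 1) / 2).
by apply: measurable_fun_pair; apply: measurable_funM => //; solve_measurable.
Qed.

Lemma measurable_dilation_jac : measurable_fun setT dilation_jac.
Proof. by apply: measurable_funM => //; exact: measurable_powq. Qed.

Lemma stretch_jac_ge0 r : 0 <= stretch_jac r. Proof. by rewrite mulr_ge0 ?powR_ge0// ltW. Qed.
Lemma dilation_jac_ge0 r : 0 <= dilation_jac r. Proof. by rewrite mulr_ge0 ?powR_ge0// ltW. Qed.

Lemma integral_half_lines (f : T -> \bar R) : measurable_fun setT f -> (forall x, (0 <= f x)%E) ->
  (\int[mu]_x f x = \int[mu]_(x in `]0%R, +oo[%classic) f x +
     \int[mu]_(x in `]0%R, +oo[%classic) f (- x)%R)%E.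
Proof.
move=> mf f0; have mi : measurable (`]0%R, +oo[%classic : set T) by exact: measurable_itv.
have mfo : measurable_fun setT (fun x : T => f (- x)%R).
  by apply: (measurableT_comp mf); exact: measurable_funN.
have m1 : measurable_fun setT (f \_ `]0%R, +oo[%classic).
  by apply/(measurable_restrictT _ _).1 => //; exact: measurable_funTS.
have m2 : measurable_fun setT ((fun x : T => f (- x)%R) \_ `]0%R, +oo[%classic).
  by apply/(measurable_restrictT _ _).1 => //; exact: measurable_funTS.
have g1 x : (0 <= (f \_ `]0%R, +oo[%classic) x)%E by rewrite patchE; case: ifP.
have g2 x : (0 <= ((fun x : T => f (- x)%R) \_ `]0%R, +oo[%classic) x)%E by rewrite patchE; case: ifP.
have m2' : measurable_fun setT (fun x : T => ((fun x : T => f (- x)%R) \_ `]0%R, +oo[%classic) (- x)%R).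
  by apply: (measurableT_comp m2); exact: measurable_funN.
rewrite [X in (_ = X + _)%E]integral_mkcond [X in (_ = _ + X)%E]integral_mkcond.
rewrite [X in (_ = _ + X)%E](cov_opp m2)//.
have -> : (\int[mu]_a (((fun x : T => f (- x)%R) \_ `]0%R, +oo[%classic) (- a)%R * 1%:E) =
    \int[mu]_a (((fun x : T => f (- x)%R) \_ `]0%R, +oo[%classic) (- a)%R))%E.
  by apply: eq_integral => x _; rewrite mule1.
rewrite -ge0_integralD//; apply: ae_eq_integral => //.
  exact: emeasurable_funD.
apply: filterS (@mpres_null0 R) => x x0 _.
rewrite !patchE !mem_setE !in_itv/= !andbT opprK oppr_gt0.
by have [h|h|h] := ltgtP x 0; rewrite ?add0e ?adde0//; rewrite h eqxx in x0.
Qed.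

Lemma powR_exp2 (s p : R) : (expR s ^+ 2) `^ (p / 2) = expR (p * s).
Proof.
rewrite /powR gt_eqF ?exprn_gt0 ?expR_gt0// lnXn ?expR_gt0// expRK.
by congr expR; rewrite -mulr_natl; field.
Qed.

(** On each half-line [r = exp s] conjugates [stretch] to the scaling [s |-> l s]. *)
Lemma cov_stretch : cov mu mu setT stretch stretch_jac.
Proof.
have c1 := @cov_expR R 1 ltr01; have cl := cov_scale l0.
have half (g : T -> \bar R) : measurable_fun setT g -> (forall x, (0 <= g x)%E) ->
    (\int[mu]_(x in `]0%R, +oo[%classic) g x =
     \int[mu]_(x in `]0%R, +oo[%classic) (g (stretch x) * (stretch_jac x)%:E))%E.
  move=> mg g0.
  have mE : measurable_fun setT (fun s : T => g (1 * expR s)%R * (1 * expR s)%:E)%E.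
    by apply: emeasurable_funM; [apply: (measurableT_comp mg)|]; solve_measurable.
  have mF : measurable_fun setT (fun x : T => g (stretch x) * (stretch_jac x)%:E)%E.
    apply: emeasurable_funM; first by apply: (measurableT_comp mg); exact: measurable_stretch.
    by apply/measurable_EFinP; exact: measurable_stretch_jac.
  rewrite (c1 _ mg g0) (c1 _ mF); last by move=> x; rewrite mule_ge0// lee_fin stretch_jac_ge0.
  rewrite (cl _ mE); last by move=> s; rewrite mule_ge0// lee_fin mul1r expR_ge0.
  apply: eq_integral => s _; rewrite !mul1r /stretch /stretch_jac !powR_exp2 -muleA -EFinM -muleA -EFinM.
  rewrite -expRD; congr (g (expR _) * _%:E)%E; first by ring.
  by rewrite -mulrA -expRD mulrC; congr (_ * expR _); ring.
move=> f mf f0.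
have mfo : measurable_fun setT (fun x : T => f (- x)%R).
  by apply: (measurableT_comp mf); exact: measurable_funN.
have mF : measurable_fun setT (fun x : T => f (stretch x) * (stretch_jac x)%:E)%E.
  apply: emeasurable_funM; first by apply: (measurableT_comp mf); exact: measurable_stretch.
  by apply/measurable_EFinP; exact: measurable_stretch_jac.
have Fge0 x : (0 <= f (stretch x) * (stretch_jac x)%:E)%E by rewrite mule_ge0// lee_fin stretch_jac_ge0.
rewrite (integral_half_lines mf f0) (integral_half_lines mF Fge0).
congr (_ + _)%E; first exact: half mf f0.
by apply: etrans (half _ mfo (fun x => f0 _)) _; apply: eq_integral => x _; rewrite /stretch /stretch_jac sqrrN mulNr.
Qed.

Lemma dilation_polar (a : pl) : dilation (polar a) = polar (stretch a.1, a.2).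
Proof. by rewrite /dilation sqnorm_polar /polar /stretch/=; congr pair; ring. Qed.

Lemma dilation_jac_polar (a : pl) : polar_jac (stretch a.1, a.2) * stretch_jac a.1 = dilation_jac (polar a) * polar_jac a.
Proof.
have h := lt0r_neq0 (oneD_gt0 a.2); set c := (a.1 ^+ 2) `^ ((l - 1) / 2).
have cc : (a.1 ^+ 2) `^ (l - 1) = c * c.
  by rewrite -expr2 -[RHS]powR_mulrn ?powR_ge0// /c -powRrM divfK// pnatr_eq0.
rewrite /dilation_jac sqnorm_polar cc /polar_jac /stretch_jac /stretch/= -/c normrM (ger0_norm (powR_ge0 _ _)) -/c.
by field.
Qed.

(** In signed polar coordinates the dilation acts on the radius alone, by [stretch]. *)
Lemma cov_dilation : cov L2 L2 setT dilation dilation_jac.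
Proof.
have c2 := cov_prod (m1 := mu) (m2 := mu) (m3 := mu) (m4 := mu) measurableT measurableT
  measurable_stretch measurable_stretch_jac stretch_jac_ge0 (@measurable_id _ T setT) (measurable_cst (1 : R)) (fun=> ler01)
  cov_stretch (mpres_id mu).2.
rewrite setXTT in c2 => f mf f0.
have mF : measurable_fun setT (fun x : pl => f (dilation x) * (dilation_jac x)%:E)%E.
  apply: emeasurable_funM; first by apply: (measurableT_comp mf); exact: measurable_dilation.
  by apply/measurable_EFinP; exact: measurable_dilation_jac.
have Fge0 x : (0 <= f (dilation x) * (dilation_jac x)%:E)%E by rewrite mule_ge0// lee_fin dilation_jac_ge0.
rewrite (cov_polar mf f0) (cov_polar mF Fge0).
have mp : measurable_fun setT (fun a : pl => f (polar a) * (polar_jac a)%:E)%E.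
  apply: emeasurable_funM; first by apply: (measurableT_comp mf); exact: measurable_polar.
  by apply/measurable_EFinP; exact: measurable_polar_jac.
rewrite [LHS](c2 _ mp); last by move=> a; rewrite mule_ge0// lee_fin polar_jac_ge0.
apply: eq_integral => a _; rewrite mulr1 -muleA -muleA -EFinM -EFinM.
by rewrite (dilation_jac_polar a) dilation_polar.
Qed.

End dilations.

End free_bound.

(** * Positive definiteness of a difference of exponentials *)

Section exponential_kernel.
Context {R : realType}.
Local Notation mu := (@lebesgue_measure R).
Local Notation T := (measurableTypeR R).
Variables (al be : R).
Hypotheses (al0 : 0 < al) (albe : al <= be).

Let be0 : 0 < be. Proof. exact: lt_le_trans al0 albe. Qed.

(** The Fourier transform of [dker] is a multiple of [1 / ((al^2 + xi^2) (be^2 + xi^2))], the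
    squared modulus of [1 / ((al + i xi) (be + i xi))]. Up to a factor and a reflection, [hker] is
    the inverse transform of this square root. *)
Definition hker (s t : R) : R := (expR (al * (t - s)) - expR (be * (t - s))) * ((t <= s)%R)%:R.

Definition dker (s s' : R) : R :=
  expR (- al * `|s - s'|) / al - expR (- be * `|s - s'|) / be.

Lemma hker_bound (s t : R) : 0 <= hker s t <= expR (al * (t - s)) * ((t <= s)%R)%:R.
Proof.
rewrite /hker; have [ts|_] := leP t s; last by rewrite !mulr0 lexx.
rewrite !mulr1 subr_ge0 ler_expR gerBl expR_ge0 andbT.
have h : t - s <= 0 by rewrite subr_le0.
by rewrite -subr_ge0 -mulrBl mulr_le0// subr_le0.
Qed.

Lemma measurable_hker (s : R) : measurable_fun setT (fun t : T => hker s t).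
Proof.
have m : measurable_fun setT (fun t : T => ((t <= s)%R)%:R : R) by exact: measurable_ler.
by rewrite /hker; solve_measurable.
Qed.

(* Makes [dker] positive definite, as an autocorrelation. *)
Lemma hker_convolution (s s' : R) :
  \int[mu]_(t in setT) (hker s t * hker s' t) = (be - al) / (2 * (al + be)) * dker s s'.
Proof.
wlog ss : s s' / s <= s'.
  move=> H; have [h|h] := leP s s'; first exact: H.
  rewrite /dker distrC -/(dker s' s) -(H s' s (ltW h)).
  by apply: eq_Int => t; rewrite mulrC.
have ab : al + be != 0 by rewrite gt_eqF// addr_gt0.
have a0 := lt0r_neq0 al0; have b0 := lt0r_neq0 be0.
have [i1 e1] := @exp_tail R (2 * al) s (mulr_gt0 (ltr0n R 2) al0).
have [i2 e2] := @exp_tail R (al + be) s (addr_gt0 al0 be0).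
have [i3 e3] := @exp_tail R (2 * be) s (mulr_gt0 (ltr0n R 2) be0).
pose c1 := expR (- al * (s + s')); pose c3 := expR (- be * (s + s')).
pose c2 := expR (- al * s - be * s') + expR (- be * s - al * s').
have E (t : T) : hker s t * hker s' t = c1 * (expR (2 * al * t) * ((t <= s)%R)%:R) -
    c2 * (expR ((al + be) * t) * ((t <= s)%R)%:R) + c3 * (expR (2 * be * t) * ((t <= s)%R)%:R).
  rewrite /hker; have [ts|ts] := leP t s; last by rewrite !(mulr0, mul0r) subrr addr0.
  rewrite (le_trans ts ss) !mulr1.
  have x1 : expR (al * (t - s)) * expR (al * (t - s')) = c1 * expR (2 * al * t).
    by rewrite /c1 -!expRD; congr expR; ring.
  have x2 : expR (al * (t - s)) * expR (be * (t - s')) = expR (- al * s - be * s') * expR ((al + be) * t).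
    by rewrite -!expRD; congr expR; ring.
  have x3 : expR (be * (t - s)) * expR (al * (t - s')) = expR (- be * s - al * s') * expR ((al + be) * t).
    by rewrite -!expRD; congr expR; ring.
  have x4 : expR (be * (t - s)) * expR (be * (t - s')) = c3 * expR (2 * be * t).
    by rewrite /c3 -!expRD; congr expR; ring.
  have bin (x y z w : R) : (x - y) * (z - w) = x * z - (x * w + y * z) + y * w by ring.
  by rewrite bin x1 x2 x3 x4 /c2; ring.
rewrite (eq_Int _ E) IntD; [|by apply: igB; exact: igZ|exact: igZ].
rewrite IntB; [|exact: igZ|exact: igZ].
have D : `|s - s'| = s' - s by rewrite ler0_norm ?subr_le0// opprB.
have y1 : c1 * (expR (2 * al * s) / (2 * al)) = expR (- al * `|s - s'|) / (2 * al).
  by rewrite mulrA -expRD D; congr (expR _ / _); ring.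
have y2 : c2 * (expR ((al + be) * s) / (al + be)) =
    (expR (- be * `|s - s'|) + expR (- al * `|s - s'|)) / (al + be).
  rewrite mulrA /c2 [X in X / _]mulrDl -!expRD D.
  by congr ((expR _ + expR _) / _); ring.
have y3 : c3 * (expR (2 * be * s) / (2 * be)) = expR (- be * `|s - s'|) / (2 * be).
  by rewrite mulrA -expRD D; congr (expR _ / _); ring.
rewrite !IntZ// e1 e2 e3 y1 y2 y3.
rewrite /dker; move: (expR _) (expR _) => x y.
by field; rewrite a0 b0 ab.
Qed.

Section positivity.
Context d (X : measurableType d).
Variables (m : {sigma_finite_measure set X -> \bar R}) (f s : X -> R) (L : R).
Hypotheses (hf : ig m f) (ms : measurable_fun setT s)
  (sL : forall x, f x != 0 -> `|s x| <= L).

(** By [hker_convolution] the form is, up to a positive factor, the integral over [t] of the square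
    of the integral of [f x * hker (s x) t] over [x]. *)
Lemma dker_psd : al < be ->
  ig (m \x m)%E (fun z => f z.1 * f z.2 * dker (s z.1) (s z.2)) /\
  0 <= \int[(m \x m)%E]_z (f z.1 * f z.2 * dker (s z.1) (s z.2)).
Proof.
move=> ab.
have mf := ig_meas hf.
have [it _] := @exp_tail R (2 * al) L (mulr_gt0 (ltr0n R 2) al0).
have mh : measurable_fun setT (fun w : X * T => hker (s w.1) w.2).
  rewrite /hker; have m1 := measurableT_comp ms (@measurable_fst _ _ X T).
  have m2 := @measurable_snd _ _ X T.
  have m3 : measurable_fun setT (fun w : X * T => ((w.2 <= s w.1)%R)%:R : R).
    by apply: measurable_ler.
  have m4 : measurable_fun setT (fun w : X * T => w.2 - s w.1) by exact: measurable_funB.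
  by apply: measurable_funM => //; apply: measurable_funB;
    apply: (measurableT_comp (@measurable_expR R)); exact: measurable_funM.
pose a (x : X) (t : T) := f x * hker (s x) t.
have hF : ig (sprod m m \x mu)%E (fun w => a w.1.1 w.2 * a w.1.2 w.2).
  have h2 := ig_norm (ig_prod hf hf).
  have h3 := @ig_prod _ _ _ _ _ (sprod m m) mu _ _ (igZ (expR (2 * al * L)) h2) it.
  apply: (ig_le _ h3).
    have p1 : measurable_fun setT (fun w : (X * X) * T => (w.1.1, w.2)).
      by apply: measurable_fun_pair => //; apply: measurableT_comp => //; exact: measurable_fst.
    have p2 : measurable_fun setT (fun w : (X * X) * T => (w.1.2, w.2)).
      by apply: measurable_fun_pair => //; apply: measurableT_comp => //; exact: measurable_fst.
    have q1 := measurableT_comp mh p1; have sqnorm := measurableT_comp mh p2.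
    have q3 := measurableT_comp mf (measurableT_comp (@measurable_fst _ _ X T) p1).
    have q4 := measurableT_comp mf (measurableT_comp (@measurable_fst _ _ X T) p2).
    by apply: measurable_funM; exact: measurable_funM.
  move=> [[x x'] t]/=; rewrite /a.
  have [e|fx] := eqVneq (f x) 0; first by rewrite e !mul0r normr0 mulr0 mul0r.
  have [e|fx'] := eqVneq (f x') 0; first by rewrite e !(mul0r, mulr0) normr0 mulr0 mul0r.
  have /andP[a0 a1] := hker_bound (s x) t; have /andP[b0 b1] := hker_bound (s x') t.
  rewrite mulrACA normrM [leLHS]mulrC [leRHS]mulrAC ler_wpM2r//.
  rewrite (ger0_norm (mulr_ge0 a0 b0)); apply: le_trans (ler_pM a0 b0 a1 b1) _.
  have [ts|ts] := leP t (s x); last by rewrite mulr0 mul0r !mulr_ge0 ?expR_ge0.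
  have [ts'|ts'] := leP t (s x'); last by rewrite !mulr0 !mulr_ge0 ?expR_ge0.
  have := sL fx; rewrite ler_norml => /andP[l1 l2].
  have := sL fx'; rewrite ler_norml => /andP[l3 l4].
  rewrite (le_trans ts l2) !mulr1 -!expRD ler_expR -subr_ge0.
  rewrite (_ : _ - _ = al * ((L + s x) + (L + s x'))); last by ring.
  by rewrite mulr_ge0 ?(ltW al0)// addr_ge0// -lerBlDl sub0r.
have ia (t : T) : ig m (fun x => a x t).
  apply: (igMb (B := expR (al * (t + L)))) => //.
    by apply: (measurableT_comp mh (g := fun x => (x, t))); solve_measurable.
  move=> x fx; have /andP[a0 a1] := hker_bound (s x) t.
  rewrite ger0_norm//; apply: le_trans a1 _.
  apply: (@le_trans _ _ (expR (al * (t - s x)))).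
    by rewrite ler_piMr ?expR_ge0// lern1 leq_b1.
  rewrite ler_expR ler_pM2l// lerD2l.
  by have := sL fx; rewrite ler_norml => /andP[l1 _]; rewrite lerNl.
have [i1 e1] := Int_mixture hF ia ia.
pose c := (be - al) / (2 * (al + be)).
have c0 : 0 < c by rewrite divr_gt0 ?subr_gt0// mulr_gt0// addr_gt0.
have E (z : X * X) : \int[mu]_t (a z.1 t * a z.2 t) = c * (f z.1 * f z.2 * dker (s z.1) (s z.2)).
  rewrite mulrCA -hker_convolution.
  have [e|fx] := eqVneq (f z.1 * f z.2) 0.
    rewrite e mul0r -[RHS](Int0 mu); apply: eq_Int => t.
    by rewrite /a mulrACA e mul0r.
  rewrite -IntZ; first by apply: eq_Int => t; rewrite /a mulrACA.
  have [it2 _] := @exp_tail R al (s z.1) al0.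
  apply: (ig_le _ (igZ (expR (- al * s z.1)) it2)).
    by apply: measurable_funM; exact: measurable_hker.
  move=> t; have /andP[a0 a1] := hker_bound (s z.1) t; have /andP[b0 b1] := hker_bound (s z.2) t.
  rewrite (ger0_norm (mulr_ge0 a0 b0)); apply: le_trans (ler_pM a0 b0 a1 (_ : _ <= 1)) _.
    apply: le_trans b1 _; have [ts|ts] := leP t (s z.2); last by rewrite mulr0.
    by rewrite mulr1 -expR0 ler_expR pmulr_rle0// subr_le0.
  by rewrite mulr1 mulrA -expRD le_eqVlt; apply/orP; left; apply/eqP; congr (expR _ * _); ring.
have i2 : ig (m \x m)%E (fun z => f z.1 * f z.2 * dker (s z.1) (s z.2)).
  have := igZ c^-1 (eq_ig E i1); apply: eq_ig => z.
  by rewrite mulrA mulVf ?mul1r// gt_eqF.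
split => //; rewrite -(pmulr_rge0 _ c0) -IntZ// -(eq_Int _ E) e1.
by apply: Int_ge0 => t; rewrite -expr2 sqr_ge0.
Qed.

End positivity.

End exponential_kernel.

(** * Logarithmic polar form and comparison of interactions under dilations *)

Section polar_form.
Context {R : realType}.
Local Notation T := (measurableTypeR R).
Local Notation pl := (T * T)%type.

Definition log_radius (x : pl) : R := 2^-1 * ln (sqnorm x).
Definition direction (x : pl) : R * R := (x.1 / Num.sqrt (sqnorm x), x.2 / Num.sqrt (sqnorm x)).

(** Up to conjugation, the quotient of the smaller of two points by the larger one, after radii are
    raised to the power [t] and directions kept. The full angle is used: no symmetry is assumed
    here, and only the kernels for [t = 1] and [t = l] are compared. *)
Definition dilated_ratio (t : R) (z : pl * pl) : R * R :=
  cscal (expR (- t * `|log_radius z.1 - log_radius z.2|)) (cmul (direction z.1) (conjp (direction z.2))).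

Lemma nrm2_direction x : 0 < sqnorm x -> nrm2 (direction x) = 1.
Proof.
move=> q0; rewrite /nrm2/direction/= !exprMn -mulrDl -/(sqnorm x) exprVn sqr_sqrtr ?divff ?gt_eqF//.
exact: ltW.
Qed.

Lemma nrm2_direction_le x : nrm2 (direction x) <= 1.
Proof.
have [q0|] := ltP 0 (sqnorm x); first by rewrite nrm2_direction.
rewrite le_eqVlt ltNge sqnorm_ge0 orbF => /eqP q0.
by rewrite /nrm2/direction/= q0 sqrtr0 invr0 !mulr0 expr0n/= addr0.
Qed.

Lemma nrm2_conjp (z : R * R) : nrm2 (conjp z) = nrm2 z.
Proof. by rewrite /nrm2/conjp/= sqrrN. Qed.

Lemma nrm2_cscal (t : R) (z : R * R) : nrm2 (cscal t z) = t ^+ 2 * nrm2 z.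
Proof. by rewrite /nrm2/cscal/=; ring. Qed.

Lemma nrm2_dilated_ratio t z : 0 <= t -> nrm2 (dilated_ratio t z) <= 1.
Proof.
move=> t0; rewrite nrm2_cscal nrm2_cmul nrm2_conjp.
have e0 := expR_ge0 (- t * `|log_radius z.1 - log_radius z.2|).
have e1 : expR (- t * `|log_radius z.1 - log_radius z.2|) <= 1.
  by rewrite -expR0 ler_expR mulNr oppr_le0 mulr_ge0.
apply: mulr_ile1; rewrite ?exprn_ge0 ?exprn_ile1 ?mulr_ge0 ?nrm2_ge0//.
by apply: mulr_ile1; rewrite ?nrm2_ge0 ?nrm2_direction_le.
Qed.

Lemma exp_log_radius x : 0 < sqnorm x -> expR (log_radius x) = Num.sqrt (sqnorm x).
Proof. by move=> q0; rewrite /log_radius -powR12_sqrt ?ltW// /powR gt_eqF. Qed.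

Lemma sqdist_polar (x y : pl) : 0 < sqnorm x -> 0 < sqnorm y ->
  sqdist x y = expR (2 * Num.max (log_radius x) (log_radius y)) *
    ((1 - (dilated_ratio 1 (x, y)).1) ^+ 2 + (dilated_ratio 1 (x, y)).2 ^+ 2).
Proof.
move=> qx qy; pose E := expR (log_radius x); pose E' := expR (log_radius y).
have hE := exp_log_radius qx; have hE' := exp_log_radius qy; rewrite -/E in hE; rewrite -/E' in hE'.
have E0 : 0 < E := expR_gt0 _; have E0' : 0 < E' := expR_gt0 _.
set c := (cmul (direction x) (conjp (direction y))).1; set s := (cmul (direction x) (conjp (direction y))).2.
have cs : c ^+ 2 + s ^+ 2 = 1.
  have := nrm2_cmul (direction x) (conjp (direction y)).
  by rewrite nrm2_conjp !nrm2_direction// mulr1.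
have n0 := lt0r_neq0 E0; have n0' := lt0r_neq0 E0'.
have S : sqdist x y = E ^+ 2 + E' ^+ 2 - 2 * (E * E') * c.
  have e1 : E ^+ 2 = sqnorm x by rewrite hE sqr_sqrtr// ltW.
  have e2 : E' ^+ 2 = sqnorm y by rewrite hE' sqr_sqrtr// ltW.
  have e3 : E * E' * c = x.1 * y.1 + x.2 * y.2.
    by rewrite /c /cmul/conjp/direction/= -hE -hE'; field; rewrite n0 n0'.
  by rewrite e1 e2 -mulrA e3 /sqnorm /sqdist; ring.
have key (r : R) : (1 - r * c) ^+ 2 + (r * s) ^+ 2 = 1 - 2 * r * c + r ^+ 2.
  have cs' : s ^+ 2 = 1 - c ^+ 2 by rewrite -cs; ring.
  by rewrite [(r * s) ^+ 2]exprMn cs'; ring.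
rewrite S /dilated_ratio/= -/c -/s key mulN1r; have [h|h] := leP (log_radius x) (log_radius y).
  rewrite ler0_norm ?subr_le0// opprK expRB expRM_natl -/E -/E'.
  by field.
rewrite gtr0_norm ?subr_gt0// opprB expRB expRM_natl -/E -/E'.
by field.
Qed.

Lemma dilated_ratio_neq1 (t : R) (x y : pl) : 0 < t -> 0 < sqnorm x -> 0 < sqnorm y -> x.1 != y.1 ->
  dilated_ratio t (x, y) != (1, 0).
Proof.
move=> t0 qx qy; apply: contraNneq => Z1.
have d0 : log_radius x - log_radius y = 0.
  have : nrm2 (dilated_ratio t (x, y)) = 1 by rewrite Z1 /nrm2/= expr1n expr0n addr0.
  rewrite nrm2_cscal nrm2_cmul nrm2_conjp !nrm2_direction// !mulr1 -expRM_natl -[RHS]expR0 => /expR_inj/eqP.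
  rewrite mulf_eq0 pnatr_eq0/= mulf_eq0 oppr_eq0 (gt_eqF t0)/= normr_eq0 => /eqP//.
have : sqdist x y = 0.
  rewrite sqdist_polar// (_ : dilated_ratio 1 (x, y) = dilated_ratio t (x, y)).
    by rewrite Z1/= subrr expr0n/= addr0 mulr0.
  by rewrite /dilated_ratio/= d0 normr0 !mulr0.
move=> /eqP; rewrite /sqdist paddr_eq0 ?sqr_ge0// => /andP[].
by rewrite sqrf_eq0 subr_eq0.
Qed.

Lemma ln_sqdist_polar (x y : pl) : 0 < sqnorm x -> 0 < sqnorm y -> dilated_ratio 1 (x, y) != (1, 0) ->
  ln (sqdist x y) = 2 * Num.max (log_radius x) (log_radius y) + 2 * lognorm1 (dilated_ratio 1 (x, y)).
Proof.
move=> qx qy Zn; rewrite sqdist_polar// /lognorm1.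
set X := _ ^+ 2 + _; have X0 : 0 < X.
  rewrite /X lt_neqAle addr_ge0 ?sqr_ge0// andbT eq_sym paddr_eq0 ?sqr_ge0//.
  rewrite !sqrf_eq0 subr_eq0; apply: contra Zn => /andP[/eqP h1 /eqP h2].
  by rewrite [dilated_ratio _ _]surjective_pairing -h1 h2.
by rewrite lnM ?posrE ?expR_gt0// expRK mulrA divff ?mul1r// pnatr_eq0.
Qed.

Lemma cpow_dilated_ratio t (z : pl * pl) n : (cpow (dilated_ratio t z) n).1 = expR (- t * `|log_radius z.1 - log_radius z.2|) ^+ n *
  ((cpow (direction z.1) n).1 * (cpow (direction z.2) n).1 + (cpow (direction z.1) n).2 * (cpow (direction z.2) n).2).
Proof.
by rewrite /dilated_ratio cpow_cscal cpowM cpow_conj /cscal/cmul/conjp/= mulrN opprK.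
Qed.

Lemma cpow_im_le (z : R * R) n : nrm2 z <= 1 -> `|(cpow z n).2| <= 1.
Proof.
move=> z1; rewrite -ler_sqr ?nnegrE// real_normK ?num_real// expr1n.
have : nrm2 (cpow z n) <= 1 by rewrite nrm2_cpow exprn_ile1// nrm2_ge0.
by rewrite /nrm2; have := sqr_ge0 (cpow z n).1; lra.
Qed.

Lemma measurable_log_radius : measurable_fun setT log_radius.
Proof.
apply: measurable_funM => //; apply: (measurableT_comp (@measurable_ln R)).
exact: measurable_sqnorm.
Qed.

Lemma measurable_direction1 : measurable_fun setT (fun x => (direction x).1).
Proof.
apply: measurable_funM; first by solve_measurable.
apply: (measurableT_comp measurable_invr); apply: (measurableT_comp measurable_sqrtr).
exact: measurable_sqnorm.
Qed.

Lemma measurable_direction2 : measurable_fun setT (fun x => (direction x).2).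
Proof.
apply: measurable_funM; first by solve_measurable.
apply: (measurableT_comp measurable_invr); apply: (measurableT_comp measurable_sqrtr).
exact: measurable_sqnorm.
Qed.

Lemma measurable_dilated_ratio t : measurable_fun setT (fun z => (dilated_ratio t z).1) /\
  measurable_fun setT (fun z => (dilated_ratio t z).2).
Proof.
have f1 := @measurable_fst _ _ pl pl; have f2 := @measurable_snd _ _ pl pl.
have a1 := measurableT_comp measurable_direction1 f1; have a2 := measurableT_comp measurable_direction2 f1.
have b1 := measurableT_comp measurable_direction1 f2; have b2 := measurableT_comp measurable_direction2 f2.
have c1 := measurableT_comp measurable_log_radius f1; have c2 := measurableT_comp measurable_log_radius f2.
have e : measurable_fun setT (fun z : pl * pl => expR (- t * `|log_radius z.1 - log_radius z.2|)).
  apply: (measurableT_comp (@measurable_expR R)); apply: measurable_funM => //.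
  by apply: (measurableT_comp measurable_normr); exact: measurable_funB.
have b2' : measurable_fun setT (fun z : pl * pl => - (direction z.2).2) by exact: measurable_funN.
split; apply: measurable_funM => //.
  by apply: measurable_funB; exact: measurable_funM.
by apply: measurable_funD; exact: measurable_funM.
Qed.

End polar_form.

Lemma dker_algebra {R : realType} (n l a b c1 c2 s1 s2 x y : R) : n != 0 -> l != 0 ->
  l^-1 * (a * b) * (x * (c1 * c2 + s1 * s2)) + - (a * b) * (y * (c1 * c2 + s1 * s2)) =
  - n * (a * c1 * (b * c2) * (y / n - x / (n * l)) + a * s1 * (b * s2) * (y / n - x / (n * l))).
Proof. by move=> n0 l0; field; rewrite n0 l0. Qed.

Lemma energy_sum {R : realType} (I I' S p l A L : R) : I' <= I -> - 1 - p <= S + I' ->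
  - 1 - p - l <= S - l - A + A + I.
Proof. by lra. Qed.

Section weighted_bound.
Context {R : realType}.
Local Notation mu := (@lebesgue_measure R).
Local Notation T := (measurableTypeR R).
Local Notation pl := (T * T)%type.
Local Notation L2 := (@lebesgue2 R).

Lemma sqnorm_dilation (l : R) (x : pl) : 0 < sqnorm x -> sqnorm (dilation l x) = (sqnorm x) `^ l.
Proof.
move=> q0; rewrite /sqnorm/dilation/= !exprMn -mulrDl -/(sqnorm x).
rewrite -[(_ `^ _) ^+ 2]powR_mulrn ?powR_ge0// -powRrM divfK ?pnatr_eq0//.
by rewrite -{1}[sqnorm x]powRr1 ?(ltW q0)// -powRD ?(gt_eqF q0) ?implybT// addrC subrK.
Qed.

Lemma log_radius_dilation (l : R) (x : pl) : 0 < sqnorm x -> log_radius (dilation l x) = l * log_radius x.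
Proof. by move=> q0; rewrite /log_radius sqnorm_dilation// ln_powR mulrCA. Qed.

Lemma direction_dilation (l : R) (x : pl) : 0 < sqnorm x -> direction (dilation l x) = direction x.
Proof.
move=> q0; have c0 : 0 < (sqnorm x) `^ ((l - 1) / 2) by rewrite powR_gt0.
have e : Num.sqrt (sqnorm (dilation l x)) = Num.sqrt (sqnorm x) * (sqnorm x) `^ ((l - 1) / 2).
  rewrite {1}/sqnorm/dilation/= !exprMn -mulrDl -/(sqnorm x) sqrtrM ?(ltW q0)// sqrtr_sqr.
  by rewrite gtr0_norm.
have n1 : Num.sqrt (sqnorm x) != 0 by rewrite gt_eqF// sqrtr_gt0.
have n2 := lt0r_neq0 c0.
by rewrite /direction e /dilation/=; congr pair; field; rewrite n1 n2.
Qed.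

Lemma dilated_ratio_dilation (l : R) (x y : pl) : 0 < l -> 0 < sqnorm x -> 0 < sqnorm y ->
  dilated_ratio 1 (dilation l x, dilation l y) = dilated_ratio l (x, y).
Proof.
move=> l0 qx qy; rewrite /dilated_ratio/= !log_radius_dilation// !direction_dilation// -mulrBr normrM gtr0_norm// mulrA.
by rewrite mulN1r.
Qed.

Variables (u : pl -> R) (l B lo hi : R).
Hypotheses (l1 : 1 < l) (du : dens u) (uB : forall x, u x <= B)
  (lo0 : 0 < lo) (usupp : forall x, u x != 0 -> lo <= sqnorm x <= hi).
Hypothesis (bv : bdd (fun y => u (dilation l y) * dilation_jac l y)).

Let l0 : 0 < l. Proof. exact: lt_trans ltr01 l1. Qed.
Let bu : bdd u. Proof. by case: du. Qed.
Let u0 x : 0 <= u x. Proof. by case: du. Qed.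
Let u1 : \int[L2]_x u x = 1. Proof. by case: du. Qed.
Let iu : ig L2 u. Proof. exact: ig_bdd. Qed.
Let mu' : measurable_fun setT u. Proof. exact: ig_meas iu. Qed.

Let v (y : pl) : R := u (dilation l y) * dilation_jac l y.

Let v0 y : 0 <= v y. Proof. by rewrite mulr_ge0// dilation_jac_ge0. Qed.
Let iv : ig L2 v. Proof. exact: ig_bdd. Qed.
Let mv : measurable_fun setT v. Proof. exact: ig_meas iv. Qed.

Lemma dilation_supp y : u (dilation l y) * dilation_jac l y != 0 -> [/\ 0 < sqnorm y, u (dilation l y) != 0 & lo <= (sqnorm y) `^ l <= hi].
Proof.
rewrite mulf_eq0 negb_or => /andP[h _]; have := usupp h.
have [q0|] := ltP 0 (sqnorm y); first by rewrite sqnorm_dilation.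
move=> qy; have q0 : sqnorm y = 0 by apply/eqP; rewrite eq_le qy sqnorm_ge0.
move: q0 => /eqP; rewrite /sqnorm paddr_eq0 ?sqr_ge0// !sqrf_eq0 => /andP[/eqP e1 /eqP e2].
by rewrite /dilation/= e1 e2 !mul0r expr0n/= addr0 => /andP[h1 _]; move: lo0; rewrite ltNge h1.
Qed.

Let v_supp y : v y != 0 -> [/\ 0 < sqnorm y, u (dilation l y) != 0 & lo <= (sqnorm y) `^ l <= hi].
Proof. exact: dilation_supp. Qed.

Let log_radius_bound : exists C, forall y, v y != 0 -> `|log_radius y| <= C.
Proof.
exists (l^-1 * (`|ln lo| + `|ln hi|)) => y /v_supp[q0 _ /andP[h1 h2]].
have qp : 0 < (sqnorm y) `^ l by rewrite powR_gt0.
have hp : 0 < hi by exact: lt_le_trans qp h2.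
have k1 : ln lo <= l * ln (sqnorm y) by rewrite -ln_powR ler_ln ?posrE.
have k2 : l * ln (sqnorm y) <= ln hi by rewrite -ln_powR ler_ln ?posrE.
rewrite /log_radius normrM ger0_norm ?invr_ge0// -ler_pdivrMl ?invr_gt0// invrK.
apply: (@le_trans _ _ (`|l * ln (sqnorm y)|)).
  rewrite normrM (gtr0_norm l0) ler_wpM2l ?(ltW l0)//.
  by rewrite ler_piMl// invf_le1// ler1n.
have k3 := ler_norm (ln hi); have k4 := ler_norm (- ln lo); rewrite normrN in k4.
have k5 := normr_ge0 (ln lo); have k6 := normr_ge0 (ln hi).
rewrite ler_norml; apply/andP; split.
  by rewrite opprD lerBlDr (le_trans _ (lerD k1 k6))// addr0 lerNl.
by rewrite (le_trans k2)// (le_trans k3)// lerDr.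
Qed.

Let w (z : pl * pl) : R := v z.1 * v z.2.
Let iw : ig (L2 \x L2)%E w. Proof. exact: (ig_prod iv iv). Qed.

Let Mx (z : pl * pl) : R := Num.max (log_radius z.1) (log_radius z.2).

Let mMx : measurable_fun setT Mx.
Proof.
by apply: measurable_maxr; apply: (measurableT_comp (@measurable_log_radius R)).
Qed.

Let iM : ig (L2 \x L2)%E (fun z => w z * (2 * Mx z)).
Proof.
have [C hC] := log_radius_bound.
apply: (igMb (B := 2 * C) iw); first exact: measurable_funM.
move=> z; rewrite /w mulf_eq0 negb_or => /andP[/hC h1 /hC h2].
rewrite normrM ger0_norm// ler_pM2l// /Mx.
by move: h1 h2; rewrite !ler_norml => /andP[a b] /andP[c d]; rewrite le_max a ge_max b.
Qed.

Let lognorm1_polar (t : R) (F : pl * pl -> R) : 0 < t ->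
  ig (L2 \x L2)%E (fun z => w z * F z) ->
  (forall x y : pl, 0 < sqnorm x -> 0 < sqnorm y -> x.1 != y.1 ->
     F (x, y) = t * (2 * Mx (x, y)) + 2 * lognorm1 (dilated_ratio t (x, y))) ->
  ig (L2 \x L2)%E (fun z => w z * lognorm1 (dilated_ratio t z)) /\
  \int[(L2 \x L2)%E]_z (w z * F z) = t * \int[(L2 \x L2)%E]_z (w z * (2 * Mx z)) +
    2 * \int[(L2 \x L2)%E]_z (w z * lognorm1 (dilated_ratio t z)).
Proof.
move=> t0 iF H; have [mz1 mz2] := measurable_dilated_ratio t.
have i1 : ig (L2 \x L2)%E (fun z => 2^-1 * (w z * F z - t * (w z * (2 * Mx z)))).
  by apply: igZ; apply: igB => //; exact: igZ.
have mL : measurable_fun setT (fun z => w z * lognorm1 (dilated_ratio t z)).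
  by apply: measurable_funM; [exact: ig_meas iw|exact: measurable_lognorm1].
have ae : {ae (L2 \x L2)%E, forall z, 2^-1 * (w z * F z - t * (w z * (2 * Mx z))) = w z * lognorm1 (dilated_ratio t z)}.
  apply: filterS (@line_null R) => -[x y]/= hz.
  have [->|wn] := eqVneq (w (x, y)) 0; first by rewrite !(mul0r, mulr0) subrr mulr0.
  move: (wn); rewrite /w mulf_eq0 negb_or => /andP[/v_supp[q1 _ _] /v_supp[q2' _ _]].
  by rewrite (H x y q1 q2' hz); lra.
have [j1 j2] := ae_eq_Int i1 mL ae; split => //.
by rewrite -j2 IntZ ?IntB ?IntZ//; [lra|exact: igZ|apply: igB => //; exact: igZ].
Qed.

Let inter_dilation : ig (L2 \x L2)%E (fun z => w z * ln (sqdist (dilation l z.1) (dilation l z.2))) /\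
  inter u = \int[(L2 \x L2)%E]_z (w z * ln (sqdist (dilation l z.1) (dilation l z.2))).
Proof.
have c2 := cov_prod measurableT measurableT (measurable_dilation l) (measurable_dilation_jac l)
  (dilation_jac_ge0 l0) (measurable_dilation l) (measurable_dilation_jac l) (dilation_jac_ge0 l0) (cov_dilation l0) (cov_dilation l0).
rewrite setXTT in c2.
have J0 (z : pl * pl) : 0 <= dilation_jac l z.1 * dilation_jac l z.2 by rewrite mulr_ge0 ?dilation_jac_ge0.
have mPhi : measurable_fun setT (fun z : pl * pl => (dilation l z.1, dilation l z.2)).
  by apply: measurable_fun_pair; apply: (measurableT_comp (measurable_dilation l)).
have mJ : measurable_fun setT (fun z : pl * pl => dilation_jac l z.1 * dilation_jac l z.2).
  by apply: measurable_funM; apply: (measurableT_comp (measurable_dilation_jac l)).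
have ii := ig_inter bu bu.
have k1 := (cov_ig mPhi mJ J0 c2 (ig_meas ii)).1 ii.
have k2 := cov_Rintegral J0 c2 (ig_meas ii).
have E (z : pl * pl) : u (dilation l z.1) * u (dilation l z.2) * ln (sqdist (dilation l z.1) (dilation l z.2)) *
    (dilation_jac l z.1 * dilation_jac l z.2) = w z * ln (sqdist (dilation l z.1) (dilation l z.2)) by rewrite /w /v; ring.
split; first exact: (eq_ig E k1).
by rewrite /inter [LHS]k2; apply: eq_Int => z; exact: E.
Qed.

(** At order [n], [l^-1 exp (- n l |.|) - exp (- n |.|)] is [- n] times the kernel [dker n (n l)],
    tested against the real and imaginary parts of the n-th power of the direction. *)
Let moment n :
  \int[(L2 \x L2)%E]_z ((l^-1 * w z) * (cpow (dilated_ratio l z) n.+1).1) +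
  \int[(L2 \x L2)%E]_z ((- w z) * (cpow (dilated_ratio 1 z) n.+1).1) <= 0.
Proof.
have [C hC] := log_radius_bound.
have [m1 m2] := measurable_cpow n.+1 (@measurable_direction1 R) (@measurable_direction2 R).
pose c x := v x * (cpow (direction x) n.+1).1; pose s x := v x * (cpow (direction x) n.+1).2.
have ic : ig L2 c by apply: (igMb (B := 1) iv m1) => x _; apply: cpow_re_le; exact: nrm2_direction_le.
have is_ : ig L2 s by apply: (igMb (B := 1) iv m2) => x _; apply: cpow_im_le; exact: nrm2_direction_le.
have n0 : 0 < n.+1%:R :> R by rewrite ltr0n.
have nl : n.+1%:R < n.+1%:R * l by rewrite ltr_pMr.
have cC x : c x != 0 -> `|log_radius x| <= C by rewrite mulf_eq0 negb_or => /andP[/hC].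
have sC x : s x != 0 -> `|log_radius x| <= C by rewrite mulf_eq0 negb_or => /andP[/hC].
have [j1 j2] := dker_psd n0 (ltW nl) ic (@measurable_log_radius R) cC nl.
have [k1 k2] := dker_psd n0 (ltW nl) is_ (@measurable_log_radius R) sC nl.
have [z1 z2] := measurable_dilated_ratio l; have [z3 z4] := @measurable_dilated_ratio R 1.
have i1 : ig (L2 \x L2)%E (fun z => l^-1 * w z * (cpow (dilated_ratio l z) n.+1).1).
  by apply: ig_cpow => //; [exact: igZ|move=> z; apply: nrm2_dilated_ratio; exact: ltW].
have i2 : ig (L2 \x L2)%E (fun z => - w z * (cpow (dilated_ratio 1 z) n.+1).1).
  by apply: ig_cpow => //; [exact: igN|move=> z; apply: nrm2_dilated_ratio].
rewrite -IntD//.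
have E (z : pl * pl) : l^-1 * w z * (cpow (dilated_ratio l z) n.+1).1 + - w z * (cpow (dilated_ratio 1 z) n.+1).1 =
    - n.+1%:R * (c z.1 * c z.2 * dker n.+1%:R (n.+1%:R * l) (log_radius z.1) (log_radius z.2) +
      s z.1 * s z.2 * dker n.+1%:R (n.+1%:R * l) (log_radius z.1) (log_radius z.2)).
  rewrite !cpow_dilated_ratio /dker -!expRM_natl.
  have -> : n.+1%:R * (- l * `|log_radius z.1 - log_radius z.2|) = - (n.+1%:R * l) * `|log_radius z.1 - log_radius z.2| by ring.
  have -> : n.+1%:R * (- 1 * `|log_radius z.1 - log_radius z.2|) = - n.+1%:R * `|log_radius z.1 - log_radius z.2| by ring.
  rewrite /c /s /w; exact: dker_algebra (lt0r_neq0 n0) (lt0r_neq0 l0).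
rewrite (eq_Int _ E) IntZ; last exact: igD.
by rewrite (IntD j1 k1) mulNr oppr_le0 mulr_ge0 ?(ltW n0)// addr_ge0.
Qed.

(** The terms with the larger of the two log-radii scale exactly by [l] and cancel. There remain the
    angular modes, which [moment] orders one by one, so the Abel summation runs with zero bounds. *)
Let inter_gap : inter v <= l^-1 * inter u.
Proof.
have [d1 d2] := inter_dilation.
have iv' : ig (L2 \x L2)%E (fun z => w z * ln (sqdist z.1 z.2)) := ig_inter bv bv.
have H1 (x y : pl) : 0 < sqnorm x -> 0 < sqnorm y -> x.1 != y.1 ->
    ln (sqdist x y) = 1 * (2 * Mx (x, y)) + 2 * lognorm1 (dilated_ratio 1 (x, y)).
  by move=> qx qy xy; rewrite ln_sqdist_polar ?mul1r//; exact: dilated_ratio_neq1.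
have Hl (x y : pl) : 0 < sqnorm x -> 0 < sqnorm y -> x.1 != y.1 ->
    ln (sqdist (dilation l x) (dilation l y)) = l * (2 * Mx (x, y)) + 2 * lognorm1 (dilated_ratio l (x, y)).
  move=> qx qy xy; have ax : 0 < sqnorm (dilation l x) by rewrite sqnorm_dilation ?powR_gt0.
  have ay : 0 < sqnorm (dilation l y) by rewrite sqnorm_dilation ?powR_gt0.
  rewrite ln_sqdist_polar ?dilated_ratio_dilation//; last exact: dilated_ratio_neq1.
  rewrite (_ : Num.max (log_radius (dilation l x)) (log_radius (dilation l y)) = l * Mx (x, y)); first by ring.
  by rewrite /Mx/= !log_radius_dilation// maxr_pMr// ltW.
have [p1 p2] := lognorm1_polar ltr01 iv' H1.
have [q1 q2'] := lognorm1_polar l0 d1 Hl.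
have [z1 z2] := measurable_dilated_ratio l; have [z3 z4] := @measurable_dilated_ratio R 1.
have iv1 := inter_dilation.
have Zae (t : R) : 0 < t -> {ae (L2 \x L2)%E, forall z, dilated_ratio t z != (1, 0)}.
  move=> t0; apply: filterS3 (@line_null R) (ae_prod1 (@ae_sqnorm R)) (ae_prod2 (@ae_sqnorm R)).
  by move=> [x y] /= h1 h2 h3; exact: dilated_ratio_neq1.
have L1 : ig (L2 \x L2)%E (fun z => l^-1 * w z * lognorm1 (dilated_ratio l z)).
  by apply: eq_ig (igZ l^-1 q1) => z; rewrite mulrA.
have L2' : ig (L2 \x L2)%E (fun z => - w z * lognorm1 (dilated_ratio 1 z)).
  by apply: eq_ig (igN p1) => z; rewrite mulNr.
have S0 N : \sum_(n < N) (0 : R) / n.+1%:R <= 0.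
  by rewrite big1// => n _; rewrite mul0r.
have := lognorm1_moments (igZ l^-1 iw) z1 z2 (fun z => nrm2_dilated_ratio z (ltW l0)) (Zae _ l0) L1
  (igN iw) z3 z4 (fun z => nrm2_dilated_ratio z ler01) (Zae _ ltr01) L2' moment (fun=> lexx 0) S0.
rewrite (eq_Int _ (fun z => esym (mulrA l^-1 (w z) _))) IntZ//.
rewrite (eq_Int _ (fun z => mulNr (w z) _)) IntN// => h.
rewrite d2 q2' [leLHS]p2 mul1r mulrDr mulrA mulVf ?gt_eqF// mul1r lerD2l.
by rewrite mulrCA ler_pM2l//; move: h; rewrite oppr_le0 subr_ge0.
Qed.

Let iq : ig L2 (fun x => v x * ln (sqnorm x)).
Proof.
have [C hC] := log_radius_bound.
apply: (igMb (B := 2 * C) iv).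
  by apply: (measurableT_comp (@measurable_ln R)); exact: measurable_sqnorm.
move=> x /hC; rewrite /log_radius normrM ger0_norm ?invr_ge0//.
by rewrite ler_pdivrMl.
Qed.

(** The Jacobian changes the entropy by [- ln l] and by [- (l - 1)] times the mean of [log |x|^2]
    under [v], while the dilation multiplies [log |x|^2] by [l]. The weight [1 - l^-1] is the one
    for which the potential terms cancel. *)
Lemma energy_dilation : - 1 - ln pi - ln l <= energy (1 - l^-1) l^-1 u.
Proof.
have mu1 := measurable_ent mu'.
have mq : measurable_fun setT (fun x : pl => ln (sqnorm x)).
  by apply: (measurableT_comp (@measurable_ln R)); exact: measurable_sqnorm.
have e1 : \int[L2]_x (u x * ln (sqnorm x)) = l * \int[L2]_x (v x * ln (sqnorm x)).
  have muq : measurable_fun setT (fun x => u x * ln (sqnorm x)) by exact: measurable_funM.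
  rewrite (cov_Rintegral (dilation_jac_ge0 l0) (cov_dilation l0) muq) -IntZ//; apply: eq_Int => x.
  rewrite mulrAC -/(v x); have [->|/v_supp[q0 _ _]] := eqVneq (v x) 0; first by rewrite !mul0r mulr0.
  by rewrite sqnorm_dilation// ln_powR mulrCA.
have vE : dens v.
  split=> //; rewrite -u1 (cov_Rintegral (dilation_jac_ge0 l0) (cov_dilation l0) mu').
  exact: eq_Int.
have ive := ig_bdd (bdd_xlnx bv v0).
have e2 : ent u = ent v - ln l - (l - 1) * \int[L2]_x (v x * ln (sqnorm x)).
  rewrite /ent (cov_Rintegral (dilation_jac_ge0 l0) (cov_dilation l0) mu1).
  have [_ _ v1] := vE.
  rewrite -[X in _ = _ - X - _](mulr1 (ln l)) -[X in _ = _ - ln l * X - _]v1 -!IntZ//.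
  rewrite -IntB//; last exact: igZ.
  rewrite -IntB//; [|by apply: igB => //; exact: igZ|exact: igZ].
  apply: eq_Int => x; rewrite mulrAC -/(v x).
  have [->|vn] := eqVneq (v x) 0; first by rewrite !(mul0r, mulr0) !subr0.
  have [q0 un _] := v_supp vn.
  have up : 0 < u (dilation l x) by rewrite lt_neqAle eq_sym un u0.
  have Jp : 0 < dilation_jac l x by rewrite mulr_gt0 ?powR_gt0.
  rewrite {3}/v lnM ?posrE// /dilation_jac lnM ?posrE ?powR_gt0// ln_powR; ring.
have := critical_energy_bound vE; rewrite /critical_energy /energy e1 e2; have := inter_gap.
set A := \int[L2]_x _; set I := inter u; set I' := inter v; set S := ent v => h1 h2.
have -> : (1 - l^-1) * (l * A) = (l - 1) * A.
  by rewrite mulrA mulrBl mul1r mulVf// gt_eqF.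
exact: energy_sum h1 h2.
Qed.

End weighted_bound.

(** * Lower bounds *)

Section lower_bounds.
Context {R : realType}.
Local Notation mu := (@lebesgue_measure R).
Local Notation T := (measurableTypeR R).
Local Notation pl := (T * T)%type.
Local Notation L2 := (@lebesgue2 R).

Lemma annulus_bound (a : R) (u : pl -> R) (lo hi : R) : 0 <= a -> a < 1 -> dens u ->
  0 < lo -> (forall x, u x != 0 -> lo <= sqnorm x <= hi) ->
  ln (1 - a) - 1 - ln pi <= energy a (1 - a) u.
Proof.
move=> a0 a1 du lo0 us.
move: a0; rewrite le_eqVlt => /predU1P[<-|a0].
  by rewrite /energy subr0 ln1 mul0r mul1r addr0 sub0r; exact: critical_energy_bound.
have k0 : 0 < 1 - a by rewrite subr_gt0.
pose l := (1 - a)^-1.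
have l1 : 1 < l by rewrite /l invf_gt1// ltrBlDr ltrDl.
have l0 : 0 < l by exact: lt_trans ltr01 l1.
have [bu u0 u1] := du; have [mu' [B [K [B0 K0 hB hK]]]] := bddE bu.
have uB x : u x <= B by apply: le_trans (hB x); exact: ler_norm.
have hi0 : 0 <= hi.
  have [x hx] : exists x, u x != 0 by apply: (@Int_neq0 R _ _ L2); rewrite u1 oner_eq0.
  by have /andP[h1 h2] := us _ hx; rewrite (le_trans (ltW lo0))// (le_trans h1).
(* On the support of the pulled-back density [|y|^(2 l) <= hi], hence [|y|^2 <= H], and the Jacobian
   is bounded there. *)
pose H := hi `^ l^-1.
have bv : bdd (fun y => u (dilation l y) * dilation_jac l y).
  apply: (@bddI _ _ (B * (l * H `^ (l - 1))) (1 + H)).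
    apply: measurable_funM; last exact: measurable_dilation_jac.
    by apply: (measurableT_comp mu'); exact: measurable_dilation.
  move=> y vy; have [q0 un /andP[h1 h2]] := dilation_supp lo0 us vy.
  have qH : sqnorm y <= H.
    have -> : sqnorm y = ((sqnorm y) `^ l) `^ l^-1.
      by rewrite -powRrM divff ?gt_eqF// powRr1// ltW.
    apply: ge0_ler_powR => //; first by rewrite invr_ge0 ltW.
    by rewrite nnegrE powR_ge0.
  split.
    rewrite normrM ler_pM// ger0_norm ?dilation_jac_ge0// /dilation_jac ler_wpM2l ?(ltW l0)//.
    apply: ge0_ler_powR => //; first by rewrite subr_ge0 ltW.
      by rewrite nnegrE ltW.
    by rewrite nnegrE powR_ge0.
  have k (c : R) : c ^+ 2 <= H -> - (1 + H) <= c <= 1 + H.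
    move=> cH; rewrite -ler_norml; have := sqr_ge0 (`|c| - 1).
    rewrite sqrrB1 real_normK ?num_real// -mulr_natl; have := normr_ge0 c.
    by have := powR_ge0 hi l^-1; rewrite -/H; clear -cH; lra.
  rewrite /in_square !k//; apply: le_trans qH; rewrite /sqnorm; [rewrite lerDr|rewrite lerDl]; exact: sqr_ge0.
have := energy_dilation l1 du lo0 us bv.
by rewrite /l invrK lnV ?posrE// opprK opprB addrCA subrr addr0; lra.
Qed.

Definition fin_energy (u : pl -> R) : Prop :=
  [/\ forall x, 0 <= u x, ig L2 u, \int[L2]_x u x = 1 &
    [/\ ig L2 (fun x => u x * ln (u x)), ig L2 (fun x => u x * ln (1 + sqnorm x)) &
      ig (L2 \x L2)%E (fun z => u z.1 * u z.2 * ln (sqdist z.1 z.2))]].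

Definition potential (u : pl -> R) : R := \int[L2]_x (u x * ln (1 + sqnorm x)).

Lemma energy_lower_bound (a : R) (u : pl -> R) n : 0 <= a -> a < 1 -> fin_energy u ->
  ln (1 - a) - 1 - ln pi + a * \int[L2]_x (cutoff u n x * ln (1 + (sqnorm x)^-1)) <=
  ent u + a * potential u + (1 - a) * inter u.
Proof.
move=> a0 a1 [u0 iu u1 [ie iv ii]].
apply: truncation_bound => // k mk.
apply: (annulus_bound (lo := k.+1%:R^-1) (hi := k%:R)) => //.
- exact: dens_ncutoff.
by move=> x; rewrite mulf_eq0 negb_or => /andP[_ /cutoff_supp[]].
Qed.

Lemma pot_ge0 u : (forall x, 0 <= u x) -> 0 <= potential u.
Proof. by move=> u0; apply: Int_ge0 => x; rewrite mulr_ge0// ln_ge0// lerDl sqnorm_ge0. Qed.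

(** [|x - y|^2 <= (1 + |x|^2) (1 + |y|^2)], the difference being [|1 + x conj y|^2] in complex
    notation. *)
Lemma inter_le_pot u : fin_energy u -> inter u <= 2 * potential u.
Proof.
move=> [u0 iu u1 [ie iv ii]].
have i1 := ig_prod iv iu; have i2 := ig_prod iu iv.
have -> : 2 * potential u = \int[(L2 \x L2)%E]_z (u z.1 * ln (1 + sqnorm z.1) * u z.2 + u z.1 * (u z.2 * ln (1 + sqnorm z.2))).
  by rewrite (IntD i1 i2) (Int_prod iv iu) (Int_prod iu iv) u1 /potential; ring.
apply: le_Int => //; first exact: igD.
move=> [x y]/=; rewrite [u x * _ * u y]mulrAC [u x * (u y * _)]mulrA -mulrDr.
rewrite ler_wpM2l ?mulr_ge0//.
have px : 0 < 1 + sqnorm x by rewrite ltr_wpDr// sqnorm_ge0.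
have py : 0 < 1 + sqnorm y by rewrite ltr_wpDr// sqnorm_ge0.
rewrite -lnM ?posrE//; have [s0|s0] := ltP 0 (sqdist x y).
  rewrite ler_ln ?posrE ?mulr_gt0// -subr_ge0 /sqdist /sqnorm.
  rewrite (_ : _ - _ = (1 + x.1 * y.1 + x.2 * y.2) ^+ 2 + (x.1 * y.2 - x.2 * y.1) ^+ 2); last by ring.
  by rewrite addr_ge0 ?sqr_ge0.
rewrite ln0//; apply: ln_ge0; rewrite mulrDl mul1r mulrDr mulr1.
by rewrite -addrA lerDl addr_ge0 ?sqnorm_ge0// addr_ge0 ?mulr_ge0 ?sqnorm_ge0.
Qed.

Lemma enormE (x : pl) : enorm x ^+ 2 = sqnorm x.
Proof. by rewrite /enorm sqr_sqrtr// sqnorm_ge0. Qed.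

Lemma ln_enorm (x y : pl) : ln (enorm (x - y)) = 2^-1 * ln (sqdist x y).
Proof.
rewrite -[enorm _]/(Num.sqrt (sqdist x y)) -powR12_sqrt ?ln_powR//.
by rewrite /sqdist addr_ge0 ?sqr_ge0.
Qed.

Lemma interaction_densityE (u : pl -> R) (z : pl * pl) :
  interaction_density u z = 2^-1 * (u z.1 * u z.2 * ln (sqdist z.1 z.2)).
Proof. by rewrite /interaction_density ln_enorm mulrCA. Qed.

Lemma entropy_density1 (u : pl -> R) (x : pl) : entropy_density 1 u x = u x * ln (u x).
Proof. by rewrite /entropy_density divr1. Qed.

Lemma potential_densityE (u : pl -> R) (x : pl) : potential_density u x = u x * ln (1 + sqnorm x).
Proof. by rewrite /potential_density enormE mulrC. Qed.

Lemma mass_classE (M : R) (u : pl -> R) : mass_class M u <->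
  [/\ forall x, 0 <= u x, ig L2 u & \int[L2]_x u x = M].
Proof.
have N u' : (forall x, 0 <= u' x) -> ig L2 u' ->
    ('N[lebesgue2]_1 [EFin \o u'] = (\int[L2]_x u' x)%:E)%E.
  move=> h0 hi; rewrite Lnorm1 -EFin_Int//; apply: eq_integral => x _ /=.
  by rewrite ger0_norm.
split=> [[[u0 iu] h]|[u0 iu h]].
  by split => //; move: h; rewrite (N u u0 iu) => -[].
by split => //; rewrite (N u u0 iu) h.
Qed.

Lemma admissible1P (u : pl -> R) : admissible 1 u <-> fin_energy u.
Proof.
split=> [[/mass_classE[u0 iu u1] [h1 h2 h3]]|[u0 iu u1 [h1 h2 h3]]].
  split => //; split.
  - by apply: (eq_ig (entropy_density1 u)).
  - by apply: (eq_ig (potential_densityE u)).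
  have := igZ 2 h3; apply: eq_ig => z.
  by rewrite interaction_densityE mulrA mulfV ?mul1r// pnatr_eq0.
split; first exact/mass_classE.
split.
- by apply: (eq_ig (fun x => esym (entropy_density1 u x))).
- by apply: (eq_ig (fun x => esym (potential_densityE u x))).
by apply: (eq_ig (fun z => esym (interaction_densityE u z))); exact: igZ.
Qed.

Lemma free_energy1E (a b : R) (u : pl -> R) : fin_energy u ->
  free_energy a b 1 u = ent u + a * potential u - b / 2 * inter u.
Proof.
move=> [u0 iu u1 [h1 h2 h3]]; rewrite /free_energy divr1.
rewrite (eq_Int _ (entropy_density1 u)) (eq_Int _ (potential_densityE u)).
by rewrite (eq_Int _ (interaction_densityE u)) IntZ// mulrA.
Qed.

Lemma free_energy_scale (a b M : R) (r : pl -> R) (u := fun x => M^-1 * r x) : 0 < M ->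
  admissible M r -> admissible 1 u /\ free_energy a b M r = M * free_energy a b 1 u.
Proof.
move=> M0 [/mass_classE[r0 ir r1] [h1 h2 h3]]; have Mn := lt0r_neq0 M0.
have e1 (x : pl) : entropy_density 1 u x = M^-1 * entropy_density M r x.
  by rewrite entropy_density1 /entropy_density /u [_ / M]mulrC mulrA.
have e2 (x : pl) : potential_density u x = M^-1 * potential_density r x.
  by rewrite /potential_density /u mulrCA.
have e3 (z : pl * pl) : interaction_density u z = M^-1 ^+ 2 * interaction_density r z.
  by rewrite /interaction_density /u; ring.
have i1 := eq_ig (fun x => esym (e1 x)) (igZ M^-1 h1).
have i2 := eq_ig (fun x => esym (e2 x)) (igZ M^-1 h2).
have i3 := eq_ig (fun x => esym (e3 x)) (igZ (M^-1 ^+ 2) h3).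
split.
  split; last by split.
  apply/mass_classE; split.
  - by move=> x; rewrite mulr_ge0// invr_ge0 ltW.
  - exact: igZ.
  by rewrite IntZ// r1 mulVf.
rewrite /free_energy (eq_Int _ e1) (eq_Int _ e2) (eq_Int _ e3) !IntZ// divr1.
by field.
Qed.

Lemma energy_bound_fin (a b c : R) :
  (forall u, fin_energy u -> c <= free_energy a b 1 u) -> energy_bound a b c%:E.
Proof.
move=> H M r M0 hr; have [/admissible1P hu ->] := free_energy_scale a b M0 hr.
by rewrite -EFinM lee_fin mulrC ler_pM2l// H.
Qed.

Lemma energy_bound_best (a b : R) : energy_bound a b (best_constant a b).
Proof.
move=> M r M0 hr; rewrite -lee_pdivlMr//; apply: ge_ereal_sup => c hc.
by rewrite lee_pdivlMr//; exact: hc.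
Qed.

Lemma best_constant_ge (a b c : R) :
  (forall u, fin_energy u -> c <= free_energy a b 1 u) -> (c%:E <= best_constant a b)%E.
Proof. by move=> H; apply: ereal_sup_ubound; exact: energy_bound_fin. Qed.

Definition sharp_constant (a : R) : R := ln (1 - a) - 1 - ln pi.

Lemma lower_bound_line (a : R) u : 0 <= a -> a < 1 -> fin_energy u ->
  sharp_constant a <= free_energy a (2 * a - 2) 1 u.
Proof.
move=> a0 a1 fu; rewrite free_energy1E//.
have := energy_lower_bound 0 a0 a1 fu; have [u0 iu u1 [ie iv ii]] := fu.
have := mulr_ge0 a0 (defect_ge0 u0 0) ; rewrite /sharp_constant.
have -> : (2 * a - 2) / 2 = - (1 - a) by lra.
by rewrite mulNr opprK; lra.
Qed.

(** If [b < 0], the point with the same [b] on the line [b = 2 a - 2] has potential weight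
    [(b + 2) / 2 <= a]. If [b >= 0], the interaction has the wrong sign and is traded for the
    potential by [inter_le_pot]: comparison with the point of the line at [a'] works as soon as
    [2 - a' <= a - b], and some [a' < 1] satisfies this because [b < a - 1]. *)
Lemma lower_bound_general (a b : R) :
  0 < a -> -2 <= b -> b < a - 1 -> b <= 2 * a - 2 ->
  exists c, forall u, fin_energy u -> c <= free_energy a b 1 u.
Proof.
move=> a0 b2 ba b2a; have [bn|bp] := ltP b 0.
  exists (sharp_constant ((b + 2) / 2)) => u fu.
  have a'0 : 0 <= (b + 2) / 2 by lra.
  have a'1 : (b + 2) / 2 < 1 by lra.
  have := lower_bound_line a'0 a'1 fu; rewrite !free_energy1E//.
  have -> : 2 * ((b + 2) / 2) - 2 = b by lra.
  have aa : 0 <= a - (b + 2) / 2 by lra.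
  have [u0 _ _ _] := fu; have := mulr_ge0 aa (pot_ge0 u0); rewrite mulrBl; lra.
pose a' := Num.max 0 (2 - (a - b)).
have a'0 : 0 <= a' by rewrite le_max lexx.
have a'1 : a' < 1 by rewrite gt_max ltr01/=; lra.
have a'2 : 2 - a' <= a - b by have : 2 - (a - b) <= a' by [rewrite le_max lexx orbT]; lra.
exists (sharp_constant a') => u fu; have [u0 _ _ _] := fu.
have := lower_bound_line a'0 a'1 fu; rewrite !free_energy1E//.
have i1 := inter_le_pot fu; have p0 := pot_ge0 u0.
have -> : (2 * a' - 2) / 2 = - (1 - a') by lra.
move=> h; apply: le_trans h _; rewrite mulNr opprK.
have h1 : (1 - a') * inter u <= (1 - a') * (2 * potential u) by rewrite ler_wpM2l// subr_ge0 ltW.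
have h2 : b / 2 * inter u <= b / 2 * (2 * potential u) by rewrite ler_wpM2l// divr_ge0.
have h3 : (2 - a') * potential u <= (a - b) * potential u by rewrite ler_wpM2r.
by rewrite -!addrA lerD2l; lra.
Qed.

(** One annulus on which the defect is positive survives the limit of truncations. *)
Lemma lower_bound_strict (a : R) u : 0 < a -> a < 1 -> fin_energy u ->
  sharp_constant a < free_energy a (2 * a - 2) 1 u.
Proof.
move=> a0 a1 fu; rewrite free_energy1E//; have [u0 iu u1 [ie iv ii]] := fu.
have [n hn] := defect_gt0 u0 iu u1.
have := energy_lower_bound n (ltW a0) a1 fu; have := mulr_gt0 a0 hn.
rewrite /sharp_constant; have -> : (2 * a - 2) / 2 = - (1 - a) by lra.
by rewrite mulNr opprK; lra.
Qed.

End lower_bounds.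

(** * Radial test densities *)

Section radial_tests.
Context {R : realType}.
Local Notation mu := (@lebesgue_measure R).
Local Notation T := (measurableTypeR R).
Local Notation pl := (T * T)%type.
Local Notation L2 := (@lebesgue2 R).

(* The radial density under which [log |x|] has law [h]. *)
Definition radial_density (h : T -> R) (x : pl) : R := h (2^-1 * ln (sqnorm x)) / (2 * pi * sqnorm x).

Definition dist_energy (h : T -> R) : R :=
  \int[(mu \x mu)%E]_z (h z.1 * h z.2 * `|z.1 - z.2|).

Definition profile_energy (a b : R) (h : T -> R) : R :=
  \int[mu]_s (h s * ln (h s)) - ln 2 - ln pi - 2 * \int[mu]_s (h s * s) +
  a * \int[mu]_s (h s * ln (1 + expR (2 * s))) -
  b / 2 * (2 * \int[mu]_s (h s * s) + dist_energy h).

Lemma norm_le_sqr (c L : R) : 0 <= L -> c ^+ 2 <= L -> `|c| <= 1 + L.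
Proof.
move=> L0 h; have := sqr_ge0 (`|c| - 1); rewrite sqrrB1 real_normK ?num_real//.
by rewrite -mulr_natl; have := normr_ge0 c; lra.
Qed.

Lemma itv_half (K t : R) : - K <= 2^-1 * t -> 2^-1 * t <= K -> 2 * - K <= t <= 2 * K.
Proof. by move=> h1 h2; apply/andP; split; lra. Qed.

Lemma radial_energy_profile (u : pl -> R) (B L l : R) (g : R -> R) (k : T -> R) :
  dens u -> even_x u -> even_y u -> (forall x, u x <= B) -> 0 < l ->
  (forall x, u x != 0 -> l <= sqnorm x <= L) -> (forall x, u x = g (sqnorm x)) ->
  (forall s, k s = 2 * pi * (g (expR (2 * s)) * expR (2 * s))) ->
  [/\ ent u = \int[mu]_s (k s * ln (k s)) - ln 2 - ln pi - 2 * \int[mu]_s (k s * s),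
      inter u = 2 * \int[mu]_s (k s * s) + dist_energy k &
      forall (phi : R -> R) (B' : R), measurable_fun setT phi ->
        (forall t, l <= t <= L -> `|phi t| <= B') ->
        \int[L2]_x (u x * phi (sqnorm x)) = \int[mu]_s (k s * phi (expR (2 * s)))].
Proof.
move=> du e1 e2 uB l0 us ug /funext ->.
exact: (radial_energy du e1 e2 uB l0 us ug).
Qed.

Section profile.
Variables (h : T -> R) (B K : R).
Hypotheses (mh : measurable_fun setT h) (h0 : forall s, 0 <= h s) (h1 : \int[mu]_s h s = 1).
Hypotheses (hB : forall s, h s <= B) (hK : forall s, h s != 0 -> - K <= s <= K).

Let l := expR (2 * - K).
Let L := expR (2 * K).
Let l0 : 0 < l. Proof. exact: expR_gt0. Qed.

Let radial_supp (t : R) : 0 <= t -> h (2^-1 * ln t) / (2 * pi * t) != 0 -> l <= t <= L.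
Proof.
move=> t0; rewrite mulf_eq0 negb_or invr_eq0 !mulf_eq0 !negb_or => /andP[/hK/andP[k1 k2] /andP[_ tn]].
have tp : 0 < t by rewrite lt_neqAle eq_sym tn.
rewrite /l /L -[t](lnK tp) !ler_expR; exact: itv_half.
Qed.

Let mlq : measurable_fun setT (fun x : pl => h (2^-1 * ln (sqnorm x))).
Proof.
apply: (measurableT_comp mh); apply: measurable_funM => //.
by apply: (measurableT_comp (@measurable_ln R)); exact: measurable_sqnorm.
Qed.

Let m_radial : measurable_fun setT (radial_density h).
Proof.
apply: measurable_funM => //; apply: (measurableT_comp measurable_invr).
by apply: measurable_funM => //; exact: measurable_sqnorm.
Qed.

Let rad0 x : 0 <= radial_density h x.
Proof. by rewrite /radial_density divr_ge0// !mulr_ge0 ?pi_ge0 ?sqnorm_ge0. Qed.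

Let B0 : 0 <= B. Proof. exact: le_trans (h0 0) (hB 0). Qed.

Let radial_le x : radial_density h x <= B / (2 * pi * l).
Proof.
have C0 : 0 <= B / (2 * pi * l) by rewrite divr_ge0// !mulr_ge0 ?pi_ge0 ?(ltW l0).
have [->//|hx] := eqVneq (radial_density h x) 0.
have /andP[h2 _] := radial_supp (sqnorm_ge0 x) hx.
rewrite /radial_density ler_pM ?invr_ge0 ?mulr_ge0 ?pi_ge0 ?sqnorm_ge0//.
have pp := @pi_gt0 R.
rewrite lef_pV2 ?posrE ?mulr_gt0//; last exact: lt_le_trans l0 h2.
by rewrite ler_pM2l// mulr_gt0.
Qed.

Lemma bdd_radial : bdd (radial_density h).
Proof.
apply: (@bddI _ _ (B / (2 * pi * l)) (1 + L)) => // x hx.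
have /andP[_ h2] := radial_supp (sqnorm_ge0 x) hx.
split; first by rewrite ger0_norm.
have k (c : R) : c ^+ 2 <= L -> - (1 + L) <= c <= 1 + L.
  by move=> cH; rewrite -ler_norml norm_le_sqr ?expR_ge0.
rewrite /in_square !k//; apply: le_trans h2; rewrite /sqnorm; [rewrite lerDr|rewrite lerDl]; exact: sqr_ge0.
Qed.

Let ih : ig mu h.
Proof.
apply: (@ig_bounded_supp _ _ B K) => // s; by rewrite ger0_norm.
Qed.

Lemma Int_radial : \int[L2]_x radial_density h x = 1.
Proof.
pose g (r : T) : R := h (2^-1 * ln (r ^+ 2)) / (2 * `|r|).
have mg : measurable_fun setT g.
  apply: measurable_funM.
    apply: (measurableT_comp mh); apply: measurable_funM => //.
    by apply: (measurableT_comp (@measurable_ln R)); solve_measurable.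
  by solve_measurable.
have gs (r : T) : g r != 0 -> l <= r ^+ 2 <= L.
  rewrite mulf_eq0 negb_or invr_eq0 mulf_eq0 pnatr_eq0/= normr_eq0 => /andP[hr rn].
  apply: radial_supp; first exact: sqr_ge0.
  by rewrite mulf_neq0// invr_neq0// !mulf_neq0// ?sqrf_eq0// gt_eqF// pi_gt0.
have g0 r : 0 <= g r by rewrite divr_ge0.
have ig_g : ig mu g.
  apply: (@ig_bounded_supp _ _ (B * (l^-1 * (1 + L))) (1 + L)) => //.
    move=> r; rewrite ger0_norm//.
    have [->|gn] := eqVneq (g r) 0.
      by rewrite !mulr_ge0 ?invr_ge0 ?(ltW l0)// addr_ge0 ?expR_ge0.
    have /andP[k1 k2] := gs _ gn; move: gn; rewrite mulf_eq0 negb_or invr_eq0 mulf_eq0 pnatr_eq0/= normr_eq0 => /andP[_ rn].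
    have rp : 0 < `|r| by rewrite normr_gt0.
    rewrite /g ler_pM ?invr_ge0// ?mulr_ge0//.
    rewrite invfM; apply: (@le_trans _ _ (1 * `|r|^-1)).
      by rewrite ler_wpM2r ?invr_ge0// invf_le1// ler1n.
    rewrite mul1r -[`|r|^-1]mulr1 ler_pdivrMl// mulrA mulrAC -ler_pdivrMr ?invr_gt0//.
    have : `|r| <= 1 + L by rewrite norm_le_sqr ?expR_ge0.
    move=> r1; rewrite invrK mul1r; apply: le_trans k1 _.
    rewrite -real_normK ?num_real// expr2 ler_pM//.
  by move=> r /gs/andP[_ k2]; rewrite -ler_norml norm_le_sqr ?expR_ge0.
rewrite (cov_Rintegral (@polar_jac_ge0 R) (@cov_polar R) m_radial).
have E (a : pl) : radial_density h (polar a) * polar_jac a = g a.1 * cauchy_density a.2.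
  rewrite /radial_density polar_jacE sqnorm_polar /g; set H := h _.
  have [->|an] := eqVneq a.1 0; first by rewrite normr0 !(mulr0, mul0r) invr0 !(mulr0, mul0r).
  have pp : pi != 0 :> R by rewrite gt_eqF// pi_gt0.
  have nn : `|a.1| != 0 by rewrite normr_eq0.
  rewrite -[a.1 ^+ 2]real_normK ?num_real//; move: `|a.1| nn (cauchy_density a.2) => y yn k.
  by move: (pi : R) pp => q qn; field; rewrite yn qn.
rewrite (eq_Int _ E) (Int_prod ig_g (@ig_cauchy R)) Int_cauchy mulr1.
have ev (r : T) : g (- r) = g r by rewrite /g sqrrN normrN.
have [k1 ->] := exp_doubling ig_g ev.
rewrite -IntZ// -[RHS]h1; apply: eq_Int => s.
have hs : 2^-1 * (2 * s) = s by rewrite mulrA mulVf ?pnatr_eq0// mul1r.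
have e0 := lt0r_neq0 (expR_gt0 s).
rewrite /g gtr0_norm ?expR_gt0// -expRM_natl expRK hs.
by move: (expR _) (h s) e0 => e y e0; field.
Qed.

Lemma dens_radial : dens (radial_density h).
Proof. by split; [exact: bdd_radial|exact: rad0|exact: Int_radial]. Qed.

Lemma fin_energy_radial : fin_energy (radial_density h).
Proof.
have b := bdd_radial; split => //; [exact: ig_bdd|exact: Int_radial|split].
- exact: ig_bdd (bdd_xlnx b rad0).
- apply: ig_bdd; apply: (bddM (C := L) b).
    by apply: (measurableT_comp (@measurable_ln R)); apply: measurable_funD => //; exact: measurable_sqnorm.
  move=> x hx; have /andP[_ h2] := radial_supp (sqnorm_ge0 x) hx.
  rewrite ger0_norm ?ln_ge0 ?lerDl ?sqnorm_ge0//; apply: le_trans h2; apply: le_ln1Dx.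
  by apply: lt_le_trans (sqnorm_ge0 x); exact: ltrN10.
exact: ig_inter.
Qed.

Lemma free_energy_radial (a b : R) : free_energy a b 1 (radial_density h) = profile_energy a b h.
Proof.
rewrite (free_energy1E _ _ fin_energy_radial).
have ev1 : even_x (radial_density h) by move=> [x y]; rewrite /radial_density /sqnorm/= sqrrN.
have ev2 : even_y (radial_density h) by move=> [x y]; rewrite /radial_density /sqnorm/= sqrrN.
have us (x : pl) : radial_density h x != 0 -> l <= sqnorm x <= L by exact: radial_supp (sqnorm_ge0 x).
have hE (s : T) : h s = 2 * pi * (h (2^-1 * ln (expR (2 * s))) / (2 * pi * expR (2 * s)) * expR (2 * s)).
  rewrite expRK mulrA [2^-1 * _]mulrA mulVf ?pnatr_eq0// mul1r.
  have e0 := lt0r_neq0 (expR_gt0 (2 * s)); have pp := lt0r_neq0 (@pi_gt0 R).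
  move: (expR _) (h s) e0 => e y e0.
  by move: (pi : R) pp => w pp; field; rewrite e0 pp.
have := radial_energy_profile dens_radial ev1 ev2 radial_le l0 us
  (g := fun t => h (2^-1 * ln t) / (2 * pi * t)) (fun x => erefl) hE.
move=> [-> -> H]; rewrite /potential (H (fun t => ln (1 + t)) (ln (1 + L))).
- by rewrite /profile_energy /dist_energy.
- by apply: (measurableT_comp (@measurable_ln R)); exact: measurable_funD.
move=> t /andP[k1 k2]; have t0 : 0 < t by exact: lt_le_trans l0 k1.
rewrite ger0_norm; last by rewrite ln_ge0// lerDl ltW.
by rewrite ler_ln ?posrE ?lerD2l// addr_gt0// expR_gt0.
Qed.

End profile.

End radial_tests.

Lemma two_blocks_algebra {R : realType} (E S D X a b ep sg A B C l p : R) : E <= 0 -> a * X <= A ->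
  (2 * a - 2 - b) * (S - ep * sg) <= B -> - (b / 2) * (D - sg * (2 * ep * (1 - ep))) <= C ->
  E - l - p + (2 * a - 2 - b) * S + a * X - b / 2 * D <=
  B + A + C - l - p + ep * sg * (2 * a - 2 - 2 * b + b * ep).
Proof.
move=> h1 h2 h3 h4; rewrite -subr_ge0.
rewrite (_ : _ - _ = (0 - E) + (A - a * X) + (B - (2 * a - 2 - b) * (S - ep * sg)) +
  (C - - (b / 2) * (D - sg * (2 * ep * (1 - ep))))); last by field.
rewrite -subr_ge0 in h1; rewrite -subr_ge0 in h2; rewrite -subr_ge0 in h3; rewrite -subr_ge0 in h4.
by rewrite addr_ge0// addr_ge0// addr_ge0.
Qed.

Lemma convex_le1 {R : realType} (e x y : R) : 0 <= 1 - e -> 0 <= e -> x <= 1 -> y <= 1 ->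
  (1 - e) * x + e * y <= 1.
Proof. by move=> h1 h2 /(ler_wpM2l h1) h3 /(ler_wpM2l h2) h4; lra. Qed.

Lemma blocks_supp {R : realType} (sg s : R) : 2 <= sg ->
  0 <= s <= 1 \/ sg <= s <= sg + 1 -> - (sg + 1) <= s <= sg + 1.
Proof. by move=> h [] /andP[h1 h2]; apply/andP; split; lra. Qed.

Lemma dist_unit {R : realType} (x s t : R) : x <= s <= x + 1 -> x <= t <= x + 1 -> `|s - t| <= 1.
Proof. by move=> /andP[h1 h2] /andP[h3 h4]; rewrite ler_norml; apply/andP; split; lra. Qed.

Lemma dist_far12 {R : realType} (sg s t : R) : 2 <= sg -> 0 <= s <= 1 -> sg <= t <= sg + 1 ->
  `| `|s - t| - sg| <= 1.
Proof.
move=> h /andP[h1 h2] /andP[h3 h4]; rewrite (ler0_norm (x := s - t)); last by lra.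
by rewrite ler_norml; apply/andP; split; lra.
Qed.

Lemma dist_far21 {R : realType} (sg s t : R) : 2 <= sg -> sg <= s <= sg + 1 -> 0 <= t <= 1 ->
  `| `|s - t| - sg| <= 1.
Proof. by move=> h h1 h2; rewrite (distrC s); exact: dist_far12. Qed.

Lemma concentration_algebra {R : realType} (A V K D r b sg S l p : R) :
  V <= A -> - (b / 2 * D) <= K -> - (2 + b) * S <= - (2 + b) * (sg + 1) ->
  - (2 + b) * (sg + 1) <= r - (A + K - l - p) ->
  0 - l - p - 2 * S + V - b / 2 * (2 * S + D) <= r.
Proof. by move=> *; lra. Qed.

Lemma borderline_algebra {R : realType} (X r l p b S D : R) : X <= 1 -> 0 <= l -> 0 <= p ->
  - (1 - r) - l - p + (2 * 1 - 2 - 0) * S + 1 * X - 0 / 2 * D <= r.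
Proof. by move=> *; lra. Qed.

(** * Laws of the log-radius and unboundedness from below *)

Section profiles.
Context {R : realType}.
Local Notation mu := (@lebesgue_measure R).
Local Notation T := (measurableTypeR R).
Local Notation pl := (T * T)%type.
Local Notation L2 := (@lebesgue2 R).

Definition profile (h : T -> R) : Prop := [/\ measurable_fun setT h, forall s, 0 <= h s,
  \int[mu]_s h s = 1 &
  exists B K : R, (forall s, h s <= B) /\ (forall s, h s != 0 -> - K <= s <= K)].

Lemma inf_le_profile (a b : R) (h : T -> R) : profile h ->
  (ereal_inf [set (free_energy a b 1 rho)%:E | rho in admissible 1]
    <= (profile_energy a b h)%:E)%E.
Proof.
move=> [mh h0 h1 [B [K [hB hK]]]]; apply: ereal_inf_lbound; exists (radial_density h).
  by apply/admissible1P; exact: (fin_energy_radial mh h0 h1 hB hK).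
by rewrite (free_energy_radial mh h0 h1 hB hK).
Qed.

Lemma best_le_profile (a b : R) (h : T -> R) : profile h ->
  (best_constant a b <= (profile_energy a b h)%:E)%E.
Proof.
move=> [mh h0 h1 [B [K [hB hK]]]]; apply: ge_ereal_sup => c hc.
have := hc 1 (radial_density h) ltr01; rewrite (free_energy_radial mh h0 h1 hB hK) mule1; apply.
by apply/admissible1P; exact: (fin_energy_radial mh h0 h1 hB hK).
Qed.

Lemma ig_profile h : profile h -> ig mu h.
Proof.
move=> [mh h0 h1 [B [K [hB hK]]]]; apply: (@ig_bounded_supp _ _ B K) => // s.
by rewrite ger0_norm.
Qed.

Lemma ig_profileM h (f : T -> R) (C : R) : profile h -> measurable_fun setT f ->
  (forall s, h s != 0 -> `|f s| <= C) -> ig mu (fun s => h s * f s).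
Proof. by move=> hp mf fC; apply: igMb (ig_profile hp) mf fC. Qed.

Lemma ig_first h : profile h -> ig mu (fun s => h s * s).
Proof.
move=> hp; have [_ _ _ [B [K [_ hK]]]] := hp.
by apply: (ig_profileM (C := K) hp) => // s /hK; rewrite ler_norml.
Qed.

Lemma measurable_log1exp : measurable_fun setT (fun s : T => ln (1 + expR (2 * s)) : R).
Proof. by solve_measurable. Qed.

Lemma ig_log1exp h : profile h -> ig mu (fun s => h s * ln (1 + expR (2 * s))).
Proof.
move=> hp; have [_ _ _ [B [K [_ hK]]]] := hp.
apply: (ig_profileM (C := expR (2 * K)) hp); first exact: measurable_log1exp.
move=> s /hK/andP[_ sK]; rewrite ger0_norm ?ln_ge0 ?lerDl ?expR_ge0//.
apply: le_trans (le_ln1Dx _) _; last by rewrite ler_expR ler_pM2l.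
by apply: lt_trans (expR_gt0 _); exact: ltrN10.
Qed.

Lemma average_le h (f : T -> R) (c : R) : profile h -> ig mu (fun s => h s * f s) ->
  (forall s, h s != 0 -> f s <= c) -> \int[mu]_s (h s * f s) <= c.
Proof.
move=> hp hf fc; have [_ h0 h1 _] := hp.
rewrite -[leRHS]mulr1 -h1 -IntZ; last exact: ig_profile.
apply: le_Int => //; first by apply: igZ; exact: ig_profile.
move=> s; have [->|hs] := eqVneq (h s) 0; first by rewrite mul0r mulr0.
by rewrite mulrC ler_wpM2r// fc.
Qed.

Lemma average_ge h (f : T -> R) (c : R) : profile h -> ig mu (fun s => h s * f s) ->
  (forall s, h s != 0 -> c <= f s) -> c <= \int[mu]_s (h s * f s).
Proof.
move=> hp hf fc; have i : ig mu (fun s => h s * - f s).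
  by apply: eq_ig (igN hf) => s; rewrite mulrN.
have := @average_le h (fun s => - f s) (- c) hp i.
rewrite (eq_Int _ (fun s => mulrN (h s) (f s))) IntN// lerN2; apply => s hs.
by rewrite lerN2 fc.
Qed.

Lemma dist_ig h : profile h -> ig (mu \x mu)%E (fun z => h z.1 * h z.2 * `|z.1 - z.2|).
Proof.
move=> hp; have [_ h0 h1 [B [K [_ hK]]]] := hp.
by have [] := Int_dist (ig_profile hp) h0 h1 hK.
Qed.

Lemma average2_le h (f : T * T -> R) (c : R) : profile h ->
  ig (mu \x mu)%E (fun z => h z.1 * h z.2 * f z) ->
  (forall s t, h s != 0 -> h t != 0 -> f (s, t) <= c) ->
  \int[(mu \x mu)%E]_z (h z.1 * h z.2 * f z) <= c.
Proof.
move=> hp hf fc; have [_ h0 h1 _] := hp; have ih := ig_profile hp.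
have ihh := ig_prod ih ih.
have -> : c = \int[(mu \x mu)%E]_z (c * (h z.1 * h z.2)).
  by rewrite (IntZ _ ihh) (Int_prod ih ih) h1 !mulr1.
apply: le_Int => //; first exact: igZ.
move=> [s t]/=; have [->|hs] := eqVneq (h s) 0; first by rewrite !mul0r mulr0.
have [->|ht] := eqVneq (h t) 0; first by rewrite !(mulr0, mul0r).
by rewrite mulrC ler_wpM2r ?mulr_ge0// fc.
Qed.

Lemma dist_ge0 h : profile h -> 0 <= dist_energy h.
Proof. by move=> [_ h0 _ _]; apply: Int_ge0 => z; rewrite !mulr_ge0. Qed.

Lemma log1exp_ge0 (s : R) : 0 <= ln (1 + expR (2 * s)).
Proof. by rewrite ln_ge0// lerDl expR_ge0. Qed.

Lemma log1exp_split (s : R) : ln (1 + expR (2 * s)) = 2 * s + ln (1 + expR (- (2 * s))).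
Proof.
rewrite -[X in _ = X + _]expRK -lnM ?posrE ?expR_gt0 ?addr_gt0 ?expR_gt0//.
by rewrite mulrDr mulr1 -expRD subrr expR0 addrC.
Qed.

Lemma ln1exp_le (x : R) : ln (1 + expR x) <= expR x.
Proof. by apply: le_ln1Dx; apply: lt_trans (expR_gt0 _); exact: ltrN10. Qed.

(* The excess of [log (1 + |x|^2)] over [log |x|^2]. *)
Definition excess (h : T -> R) : R := \int[mu]_s (h s * ln (1 + expR (- (2 * s)))).

Lemma excess_ig h : profile h -> ig mu (fun s => h s * ln (1 + expR (- (2 * s)))).
Proof.
move=> hp; have := igB (ig_log1exp hp) (igZ 2 (ig_first hp)); apply: eq_ig => s.
by rewrite log1exp_split; ring.
Qed.

Lemma excessE h : profile h ->
  \int[mu]_s (h s * ln (1 + expR (2 * s))) = 2 * \int[mu]_s (h s * s) + excess h.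
Proof.
move=> hp; rewrite -IntZ; last exact: ig_first.
rewrite /excess -IntD; [|by apply: igZ; exact: ig_first|exact: excess_ig].
by apply: eq_Int => s; rewrite log1exp_split; ring.
Qed.

(** Translating [h] changes the first moment and the excess only. The first moment has weight
    [2 a - 2 - b], so on the line [b = 2 a - 2] a translation to [+oo] just removes the excess. *)
Lemma profile_energyE (a b : R) h : profile h -> profile_energy a b h =
  \int[mu]_s (h s * ln (h s)) - ln 2 - ln pi + (2 * a - 2 - b) * \int[mu]_s (h s * s)
  + a * excess h - b / 2 * dist_energy h.
Proof. by move=> hp; rewrite /profile_energy excessE//; field. Qed.

Lemma excess_ge0 h : profile h -> 0 <= excess h.
Proof.
move=> [_ h0 _ _]; apply: Int_ge0 => s.
by rewrite mulr_ge0// ln_ge0// lerDl expR_ge0.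
Qed.

Lemma excess_le h (c : R) : profile h -> (forall s, h s != 0 -> c <= s) ->
  excess h <= expR (- (2 * c)).
Proof.
move=> hp hc; apply: average_le => //; first exact: excess_ig.
move=> s /hc cs; apply: le_trans (ln1exp_le _) _.
by rewrite ler_expR lerN2 ler_pM2l.
Qed.

Definition block (sg w : R) (s : T) : R := w^-1 * ((sg <= s <= sg + w)%R)%:R.

Lemma block_supp (sg w s : R) : block sg w s != 0 -> sg <= s <= sg + w.
Proof. by rewrite /block; case: (_ <= _ <= _)%R; rewrite ?mulr0 ?eqxx. Qed.

Lemma profile_block (sg w : R) : 0 < w -> profile (block sg w).
Proof.
move=> w0; have wi : 0 <= w^-1 by rewrite invr_ge0 ltW.
have ab : sg <= sg + w by rewrite lerDl ltW.
split.
- by apply: measurable_funM => //; apply: measurable_boolr; exact: measurable_inside.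
- by move=> s; rewrite mulr_ge0.
- rewrite IntZ; last exact: ig_inside.
  by rewrite Int_inside// addrAC subrr add0r mulVf// gt_eqF.
exists w^-1, (`|sg| + w); split => s; first by rewrite ler_piMr// lern1 leq_b1.
move=> /block_supp/andP[h1 h2]; have k1 := ler_norm sg; have k2 := ler_norm (- sg).
by rewrite normrN in k2; apply/andP; split; lra.
Qed.

Lemma block_entropy (sg w : R) : 0 < w ->
  \int[mu]_s (block sg w s * ln (block sg w s)) = - ln w.
Proof.
move=> w0; have hp := profile_block sg w0; have [_ _ h1 _] := hp.
have E (s : T) : block sg w s * ln (block sg w s) = - ln w * block sg w s.
  rewrite /block; case: (_ <= _ <= _)%R; last by rewrite !(mulr0, mul0r).
  by rewrite mulr1 lnV ?posrE// mulrC.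
by rewrite (eq_Int _ E) (IntZ _ (ig_profile hp)) h1 mulr1.
Qed.

Lemma inf_Ny (a b : R) : (forall r : R, exists2 h, profile h & profile_energy a b h <= r) ->
  ereal_inf [set (free_energy a b 1 rho)%:E | rho in admissible 1] = -oo%E.
Proof.
move=> H; have H' r : (ereal_inf [set (free_energy a b 1 rho)%:E | rho in admissible 1] <= r%:E)%E.
  have [h hp hr] := H r; apply: (le_trans (inf_le_profile a b hp)).
  by rewrite lee_fin.
move: (ereal_inf _) H' => [r| |]//; last by move=> /(_ 0); rewrite leye_eq.
by move=> /(_ (r - 1)); rewrite lee_fin lerBrDl gerDr ler10.
Qed.

Lemma unbounded_concentration (a b : R) : b < -2 ->
  ereal_inf [set (free_energy a b 1 rho)%:E | rho in admissible 1] = -oo%E.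
Proof.
move=> b2; apply: inf_Ny => r.
pose k := - (2 + b); have k0 : 0 < k by rewrite /k; lra.
pose c := `|a| + `|b / 2| - ln 2 - ln pi.
(* The first moment has weight [- (2 + b) = k], and it is at most [sg + 1 <= 0], a region where the
   potential is at most 1; the second entry of the minimum ensures [k (sg + 1) + c <= r]. *)
pose sg := Num.min (- 1) ((r - c) / k - 1).
have s1 : sg + 1 <= 0 by rewrite -lerBrDr sub0r ge_min lexx.
have s2 : k * (sg + 1) <= r - c.
  by rewrite -ler_pdivlMl// -lerBrDr mulrC ge_min lexx orbT.
have hp := profile_block sg (@ltr01 R); exists (block sg 1) => //.
have i1 := ig_first hp; have i2 := ig_log1exp hp.
rewrite /profile_energy block_entropy// ln1 oppr0.
have m1 : \int[mu]_s (block sg 1 s * s) <= sg + 1.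
  by apply: average_le => // s /block_supp/andP[].
have v1 : \int[mu]_s (block sg 1 s * ln (1 + expR (2 * s))) <= 1.
  apply: average_le => // s /block_supp/andP[_ h]; apply: le_trans (ln1exp_le _) _.
  by rewrite -expR0 ler_expR pmulr_rle0// (le_trans h).
have v0 : 0 <= \int[mu]_s (block sg 1 s * ln (1 + expR (2 * s))).
  by apply: average_ge => // s _; exact: log1exp_ge0.
have d0 := dist_ge0 hp.
have d1 : dist_energy (block sg 1) <= 1.
  apply: average2_le => //; first exact: dist_ig.
  move=> s t /block_supp/andP[h1 h2] /block_supp/andP[h3 h4].
  by rewrite ler_norml; apply/andP; split=> /=; lra.
move: m1 v1 v0 d0 d1; set S := Rintegral _ _ _; set V := Rintegral _ _ _.
set D := dist_energy _ => m1 v1 v0 d0 d1.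
have a1 : a * V <= `|a|.
  by apply: le_trans (ler_norm _) _; rewrite normrM (ger0_norm v0) ler_piMr.
have b1 : - (b / 2 * D) <= `|b / 2|.
  by apply: le_trans (ler_norm _) _; rewrite normrN normrM (ger0_norm d0) ler_piMr.
have kS : k * S <= k * (sg + 1) by rewrite ler_pM2l.
exact: concentration_algebra a1 b1 kS s2.
Qed.

(** At [(1, 0)] the weights of the first moment and of the distances both vanish, so spreading
    lowers the entropy at no cost. The width [w] has [ln w = 1 - r], which leaves room for an excess
    of at most 1. *)
Lemma unbounded_borderline :
  ereal_inf [set (free_energy 1 0 1 rho)%:E | rho in @admissible R 1] = -oo%E.
Proof.
apply: inf_Ny => r; pose w := expR (1 - r); have w0 : 0 < w by exact: expR_gt0.
have hp := profile_block 0 w0; exists (block 0 w) => //.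
rewrite profile_energyE// block_entropy// expRK.
have e1 : excess (block 0 w) <= expR (- (2 * 0)).
  by apply: excess_le => // s /block_supp/andP[].
rewrite mulr0 oppr0 expR0 in e1.
have l2 : 0 <= ln 2 :> R by rewrite ln_ge0// ler1n.
have lp : 0 <= ln pi :> R by rewrite ln_ge0// (le_trans _ (@pi_ge2 R))// ler1n.
exact: borderline_algebra.
Qed.

Section two_blocks.
Variables (eps sg : R).
Hypotheses (e0 : 0 <= eps) (e1 : eps <= 1) (sg2 : 2 <= sg).

Let h1 (s : T) : R := ((0 <= s <= 1)%R)%:R.
Let h2 (s : T) : R := ((sg <= s <= sg + 1)%R)%:R.
Definition two_blocks (s : T) : R := (1 - eps) * h1 s + eps * h2 s.
Let h := two_blocks.
Let chi (s : T) : R := ((sg <= s)%R)%:R.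

Let i1 : ig mu h1. Proof. exact: ig_inside. Qed.
Let i2 : ig mu h2. Proof. exact: ig_inside. Qed.
Let e1' : 0 <= 1 - eps. Proof. by rewrite subr_ge0. Qed.

Let h_cases s : h s != 0 -> (0 <= s <= 1 /\ chi s = 0) \/ (sg <= s <= sg + 1 /\ chi s = 1).
Proof.
rewrite /h /two_blocks /h1 /h2 /chi; have [/andP[a b]|_] := boolP (0 <= s <= 1)%R.
  move=> _; left; split=> //.
  by rewrite leNgt (lt_le_trans _ sg2)// (le_lt_trans b)// ltr1n.
have [/andP[a b]|_] := boolP (sg <= s <= sg + 1)%R; last by rewrite !mulr0 addr0 eqxx.
by move=> _; right; split=> //; rewrite a.
Qed.

Let h_chi s : h s * chi s = eps * h2 s.
Proof.
rewrite /h /two_blocks /h1 /h2 /chi; have [a|a] := leP sg s => /=; last by rewrite !mulr0.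
rewrite (_ : (s <= 1)%R = false) ?andbF ?mulr0 ?add0r ?mulr1//.
by apply/negbTE; rewrite -ltNge; apply: lt_le_trans a; apply: lt_le_trans sg2; rewrite ltr1n.
Qed.

Let Int2 : \int[mu]_s h2 s = 1.
Proof. by rewrite Int_inside ?lerDl// addrAC subrr add0r. Qed.

Lemma profile_two_blocks : profile h.
Proof.
split.
- by apply: measurable_funD; apply: measurable_funM => //; apply: measurable_boolr; exact: measurable_inside.
- by move=> s; rewrite addr_ge0// mulr_ge0.
- rewrite IntD; [|exact: igZ|exact: igZ].
  by rewrite !IntZ// Int2 Int_inside// subr0; ring.
exists 1, (sg + 1); split => s.
  rewrite /h /two_blocks; have a1 : h1 s <= 1 by rewrite lern1 leq_b1.
  have a2 : h2 s <= 1 by rewrite lern1 leq_b1.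
  exact: convex_le1.
move=> /h_cases H; apply: (blocks_supp sg2).
by case: H => -[H _]; [left|right].
Qed.

Let hp := profile_two_blocks.

Let two_entropy : \int[mu]_s (h s * ln (h s)) <= 0.
Proof.
have [mh h0 hI [B [K [hB hK]]]] := hp.
rewrite -(Int0 mu); apply: le_Int; [|exact: ig0|move=> s].
  exact: (ig_xlnx (ig_profile hp) h0 hB hK).
rewrite mulr_ge0_le0// ln_le0//.
rewrite /h /two_blocks; have a1 : h1 s <= 1 by rewrite lern1 leq_b1.
have a2 : h2 s <= 1 by rewrite lern1 leq_b1.
exact: convex_le1.
Qed.

Let mchi : measurable_fun setT chi. Proof. exact: measurable_ler. Qed.

Let ichi : ig mu (fun s => h s * chi s).
Proof. by apply: eq_ig (igZ eps i2) => s; rewrite h_chi. Qed.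

Let Intchi : \int[mu]_s (h s * chi s) = eps.
Proof. by rewrite (eq_Int _ h_chi) IntZ// Int2 mulr1. Qed.

Let first_moment : `|\int[mu]_s (h s * s) - eps * sg| <= 1.
Proof.
have is_ := ig_first hp.
have i3 : ig mu (fun s => h s * (s - sg * chi s)).
  by have := igB is_ (igZ sg ichi); apply: eq_ig => s; ring.
have -> : \int[mu]_s (h s * s) - eps * sg = \int[mu]_s (h s * (s - sg * chi s)).
  rewrite -Intchi mulrC -IntZ// -IntB//; last exact: igZ.
  by apply: eq_Int => s; ring.
have P s : h s != 0 -> 0 <= s - sg * chi s <= 1.
  by move=> /h_cases[[a ->]|[a ->]]; rewrite ?mulr0 ?mulr1 ?subr0// lerBrDl addr0 lerBlDl.
rewrite ler_norml; apply/andP; split; last by apply: average_le => // s /P/andP[].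
by apply: le_trans (_ : 0 <= _); [rewrite oppr_le0|apply: average_ge => // s /P/andP[]].
Qed.

Let dist_moment : `|dist_energy h - sg * (2 * eps * (1 - eps))| <= 1.
Proof.
have ih := ig_profile hp; have [_ h0 hI _] := hp.
(* On the support, 1 if the two points lie in different blocks and 0 otherwise, so that [|s - t|] is
   [sg] times [q] up to an error 1. *)
pose q (z : T * T) : R := chi z.1 + chi z.2 - 2 * (chi z.1 * chi z.2).
have j1 := ig_prod ichi ih; have j2 := ig_prod ih ichi; have j3 := ig_prod ichi ichi.
have E (z : T * T) : h z.1 * h z.2 * q z =
    h z.1 * chi z.1 * h z.2 + h z.1 * (h z.2 * chi z.2) - 2 * (h z.1 * chi z.1 * (h z.2 * chi z.2)).
  by rewrite /q; ring.
have jq : ig (mu \x mu)%E (fun z => h z.1 * h z.2 * q z).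
  by apply: (eq_ig (fun z => esym (E z))); apply: igB; [exact: igD|exact: igZ].
have Iq : \int[(mu \x mu)%E]_z (h z.1 * h z.2 * q z) = 2 * eps * (1 - eps).
  rewrite (eq_Int _ E) (IntB (igD j1 j2) (igZ 2 j3)) (IntD j1 j2) (IntZ 2 j3).
  rewrite (Int_prod ichi ih) (Int_prod ih ichi) (Int_prod ichi ichi) Intchi hI.
  by ring.
have id := dist_ig hp.
have E2 (z : T * T) : h z.1 * h z.2 * (`|z.1 - z.2| - sg * q z) =
    h z.1 * h z.2 * `|z.1 - z.2| - sg * (h z.1 * h z.2 * q z) by ring.
have i3 : ig (mu \x mu)%E (fun z => h z.1 * h z.2 * (`|z.1 - z.2| - sg * q z)).
  by apply: (eq_ig (fun z => esym (E2 z))); apply: igB => //; exact: igZ.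
have i4 : ig (mu \x mu)%E (fun z => h z.1 * h z.2 * - (`|z.1 - z.2| - sg * q z)).
  by apply: eq_ig (igN i3) => z; rewrite mulrN.
have -> : dist_energy h - sg * (2 * eps * (1 - eps)) =
    \int[(mu \x mu)%E]_z (h z.1 * h z.2 * (`|z.1 - z.2| - sg * q z)).
  by rewrite (eq_Int _ E2) (IntB id (igZ sg jq)) (IntZ sg jq) Iq.
have P s t : h s != 0 -> h t != 0 -> `| `|s - t| - sg * q (s, t)| <= 1.
  rewrite /q/= => /h_cases[[a ->]|[a ->]] /h_cases[[c ->]|[c ->]].
  - by rewrite mulr0 mulr0 addr0 subr0 mulr0 subr0 normr_id; apply: (dist_unit (x := 0)); rewrite ?add0r.
  - by rewrite mul0r mulr0 subr0 add0r mulr1; exact: dist_far12.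
  - by rewrite mulr0 mulr0 subr0 addr0 mulr1; exact: dist_far21.
  - rewrite mulr1 mulr1 (_ : 1 + 1 - 2 = 0) ?mulr0 ?subr0 ?normr_id; last by ring.
    exact: dist_unit a c.
rewrite ler_norml; apply/andP; split; last first.
  by apply: average2_le => // s t hs ht; have := P s t hs ht; rewrite ler_norml => /andP[].
rewrite lerNl -(IntN i3) -(eq_Int _ (fun z => mulrN (h z.1 * h z.2) _)).
apply: average2_le => // s t hs ht.
by have := P s t hs ht; rewrite ler_norml => /andP[k _]; rewrite lerNl.
Qed.

(** All terms stay bounded except the mean, [eps sg], and the mean distance, [2 eps (1 - eps) sg],
    each known up to an error 1. *)
Lemma two_blocks_energy (a b : R) : profile_energy a b h <=
  `|2 * a - 2 - b| + `|a| + `|b / 2| - ln 2 - ln pi +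
  eps * sg * (2 * a - 2 - 2 * b + b * eps).
Proof.
rewrite profile_energyE//; have x0 := excess_ge0 hp.
have x1 : excess h <= expR (- (2 * 0)).
  apply: excess_le => // s /h_cases[[/andP[]//]|[/andP[+ _] _]].
  by apply: le_trans; apply: le_trans sg2.
rewrite mulr0 oppr0 expR0 in x1.
move: two_entropy first_moment dist_moment x0 x1.
set E := Rintegral _ _ _; set S := Rintegral _ _ _; set D := dist_energy h; set X := excess h.
move=> hE hS hD x0 x1.
have a1 : a * X <= `|a|.
  by apply: le_trans (ler_norm _) _; rewrite normrM (ger0_norm x0) ler_piMr.
have a2 : (2 * a - 2 - b) * (S - eps * sg) <= `|2 * a - 2 - b|.
  by apply: le_trans (ler_norm _) _; rewrite normrM ler_piMr.
have a3 : - (b / 2) * (D - sg * (2 * eps * (1 - eps))) <= `|b / 2|.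
  by apply: le_trans (ler_norm _) _; rewrite normrM normrN ler_piMr.
exact: two_blocks_algebra hE a1 a2 a3.
Qed.

End two_blocks.

Lemma unbounded_two_blocks (a b eps : R) : 0 <= eps -> eps <= 1 ->
  eps * (2 * a - 2 - 2 * b + b * eps) < 0 ->
  ereal_inf [set (free_energy a b 1 rho)%:E | rho in admissible 1] = -oo%E.
Proof.
move=> e0 e1 k0; apply: inf_Ny => r.
set k := eps * _ in k0.
pose c := `|2 * a - 2 - b| + `|a| + `|b / 2| - ln 2 - ln pi : R.
pose sg := Num.max 2 ((r - c) / k).
have sg2 : 2 <= sg by rewrite le_max lexx.
exists (two_blocks eps sg); first exact: profile_two_blocks.
apply: le_trans (two_blocks_energy e0 e1 sg2 a b) _.
rewrite -lerBrDl mulrAC -/k -ler_ndivrMl// mulrC.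
by rewrite le_max lexx orbT.
Qed.

(** The factor of [sg] is [eps (2 a - 2 - 2 b + b eps)]. With [eps = 1], when all the mass escapes,
    it is negative for [b > 2 a - 2]; with small [eps] it is negative for [b > a - 1]. *)
Lemma unbounded_mass_escape (a b : R) : Num.min (a - 1) (2 * a - 2) < b ->
  ereal_inf [set (free_energy a b 1 rho)%:E | rho in admissible 1] = -oo%E.
Proof.
rewrite gt_min => /orP[h|h]; last first.
  by apply: (@unbounded_two_blocks a b 1) => //; lra.
have d0 : 0 < b - a + 1 by lra.
have n1 : 0 < 1 + `|b| by rewrite ltr_wpDr.
pose e := Num.min 1 ((b - a + 1) / (1 + `|b|)).
have e0 : 0 < e by rewrite lt_min ltr01 divr_gt0.
have e1 : e <= 1 by rewrite ge_min lexx.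
have e2 : e * (1 + `|b|) <= b - a + 1 by rewrite -ler_pdivlMr// ge_min lexx orbT.
apply: (@unbounded_two_blocks a b e (ltW e0) e1).
rewrite pmulr_rlt0//; have : b * e <= `|b| * e by rewrite ler_pM2r// ler_norm.
by move: e0 e2 d0; clear; lra.
Qed.

End profiles.

(** * Truncated logistic laws and the sharp constant *)

Lemma logistic_tail_algebra {R : realType} (m d c : R) : 0 <= d ->
  c * (1 - 2 * d) = 1 -> d <= m -> m <= 1 - d ->
  c * (m - d) * (1 - c * (m - d)) <= c ^+ 2 * (m * (1 - m)).
Proof.
move=> d0 cd h1 h2; rewrite -subr_ge0.
rewrite (_ : _ - _ = c ^+ 2 * (m * (1 - m)) - c * (m - d) * (c * (1 - 2 * d) - c * (m - d))).
  rewrite (_ : _ - _ = c ^+ 2 * (d * (1 - d))); last by ring.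
  by rewrite mulr_ge0 ?sqr_ge0// mulr_ge0//; lra.
by rewrite cd.
Qed.

(** Origin of 13: [c - 1 <= 2 eta] enters once through [ln c] and once through the distances,
    [4 c eta] is at most [8 eta], and the excess costs at most [eta]. *)
Lemma logistic_energy_algebra {R : realType} (a c eta lk lc l2 lp S X D E : R) :
  0 <= a -> a <= 1 -> 0 < eta -> eta <= 2^-1 -> c * (1 - 2 * eta ^+ 2) = 1 ->
  lc <= c - 1 -> E <= lc + (l2 + lk) + 2 * (c * (2 * eta)) - 2 -> X <= eta ^+ 2 ->
  (1 - a) * D <= c ->
  E - l2 - lp + (2 * a - 2 - (2 * a - 2)) * S + a * X - (2 * a - 2) / 2 * D <=
    lk - 1 - lp + 13 * eta.
Proof.
move=> a0 a1 e0 e1 hc hlc hE hX hD.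
have e2 : eta ^+ 2 <= eta * 2^-1 by rewrite expr2 ler_pM2l.
have c2 : c <= 2.
  have k : 0 < 1 - 2 * eta ^+ 2 by lra.
  by rewrite -(ler_pM2r k) hc; lra.
have ce : c * eta <= 2 * eta by rewrite ler_pM2r.
have c1 : c - 1 <= 2 * eta.
  have : c * eta ^+ 2 <= 2 * (eta * 2^-1) by rewrite expr2 mulrA; have := ler_pM2r e0 (c * eta) (2 * 2^-1); nra.
  by move: hc; lra.
have aX : a * X <= eta.
  apply: le_trans (ler_wpM2l a0 hX) _; apply: le_trans (_ : 1 * eta ^+ 2 <= _); last by lra.
  by rewrite ler_wpM2r// sqr_ge0.
have -> : (2 * a - 2) / 2 * D = - ((1 - a) * D) by field.
lra.
Qed.

Lemma ln_le_sub1 {R : realType} (x : R) : 0 < x -> ln x <= x - 1.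
Proof.
move=> x0; have := @le_ln1Dx R (x - 1); rewrite [1 + _]addrC subrK; apply.
by rewrite ltrBrDr addrC subrr.
Qed.

Section logistic.
Context {R : realType}.
Local Notation mu := (@lebesgue_measure R).
Local Notation T := (measurableTypeR R).

Lemma Int_itv_derive (f F : R -> R) (lo hi : R) : lo <= hi -> continuous f ->
  (forall s : R, is_derive s (1 : R) F (f s)) ->
  ig mu (fun s : T => f s * ((lo <= s <= hi)%R)%:R) /\
  \int[mu]_s (f s * ((lo <= s <= hi)%R)%:R) = F hi - F lo.
Proof.
move=> lh cf dF; have cfi : {within `[lo, hi], continuous f} by exact: continuous_subspaceT.
have P (s : T) : (f s * ((lo <= s <= hi)%R)%:R)%:E = ((EFin \o f) \_ `[lo, hi]%classic) s.
  by rewrite patchE mem_setE in_itv/=; case: ifP => _; rewrite ?mulr1 ?mulr0.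
split.
  have I := (@integrable_mkcond _ T _ mu _ (EFin \o f) (measurable_itv `[lo, hi])).1
    (continuous_compact_integrable (@segment_compact _ lo hi) cfi).
  by apply: eq_integrable I => // s _ /=; rewrite -P.
move: lh; rewrite le_eqVlt => /predU1P[<-|lh].
  rewrite subrr (_ : (fun s => _) = fun s : T => f lo * ((lo <= s <= lo)%R)%:R).
    by rewrite IntZ ?Int_inside ?subrr ?mulr0//; exact: ig_inside.
  apply/funext => s; case: (boolP (lo <= s <= lo)) => [h|_]; last by rewrite !mulr0.
  by rewrite (_ : s = lo)//; apply/eqP; rewrite eq_le andbC.
apply: ge0_Int.
have -> : (\int[mu]_s (f s * ((lo <= s <= hi)%R)%:R)%:E = \int[mu]_s ((EFin \o f) \_ `[lo, hi]%classic) s)%E.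
  by apply: eq_integral => s _; exact: P.
rewrite -integral_mkcond.
have cF x : {for x, continuous F}.
  by apply: differentiable_continuous; apply/derivable1_diffP; have [] := dF x.
rewrite (continuous_FTC2 (F := F) lh cfi)//.
- split; first by move=> x _; have [] := dF x.
    exact: cvg_at_right_filter (cF lo).
  exact: cvg_at_left_filter (cF hi).
by move=> x _; rewrite derive1E; have [_ ->] := dF x.
Qed.

Variables (k eta : R).
Hypotheses (k0 : 0 < k) (eta0 : 0 < eta) (eta1 : eta <= 2^-1).

(** [d] is the quantile cut off at each end and [c] the renormalization. As [eta] tends to 0, [lo]
    tends to [+oo], with [exp (- 2 lo) = eta^2] bounding the excess; the square in [d] keeps
    [- d ln d] below [2 eta]. *)
Let d := eta ^+ 2.
Let q := (1 - d) / d.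
Let lo := - ln eta.
(* So that the logistic function [m] below runs from [d] to [1 - d] on [lo, hi]. *)
Let hi := lo + 2 * ln q / k.
Let c := (1 - 2 * d)^-1.

Let e4 : d <= 4^-1.
Proof. by rewrite /d (_ : 4^-1 = 2^-1 ^+ 2) ?lerXn2r// ?nnegrE ?(ltW eta0)//; field. Qed.
Let d0 : 0 < d. Proof. exact: exprn_gt0. Qed.
Let d1 : 0 < 1 - d. Proof. by move: e4; lra. Qed.
Let cd : c * (1 - 2 * d) = 1.
Proof. by rewrite /c mulVf// gt_eqF//; move: e4; lra. Qed.
Let c0 : 0 < c. Proof. by rewrite /c invr_gt0; move: e4; lra. Qed.
Let q0 : 0 < q. Proof. by rewrite divr_gt0. Qed.
Let q1 : 1 <= q. Proof. by rewrite ler_pdivlMr// mul1r; move: e4; lra. Qed.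
Let lh : lo <= hi.
Proof. by rewrite lerDl mulr_ge0 ?invr_ge0 ?(ltW k0)// mulr_ge0// ln_ge0. Qed.

Let den (s : R) : R := 1 + q * expR (- (k * (s - lo))).
Let m (s : R) : R := (den s)^-1.

Let den1 s : 1 < den s. Proof. by rewrite /den ltrDl mulr_gt0// expR_gt0. Qed.
Let den0 s : 0 < den s. Proof. exact: lt_trans ltr01 (den1 s). Qed.
Let m0 s : 0 < m s. Proof. by rewrite invr_gt0. Qed.
Let m1 s : m s < 1. Proof. by rewrite invf_lt1. Qed.

Let dm (s : R) : is_derive s (1 : R) m (k * (m s * (1 - m s))).
Proof.
have D : is_derive s (1 : R) den (- k * (q * expR (- (k * (s - lo))))).
  by apply: is_derive_eq; rewrite /GRing.scale/=; ring.
have dn : den s != 0 by rewrite gt_eqF.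
apply: (is_derive_eq (is_deriveV dn D)).
rewrite /GRing.scale/= /m; rewrite (_ : q * _ = den s - 1); last by rewrite /den; ring.
by field.
Qed.

Let cm : continuous m.
Proof.
by move=> s; apply: differentiable_continuous; apply/derivable1_diffP; have [] := dm s.
Qed.

Let m_lo : m lo = d.
Proof. 
rewrite /m /den subrr mulr0 oppr0 expR0 mulr1 /q mulrBl mul1r divff ?gt_eqF//.
by rewrite addrC subrK invrK.
 Qed.

Let m_hi : m hi = 1 - d.
Proof.
have E : k * (hi - lo) = ln q + ln q.
  by rewrite /hi addrAC subrr add0r mulrC divfK ?gt_eqF// mulr_natl mulr2n.
rewrite /m /den E opprD expRD expRN lnK ?posrE// mulrA mulfV ?gt_eqF// mul1r /q invf_div.
rewrite -[X in X + _](@mulfV _ (1 - d)) ?gt_eqF// -mulrDl subrK mul1r invrK //.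
Qed.

Let m_mono s t : s <= t -> m s <= m t.
Proof.
move=> st; rewrite lef_pV2 ?posrE// lerD2l ler_pM2l// ler_expR lerN2 ler_pM2l//.
by rewrite lerD2r.
Qed.

Definition logistic (s : T) : R := c * k * (m s * (1 - m s) * ((lo <= s <= hi)%R)%:R).

Let mm' : continuous (fun s => k * (m s * (1 - m s))).
Proof.
by move=> s; apply: cvgM; [exact: cvg_cst|apply: cvgM; [exact: cm|apply: cvgB; [exact: cvg_cst|exact: cm]]].
Qed.

Let h_supp s : logistic s != 0 -> lo <= s <= hi.
Proof. by rewrite /logistic; case: (lo <= s <= hi)%R => //; rewrite !mulr0 eqxx. Qed.

Let h0 s : 0 <= logistic s.
Proof.
rewrite mulr_ge0//; first by rewrite mulr_ge0// ltW.
by rewrite mulr_ge0// mulr_ge0 ?(ltW (m0 s))// subr_ge0 ltW.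
Qed.

Let mass (t : R) : lo <= t -> \int[mu]_s (k * (m s * (1 - m s)) * ((lo <= s <= t)%R)%:R) = m t - d.
Proof. by move=> lt; have [_ ->] := Int_itv_derive lt mm' dm; rewrite m_lo. Qed.

Let hE s : logistic s = c * (k * (m s * (1 - m s)) * ((lo <= s <= hi)%R)%:R).
Proof. by rewrite /logistic; ring. Qed.

Let ih : ig mu logistic.
Proof.
apply: (eq_ig (fun s => esym (hE s))); apply: igZ.
by have [] := Int_itv_derive lh mm' dm.
Qed.

Lemma profile_logistic : profile logistic.
Proof.
split => //; first exact: ig_meas ih.
  rewrite (eq_Int _ hE) IntZ; last by have [] := Int_itv_derive lh mm' dm.
  by rewrite mass// m_hi -[RHS]cd; ring.
exists (c * k), (`|lo| + `|hi|); split=> s.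
  apply: ler_piMr; first by rewrite mulr_ge0// ltW.
  have a1 := m0 s; have a2 := m1 s.
  have a3 : m s * (1 - m s) <= 1 by nra.
  by case: (lo <= s <= hi)%R; rewrite ?mulr1 ?mulr0.
move=> /h_supp/andP[a1 a2]; have b1 := ler_norm (- lo); have b2 := ler_norm hi.
have b3 := normr_ge0 lo; have b4 := normr_ge0 hi; rewrite normrN in b1.
by apply/andP; split; move: a1 a2 b1 b2 b3 b4; lra.
Qed.

Let hp := profile_logistic.

Let h1 : \int[mu]_s logistic s = 1. Proof. by case: hp. Qed.

Let cdf_in t : lo <= t -> t <= hi -> cdf logistic t = c * (m t - d).
Proof.
move=> lt th; rewrite -mass// -IntZ; last by have [] := Int_itv_derive lt mm' dm.
apply: eq_Int => s; rewrite hE.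
case: (leP s t) => [st|ts]; last by rewrite andbF !mulr0.
by rewrite mulr1 andbT (le_trans st th) andbT.
Qed.

Let cdf_out t : (lo <= t <= hi) = false -> cdf logistic t * (1 - cdf logistic t) = 0.
Proof.
have g0 := cdf_ge0 h0 t; have g1 := cdf_le1 ih h0 h1 t.
have [lt /=|tl _] := leP lo t.
  move=> /negbT; rewrite -ltNge => /ltW ht.
  have : 1 <= cdf logistic t.
    apply: le_trans (cdf_mono ih h0 ht); rewrite cdf_in// m_hi -[X in X <= _]cd.
    by rewrite le_eqVlt; apply/orP; left; apply/eqP; ring.
  by move=> g2; rewrite (_ : cdf logistic t = 1) ?subrr ?mulr0//; apply/eqP; rewrite eq_le g1.
have g2 : cdf logistic t <= 0.
  by apply: le_trans (cdf_mono ih h0 (ltW tl)) _; rewrite cdf_in// m_lo subrr mulr0.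
by rewrite (_ : cdf logistic t = 0) ?mul0r//; apply/eqP; rewrite eq_le g2.
Qed.

(** For the untruncated law this is the identity [H (1 - H) = h / k]; truncation costs the factor
    [c]. *)
Let cdf_bound t : cdf logistic t * (1 - cdf logistic t) <= c / k * logistic t.
Proof.
have [/andP[lt th]|/negbTE o] := boolP (lo <= t <= hi); last first.
  by rewrite cdf_out// mulr_ge0// divr_ge0// ltW.
rewrite cdf_in// /logistic lt th mulr1.
rewrite (_ : c / k * _ = c ^+ 2 * (m t * (1 - m t))); last by field; rewrite gt_eqF.
apply: logistic_tail_algebra => //; first exact: ltW.
  by rewrite -m_lo m_mono.
by rewrite -m_hi m_mono.
Qed.

Let dist_logistic : dist_energy logistic <= 2 * (c / k).
Proof.
have [_ _ _ [B [K [hB hK]]]] := hp; have [_ E] := Int_dist ih h0 h1 hK.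
have e : c / k = \int[mu]_s (c / k * logistic s) by rewrite IntZ// h1 mulr1.
rewrite /dist_energy E ler_pM2l// e; apply: le_Int; [|exact: igZ|exact: cdf_bound].
apply: ig_le (igZ (c / k) ih) _.
  have mc := measurable_cdf ih h0; apply: measurable_funM => //.
  exact: measurable_funB.
move=> s; rewrite ger0_norm; first exact: cdf_bound.
by rewrite mulr_ge0 ?cdf_ge0// subr_ge0 cdf_le1.
Qed.

(** An antiderivative of [ln x + ln (1 - x)], so that [G \o m] integrates the entropy of
    [k m (1 - m)] in closed form. *)
Let G (x : R) : R := x * ln x - (1 - x) * ln (1 - x) + (1 - 2 * x).

Let dG (x : R) : 0 < x -> x < 1 -> is_derive x (1 : R) G (ln x + ln (1 - x)).
Proof.
move=> x0 x1; have y0 : 0 < 1 - x by rewrite subr_gt0.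
have D1 := is_derive1_ln x0.
have D2 : is_derive x (1 : R) (fun y : R => ln (1 - y)) (- (1 - x)^-1).
  have D3 : is_derive (1 - x) (1 : R) (@ln R) ((1 - x)^-1) := is_derive1_ln y0.
  have D4 : is_derive x (1 : R) (fun y : R => 1 - y) (-1).
    by apply: is_derive_eq; rewrite /GRing.scale/=; ring.
  by have D5 := @is_derive1_comp _ (@ln R) (fun y => 1 - y) x _ _ D3 D4; rewrite mulrN1 in D5; exact: D5.
apply: is_derive_eq; rewrite /GRing.scale/=.
by field; rewrite !gt_eqF.
Qed.

Let dGm (s : R) : is_derive s (1 : R) (G \o m) (k * (m s * (1 - m s)) * (ln (m s) + ln (1 - m s))).
Proof.
apply: (is_derive_eq (is_derive1_comp (dG (m0 s) (m1 s)) (dm s))).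
by rewrite mulrC.
Qed.

Let cGm : continuous (fun s => k * (m s * (1 - m s)) * (ln (m s) + ln (1 - m s))).
Proof.
move=> s; apply: cvgM; first exact: mm'.
apply: cvgD.
  by apply: (continuous_comp (cm (x := s))); exact: continuous_ln.
apply: (@continuous_comp _ _ _ (fun s => 1 - m s) (@ln R)).
  by apply: cvgB; [exact: cvg_cst|exact: cm].
by apply: continuous_ln; rewrite subr_gt0.
Qed.

Let entropy_logistic : \int[mu]_s (logistic s * ln (logistic s)) <=
  ln c + ln k + 2 * (c * (2 * eta)) - 2.
Proof.
have [i2 J2] := Int_itv_derive lh cGm dGm.
have E (s : T) : logistic s * ln (logistic s) = (ln c + ln k) * logistic s +
    c * (k * (m s * (1 - m s)) * (ln (m s) + ln (1 - m s)) * ((lo <= s <= hi)%R)%:R).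
  rewrite /logistic; case: (lo <= s <= hi)%R; last by rewrite !(mulr0, mul0r, addr0).
  have y0 : 0 < 1 - m s by rewrite subr_gt0.
  by rewrite !mulr1 !lnM ?posrE ?mulr_gt0//; ring.
rewrite (eq_Int _ E) (IntD (igZ _ ih) (igZ _ i2)) (IntZ _ ih) (IntZ _ i2) h1 J2 /= m_lo m_hi mulr1.
(* [- d ln d] equals [2 eta^2 ln (1 / eta)], and [ln (1 / eta) <= 1 / eta]. *)
have lnd : - (d * ln d) <= 2 * eta.
  rewrite /d lnXn// -mulr_natl.
  have : ln eta^-1 <= eta^-1 by rewrite (le_trans (ln_le_sub1 _)) ?invr_gt0// gerBl.
  rewrite lnV ?posrE// => /(ler_wpM2l (sqr_ge0 eta)).
  by rewrite [X in _ <= X](_ : _ = eta) => [h|]; [lra|field; rewrite gt_eqF].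
have ln1d : (1 - d) * ln (1 - d) <= 0.
  by rewrite mulr_ge0_le0 ?(ltW d1)// ln_le0// gerBl ltW.
rewrite -[leRHS]addrA lerD2l.
rewrite (_ : c * (G (1 - d) - G d) = 2 * (c * ((1 - d) * ln (1 - d) - d * ln d)) - 2 * (c * (1 - 2 * d))); last first.
  by rewrite /G subKr; ring.
by rewrite cd mulr1 lerD2r ler_pM2l// ler_pM2l//; lra.
Qed.

Let excess_logistic : excess logistic <= eta ^+ 2.
Proof.
have -> : eta ^+ 2 = expR (- (2 * lo)).
  by rewrite /lo mulrN opprK mulr_natl mulr2n expRD lnK ?posrE// expr2.
by apply: excess_le => // s /h_supp/andP[].
Qed.

(** [k = 2 (1 - a)] minimizes [ln k + 2 (1 - a) / k], the dependence on [k] of entropy plus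
    interaction as [eta] tends to 0. *)
Lemma logistic_energy (a : R) : 0 <= a -> a < 1 -> k = 2 * (1 - a) ->
  profile_energy a (2 * a - 2) logistic <= sharp_constant a + 13 * eta.
Proof.
move=> a0 a1 ka; rewrite profile_energyE//.
have a2 : 0 < 1 - a by rewrite subr_gt0.
have E := entropy_logistic; rewrite {1}ka lnM ?posrE// in E.
have D : (1 - a) * dist_energy logistic <= c.
  apply: le_trans (ler_wpM2l (ltW a2) dist_logistic) _.
  by rewrite le_eqVlt ka; apply/orP; left; apply/eqP; field; rewrite gt_eqF.
have lc : ln c <= c - 1 by exact: ln_le_sub1.
have K l2 lk lp S E' hE := @logistic_energy_algebra R a c eta lk (ln c) l2 lp S (excess logistic) (dist_energy logistic) E' a0 (ltW a1) eta0 eta1 cd lc hE excess_logistic D.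
rewrite /sharp_constant; apply: K.
exact: E.
Qed.

End logistic.

Lemma best_constant_le {R : realType} (a : R) : 0 <= a -> a < 1 ->
  (best_constant a (2 * a - 2) <= (sharp_constant a)%:E)%E.
Proof.
move=> a0 a1; have k0 : 0 < 2 * (1 - a) by rewrite mulr_gt0// subr_gt0.
apply/lee_addgt0Pr => e e0.
pose eta := Num.min 2^-1 (e / 13).
have h0 : 0 < eta by rewrite lt_min invr_gt0 ltr0n divr_gt0.
have h1 : eta <= 2^-1 by rewrite ge_min lexx.
have h2 : 13 * eta <= e by rewrite mulrC -ler_pdivlMr// ge_min lexx orbT.
apply: le_trans (best_le_profile a (2 * a - 2) (profile_logistic k0 h0 h1)) _.
by rewrite -EFinD lee_fin (le_trans (logistic_energy k0 h0 h1 a0 a1 erefl))// lerD2l.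
Qed.

Theorem theorem3 (R : realType) :
  (forall a b : R,
     (a = 0 /\ b = -2) \/
       [/\ 0 < a, -2 <= b, b < a - 1 & b <= 2 * a - 2] ->
     (-oo < best_constant a b)%E /\ energy_bound a b (best_constant a b)) /\
  (forall a b : R,
     [\/ a < 0, b < -2, Num.min (a - 1) (2 * a - 2) < b
       | (a = 1 /\ b = 0)] ->
     ereal_inf [set (free_energy a b 1 rho)%:E | rho in admissible 1]
       = -oo%E) /\
  (forall a : R, 0 <= a -> a < 1 ->
     best_constant a (2 * a - 2) = (- ln (expR 1 * pi / (1 - a)))%:E /\
     (0 < a ->
      forall M : R, 0 < M ->
        ~ exists rho : R * R -> R, is_minimizer a (2 * a - 2) M rho)).
Proof.
have bestE (a : R) : 0 <= a -> a < 1 -> best_constant a (2 * a - 2) = (sharp_constant a)%:E.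
  move=> a0 a1; apply/eqP; rewrite eq_le best_constant_le//=.
  by apply: best_constant_ge => u; exact: lower_bound_line.
split; [|split].
- move=> a b H; split; last exact: energy_bound_best.
  have [c hc] : exists c : R, (c%:E <= best_constant a b)%E.
    case: H => [[-> ->]|[a0 b2 ba ba2]].
      exists (sharp_constant 0); rewrite (_ : -2 = 2 * 0 - 2); last by rewrite mulr0 sub0r.
      by rewrite bestE.
    have [c hc] := lower_bound_general a0 b2 ba ba2.
    by exists c; exact: best_constant_ge.
  by apply: lt_le_trans hc; rewrite ltNyr.
- move=> a b [a0|b2|h|[-> ->]].
  (* If [a < 0] and [b >= -2], then [2 a - 2 < -2 <= b]: all the mass escapes. *)
  + have [b2|b2] := ltP b (-2); first exact: unbounded_concentration.
    apply: unbounded_mass_escape; rewrite gt_min; apply/orP; right.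
    by apply: lt_le_trans b2; rewrite gtrDr pmulr_rlt0.
  + exact: unbounded_concentration.
  + exact: unbounded_mass_escape.
  + exact: unbounded_borderline.
- move=> a a0 a1; rewrite bestE//; split.
    have k0 : 0 < 1 - a by rewrite subr_gt0.
    rewrite ln_div ?posrE ?mulr_gt0 ?expR_gt0 ?pi_gt0// lnM ?posrE ?expR_gt0 ?pi_gt0//.
    by rewrite expRK /sharp_constant opprB opprD addrA.
  move=> ap M M0 [r [hr]]; rewrite bestE//.
  have [/admissible1P fu ->] := free_energy_scale a (2 * a - 2) M0 hr.
  move=> -[]; rewrite mulrC => /(mulIf (lt0r_neq0 M0)) e.
  by have := lower_bound_strict ap a1 fu; rewrite e ltxx.
Qed.
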